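(* Let $X_1,X_2,\dots$ be i.i.d. uniformly random points in $[0,1]^2$. Then, with probability tending to $1$ as $n\to\infty$ along even $n$, \[ \rho_n(\text{Maker wins the perfect matching game}) = \rho_n(\text{minimum degree} \geq 2 \text{ and minimum edge-degree} \geq 3). \]
   Context: For points $x_1,\dots,x_n\in\mathbb{R}^2$ and $r>0$, the geometric graph $G(x_1,\dots,x_n;r)$ has vertex set $\{x_1,\dots,x_n\}$ and an edge $x_ix_j$ iff $\|x_i-x_j\|\le r$ (Euclidean norm). For an increasing graph property $\mathcal{P}$, the hitting radius is $\rho_n(\mathcal{P}) := \inf\{ r\ge 0 : G(X_1,\dots,X_n;r) \text{ satisfies } \mathcal{P}\}$, with the points held fixed. The edge-degree of an edge $e=uv$ of a graph is $d(e)=|(N(u)\cup N(v))\setminus\{u,v\}|$, where $N(\cdot)$ denotes the neighbourhood; minimum edge-degree is the minimum over all edges. In the Maker-Breaker game on a graph $G$, Breaker and Maker alternately claim unclaimed edges of $G$, Breaker moving first, until all edges are claimed; in the perfect matching game Maker wins iff his claimed edges contain a perfect matching of $G$. ''Maker wins'' means Maker has a winning strategy. *)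

(* Defs.v *)
From HB Require Import structures.
From mathcomp Require Import all_boot all_order all_algebra.
Set Implicit Arguments.
Unset Strict Implicit.
Unset Printing Implicit Defensive.
Import Order.TTheory GRing.Theory Num.Theory.

(* The combinatorial part precedes the import of mathcomp-classical, so that
   [set ...], [trivIset] and [cover] are those of finset. *)

(* A finite simple graph on T is a symmetric irreflexive relation e : rel T;
   its edges are unordered pairs. *)
Section Graph.
Variables (T : finType) (e : rel T).

Definition edges : {set {set T}} := [set [set p.1; p.2] | p : T * T & e p.1 p.2].

Definition neighbours (u : T) : {set T} := [set v | e u v].

Definition min_degree_ge (k : nat) : Prop := forall u : T, k <= #|neighbours u|.

Definition edge_degree (u v : T) : nat :=
  #|(neighbours u :|: neighbours v) :\: [set u; v]|.

Definition min_edge_degree_ge (k : nat) : Prop :=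
  forall u v : T, e u v -> k <= edge_degree u v.

Definition perfect_matching (M : {set {set T}}) : bool :=
  [&& M \subset edges, trivIset M & cover M == [set: T]].

End Graph.

(* Maker-Breaker game on the board E. A history lists the elements claimed so
   far in chronological order; Breaker moves first, so the entries with even
   (0-based) index are Breaker's and Maker is to move after a history of odd
   length. *)
Section MakerBreaker.
Variables (X : finType) (E : {set X}).

Definition history (h : seq X) : bool := uniq h && all (mem E) h.

Definition complete_play (p : seq X) : Prop := uniq p /\ p =i E.

Definition claimed_by_maker (p : seq X) : {set X} :=
  [set x | (x \in p) && odd (index x p)].

(* Without this requirement a strategy proposing illegal moves would be winning
   vacuously, no complete play being consistent with it. *)
Definition maker_strategy (s : seq X -> X) : Prop :=
  forall h, history h -> odd (size h) -> size h < #|E| ->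
    s h \in E /\ s h \notin h.

Definition consistent (s : seq X -> X) (p : seq X) : Prop :=
  forall h x t, p = h ++ x :: t -> odd (size h) -> x = s h.

Definition maker_wins (W : {set X} -> Prop) : Prop :=
  exists2 s : seq X -> X, maker_strategy s &
    forall p, complete_play p -> consistent s p -> W (claimed_by_maker p).

End MakerBreaker.

Definition maker_wins_pm (T : finType) (e : rel T) : Prop :=
  maker_wins (edges e)
    (fun C => exists2 M : {set {set T}}, perfect_matching e M & M \subset C).

From mathcomp Require Import finmap all_classical all_reals all_analysis.
Import numFieldNormedType.Exports.
Local Open Scope classical_set_scope.
Local Open Scope ring_scope.

(* The norm that the library puts on R * R is the max norm. *)
Definition edist (R : realType) (x y : R * R) : R :=
  Num.sqrt ((x.1 - y.1) ^+ 2 + (x.2 - y.2) ^+ 2).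

(* Vertices are the indices of the points. *)
Definition geom_graph (R : realType) (n : nat) (x : 'I_n -> R * R) (r : R) :
    rel 'I_n :=
  fun i j => (i != j) && (edist (x i) (x j) <= r).

(* The infimum is taken in the extended reals, with value +oo if no radius
   qualifies. *)
Definition hitting_radius (R : realType) (n : nat) (x : 'I_n -> R * R)
    (Q : rel 'I_n -> Prop) : \bar R :=
  ereal_inf [set r%:E | r in [set r : R | 0 <= r /\ Q (geom_graph x r)]].

Section RandomPoints.
Context (d : measure_display) (Omega : measurableType d) (R : realType).
Variable P : probability Omega R.

Definition uniform_unit_square (Y : Omega -> R * R) : Prop :=
  forall A : set (R * R), measurable A ->
    P (Y @^-1` A) =
    (lebesgue_measure \x lebesgue_measure)%E (A `&` (`[0, 1] `*` `[0, 1])).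

Definition mutually_independent (X : nat -> Omega -> R * R) : Prop :=
  forall (J : {fset nat}) (A : nat -> set (R * R)),
    (forall i, measurable (A i)) ->
    P (\bigcap_(i in [set` J]) (X i @^-1` A i)) =
    (\prod_(i <- J) P (X i @^-1` A i))%E.

Definition iid_uniform_unit_square (X : nat -> Omega -> R * R) : Prop :=
  [/\ forall i, measurable_fun [set: Omega] (X i),
      forall i, uniform_unit_square (X i)
    & mutually_independent X].

End RandomPoints.

(* Main.v *)
(* The points are replaced by their cells in a fine grid. Let r0 be a radius for
   which a disc is expected to contain ln n - ln z + O(1) points, where z is a
   small power of ln n.  A second moment argument gives a vertex that is isolated
   at every radius below r0, so neither property holds there.  At a radius above
   r0, Maker uses the graph H of radius about r0, plus what the two degree
   conditions give him.
   Coarse cells (of side about r0/5) are cliques of H.  Starting from a root,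
   activate a cell when many of its points have many H-neighbours in some active
   cell.  On each active cell Maker builds, by the Erdos-Selfridge criterion, a
   graph that keeps a perfect matching after the removal of any few vertices
   (parity permitting); vertices with many H-neighbours in an active cell are
   matched into it, and the surplus parities are pushed towards the root along
   edges between active cells.
   The other vertices have few H-neighbours outside their own H-components.  A
   first moment bound excludes wide regions with few points, so with high
   probability these components are far apart and of tiny diameter; a second
   such bound shows that a component is a single vertex or all its vertices have
   many common neighbours, and then the minimum degree and edge-degree conditions
   are just what Maker needs to match it by local replies. *)

(* All conditions on a configuration concern the single scale [s], so one good event settles every
   radius at once, and the hitting radii agree because the two properties agree at each [r]. The
   constants [T1], [T2], [B] and the degree bound [J0] do not depend on [n]; only [w], [beta] and
   [h] do. The boundary of the square shapes the estimates. With [ln n = z ^ (2 * P)], about [z]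
   empty discs of radius [s] are expected in the interior, but the bound near the sides, where discs
   are halved, is of order [z ^ P.+1]. Every first moment has to beat this: a wide cluster by the
   factor [exp (- z / 16)] for the additional area that its width forces to be nearly empty, a poor
   cluster by a negative power of [ln n] for a surplus close point; [P] is fitted to the latter.
   Maker's tasks must be separate games, as he answers each move in the board where it was made.
   This is why every edge he uses is assigned to one active cell, to one vertex asking for a partner
   in an earlier active cell, or to one small component. *)
Require Import Defs.

From mathcomp Require Import all_boot all_order all_algebra fingroup perm.
From mathcomp Require Import zify ring lra boolp.
Set Implicit Arguments.
Unset Strict Implicit.
Unset Printing Implicit Defensive.
Import Order.TTheory GRing.Theory Num.Theory.

(** * Maker-Breaker positions *)

Section Positions.
Variable X : finType.
Implicit Types (F M : {set X}) (W : {set X} -> Prop).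

Definition upward W := forall A B : {set X}, A \subset B -> W A -> W B.

(** A position is winning when some set of positions contains it and is closed under suitable
    replies. Giving this set as a predicate avoids induction on the length of the game: each
    strategy below is stated by what it preserves. *)
Definition maker_invariant W (I : {set X} -> {set X} -> Prop) : Prop :=
  (forall F M x, I F M -> x \in F -> exists r : {set X},
     [/\ r \subset F :\ x, #|r| <= 1 & I (F :\ x :\: r) (M :|: r)]) /\
  (forall M, I set0 M -> W M).

(* Breaker is to move, F is the set of free elements and M is Maker's set.
   Maker may pass, which is why replies are sets with at most one element. *)
Definition mwin W F M := exists2 I, maker_invariant W I & I F M.

Lemma mwin_step W F M x : mwin W F M -> x \in F -> exists r : {set X},
  [/\ r \subset F :\ x, #|r| <= 1 & mwin W (F :\ x :\: r) (M :|: r)].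
Proof.
move=> [I [Is Ie] IFM] xF; have [r [r1 r2 r3]] := Is _ _ _ IFM xF.
by exists r; split=> //; exists I.
Qed.

Lemma mwin_end W M : mwin W set0 M -> W M.
Proof. by case=> I [_ Ie] /Ie. Qed.

Lemma mwin_impl W W' F M : mwin W F M ->
  (forall M', M \subset M' -> W M' -> W' M') -> mwin W' F M.
Proof.
move=> h WW'; exists (fun F' M' => mwin W F' M' /\ M \subset M') => //.
split=> [F' M' x [h1 s1] xF|M' [h1 s1]]; last by apply: WW' => //; apply: mwin_end.
have [r [r1 r2 r3]] := mwin_step h1 xF; exists r; split=> //; split=> //.
by apply: subset_trans s1 _; apply: subsetUl.
Qed.

Lemma mwin_now W F M : upward W -> W M -> mwin W F M.
Proof.
move=> up WM; exists (fun _ M' => W M') => //; split=> // F' M' x WM' _.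
exists set0; split; rewrite ?sub0set ?cards0 //.
by apply: up WM'; apply: subsetUl.
Qed.

Lemma mwin_reply W F M : F != set0 ->
  (forall x, x \in F -> exists r : {set X},
     [/\ r \subset F :\ x, #|r| <= 1 & mwin W (F :\ x :\: r) (M :|: r)]) ->
  mwin W F M.
Proof.
move=> F0 h.
exists (fun F' M' => (F' = F /\ M' = M) \/ mwin W F' M'); last by left.
split=> [F' M' x [[-> ->]|h1] xF|M' [[e _]|]].
- by have [r [? ? ?]] := h x xF; exists r; split=> //; right.
- by have [r [? ? ?]] := mwin_step h1 xF; exists r; split=> //; right.
- by move: F0; rewrite -e eqxx.
- exact: mwin_end.
Qed.

(** Maker answers in the board that Breaker has just played in and passes if there is none. Each
    board keeps its own record of free elements and of elements counted as Maker's. *)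
Lemma mwin_family (T : finType) (W : T -> {set X} -> Prop) (B : T -> {set X})
    (F M : {set X}) : (forall i, upward (W i)) ->
  (forall i, mwin (W i) (B i) M) ->
  (forall i j, i != j -> [disjoint B i & B j]) ->
  (forall i, B i \subset F) ->
  mwin (fun N => forall i, W i N) F M.
Proof.
move=> up hB dB sB.
exists (fun F' M' => exists Fs Ms : T -> {set X},
  [/\ forall i, mwin (W i) (Fs i) (Ms i),
      forall i j, i != j -> [disjoint Fs i & Fs j],
      forall i, Fs i \subset F' & forall i, Ms i \subset M']).
  split=> [F' M' x [Fs [Ms [h1 h2 h3 h4]]] xF|M' [Fs [Ms [h1 h2 h3 h4]]] i].
  - case: (pickP (fun i => x \in Fs i)) => [i xi|no].
    + have [r [r1 r2 r3]] := mwin_step (h1 i) xi.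
      exists r; split=> //.
        by apply: subset_trans r1 _; apply: setSD.
      exists (fun j => if j == i then Fs i :\ x :\: r else Fs j).
      exists (fun j => if j == i then Ms i :|: r else Ms j).
      have sub j : (if j == i then Fs i :\ x :\: r else Fs j) \subset Fs j.
        case: eqP => // ->; apply: subset_trans (subsetDl _ _) (subsetDl _ _).
      split=> [j|j k jk|j|j].
      * by case: eqP => [->|_].
      * by apply: disjointWl (sub j) _; apply: disjointWr (sub k) _; apply: h2.
      * case: eqP => [_|/eqP ji].
          by apply: setSD; apply: setSD.
        apply/subsetP => y yj; rewrite !inE (subsetP (h3 j) _ yj) andbT.
        have yi : y \notin Fs i by have := h2 _ _ ji; move/disjointFr => ->.
        apply/andP; split.
          apply: contra yi => yr.
          by move: (subsetP r1 _ yr); rewrite !inE => /andP[].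
        by apply: contraNneq yi => ->.
      * case: eqP => _; first by apply: setSU.
        by apply: subset_trans (h4 j) (subsetUl _ _).
    + exists set0; split; rewrite ?sub0set ?cards0 //.
      exists Fs, Ms; split=> // j; last by rewrite setU0.
      rewrite setD0; apply/subsetP => y yj; rewrite !inE (subsetP (h3 j)) // andbT.
      by apply: contraTneq yj => ->; rewrite no.
  - apply: up (h4 i) _; apply: mwin_end; have := h3 i.
    by rewrite subset0 => /eqP <-.
by exists B, (fun=> M); split.
Qed.

(** In any play from the position Maker ends with a subset of [F :|: M] that satisfies [W], and [W]
    is upward closed. *)
Lemma mwin_all W F M (N : {set X}) : upward W -> mwin W F M -> F :|: M \subset N -> W N.
Proof.
move=> up; have [k] := ubnP #|F|; elim: k F M => // k IH F M kF h s.
have [F0|[x xF]] := set_0Vmem F.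
  by apply: up (mwin_end _); last (by rewrite F0 in h; exact: h);
     apply: subset_trans s; apply: subsetUr.
have [r [r1 r2 r3]] := mwin_step h xF.
apply: IH r3 _.
  apply: leq_trans (_ : #|F| <= k) => //; apply: leq_trans (_ : #|F :\ x| < #|F|).
    by rewrite ltnS subset_leq_card // subsetDl.
  by rewrite [X in _ < X](cardsD1 x) xF.
apply: subset_trans s; rewrite subUset; apply/andP; split.
  by apply: subset_trans (subsetDl _ _) _; apply: subset_trans (subsetDl _ _) (subsetUl _ _).
rewrite subUset subsetUr andTb; apply: subset_trans r1 _.
by apply: subset_trans (subsetDl _ _) (subsetUl _ _).
Qed.

(** Extra elements never hurt Maker: he follows the strategy of the poorer position. A prescribed
    element that is already his, or a Breaker move outside the poorer board, becomes a pass; what is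
    left of that board at the end belongs to Maker. *)
Lemma mwin_mono W F M F' M' : upward W -> mwin W F M -> F \subset F' :|: M' ->
  M \subset M' -> mwin W F' M'.
Proof.
move=> up h sF sM.
exists (fun A C => exists A' C', [/\ mwin W A' C', A' \subset A :|: C & C' \subset C]);
  last by exists F, M.
split=> [A C x [A' [C' [h1 h2 h3]]] xA|C [A' [C' [h1]]]]; last first.
  by rewrite set0U => s s'; apply: mwin_all h1 _ => //; rewrite subUset s.
have [xA'|xA'] := boolP (x \in A').
  have [r [r1 r2 r3]] := mwin_step h1 xA'; exists (r :&: A :\ x); split.
  - by apply: setSD; apply: subsetIr.
  - apply: leq_trans r2; apply: subset_leq_card.
    by apply: subset_trans (subsetDl _ _) (subsetIl _ _).
  exists (A' :\ x :\: r), (C' :|: r); split=> //; apply/subsetP => y; rewrite !inE.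
    case/and3P => yr yx yA'; move/subsetP/(_ _ yA'): h2; rewrite !inE yx (negbTE yr).
    by case/orP => -> //=; rewrite ?orbT.
  case/orP => [/(subsetP h3) -> //|yr]; move/subsetP/(_ _ yr): (r1).
  rewrite !inE yr => /andP[-> /(subsetP h2)]; rewrite !inE.
  by case/orP => ->; rewrite ?orbT.
exists set0; split; rewrite ?sub0set ?cards0 //.
exists A', C'; split; rewrite ?setU0 // setD0.
apply/subsetP => y yA; move/subsetP/(_ _ yA): (h2); rewrite !inE.
by have -> : y != x by apply: contraNneq xA' => <-.
Qed.

End Positions.

Lemma claimed_rcons (X : finType) (h : seq X) (x : X) : x \notin h ->
  claimed_by_maker (rcons h x) =
  if odd (size h) then x |: claimed_by_maker h else claimed_by_maker h.
Proof.
move=> xh; apply/setP => y; rewrite !inE mem_rcons inE -cats1 index_cat.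
have [->|yx] := eqVneq y x.
  rewrite (negbTE xh) /= eqxx addn0; case: ifP => o; rewrite !inE ?eqxx ?(negbTE xh) //.
by case: (odd (size h)); rewrite !inE /= ?(negbTE yx); case: (y \in h).
Qed.

Section ToStrategy.
Variables (X : finType) (E : {set X}) (W : {set X} -> Prop) (x0 : X).
Hypothesis up : upward W.

Let free (h : seq X) : {set X} := E :\: [set x in h].

(** A genuine move must claim a free element, while a reply in [mwin] may be empty. So any free
    element that leaves a winning position is accepted; by [mwin_mono] one exists even where the
    invariant prescribes a pass. *)
Let ok (h : seq X) (y : X) : bool :=
  (y \in free h) &&
  `[< mwin W (free (rcons h y)) (y |: claimed_by_maker h) >].

Let strat (h : seq X) : X :=
  if [pick y | ok h y] is Some y then y
  else if [pick y in free h] is Some y then y else x0.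

Let free_rcons h x : free (rcons h x) = free h :\ x.
Proof. by apply/setP => y; rewrite !inE mem_rcons inE negb_or andbA. Qed.

Let strat_legal : maker_strategy E strat.
Proof.
move=> h /andP[uh /allP hE] _ sz.
have [y] : exists y, y \in free h.
  apply/set0Pn; apply: contraTneq sz => /eqP; rewrite setD_eq0 => sE.
  rewrite -leqNgt; apply: leq_trans (subset_leq_card sE) _.
  by rewrite cardsE card_size.
have mem z : z \in free h -> z \in E /\ z \notin h.
  by rewrite !inE => /andP[].
move=> yF; rewrite /strat; case: pickP => [z /andP[/mem]//|_].
by case: pickP => [z /mem //|/(_ y)]; rewrite yF.
Qed.

Lemma mwin_maker_wins : mwin W E set0 -> maker_wins E W.
Proof.
move=> hE; exists strat => // p [up_ pE] cp.
(* After an odd number of moves Maker is to move, and what is known is a reply [r], not yet claimed,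
   that restores a winning position. *)
suff inv k : k <= size p -> if odd k
    then exists2 M : {set X}, (exists r : {set X}, [/\ r \subset free (take k p), #|r| <= 1 &
      mwin W (free (take k p) :\: r) (M :|: r)]) & M = claimed_by_maker (take k p)
    else mwin W (free (take k p)) (claimed_by_maker (take k p)).
  have := inv (size p) (leqnn _); rewrite take_size.
  have -> : free p = set0.
    by apply/setP => y; rewrite !inE -pE; case: (y \in p).
  case: ifP => _; last exact: mwin_end.
  by case=> M [r [r1 _]]; move: r1; rewrite subset0 => /eqP ->; rewrite setD0 setU0 => + <-; exact: mwin_end.
elim: k => [_|k IH kp] /=.
  rewrite take0 /=; have -> : free [::] = E.
    by apply/setP => y; rewrite !inE.
  have -> // : claimed_by_maker [::] = set0 :> {set X}.
  by apply/setP => y; rewrite !inE.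
have {IH} := IH (ltnW kp).
have tk : take k.+1 p = rcons (take k p) (nth x0 p k) by rewrite (take_nth x0).
set x := nth x0 p k in tk; have xp : x \notin take k p.
  by move: (take_uniq k.+1 up_); rewrite tk rcons_uniq => /andP[].
have xF : x \in free (take k p) by rewrite !inE xp -pE mem_nth.
have sk : size (take k p) = k by rewrite size_takel // ltnW.
rewrite tk claimed_rcons // sk free_rcons; case: ifP => ok_ /=.
  case=> M [r [r1 r2 r3]] eM.
  have xs : x = strat (take k p).
    apply: (cp _ x (drop k.+1 p)); last by rewrite sk.
    by rewrite -cat_rcons -tk cat_take_drop.
  rewrite xs -free_rcons /strat -eM; case: pickP => [y /andP[_ /asboolP]|no].
    by rewrite eM.
  case: pickP => [y yF|F0]; last by move: (F0 x); rewrite xF.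
  have [y' y'F sr] : exists2 y, y \in free (take k p) & r \subset [set y].
    have [r0|[z zr]] := set_0Vmem r; first by exists y; rewrite // r0 sub0set.
    exists z; first exact: (subsetP r1).
    by apply/subsetP => t tr; rewrite inE; apply/eqP; move/card_le1_eqP: r2; apply.
  suff : ok (take k p) y' by rewrite no.
  rewrite /ok y'F; apply/asboolP.
  apply: mwin_mono r3 _ _ => //; rewrite -?eM ?free_rcons.
    apply/subsetP => t; rewrite !inE => /and3P[tr tp tE].
    by rewrite tp tE andbT; case: eqP.
  by rewrite setUC; apply: setSU.
move=> h; have [r [r1 r2 r3]] := mwin_step h xF.
by exists (claimed_by_maker (take k p)) => //; exists r.
Qed.
End ToStrategy.

(** * Two general games: half of a set, and the Erdos-Selfridge criterion *)

Section SimpleGames.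
Variable X : finType.
Implicit Types (F M : {set X}) (W : {set X} -> Prop).

Lemma mwin_half F0 : mwin (fun M => #|F0|./2 <= #|F0 :&: M|) F0 set0.
Proof.
exists (fun F M => [/\ F \subset F0, [disjoint F & M] &
   #|F0|./2 <= #|F0 :&: M| + #|F|./2]); last first.
  by split; rewrite ?leq_addl // -setI_eq0 setI0.
split=> [F M x [s d h] xF|M [_ _]]; last by rewrite cards0 addn0.
have cF : #|F| = (#|F :\ x|).+1 by rewrite (cardsD1 x) xF.
have [F1|[y yF]] := set_0Vmem (F :\ x).
  exists set0; rewrite sub0set cards0 setU0 F1 set0D; split=> //; split.
  - exact: sub0set.
  - by rewrite -setI_eq0 set0I.
  - by move: h; rewrite cF F1 cards0.
have [yx yF'] : y != x /\ y \in F by move: yF; rewrite !inE => /andP[].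
exists [set y]; rewrite sub1set yF cards1; split=> //; split.
- by apply: subset_trans s; apply: subset_trans (subsetDl _ _) (subsetDl _ _).
- rewrite -setI_eq0; apply/eqP/setP => z; rewrite !inE.
  case: (eqVneq z y) => //= zy; rewrite -andbA; apply/negP => /and3P[_ zF]; rewrite orbF => zM.
  by move/disjointFr/(_ zF): d; rewrite zM.
have -> : #|F0 :&: (M :|: [set y])| = (#|F0 :&: M|).+1.
  rewrite setIUr (_ : F0 :&: [set y] = [set y]) 1?setUC ?cardsU1 ?inE.
    by rewrite (disjointFr d yF') andbF.
  by apply/setIidPr; rewrite sub1set (subsetP s).
have cF' : #|F :\ x| = (#|F :\ x :\: [set y]|).+1 by rewrite (cardsD1 y) yF.
by apply: leq_trans h _; rewrite cF cF' /= addnS addSn.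
Qed.

(* Erdos-Selfridge: the potential is the sum of 2^-|A| over the sets A of the
   family that Maker has not hit, restricted to their free elements. *)
Section Potential.
Variables (I : finType) (A : I -> {set X}).
Local Open Scope ring_scope.

Let wt F M i : rat := if [disjoint A i & M] then 2%:R ^- #|A i :&: F| else 0.
Let phi F M : rat := \sum_i wt F M i.
Let phix F M x : rat := \sum_(i | x \in A i) wt F M i.

Let wt_ge0 F M i : 0 <= wt F M i.
Proof. by rewrite /wt; case: ifP => // _; rewrite invr_ge0 exprn_ge0. Qed.

Let wt_breaker F M i x : x \in F ->
  wt (F :\ x) M i = if x \in A i then 2%:R * wt F M i else wt F M i.
Proof.
move=> xF; rewrite /wt; have [xA|xA] := boolP (x \in A i); last first.
  congr (if _ then _ ^- _ else _); apply: eq_card => y; rewrite !inE.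
  by case: (eqVneq y x) => // ->; rewrite (negbTE xA).
case: ifP => _; last by rewrite mulr0.
have -> : #|A i :&: F| = (#|A i :&: (F :\ x)|).+1.
  rewrite (cardsD1 x) inE xA xF add1n; congr _.+1; apply: eq_card => y.
  by rewrite !inE andbCA.
by rewrite exprS invfM mulrA divff ?mul1r.
Qed.

Let phi_breaker F M x : x \in F -> phi (F :\ x) M = phi F M + phix F M x.
Proof.
move=> xF; rewrite /phi /phix [X in _ = _ + X]big_mkcond -[RHS]big_split /=.
apply: eq_bigr => i _; rewrite wt_breaker //; case: ifP => _; last by rewrite addr0.
by rewrite mulr_natl mulr2n.
Qed.

Let wt_maker F M i y : y \in F ->
  wt (F :\: [set y]) (M :|: [set y]) i = if y \in A i then 0 else wt F M i.
Proof.
move=> yF; rewrite /wt; have -> : [disjoint A i & M :|: [set y]] = [disjoint A i & M] && (y \notin A i).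
  by rewrite -!setI_eq0 setIUr setU_eq0 !setI_eq0 disjoint_sym (disjoint_sym (A i) [set y]) disjoints1 disjoint_sym.
have [yA|yA] := boolP (y \in A i); first by rewrite andbF.
rewrite andbT; congr (if _ then _ ^- _ else _); apply: eq_card => z; rewrite !inE.
by case: (eqVneq z y) => // ->; rewrite (negbTE yA).
Qed.

Let phix_le F M x y : y \in F -> phix (F :\: [set y]) (M :|: [set y]) x <= phix F M x.
Proof.
move=> yF; apply: ler_sum => i _; rewrite wt_maker //; case: ifP => // _.
Qed.

(** By claiming [x] Breaker raises the potential by [phix x]; the factor 2 pays for his first move.
    Maker takes the free [y] with the largest [phix], and the decrease [phix y] makes up for the
    next increase [phix z]. *)
Lemma erdos_selfridge : (2%:R * \sum_i 2%:R ^- #|A i| < 1 :> rat) ->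
  mwin (fun M => forall i, ~~ [disjoint A i & M]) (\bigcup_i A i) set0.
Proof.
move=> small.
exists (fun F M => phi F M < 1 /\ forall x, x \in F -> phi F M + phix F M x < 1).
  split=> [F M x [h1 h2] xF|M [h1 _] i].
    have [F1|[y0 y0F]] := set_0Vmem (F :\ x).
      exists set0; rewrite sub0set cards0 setU0 F1 setD0; split=> //; split.
        by rewrite -F1 phi_breaker // h2.
      by move=> z; rewrite inE.
    have [y yF ymax] : exists2 y, y \in F :\ x &
       forall z, z \in F :\ x -> phix (F :\ x) M z <= phix (F :\ x) M y.
      case: (@arg_maxP _ _ _ y0 (mem (F :\ x)) (phix (F :\ x) M) y0F) => y yF ym.
      by exists y.
    have e : phi (F :\ x :\: [set y]) (M :|: [set y]) = phi (F :\ x) M - phix (F :\ x) M y.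
      apply/eqP; rewrite eq_sym subr_eq eq_sym /phi /phix [X in _ + X]big_mkcond -[X in X == _]big_split /=.
      apply/eqP/eq_bigr => i _; rewrite wt_maker //; case: ifP => _; by rewrite ?add0r ?addr0.
    exists [set y]; rewrite sub1set yF cards1; split=> //; rewrite e.
    have p1 : phi (F :\ x) M < 1 by rewrite phi_breaker // h2.
    have ge0 : 0 <= phix (F :\ x) M y by apply: sumr_ge0.
    split; first by lra.
    move=> z zF; have zF' : z \in F :\ x by move: zF; rewrite inE => /andP[].
    have := phix_le M z yF; have := ymax z zF'; lra.
  (* With no free element left, an unhit set would contribute exactly 1. *)
  apply/negP => dis; move: h1; apply/negP; rewrite -leNgt.
  have -> : 1 = wt set0 M i by rewrite /wt dis setI0 cards0 expr0 invr1.
  by rewrite /phi (bigD1 i) //= lerDl sumr_ge0.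
have e : phi (\bigcup_i A i) set0 = \sum_i 2%:R ^- #|A i|.
  apply: eq_bigr => i _; rewrite /wt -setI_eq0 setI0 eqxx.
  congr (_ ^- _); apply: eq_card => x; rewrite inE; apply/andb_idr => xA.
  by apply/bigcupP; exists i.
have ge0 : 0 <= \sum_i 2%:R ^- #|A i| :> rat.
  by apply: sumr_ge0 => i _; rewrite invr_ge0 exprn_ge0.
rewrite e; split=> [|x _]; first lra.
have : phix (\bigcup_i A i) set0 x <= phi (\bigcup_i A i) set0.
  by rewrite /phi [leRHS](bigID (fun i => x \in A i)) /= lerDl sumr_ge0.
by rewrite e; lra.
Qed.

End Potential.
End SimpleGames.

Lemma mwin_answer (X : finType) W (F M : {set X}) : F != set0 ->
  (forall x, x \in F -> exists2 y, y \in F :\ x & mwin W (F :\ x :\ y) (M :|: [set y])) ->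
  mwin W F M.
Proof.
move=> F0 h; apply: mwin_reply => // x /h[y yF yw]; exists [set y].
by rewrite sub1set yF cards1.
Qed.

Lemma disjoint_set2 (T : finType) (x y : T) (A : {set T}) :
  [disjoint [set x; y] & A] = (x \notin A) && (y \notin A).
Proof. by rewrite disjoints_subset subUset !sub1set !inE. Qed.

(** * Saturating small clusters *)

Section Matchings.
Variable V : finType.
Implicit Types (M N : {set {set V}}) (S : {set V}).

Definition pm M S : Prop := exists2 N : {set {set V}}, N \subset M &
  trivIset N /\ cover N = S.

Lemma pm_set0 M : pm M set0.
Proof.
exists set0; first exact: sub0set.
by split; [apply/trivIsetP => A B; rewrite inE|rewrite /cover big_set0].
Qed.

Lemma pm_edge M x y : [set x; y] \in M -> pm M [set x; y].
Proof.
move=> xy; exists [set [set x; y]]; rewrite ?sub1set //.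
by split; [exact: trivIset1|rewrite cover1].
Qed.

Lemma pm_union M S1 S2 : [disjoint S1 & S2] -> pm M S1 -> pm M S2 -> pm M (S1 :|: S2).
Proof.
move=> d [N1 s1 [t1 e1]] [N2 s2 [t2 e2]]; exists (N1 :|: N2); first by rewrite subUset s1.
split; last by rewrite -e1 -e2 /cover bigcup_setU.
by apply: trivIsetU; rewrite ?e1 ?e2.
Qed.

Lemma pm_upward S : upward (fun M => pm M S).
Proof. by move=> A B AB [N s h]; exists N => //; apply: subset_trans s AB. Qed.

(* The board of a cluster P with outside neighbours Y. *)
Definition touching (e : rel V) (P Y : {set V}) : {set {set V}} :=
  [set [set p.1; p.2] | p : V * V & [&& p.1 \in P, p.2 \in P :|: Y & e p.1 p.2]].

(** [Z] consists of the outside vertices used as partners; the bound [k] limits what the cells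
    containing them lose. *)
Definition saturated k (P Y : {set V}) M : Prop := exists Z : {set V},
  [/\ Z \subset Y, #|Z| <= k & pm M (P :|: Z)].

Lemma saturated_upward k P Y : upward (saturated k P Y).
Proof. by move=> A B AB [Z [h1 h2 h3]]; exists Z; split=> //; apply: pm_upward h3. Qed.

Implicit Types (e : rel V) (P Y x : {set V}).

Lemma touchingP e P Y x : reflect (exists u v,
  [/\ u \in P, v \in P :|: Y, e u v & x = [set u; v]]) (x \in touching e P Y).
Proof.
apply: (iffP imsetP) => [[[u v]]|[u [v [uP vP uv ->]]]].
  by rewrite inE => /and3P[/= uP vP uv] ->; exists u, v.
by exists (u, v); rewrite ?inE /= ?uP ?uv ?andbT //; move: vP; rewrite inE.
Qed.

Lemma mem_touching e P Y u v : u \in P -> v \in P :|: Y -> e u v -> [set u; v] \in touching e P Y.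
Proof. by move=> uP vP uv; apply/touchingP; exists u, v. Qed.

Lemma touching_sub e P Y P' Y' : P \subset P' -> P :|: Y \subset P' :|: Y' ->
  touching e P Y \subset touching e P' Y'.
Proof.
move=> sP sY; apply/subsetP => x /touchingP[u [v [uP vP uv ->]]].
by apply: mem_touching => //; [apply: (subsetP sP)|apply: (subsetP sY)].
Qed.

Lemma touching_notin e P Y x a : x \in touching e P Y -> a \in x -> a \in P :|: Y.
Proof.
case/touchingP => u [v [uP vP _ ->]]; rewrite in_set2 => /orP[]/eqP-> //.
by rewrite inE uP.
Qed.

Section Cluster.
Variable e : rel V.
Hypotheses (esym : symmetric e) (eirr : irreflexive e).

Lemma mwin_one u (Y : {set V}) : u \notin Y -> 1 < #|[set y in Y | e u y]| ->
  mwin (saturated 1 [set u] Y) (touching e [set u] Y) set0.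
Proof.
move=> uY; set E := [set y in Y | e u y] => E2.
have mem a : a \in E -> [set u; a] \in touching e [set u] Y.
  by rewrite inE => /andP[aY ua]; apply: mem_touching; rewrite ?inE ?eqxx ?aY ?orbT.
have /card_gt0P[a0 a0E] : 0 < #|E| by apply: ltn_trans E2.
apply: mwin_answer => [|x xF].
  by apply/set0Pn; exists [set u; a0]; apply: mem.
have [a [b [aE bE ab]]] := card_gt1P E2.
have [y yE yx] : exists2 y, y \in E & [set u; y] != x.
  have [xa|] := eqVneq [set u; a] x; last by exists a.
  exists b => //; apply/eqP => xb; have : b \in [set u; a] by rewrite xa -xb !inE eqxx orbT.
  have bu : b != u by apply: contraNneq uY => <-; move: bE; rewrite inE => /andP[].
  by rewrite !inE (negbTE bu) eq_sym (negbTE ab).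
exists [set u; y]; first by rewrite !inE yx mem.
apply: mwin_now; first exact: saturated_upward.
exists [set y]; split; rewrite ?cards1 //.
  by rewrite sub1set; move: yE; rewrite inE => /andP[].
by apply: pm_edge; rewrite !inE eqxx orbT.
Qed.

(** The position after Breaker has claimed [uv] and Maker has answered [ua]: what remains for [v] is
    the game of [mwin_one] on the partners other than [a]. *)
Lemma mwin_pair_aux u v a (Y : {set V}) : u != v -> u \notin Y -> v \notin Y ->
  a \in Y -> e u a -> 1 < #|[set y in Y | e v y] :\ a| ->
  mwin (saturated 2 [set u; v] Y)
    (touching e [set u; v] Y :\ [set u; v] :\ [set u; a]) (set0 :|: [set [set u; a]]).
Proof.
move=> uv uY vY aY ua h.
have av : v != a by apply: contraNneq vY => ->.
have au : u != a by apply: contraNneq uY => ->.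
have h' : mwin (saturated 1 [set v] (Y :\ a)) (touching e [set v] (Y :\ a)) set0.
  apply: mwin_one; first by rewrite !inE negb_and vY orbT.
  by rewrite (_ : [set y in Y :\ a | e v y] = [set y in Y | e v y] :\ a) //; apply/setP => y; rewrite !inE andbA.
have {h'} : mwin (saturated 1 [set v] (Y :\ a))
    (touching e [set u; v] Y :\ [set u; v] :\ [set u; a]) (set0 :|: [set [set u; a]]).
  apply: mwin_mono (h') _ _; [exact: saturated_upward| |exact: sub0set].
  apply: subset_trans (subsetUl _ _); apply/subsetP => x xt.
  have ux : u \notin x.
    apply/negP => /(touching_notin xt).
    by rewrite !inE (negbTE uv) (negbTE uY) andbF.
  rewrite !inE; apply/and3P; split; try by apply: contraNneq ux => ->; rewrite !inE eqxx.
  apply: subsetP xt; apply: touching_sub; first by rewrite sub1set !inE eqxx orbT.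
  by apply: setUSS; [rewrite sub1set !inE eqxx orbT|apply: subsetDl].
move=> h'; apply: mwin_impl h' _ => M' s [Z [Z1 Z2 Z3]].
have aZ : a \notin Z by apply/negP => /(subsetP Z1); rewrite !inE eqxx.
have uZ : u \notin Z by apply/negP => /(subsetP Z1); rewrite !inE (negbTE uY) andbF.
exists (a |: Z); split.
- by rewrite subUset sub1set aY; apply: subset_trans Z1 (subsetDl _ _).
- by rewrite cardsU1 aZ.
have -> : [set u; v] :|: (a |: Z) = [set u; a] :|: ([set v] :|: Z).
  by apply/setP => y; rewrite !inE; do !case: (_ == _).
apply: pm_union Z3.
  rewrite disjoint_set2 !inE (negbTE aZ) (negbTE uZ) (negbTE uv).
  by rewrite eq_sym (negbTE av).
by apply: pm_edge; apply: (subsetP s); rewrite !inE eqxx.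
Qed.

Lemma mwin_pair u v (Y : {set V}) : e u v -> u \notin Y -> v \notin Y ->
  0 < #|[set y in Y | e u y]| -> 0 < #|[set y in Y | e v y]| ->
  2 < #|[set y in Y | e u y] :|: [set y in Y | e v y]| ->
  mwin (saturated 2 [set u; v] Y) (touching e [set u; v] Y) set0.
Proof.
move=> euv uY vY u1 v1 uv3.
have uv : u != v by apply: contraTneq euv => ->; rewrite eirr.
have uvT : [set u; v] \in touching e [set u; v] Y.
  by apply: mem_touching; rewrite ?inE ?eqxx ?orbT.
apply: mwin_answer => [|x xF]; first by apply/set0Pn; exists [set u; v].
have [->|xuv] := eqVneq x [set u; v]; last first.
  exists [set u; v]; first by rewrite !inE eq_sym xuv.
  apply: mwin_now; first exact: saturated_upward.
  exists set0; split; rewrite ?sub0set ?cards0 ?setU0 //.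
  by apply: pm_edge; rewrite !inE eqxx.
set Eu := [set y in Y | e u y] in u1 uv3 *.
set Ev := [set y in Y | e v y] in v1 uv3 *.
(* One of the two vertices has a partner [a] whose use leaves at least two for the other; this is
   where three outside neighbours in total are needed. *)
have key : (exists2 a, a \in Eu & 1 < #|Ev :\ a|) \/ (exists2 a, a \in Ev & 1 < #|Eu :\ a|).
  have cD (A : {set V}) a : #|A| - 1 <= #|A :\ a|.
    by rewrite (cardsD1 a A); case: (a \in A); lia.
  have [Ev3|Ev3] := ltnP 2 #|Ev|.
    by case/card_gt0P: u1 => a aE; left; exists a => //; apply: leq_trans (cD _ _); lia.
  have [Eu3|Eu3] := ltnP 2 #|Eu|.
    by case/card_gt0P: v1 => a aE; right; exists a => //; apply: leq_trans (cD _ _); lia.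
  have [Ev2|Ev2] := leqP 2 #|Ev|.
    have : 0 < #|Eu :\: Ev|.
      have := cardsU Eu Ev; have := cardsID Ev Eu; lia.
    case/card_gt0P => a; rewrite !inE => /andP[aEv aEu]; left; exists a; first by rewrite inE.
    by have := cardsD1 a Ev; rewrite !inE (negbTE aEv) /=; move: Ev2; clear; lia.
  have : 0 < #|Ev :\: Eu|.
    have := cardsU Eu Ev; have := cardsID Eu Ev; rewrite [Ev :&: Eu]setIC; lia.
  case/card_gt0P => a; rewrite !inE => /andP[aEu aEv]; right; exists a; first by rewrite inE.
  have := cardsD1 a Eu; rewrite !inE (negbTE aEu) /=.
  have := cardsU Eu Ev; move: uv3 Ev2 Eu3; clear; lia.
have nin z t a : z != t -> z \notin Y -> t \notin Y -> a \in Y -> [set z; a] != [set z; t].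
  move=> zt zY tY aY; apply/eqP => /setP/(_ t); rewrite !inE eqxx orbT eq_sym (negbTE zt) /=.
  by move=> /eqP ta; rewrite ta aY in tY.
case: key => [[a]|[a]]; rewrite inE => /andP[aY ua] h.
  exists [set u; a]; last exact: mwin_pair_aux.
  rewrite !inE nin //; apply: mem_touching => //; first by rewrite !inE eqxx.
  by rewrite inE aY orbT.
exists [set v; a].
  rewrite !inE [[set u; v]]setUC nin 1?eq_sym //; apply: mem_touching => //; first by rewrite !inE eqxx.
  by rewrite inE aY orbT.
by rewrite [[set u; v]]setUC; apply: mwin_pair_aux; rewrite 1?eq_sym.
Qed.

(** Breaker's edge has an endpoint [u] in [P]. While [P] has more than two vertices Maker answers
    with another edge [uw] inside [P]; Breaker's edge becomes irrelevant and [P] loses two vertices.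
    Parity decides the end: a single vertex needs two partners, a pair needs three. *)
Lemma mwin_cluster (P Y : {set V}) : [disjoint P & Y] ->
  {in P &, forall u v, u != v -> e u v} ->
  {in P & Y, forall u y, e u y} ->
  (P != set0 -> 2 <= #|Y|) -> (P != set0 -> ~~ odd #|P| -> 3 <= #|Y|) ->
  mwin (saturated 2 P Y) (touching e P Y) set0.
Proof.
have [k] := ubnP #|P|; elim: k P => // k IH P Pk dPY ePP ePY Y2 Y3.
have [P0|P0] := eqVneq P set0.
  apply: mwin_now; first exact: saturated_upward.
  by exists set0; rewrite sub0set cards0 setU0 P0; split=> //; apply: pm_set0.
have inY u : u \in P -> [set y in Y | e u y] = Y.
  by move=> uP; apply/setP => y; rewrite inE; apply/andb_idr => yY; apply: ePY.
have PY u : u \in P -> u \notin Y by move=> uP; rewrite (disjointFr dPY).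
have [/eqP/cards1P[u Pu]|P1] := eqVneq #|P| 1.
  have uP : u \in P by rewrite Pu inE.
  apply: (@mwin_impl _ (saturated 1 P Y)).
    by rewrite Pu; apply: mwin_one; rewrite ?PY ?inY ?Y2.
  by move=> M' _ [Z [z1 z2 z3]]; exists Z; split=> //; apply: leq_trans z2 _.
have [/eqP/cards2P[u [v [uv Puv]]]|P2] := eqVneq #|P| 2.
  have uP : u \in P by rewrite Puv !inE eqxx.
  have vP : v \in P by rewrite Puv !inE eqxx orbT.
  have Y3' : 3 <= #|Y| by apply: Y3; rewrite // Puv cards2 uv.
  by rewrite Puv; apply: mwin_pair; rewrite ?PY ?inY ?setUid //; [apply: ePP|lia|lia].
have P3 : 2 < #|P| by move: P0; rewrite -card_gt0; lia.
have /card_gt1P[u0 [v0 [u0P v0P uv0]]] : 1 < #|P| by lia.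
apply: mwin_answer => [|x xF].
  by apply/set0Pn; exists [set u0; v0]; apply: mem_touching; rewrite ?inE ?v0P //; apply: ePP.
case/touchingP: (xF) => u [v [uP vP uv xuv]].
have [w wP] : exists w, w \in P :\ u :\ v.
  apply/card_gt0P; have := cardsD1 u P; have := cardsD1 v (P :\ u); rewrite uP; move: P3; clear; case: (v \in _); lia.
move: wP; rewrite !inE => /and3P[wv wu wP].
have xw : [set u; w] != x.
  by apply/eqP => /setP/(_ w); rewrite xuv !inE eqxx orbT (negbTE wv) (negbTE wu).
have uw : e u w by apply: ePP; rewrite // eq_sym.
have uwT : [set u; w] \in touching e P Y by apply: mem_touching; rewrite ?inE ?wP.
exists [set u; w]; first by rewrite !inE xw.
pose P' := P :\ u :\ w.
have sP : P' \subset P by apply: subset_trans (subsetDl _ _) (subsetDl _ _).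
have cP : #|P| = #|P'|.+2.
  by rewrite (cardsD1 u) uP (cardsD1 w (P :\ u)) !inE wu wP.
have uP' : u \notin P' by rewrite !inE eqxx andbF.
have win' : mwin (saturated 2 P' Y) (touching e P' Y) set0.
  apply: IH.
  - by move: Pk; rewrite cP ltnS => /ltnW.
  - exact: disjointWl sP dPY.
  - by move=> a b /(subsetP sP) aP /(subsetP sP) bP; apply: ePP.
  - by move=> a b /(subsetP sP) aP; apply: ePY.
  - by move=> _; apply: Y2.
  - by move=> _ o; apply: Y3; rewrite // cP /= negbK.
have : mwin (saturated 2 P' Y) (touching e P Y :\ x :\ [set u; w]) (set0 :|: [set [set u; w]]).
  apply: mwin_mono win' _ (sub0set _); first exact: saturated_upward.
  apply: subset_trans (subsetUl _ _); apply/subsetP => t tt.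
  have ut : u \notin t.
    by apply/negP => /(touching_notin tt); rewrite inE (negbTE uP') (negbTE (PY _ uP)).
  rewrite !inE; apply/and3P; split.
  - by apply: contraNneq ut => ->; rewrite !inE eqxx.
  - by apply: contraNneq ut => ->; rewrite xuv !inE eqxx.
  - by apply: subsetP tt; apply: touching_sub => //; apply: setSU.
move=> h; apply: mwin_impl h _ => M' s [Z [Z1 Z2 Z3]].
exists Z; split=> //.
have -> : P :|: Z = [set u; w] :|: (P' :|: Z).
  apply/setP => y; rewrite !inE; case: eqVneq => [->|_]; rewrite ?uP //.
  by case: eqVneq => [->|_]; rewrite ?wP.
apply: pm_union Z3; last by apply: pm_edge; apply: (subsetP s); rewrite !inE eqxx.
rewrite disjoint_set2 !inE !eqxx andbF /=.
by apply/andP; split; apply/negP => /(subsetP Z1); rewrite (negbTE (PY _ _)).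
Qed.

End Cluster.
End Matchings.

(** * Necessity of the degree conditions *)

Section BreakerPairing.
Variables (X : finType) (E : {set X}) (s : seq X -> X).
Hypothesis sL : maker_strategy E s.

Let legal (b : seq X -> X) := forall h, history E h -> ~~ odd (size h) ->
  size h < #|E| -> b h \in E /\ b h \notin h.

Lemma play_out b : legal b -> exists p, [/\ complete_play E p, consistent s p &
  forall h x t, p = h ++ x :: t -> ~~ odd (size h) -> x = b h].
Proof.
move=> bL; pose next h := if odd (size h) then s h else b h.
pose play k := iter k (fun h => rcons h (next h)) [::].
have sz k : size (play k) = k by elim: k => //= k IH; rewrite size_rcons IH.
have nextL h : history E h -> size h < #|E| -> next h \in E /\ next h \notin h.
  by move=> hh hs; rewrite /next; case: ifP => o; [apply: sL|apply: bL; rewrite ?o].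
have hist k : k <= #|E| -> history E (play k).
  elim: k => //= k IH kE; have := nextL _ (IH (ltnW kE)); rewrite sz => /(_ kE)[nE nh].
  have /andP[u a] := IH (ltnW kE).
  by rewrite /history rcons_uniq nh u all_rcons /= nE.
have pre k h x t : play k = h ++ x :: t -> x = next h.
  move=> e; have le : size h < k by rewrite -(sz k) e size_cat /=; lia.
  have tk j i : take j (play (j + i)) = play j.
    elim: i => [|i IH]; first by rewrite addn0 -[X in take X](sz j) take_size.
    rewrite addnS /= -cats1 takel_cat ?IH // sz; lia.
  have : take (size h).+1 (play k) = rcons (play (size h)) (next (play (size h))).
    by rewrite -(subnKC le) tk.
  have : take (size h) (play k) = play (size h) by rewrite -(subnKC (ltnW le)) tk.
  rewrite e take_size_cat // => <-.
  rewrite -cat_rcons take_size_cat ?size_rcons // => /eqP.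
  by rewrite eqseq_rcons => /andP[_ /eqP].
exists (play #|E|).
have /andP[u /allP a] := hist _ (leqnn _).
split=> [|h x t /pre -> o|h x t /pre -> o].
- split=> //; apply/subset_cardP; first by rewrite (card_uniqP u) sz.
  by apply/subsetP => y /a.
- by rewrite /next o.
- by rewrite /next (negbTE o).
Qed.

(* Breaker claims x0 first and then always answers y by f y. *)
Lemma breaker_pairing (x0 : X) (f : X -> X) : involutive f ->
  exists p, [/\ complete_play E p, consistent s p, x0 \notin claimed_by_maker p &
    forall y, y \in claimed_by_maker p -> f y != y -> f y \notin claimed_by_maker p].
Proof.
move=> fI.
(* The fallback keeps [b] legal when the intended answer is taken or not on the board. *)
pose b h := let y := if h is z :: h' then f (last z h') else x0 in
  if (y \in E) && (y \notin h) then y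
  else if [pick y in E :\: [set z in h]] is Some y then y else x0.
have bL : legal b.
  move=> h /andP[uh ah] _ hs; rewrite /b.
  set y := (if h is z :: h' then _ else _); case: ifP => [/andP[]//|_].
  case: pickP => [z|no]; first by rewrite !inE => /andP[].
  have : E \subset [set z in h].
    by apply/subsetP => z zE; have := no z; rewrite !inE zE andbT => /negbFE.
  move/subset_leq_card; rewrite cardsE => /leq_trans/(_ (card_size h)); lia.
have [p [[u pE] cp bp]] := play_out bL; exists p; split=> //.
  rewrite inE; apply/negP => /andP[x0p o].
  case: p u pE cp bp x0p o => // x p u pE cp bp x0p o.
  have := bp [::] x p erefl isT; rewrite /b -pE x0p /= => xx.
  by rewrite xx /= eqxx in o.
(* If Maker claimed [y] before [f y], the move right after [y] was Breaker's and [f y] was still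
   free, so Breaker took it. *)
have wlog_lem y : y \in p -> f y \in p -> odd (index y p) -> odd (index (f y) p) ->
    f y != y -> index y p < index (f y) p -> False.
  move=> yp fp oy of_ ne lt.
  have e1 : p = take (index y p).+1 p ++ drop (index y p).+1 p by rewrite cat_take_drop.
  have sp : (index y p).+1 < size p by apply: leq_ltn_trans lt _; rewrite index_mem.
  pose h := take (index y p).+1 p; pose x := nth x0 p (index y p).+1.
  have eh : h = rcons (take (index y p) p) y.
    by rewrite /h (take_nth y) ?index_mem // nth_index.
  have := bp h x (drop (index y p).+2 p); rewrite -(drop_nth x0) // -e1 => /(_ erefl).
  have sh : size h = (index y p).+1 by rewrite size_takel // ltnW.
  rewrite sh /= oy => /(_ isT).
  have lh : (if h is z :: h' then f (last z h') else x0) = f y.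
    by rewrite eh; case: (take (index y p) p) => //= z h'; rewrite last_rcons.
  rewrite /b lh -pE fp /=.
  have -> : f y \notin h.
    by rewrite (in_take_leq _ (ltnW sp)) ltnS -ltnNge.
  move=> xf; have : index (f y) p = (index y p).+1 by rewrite -xf index_uniq.
  by move=> e; rewrite e /= oy in of_.
move=> y; rewrite !inE => /andP[yp oy] ne; apply/negP => /andP[fp of_].
have [lt|le] := ltnP (index y p) (index (f y) p); first exact: (wlog_lem y).
apply: (wlog_lem (f y)); rewrite ?fI // 1?eq_sym //.
rewrite ltn_neqAle le andbT; apply: contraNneq ne => e.
by rewrite -(nth_index x0 fp) e nth_index.
Qed.

End BreakerPairing.

Lemma edgesP (T : finType) (e : rel T) (x : {set T}) :
  reflect (exists u v, e u v /\ x = [set u; v]) (x \in edges e).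
Proof.
apply: (iffP imsetP) => [[[u v]]|[u [v [uv ->]]]].
  by rewrite inE /= => uv ->; exists u, v.
by exists (u, v); rewrite ?inE.
Qed.

Lemma set2_inj_l (T : finType) (u a b : T) : a != u -> [set u; a] = [set u; b] -> a = b.
Proof.
by move=> au /setP/(_ a); rewrite !inE eqxx orbT (negbTE au) => /esym/eqP.
Qed.

(** Breaker opens with the edge, if any, at a vertex of degree at most one, or with an edge [uv] of
    edge-degree at most 2. In the second case [u] and [v] need different partners in [D]; if [D] is
    [[set a; b]], Breaker answers along the involution exchanging [u] with [v] and [a] with [b], so
    Maker gets at most one of [ua] and [vb], and at most one of [ub] and [va]. *)
Lemma maker_wins_pm_necessary (T : finType) (e : rel T) : symmetric e -> irreflexive e ->
  maker_wins_pm e -> min_degree_ge e 2 /\ min_edge_degree_ge e 3.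
Proof.
move=> esym eirr [s sL sW].
have inc u M : perfect_matching e M -> exists2 v, e u v & [set u; v] \in M.
  case/and3P => ME tM /eqP cM; have : u \in cover M by rewrite cM inE.
  case/bigcupP => x xM ux; have /edgesP[a [b [ab xab]]] := subsetP ME _ xM.
  move: ux xM; rewrite xab !inE => /orP[]/eqP ->; first by exists b.
  by move=> h; exists a; rewrite 1?esym // setUC.
split=> [u|u v uv]; rewrite leqNgt; apply/negP => lt.
  have [x0 hx0] : exists x0, forall v, e u v -> [set u; v] = x0.
    have [N0|[a aN]] := set_0Vmem (neighbours e u).
      by exists set0 => v uv; move/setP/(_ v): N0; rewrite !inE uv.
    exists [set u; a] => v uv; have /card_le1_eqP le1 : #|neighbours e u| <= 1 by [].
    by rewrite (le1 v a) // inE.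
  have [p [cp cons nx0 _]] := breaker_pairing sL x0 (f := id) (fun=> erefl).
  have [M pmM sM] := sW _ cp cons; have [v uv vM] := inc u M pmM.
  by move: nx0; rewrite -(hx0 v uv) (subsetP sM).
set D := (neighbours e u :|: neighbours e v) :\: [set u; v].
have vu : v != u by apply: contraTneq uv => ->; rewrite eirr.
have sym2 z1 z2 : [set z1; z2] = [set z2; z1] :> {set T} by rewrite setUC.
have final p : complete_play (edges e) p -> consistent s p ->
    [set u; v] \notin claimed_by_maker p -> exists y1 y2, [/\ y1 \in D, y2 \in D, y1 != y2,
      [set u; y1] \in claimed_by_maker p & [set v; y2] \in claimed_by_maker p].
  move=> cp cons nuv; have [M pmM sM] := sW _ cp cons.
  have [y1 uy1 m1] := inc u M pmM; have [y2 vy2 m2] := inc v M pmM.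
  have y1v : y1 != v by apply: contraNneq nuv => <-; apply: (subsetP sM).
  have y2u : y2 != u by apply: contraNneq nuv => <-; rewrite sym2; apply: (subsetP sM).
  have y1u : y1 != u by apply: contraTneq uy1 => ->; rewrite eirr.
  have y2v : y2 != v by apply: contraTneq vy2 => ->; rewrite eirr.
  exists y1, y2; rewrite !inE uy1 vy2 !negb_or y1v y2u y1u y2v orbT; split=> //.
  - case/and3P: pmM => _ /trivIsetP tM _.
    have ne : [set u; y1] != [set v; y2].
      by apply/eqP => /setP/(_ v); rewrite !inE eqxx (negbTE vu) eq_sym (negbTE y1v).
    apply: contraL (tM _ _ m1 m2 ne) => /eqP y12; rewrite disjoint_set2 y12.
    by rewrite !inE eqxx orbT andbF.
  - by have := subsetP sM _ m1; rewrite inE.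
  - by have := subsetP sM _ m2; rewrite inE.
have [D2|D2] := eqVneq #|D| 2; last first.
  have [p [cp cons nuv _]] := breaker_pairing sL [set u; v] (f := id) (fun=> erefl).
  have [y1 [y2 [y1D y2D ne _ _]]] := final _ cp cons nuv.
  have /card_le1_eqP le1 : #|D| <= 1 by move: lt; rewrite /edge_degree -/D; lia.
  by rewrite (le1 y1 y2) ?eqxx in ne.
have /eqP/cards2P[a [b [ab eD]]] := D2.
have aD : a \in D by rewrite eD !inE eqxx.
have bD : b \in D by rewrite eD !inE eqxx orbT.
have [au av] : a != u /\ a != v by move: aD; rewrite !inE negb_or => /andP[/andP[]].
have [bu bv] : b != u /\ b != v by move: bD; rewrite !inE negb_or => /andP[/andP[]].
pose t := (tperm u v * tperm a b)%g; pose f (x : {set T}) := t @: x.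
have tE z : t z = tperm a b (tperm u v z) by rewrite permM.
have tu : t u = v by rewrite tE tpermL tpermD.
have tv : t v = u by rewrite tE tpermR tpermD.
have ta : t a = b by rewrite tE [tperm u v a]tpermD 1?eq_sym // tpermL.
have tb : t b = a by rewrite tE [tperm u v b]tpermD 1?eq_sym // tpermR.
have tI : involutive t.
  move=> z; have [->|zu] := eqVneq z u; first by rewrite tu tv.
  have [->|zv] := eqVneq z v; first by rewrite tv tu.
  have [->|za] := eqVneq z a; first by rewrite ta tb.
  have [->|zb] := eqVneq z b; first by rewrite tb ta.
  have tz : t z = z by rewrite tE !tpermD // eq_sym.
  by rewrite !tz.
have fI : involutive f by move=> x; rewrite /f -imset_comp (eq_imset _ tI) imset_id.
have f2 z1 z2 : f [set z1; z2] = [set t z1; t z2] by rewrite /f imsetU1 imset_set1.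
have [p [cp cons nuv fp]] := breaker_pairing sL [set u; v] fI.
have [y1 [y2 [y1D y2D ne c1 c2]]] := final _ cp cons nuv.
have y2E : y2 = t y1.
  move: y1D y2D ne; rewrite eD !inE => /orP[]/eqP-> /orP[]/eqP->; rewrite ?eqxx ?ta ?tb //.
have y1v : y1 != v by move: y1D; rewrite !inE negb_or => /andP[/andP[]].
have := fp _ c1; rewrite f2 tu -y2E c2; case: eqP => [/setP/(_ v)|_ /(_ isT)//].
by rewrite !inE eqxx (negbTE vu) [v == y1]eq_sym (negbTE y1v).
Qed.

(** * Matchings inside a cell that survive the loss of vertices *)

Lemma card_subset_exists (V : finType) (A : {set V}) k : k <= #|A| ->
  exists2 B : {set V}, B \subset A & #|B| = k.
Proof.
elim: k => [|k IH] kA; first by exists set0; rewrite ?sub0set ?cards0.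
have [B sB cB] := IH (ltnW kA).
have /card_gt0P[x] : 0 < #|A :\: B|.
  by rewrite cardsD (setIidPr sB) cB subn_gt0.
rewrite inE => /andP[xB xA]; exists (x |: B); last by rewrite cardsU1 xB cB.
by rewrite subUset sub1set xA.
Qed.

Section DenseMatching.
Variables (V : finType) (M : {set {set V}}).
Hypothesis M2 : forall x, x \in M -> #|x| = 2.

(** A matching of [S] as a fixed-point-free involution, so that partners can be followed along an
    augmenting path. *)
Definition pairing_on (S : {set V}) (p : V -> V) :=
  forall a, a \in S -> [/\ p a \in S, p a != a, [set a; p a] \in M & p (p a) = a].

Lemma pairing_pm S p : pairing_on S p -> pm M S.
Proof.
move=> h; exists [set [set a; p a] | a in S].
  by apply/subsetP => x /imsetP[a /h[_ _ ? _] ->].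
split.
  apply/trivIsetP => x y /imsetP[a /h[_ _ _ pa] ->] /imsetP[b /h[_ _ _ pb] ->] ne.
  rewrite disjoint_set2 !inE !negb_or; apply: contraNT ne.
  rewrite !negb_and !negbK -!orbA => /or4P[]/eqP e.
  - by rewrite e.
  - by rewrite e pb setUC.
  - by rewrite -e pa setUC.
  - by rewrite -pb -e pa.
apply/setP => a; apply/bigcupP/idP => [[x /imsetP[b bS ->]]|aS].
  by rewrite !inE => /orP[]/eqP-> //; case: (h b bS).
by exists [set a; p a]; [exact: imset_f|rewrite !inE eqxx].
Qed.

Lemma pm_pairing S : pm M S -> exists p, pairing_on S p.
Proof.
case=> N sN [tN cN].
have ex a : a \in S -> exists b, (b != a) && ([set a; b] \in N).
  rewrite -cN => /bigcupP[x xN ax].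
  have /eqP/cards2P[u [v [uv xuv]]] := M2 (subsetP sN _ xN).
  move: ax xN; rewrite xuv !inE => /orP[]/eqP -> h; first by exists v; rewrite eq_sym uv.
  by exists u; rewrite uv setUC.
pose p a := if [pick b | (b != a) && ([set a; b] \in N)] is Some b then b else a.
have pP a : a \in S -> p a != a /\ [set a; p a] \in N.
  move=> /ex[b hb]; rewrite /p; case: pickP => [c /andP[]//|/(_ b)]; by rewrite hb.
exists p => a aS; have [pa na] := pP a aS.
have paS : p a \in S.
  by rewrite -cN; apply/bigcupP; exists [set a; p a]; rewrite // !inE eqxx orbT.
split=> //; first exact: (subsetP sN).
have [ppa nb] := pP _ paS.
have [e|ne] := eqVneq [set a; p a] [set p a; p (p a)].
  have : p (p a) \in [set a; p a] by rewrite e !inE eqxx orbT.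
  by rewrite !inE (negbTE ppa) orbF => /eqP.
have := trivIsetP tN _ _ na nb ne; rewrite disjoint_set2 !inE eqxx.
by rewrite andbF.
Qed.

Lemma pm_even S : pm M S -> ~~ odd #|S|.
Proof.
case=> N sN [tN <-]; move: (tN); rewrite /trivIset => /eqP <-.
rewrite (eq_bigr (fun=> 2)); last by move=> x /(subsetP sN) /M2.
by rewrite sum_nat_const muln2 odd_double.
Qed.

Lemma pm_edge_disj S x y : pm M S -> x \notin S -> y \notin S ->
  [set x; y] \in M -> pm M ([set x; y] :|: S).
Proof.
by move=> h xS yS xy; apply: pm_union h; [rewrite disjoint_set2 xS|apply: pm_edge].
Qed.

Lemma pm_max (S : {set V}) : exists2 T : {set V}, T \subset S /\ pm M T &
  forall T' : {set V}, T' \subset S -> pm M T' -> #|T'| <= #|T|.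
Proof.
pose P (T : {set V}) := (T \subset S) && `[< pm M T >].
have P0 : P set0 by rewrite /P sub0set; apply/asboolP/pm_set0.
case: (arg_maxnP (fun T : {set V} => #|T|) P0) => T /andP[TS /asboolP pmT] mT.
by exists T => // T' s h; apply: mT; rewrite /P s; apply/asboolP.
Qed.

(* Two unmatched vertices u, v: the partners of the neighbours of u and of v
   form two large sets, and an edge between them gives an augmenting path. *)
Lemma pm_dense (S : {set V}) t :
  (forall x, x \in S -> 2 * t <= #|[set y in S | [set x; y] \in M]|) ->
  (forall A B : {set V}, A \subset S -> B \subset S -> [disjoint A & B] ->
     #|A| = t -> #|B| = t -> exists a b, [/\ a \in A, b \in B & [set a; b] \in M]) ->
  ~~ odd #|S| -> pm M S.
Proof.
move=> deg exp evS; have [T [TS pmT] noT'] := pm_max S.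
have [->//|TnS] := eqVneq S T.
have ne2 a b : [set a; b] \in M -> a != b.
  by move=> /M2; rewrite cards2; case: eqP.
have U2 : 1 < #|S :\: T|.
  have := pm_even pmT; have := cardsD S T; rewrite (setIidPr TS).
  have : #|T| < #|S|.
    by apply: proper_card; rewrite properEneq eq_sym TnS.
  by move: evS; clear; lia.
case/card_gt1P: U2 => u [v []]; rewrite !inE => /andP[uT uS] /andP[vT vS] uv.
have [p pP] := pm_pairing pmT.
have nb x : x \in S -> x \notin T -> forall a, a \in S -> [set x; a] \in M -> a \in T.
  move=> xS xT a aS xa; apply: contraT => aT.
  have := noT' ([set x; a] :|: T); rewrite subUset TS subUset !sub1set xS aS => /(_ isT).
  have -> : #|[set x; a] :|: T| = #|T|.+2.
    by rewrite -setUA !cardsU1 !inE (negbTE xT) (negbTE aT) (negbTE (ne2 _ _ xa)).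
  by move=> /(_ (pm_edge_disj pmT xT aT xa)); rewrite ltnNge leqnSn.
pose Nb x := [set y in S | [set x; y] \in M].
have sub x : x \in S -> x \notin T -> Nb x \subset T.
  by move=> xS xT; apply/subsetP => a; rewrite inE => /andP[aS]; apply: nb.
have cp x : x \in S -> x \notin T -> 2 * t <= #|p @: Nb x|.
  move=> xS xT; rewrite card_in_imset ?deg // => a b /(subsetP (sub _ xS xT)) aT /(subsetP (sub _ xS xT)) bT e.
  by have [_ _ _ <-] := pP a aT; have [_ _ _ <-] := pP b bT; rewrite e.
have [A sA cA] : exists2 A : {set V}, A \subset p @: Nb u & #|A| = t.
  by apply: card_subset_exists; have := cp u uS uT; clear; lia.
(* The degree [2 * t] leaves [t] partners for [B] even outside [A]. *)
have [B sB cB] : exists2 B : {set V}, B \subset (p @: Nb v) :\: A & #|B| = t.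
  apply: card_subset_exists; have := cp v vS vT; have := cardsID A (p @: Nb v).
  have := subset_leq_card (subsetIr (p @: Nb v) A); move: cA; clear; lia.
have pT x a : x \in S -> x \notin T -> a \in p @: Nb x ->
    [/\ a \in T, p a \in T, [set x; p a] \in M, [set a; p a] \in M & p (p a) = a].
  move=> xS xT /imsetP[b bN ->]; have bT := subsetP (sub _ xS xT) _ bN.
  have [h1 h2 h3 h4] := pP b bT; have [h5 h6 h7 h8] := pP _ h1.
  split=> //; rewrite h4; first by move: bN; rewrite inE => /andP[].
have [a [b [aA bB ab]]] : exists a b, [/\ a \in A, b \in B & [set a; b] \in M].
  apply: exp => //.
  - by apply/subsetP => a /(subsetP sA) /(pT u a uS uT)[/(subsetP TS)].
  - apply/subsetP => b /(subsetP sB); rewrite inE => /andP[_] /(pT v b vS vT)[/(subsetP TS)] //.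
  - rewrite disjoint_sym; apply: disjointWl sB _.
    by rewrite disjoints_subset subsetDr.
have aA' := subsetP sA _ aA; have := subsetP sB _ bB; rewrite inE => /andP[bA bB'].
have [aT paT upa apa ppa] := pT _ _ uS uT aA'.
have [bT pbT vpb bpb ppb] := pT _ _ vS vT bB'.
have neab : a != b by apply: contraNneq bA => <-.
have neT x y : x \in T -> y \notin T -> x != y by move=> xT yT; apply: contraNneq yT => <-.
have pdel (D : {set V}) : (forall z, z \in D -> p z \in D) -> pm M (T :\: D).
  move=> hD; apply: (pairing_pm (p := p)) => z; rewrite inE => /andP[zD zT].
  have [h1 h2 h3 h4] := pP z zT; split=> //; rewrite inE h1 andbT.
  by apply: contra zD => /hD; rewrite h4.
have fin (T' : {set V}) : T' \subset S -> pm M T' -> T \subset T' -> u \in T' -> False.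
  move=> s h sT uT'; have := noT' _ s h; rewrite leqNgt => /negP; apply.
  by apply: proper_card; rewrite properE sT; apply/subsetPn; exists u.
have apa' := ne2 _ _ apa; have bpb' := ne2 _ _ bpb.
have uD (D : {set V}) : u \notin T :\: D by rewrite inE (negbTE uT) andbF.
have vD (D : {set V}) : v \notin T :\: D by rewrite inE (negbTE vT) andbF.
have u2 x y : x \in T -> y \in T -> u \notin [set x; y].
  by move=> xT yT; rewrite !inE ![u == _]eq_sym (negbTE (neT _ _ xT uT)) (negbTE (neT _ _ yT uT)).
have v2 x y : x \in T -> y \in T -> v \notin [set x; y].
  by move=> xT yT; rewrite !inE ![v == _]eq_sym (negbTE (neT _ _ xT vT)) (negbTE (neT _ _ yT vT)).
(* If [b] is the partner of [a], the edges [ub] and [va] replace [ab]. Otherwise [u (p a)], [ab] and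
   [v (p b)] replace the two matching edges at [a] and [b]. *)
exfalso; have [e|ne] := eqVneq b (p a).
  have h0 : pm M (T :\: [set a; b]).
    by apply: pdel => z; rewrite !inE e => /orP[]/eqP->; rewrite ?ppa ?eqxx ?orbT.
  have va : [set v; a] \in M by rewrite -ppa -e.
  have ub : [set u; b] \in M by rewrite e.
  have h1 : pm M ([set v; a] :|: (T :\: [set a; b])).
    by apply: pm_edge_disj h0 (vD _) _ va; rewrite !inE eqxx.
  have : pm M ([set u; b] :|: ([set v; a] :|: (T :\: [set a; b]))).
    apply: pm_edge_disj h1 _ _ ub; rewrite inE negb_or ?uD ?andbT in_set2 negb_or.
      by rewrite uv eq_sym neT.
    by rewrite neT // eq_sym neab !inE eqxx orbT.
  move=> h; apply: (fin _ _ h).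
  - rewrite !subUset !sub1set uS vS (subsetP TS _ aT) (subsetP TS _ bT) /=.
    by apply: subset_trans (subsetDl _ _) TS.
  - apply/subsetP => z zT; rewrite !inE zT.
    by case: (z == a); case: (z == b); rewrite ?orbT.
  - by rewrite !inE eqxx.
have ne' : a != p b by apply: contraNneq ne => ->; rewrite ppb.
have nepab : p a != p b by apply: contraNneq neab => h; rewrite -ppa h ppb.
set D := [set a; p a; b; p b].
have : pm M ([set u; p a] :|: ([set v; p b] :|: ([set a; b] :|: (T :\: D)))).
  have h0 : pm M (T :\: D).
    by apply: pdel => z; rewrite !inE -!orbA => /or4P[]/eqP->; rewrite ?ppa ?ppb ?eqxx ?orbT.
  have inD (x : V) : x \in D -> x \notin T :\: D by rewrite in_setD => ->.
  have h1 : pm M ([set a; b] :|: (T :\: D)).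
    by apply: pm_edge_disj => //; apply: inD; rewrite !inE eqxx ?orbT.
  have h2 : pm M ([set v; p b] :|: ([set a; b] :|: (T :\: D))).
    apply: pm_edge_disj => //; rewrite inE negb_or ?vD ?v2 // inD ?andbT.
      by rewrite in_set2 negb_or eq_sym ne' eq_sym bpb'.
    by rewrite !inE eqxx orbT.
  apply: pm_edge_disj => //; rewrite !in_setU !negb_or.
    by rewrite uD !in_set1 uv ![u == _]eq_sym !neT.
  rewrite (@inD (p a)) ?andbT; last by rewrite !inE eqxx ?orbT.
  by rewrite !in_set1 (neT _ _ paT vT) nepab eq_sym apa' eq_sym ne.
move=> h; apply: (fin _ _ h).
- rewrite !subUset !sub1set uS vS !(subsetP TS) //=.
  by apply: subset_trans (subsetDl _ _) TS.
- apply/subsetP => z zT; rewrite !inE zT.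
  by case: (z == a); case: (z == p a); case: (z == b); case: (z == p b); rewrite ?orbT.
- by rewrite !inE eqxx.
Qed.

End DenseMatching.

Lemma disjoint_blocks (V : finType) (A : {set V}) D b : D * b <= #|A| ->
  exists f : nat -> {set V}, [/\ forall j, j < D -> f j \subset A, forall j, j < D -> #|f j| = b &
    forall i j, i < D -> j < D -> i != j -> [disjoint f i & f j]].
Proof.
elim: D A => [|D IH] A; first by exists (fun=> set0).
rewrite mulSn => h; have [B BA cB] : exists2 B : {set V}, B \subset A & #|B| = b.
  by apply: card_subset_exists; apply: leq_trans h; apply: leq_addr.
have [|f [f1 f2 f3]] := IH (A :\: B).
  by rewrite cardsD (setIidPr BA) cB leq_subRL ?(leq_trans _ h) ?leq_addr.
have fB j : j < D -> [disjoint f j & B].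
  by move=> /f1 s; apply: disjointWl s _; rewrite disjoints_subset subsetDr.
exists (fun j => if j is j'.+1 then f j' else B); split=> [[|j]|[|j]|[|i] [|j]] //.
- by rewrite ltnS => /f1 s; apply: subset_trans s (subsetDl _ _).
- by rewrite ltnS; apply: f2.
- by move=> _; rewrite ltnS disjoint_sym => /fB.
- by rewrite ltnS => /fB.
- by rewrite !ltnS eqSS; apply: f3.
Qed.

Lemma half_pow_small (m e : nat) : 8 * m <= 2 ^ e -> ((2%:R ^- e *+ m) <= 8%:R^-1 :> rat)%R.
Proof.
move=> h; rewrite -[X in (X <= _)%R]mulr_natl ler_pdivrMr ?exprn_gt0 // ler_pdivlMl //.
by rewrite -natrX -natrM ler_nat.
Qed.

Section Clique.
Variables (V : finType) (c : {set V}) (q : nat).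
Let k := #|c|.
Hypotheses (q4 : 3 < q) (qk : q * q <= k) (kq : k < q.+1 * q.+1)
  (q_large : 48 * (k * q) <= 2 ^ (q.-1 %/ 6)).

Definition clique_edges : {set {set V}} :=
  [set [set p.1; p.2] | p : V * V & [&& p.1 \in c, p.2 \in c & p.1 != p.2]].

(** The [2 * q] spare vertices are what a cell may lose to clusters, to requests and to the
    correction of parity. *)
Definition robust (M : {set {set V}}) := forall S : {set V}, S \subset c ->
  #|c :\: S| <= 2 * q -> ~~ odd #|S| -> pm M S.

Lemma robust_upward : upward robust.
Proof. by move=> A B AB h S s1 s2 s3; apply: pm_upward AB _; apply: h. Qed.

(* Maker must hit D disjoint stars with b edges at each vertex, and every set of
   edges between two disjoint sets of t vertices. *)
Let b := q.-1 %/ 6.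
Let D := 6 * q.
Let t := 2 * q.

Let I1 := ({x : V | x \in c} * 'I_D)%type.
Let I2 := {P : {set V} * {set V} | [&& P.1 \subset c, P.2 \subset c, [disjoint P.1 & P.2],
   #|P.1| == t & #|P.2| == t]}.

(** Hitting [D = 6 * q] stars leaves degree [4 * q = 2 * t] after [2 * q] losses, and [b] edges per
    star fit around a vertex since [D * b < k]. The at most [4 ^ k] pairs of sets are beaten by
    [2 ^ (t * t)], because [t * t = 4 * q * q] exceeds [2 * k] when [q] is about the square root of
    [k]. Each of the two families contributes at most 1/8 to the sum. *)
Lemma mwin_clique : mwin robust clique_edges set0.
Proof.
have blkE x : exists f : nat -> {set V}, x \in c -> [/\ forall j, j < D -> f j \subset c :\ x,
    forall j, j < D -> #|f j| = b & forall i j, i < D -> j < D -> i != j -> [disjoint f i & f j]].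
  have [xc|//] := boolP (x \in c); last by exists (fun=> set0).
  have [|f hf] := @disjoint_blocks _ (c :\ x) D b; last by exists f.
  have -> : #|c :\ x| = k.-1 by rewrite /k (cardsD1 x c) xc.
  have h6 : q.-1 %/ 6 * 6 <= q.-1 by apply: leq_trunc_div.
  rewrite /D /b; move: h6 qk q4; clear; move: (_ %/ _) => B; nia.
have [blk blkP] := fin_all_exists blkE.
pose A (i : I1 + I2) : {set {set V}} := match i with
  | inl (x, j) => [set [set val x; y] | y in blk (val x) j]
  | inr P => [set [set p.1; p.2] | p in setX (val P).1 (val P).2] end.
have cA1 x j : #|A (inl (x, j))| = b.
  have [h1 h2 h3] := blkP _ (valP x).
  rewrite /= card_in_imset ?h2 // => y z yb zb; apply: set2_inj_l.
  by have := subsetP (h1 j (ltn_ord j)) _ yb; rewrite !inE => /andP[].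
have cA2 P : #|A (inr P)| = t * t.
  case: P => [[P1 P2] /= /and5P[s1 s2 d /eqP c1 /eqP c2]].
  rewrite card_in_imset ?cardsX ?c1 ?c2 //= => [[x y] [x' y']] /=.
  rewrite !inE /= => /andP[xP yP] /andP[xP' yP'] e.
  have xy' : x != y' by apply: contraTneq xP => ->; rewrite (disjointFl d).
  have xx : x = x'.
    by move/setP/(_ x): e; rewrite !inE eqxx (negbTE xy') orbF => /esym/eqP.
  have yx' : y != x' by apply: contraTneq yP => ->; rewrite (disjointFr d).
  by rewrite -xx in e yx' *; rewrite (set2_inj_l yx' e).
have small : (2%:R * \sum_i 2%:R ^- #|A i| < 1 :> rat)%R.
  have -> : (\sum_i 2%:R ^- #|A i| = 2%:R ^- b *+ #|{: I1}| + 2%:R ^- (t * t) *+ #|{: I2}| :> rat)%R.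
    rewrite big_sumType; congr (_ + _)%R; rewrite -sumr_const; apply: eq_bigr.
      by move=> [x j] _; rewrite cA1.
    by move=> P _; rewrite cA2.
  have -> : #|{: I1}| = k * D by rewrite card_prod card_sig card_ord.
  have cI2 : #|{: I2}| <= 2 ^ k * 2 ^ k.
    rewrite card_sig -!card_powerset -cardsX; apply: subset_leq_card.
    by apply/subsetP => [[P1 P2]]; rewrite !inE /= => /and5P[-> ->].
  have e1 : ((2%:R ^- b *+ (k * D)) <= 8%:R^-1 :> rat)%R.
    by apply: half_pow_small; apply: leq_trans q_large; rewrite /D; move: k; clear; lia.
  have e2 : ((2%:R ^- (t * t) *+ #|{: I2}|) <= 8%:R^-1 :> rat)%R.
    apply: half_pow_small; rewrite mulnC.
    apply: (@leq_trans (2 ^ k * 2 ^ k * 2 ^ 3)); first by rewrite leq_mul2r cI2 orbT.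
    rewrite -!expnD leq_exp2l // /t; move: kq q4; clear; nia.
  by lra.
have up : upward robust := robust_upward.
have AE : \bigcup_i A i \subset clique_edges.
  apply/bigcupsP => [[[x j]|P]] _; apply/subsetP => z /imsetP.
    case=> y yb ->; have [h1 _ _] := blkP _ (valP x).
    have := subsetP (h1 j (ltn_ord j)) _ yb; rewrite !inE => /andP[yx yc].
    by apply/imsetP; exists (val x, y); rewrite // !inE /= yc (valP x) eq_sym.
  case: P => [[P1 P2] /= /and5P[s1 s2 d _ _]] [[x y]]; rewrite !inE /= => /andP[xP yP] ->.
  apply/imsetP; exists (x, y) => //; rewrite !inE /= (subsetP s1) // (subsetP s2) //=.
  by apply: contraTneq xP => ->; rewrite (disjointFl d).
apply: mwin_mono (mwin_impl (erdos_selfridge small) _) _ (sub0set _) => //; last first.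
  by apply: subset_trans AE (subsetUl _ _).
move=> M _ hit S Sc cS evS.
pose M2 := [set x in M | #|x| == 2].
suff h : pm M2 S by apply: pm_upward h; apply/subsetP => x; rewrite inE => /andP[].
have inM2 x y : x != y -> [set x; y] \in M -> [set x; y] \in M2.
  by move=> xy h; rewrite inE h cards2 xy.
apply: (@pm_dense _ _ _ _ t) => //.
- by move=> x; rewrite inE => /andP[_ /eqP].
- move=> x xS; have xc := subsetP Sc _ xS; have [h1 h2 h3] := blkP x xc.
  have ex (j : 'I_D) : exists y, (y \in blk x j) && ([set x; y] \in M).
    have := hit (inl (Sub x xc, j)); rewrite -setI_eq0 => /set0Pn[z].
    by rewrite inE => /andP[/imsetP[y yb ->] h]; exists y; rewrite yb h.
  have [y yP] := fin_all_exists ex.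
  have yinj : injective y.
    move=> i j e; apply/val_inj/eqP; apply: contraT => ij.
    have := h3 i j (ltn_ord _) (ltn_ord _) ij; have /andP[yi _] := yP i; have /andP[yj _] := yP j.
    by move/disjointFr/(_ yi); rewrite e yj.
  have : D <= #|[set z in c | [set x; z] \in M2]|.
    rewrite -[D]card_ord -(card_imset _ yinj); apply: subset_leq_card.
    apply/subsetP => _ /imsetP[j _ ->]; have /andP[yj yM] := yP j.
    have := subsetP (h1 j (ltn_ord j)) _ yj; rewrite in_setD1 => /andP[yx yc].
    by rewrite inE yc inM2 // eq_sym.
  have : #|[set z in c | [set x; z] \in M2]| <= #|[set z in S | [set x; z] \in M2]| + #|c :\: S|.
    apply: leq_trans (leq_card_setU _ _); apply: subset_leq_card; apply/subsetP => z.
    by rewrite in_set in_setU in_set in_setD => /andP[-> ->]; rewrite !andbT orbN.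
  move: cS; rewrite /D /t; clear; lia.
- move=> P Q Ps Qs dPQ cP cQ.
  have PQ : [&& (P, Q).1 \subset c, (P, Q).2 \subset c, [disjoint (P, Q).1 & (P, Q).2],
      #|(P, Q).1| == t & #|(P, Q).2| == t].
    by rewrite /= cP cQ !eqxx dPQ (subset_trans Ps) // (subset_trans Qs).
  have := hit (inr (Sub (P, Q) PQ)); rewrite -setI_eq0 => /set0Pn[z].
  rewrite inE => /andP[/imsetP[[x y]]]; rewrite !inE /= => /andP[xP yQ] -> h.
  exists x, y; split=> //; apply: inM2 => //.
  by apply: contraTneq xP => ->; rewrite (disjointFl dPQ).
Qed.

End Clique.

(** From [187] on the exponent is at least [30], where [2 ^ 30] already beats the cubic bound.
    Adding 1 to the exponent multiplies each of the three factors by at most 5/4, hence their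
    product by less than 2. *)
Lemma q_large_ok q k : 187 <= q -> k < q.+1 * q.+1 -> 48 * (k * q) <= 2 ^ (q.-1 %/ 6).
Proof.
move=> q187 kq; set b := q.-1 %/ 6.
have qb : q <= 6 * b + 6.
  by have := ltn_ceil q.-1 (isT : 0 < 6); rewrite -/b; move: q187; clear; lia.
have b30 : 30 < b.+1 by rewrite ltnS /b leq_divRL //; move: q187; clear; lia.
have pb : 48 * ((6 * b + 7) * (6 * b + 7) * (6 * b + 6)) <= 2 ^ b.
  move: b30; clear; case: (leqP b 29) => [|b30 _]; first by lia.
  rewrite -(subnKC b30); elim: (b - 30) => [|n IH].
    have -> : 2 ^ (30 + 0) = 1024 * 1024 * 1024.
      have e10 : 2 ^ 10 = 1024 by [].
      by rewrite addn0 -{1}e10 -{1}e10 -e10 -!expnD; congr (2 ^ _).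
    rewrite addn0; clear; lia.
  rewrite (addnS 30 n); move: (30 + n) (leq_addr n 30) IH => N N30 IH.
  rewrite (expnS 2 N); apply: leq_trans (leq_mul (leqnn 2) IH).
  have ratio (x y z t : nat) : 4 * x <= 5 * z -> 4 * y <= 5 * t -> x * x * y <= 2 * (z * z * t).
    move=> h1 h2; have := leq_mul (leq_mul h1 h1) h2; clear; lia.
  by rewrite (mulnCA 2) leq_mul2l /=; apply: ratio; move: N30; clear; lia.
apply: leq_trans pb; rewrite leq_mul2l /=; apply: leq_mul => //.
by apply: leq_trans (ltnW kq) _; apply: leq_mul; move: qb; clear; lia.
Qed.

Lemma mwin_restrict (X : finType) (W : {set X} -> Prop) (E F : {set X}) :
  F \subset E -> mwin W F set0 -> mwin (fun M => W (M :&: E)) F set0.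
Proof.
move=> FE h; exists (fun F M : {set X} => F \subset E /\ mwin W F (M :&: E)); last by rewrite set0I.
split=> [F' M x [FE' h'] xF|M [_]]; last exact: mwin_end.
have [r [r1 r2 r3]] := mwin_step h' xF; exists r; split=> //; split.
  by apply: subset_trans FE'; rewrite setDDl subsetDl.
rewrite setIUl (_ : r :&: E = r) //; apply/setIidPl.
by apply: subset_trans r1 (subset_trans (subsetDl _ _) FE').
Qed.

Lemma disjoint_intro (T : finType) (A B : {set T}) :
  (forall x, x \in A -> x \in B -> False) -> [disjoint A & B].
Proof.
by move=> h; rewrite -setI_eq0; apply/set0Pn => -[x]; rewrite inE => /andP[xA]; apply: h.
Qed.

Lemma disjoint_elim (T : finType) (A B : {set T}) x :
  [disjoint A & B] -> x \in A -> x \in B -> False.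
Proof. by move=> /disjointFr h /h ->. Qed.

Lemma card_setD1_lt (T : finType) (R : {set T}) r n : r \in R -> #|R| < n.+1 -> #|R :\ r| < n.
Proof. by move=> rR; rewrite (cardsD1 r R) rR add1n ltnS. Qed.

Lemma pm_bigcup (V I : finType) (M : {set {set V}}) (B : I -> {set V}) (R : {set I}) :
  {in R, forall i, pm M (B i)} -> {in R &, forall i j, i != j -> [disjoint B i & B j]} ->
  pm M (\bigcup_(i in R) B i).
Proof.
have [n] := ubnP #|R|; elim: n R => // n IH R Rn h d.
have [->|[i iR]] := set_0Vmem R; first by rewrite big_set0; apply: pm_set0.
rewrite (big_setD1 i) //=; apply: pm_union.
- apply: disjoint_intro => x xi /bigcupP[j]; rewrite !inE => /andP[ji jR] xj.
  by rewrite eq_sym in ji; apply: disjoint_elim (d _ _ iR jR ji) xi xj.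
- exact: h.
apply: IH => [|j|j k]; rewrite ?inE.
- exact: card_setD1_lt.
- by move=> /andP[_]; apply: h.
- by move=> /andP[_ jR] /andP[_ kR]; apply: d.
Qed.

(** A greedy choice works: only elements with the same key compete for the same cell, and [Y r] is
    at least as large as the number of competitors. *)
Lemma distinct_representatives (V C : finType) (R : {set V}) (key : V -> C)
    (cell : V -> C) (Y : V -> {set V}) :
  {in R, forall r, Y r \subset [set y | cell y == key r]} ->
  {in R, forall r, #|[set r' in R | key r' == key r]| <= #|Y r|} ->
  exists y : V -> V, {in R, forall r, y r \in Y r} /\ {in R &, injective y}.
Proof.
have [n] := ubnP #|R|; elim: n R => // n IH R Rn sub big.
have [->|[r rR]] := set_0Vmem R.
  by exists id; split=> [x|x y]; rewrite inE.
have [|x|x|y [yY yI]] := IH (R :\ r).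
- exact: card_setD1_lt.
- by rewrite inE => /andP[_]; apply: sub.
- rewrite inE => /andP[_ xR]; apply: leq_trans (big x xR).
  by apply: subset_leq_card; apply/subsetP => z; rewrite !inE => /andP[/andP[_ ->] ->].
pose used := y @: [set r' in R :\ r | key r' == key r].
have [y0] : exists y0, y0 \in Y r :\: used.
  apply/set0Pn; rewrite setD_eq0; apply/negP => /subset_leq_card.
  apply/negP; rewrite -ltnNge; apply: leq_trans (big r rR).
  apply: leq_ltn_trans (leq_imset_card _ _) _.
  rewrite [X in _ < X](cardsD1 r) !inE rR eqxx ltnS; apply: subset_leq_card.
  by apply/subsetP => z; rewrite !inE => /andP[/andP[-> ->] ->].
rewrite inE => /andP[y0u y0Y].
have nu z : z \in R -> z != r -> y z != y0.
  move=> zR zr; apply: contraNneq y0u => e; apply/imsetP; exists z => //.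
  have zR' : z \in R :\ r by rewrite !inE zr.
  have /(subsetP (sub z zR)) := yY _ zR'; rewrite e inE => yz.
  have := subsetP (sub r rR) _ y0Y; rewrite inE => yr.
  by rewrite inE zR' -(eqP yz) (eqP yr) eqxx.
exists (fun z => if z == r then y0 else y z); split=> [z zR|z t zR tR].
  by case: eqVneq => [->//|zr]; apply: yY; rewrite !inE zr.
case: eqVneq => [->|zr]; case: eqVneq => [->//|tr] e.
- by case/eqP: (nu t tR tr).
- by case/eqP: (nu z zR zr).
- by apply: yI; rewrite ?inE ?zr ?tr.
Qed.

(** * Assembling a perfect matching along a forest of active cells *)

(* The active cells are listed by cs, the root first; A c consists of T2 vertices
   of c with many neighbours in the cell par c, Sg of the outside vertices v to
   be matched into the cell host v, and U of the clusters P k, of which Maker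
   saturates each with at most two vertices of Y k. *)
Section Forest.
Variables (V C : finType) (e : rel V) (cell : V -> C) (cs : seq C) (root : C)
  (par : C -> C) (A : C -> {set V}) (Sg U : {set V}) (host : V -> C) (q : C -> nat)
  (cl : V -> V) (Y : V -> {set V}) (T1 T2 : nat).
Let vc c := [set v | cell v == c].
(** The requests that [c] may receive: one from each outside vertex hosted by it and one from each
    child, for parity. *)
Let load c := #|[set v in Sg | host v == c]| +
  #|[set d | [&& d \in cs, d != root & par d == c]]|.
Let P k := [set u in U | cl u == k].
Hypotheses (esym : symmetric e) (eirr : irreflexive e) (evV : ~~ odd #|V|).
Hypotheses (ucs : uniq cs)
  (cover3 : forall v, [|| cell v \in cs, v \in Sg | v \in U])
  (SgU : forall v, v \in Sg -> cell v \notin cs /\ v \notin U)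
  (Ucs : forall v, v \in U -> cell v \notin cs)
  (parP : forall c, c \in cs -> c != root -> par c \in cs /\ index (par c) cs < index c cs)
  (A0 : A root = set0)
  (AP : forall c, c \in cs -> c != root -> A c \subset vc c /\ #|A c| = T2)
  (Adeg : forall c v, c \in cs -> c != root -> v \in A c -> T1 <= #|[set y in vc (par c) | e v y]|)
  (hostP : forall v, v \in Sg -> host v \in cs /\ T1 <= #|[set y in vc (host v) | e v y]|)
  (clique : forall c x y, c \in cs -> cell x = c -> cell y = c -> x != y -> e x y)
  (qP : forall c, c \in cs -> [/\ 187 <= q c, q c * q c <= #|vc c|, #|vc c| < (q c).+1 * (q c).+1
      & 3 + load c <= 2 * q c])
  (loadT : forall c, c \in cs -> T2 + 2 + load c <= T1./2)
  (T2_3 : 2 < T2)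
  (YU : forall k v, v \in Y k -> v \notin U)
  (Ysep : forall k k' v v', v \in Y k -> v' \in Y k' -> cell v = cell v' -> k = k')
  (win : forall k, mwin (saturated 2 (P k) (Y k)) (touching e (P k) (Y k)) set0).

(** Which vertex of [A c] repairs the parity of [c] is decided only when the game is over, so Maker
    plays on the stars of all of them. *)
Let requester v := (v \in Sg) || [&& cell v \in cs, cell v != root & v \in A (cell v)].
Let hst v := if v \in Sg then host v else par (cell v).
Let star v := [set [set v; y] | y in [set y in vc (hst v) | e v y]].

Let Acell c v : c \in cs -> v \in A c -> c != root /\ cell v = c.
Proof.
move=> ccs vA; have cr : c != root by apply: contraTneq vA => ->; rewrite A0 inE.
by split=> //; have [/subsetP/(_ _ vA)] := AP ccs cr; rewrite inE => /eqP.
Qed.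

(** A cell outside [cs] has index [size cs], so every request goes to a cell of smaller index; this
    is what makes the stars edge-disjoint. *)
Let hstP v : requester v -> [/\ hst v \in cs, index (hst v) cs < index (cell v) cs &
  T1 <= #|[set y in vc (hst v) | e v y]|].
Proof.
rewrite /requester /hst; case: ifP => [vS _|_ /= /and3P[ccs cr vA]].
  have [h1 h2] := hostP vS; have [h3 _] := SgU vS; split=> //.
  by rewrite (memNindex h3) index_mem.
by have [h1 h2] := parP ccs cr; split=> //; apply: Adeg.
Qed.

Let card_star v : #|star v| = #|[set y in vc (hst v) | e v y]|.
Proof.
rewrite card_in_imset // => y z; rewrite !inE => /andP[_ vy] _; apply: set2_inj_l.
by apply: contraTneq vy => ->; rewrite eirr.
Qed.

(* Each requester gets its own partner in its host cell; a cell other than the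
   root uses one vertex of A c for this if what remains of it is odd, so cells
   are treated from the last one in cs to the root. *)
Section Assembly.
Variable M : {set {set V}}.
Hypotheses (ME : M \subset edges e)
  (M1 : forall c, c \in cs -> robust (vc c) (q c) M)
  (M2 : forall v, requester v -> #|star v|./2 <= #|star v :&: M|)
  (M3 : forall k, saturated 2 (P k) (Y k) M).

Let Mcard x : x \in M -> #|x| = 2.
Proof.
move=> /(subsetP ME)/edgesP[u [v [uv ->]]]; rewrite cards2.
by have -> : u != v by apply: contraTneq uv => ->; rewrite eirr.
Qed.

Lemma assembly : pm M [set: V].
Proof.
case: (pickP (@predT V)) => [v0 _|no]; last first.
  rewrite (_ : [set: V] = set0); first exact: pm_set0.
  by apply/setP => v; have := no v.
have [Z ZP] : exists Z : V -> {set V}, forall k,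
    [/\ Z k \subset Y k, #|Z k| <= 2 & pm M (P k :|: Z k)].
  by apply: fin_all_exists M3.
pose ZZ := \bigcup_k Z k.
have ZY k v : v \in Z k -> v \in Y k by have [/subsetP h _ _] := ZP k; apply: h.
have ZU v : v \in ZZ -> v \notin U by case/bigcupP => k _ /ZY; apply: YU.
have pmUZ : pm M (U :|: ZZ).
  have -> : U :|: ZZ = \bigcup_(k in [set: V]) (P k :|: Z k).
    apply/setP => v; apply/setUP/bigcupP => [[vU|/bigcupP[k _ vk]]|[k _ /setUP[]]].
    - by exists (cl v); rewrite ?in_setT // !inE vU eqxx.
    - by exists k; rewrite ?in_setT // inE vk orbT.
    - by rewrite inE => /andP[]; left.
    - by right; apply/bigcupP; exists k.
  apply: pm_bigcup => [k _|k k' _ _ kk']; first by case: (ZP k).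
  apply: disjoint_intro => v /setUP[vP|vZ] /setUP[vP'|vZ'].
  - by move: vP vP' kk'; rewrite !inE => /andP[_ /eqP->] /andP[_ ->].
  - by move: vP; rewrite inE => /andP[]; have := YU (ZY _ _ vZ') => /negbTE ->.
  - by move: vP'; rewrite inE => /andP[]; have := YU (ZY _ _ vZ) => /negbTE ->.
  - by move: kk'; rewrite (Ysep (ZY _ _ vZ) (ZY _ _ vZ') erefl) eqxx.
(* By [Ysep] at most one cluster uses vertices of a given cell, so clusters take at most two from
   it. *)
have Z2 c : #|ZZ :&: vc c| <= 2.
  have [->|[v]] := set_0Vmem (ZZ :&: vc c); first by rewrite cards0.
  rewrite 2!inE => /andP[/bigcupP[k _ vk] /eqP cv].
  have [_ h _] := ZP k; apply: leq_trans h; apply: subset_leq_card.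
  apply/subsetP => v'; rewrite 2!inE => /andP[/bigcupP[k' _ vk'] /eqP cv'].
  by rewrite (Ysep (ZY _ _ vk) (ZY _ _ vk') _) ?cv.
have xE c : exists x, (c \in cs) && (c != root) -> (x \in A c) && (x \notin ZZ).
  case: (boolP (_ && _)) => [/andP[ccs cr]|_]; last by exists v0.
  have [AV cA] := AP ccs cr.
  have : 0 < #|A c :\: ZZ|.
    have := cardsID ZZ (A c); have : #|A c :&: ZZ| <= 2.
      apply: leq_trans (Z2 c); apply: subset_leq_card; rewrite setIC.
      by apply: setIS.
    by move: cA T2_3; clear; lia.
  by case/card_gt0P => v; rewrite inE => /andP[h1 h2]; exists v; rewrite h1 h2.
have [x xP] := fin_all_exists xE.
pose nonroot c := (c \in cs) && (c != root).
have xcell c : nonroot c -> cell (x c) = c.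
  by move=> nc; have /andP[xA _] := xP c nc; have /andP[ccs _] := nc; case: (Acell ccs xA).
pose X := [set x c | c in [set c | nonroot c]].
have xX c : nonroot c -> x c \in X by move=> nc; apply: imset_f; rewrite inE.
have XP v : v \in X -> [/\ nonroot (cell v), v = x (cell v), v \in A (cell v), v \notin ZZ & v \notin Sg].
  case/imsetP => c; rewrite inE => nc ->; rewrite (xcell c nc); have /andP[xA xZ] := xP c nc.
  split=> //; apply/negP => /SgU[]; rewrite (xcell c nc).
  by have /andP[->] := nc.
pose S1 := Sg :\: ZZ; pose R := S1 :|: X.
have reqR r : r \in R -> requester r.
  rewrite /requester => /setUP[/setDP[-> _] //|/XP[/andP[ccs cr] _ vA _ _]].
  by rewrite ccs cr vA orbT.
have hstX c : nonroot c -> hst (x c) = par c.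
  move=> nc; have [_ _ _ _ nS] := XP _ (xX c nc).
  by rewrite /hst (negbTE nS) xcell.
have loadR c : #|[set r in R | hst r == c]| <= load c.
  have xinj : {in [set d | nonroot d] &, injective x}.
    by move=> a b; rewrite !inE => na nb h; rewrite -(xcell a na) h xcell.
  have xD : #|x @: [set d | [&& d \in cs, d != root & par d == c]]| =
      #|[set d | [&& d \in cs, d != root & par d == c]]|.
    apply: card_in_imset => a b; rewrite !inE => /and3P[a1 a2 _] /and3P[b1 b2 _].
    by apply: xinj; rewrite inE /nonroot ?a1 ?b1.
  rewrite /load -xD; apply: leq_trans (leq_card_setU _ _); apply: subset_leq_card; apply/subsetP => r.
  rewrite inE => /andP[/setUP[/setDP[rS _]|rX] hr].
    rewrite inE; apply/orP; left; rewrite inE rS.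
    by move: hr; rewrite /hst rS.
  rewrite inE; apply/orP; right; have [nc rx _ _ _] := XP r rX; apply/imsetP.
  exists (cell r) => //; rewrite inE; have /andP[-> ->] := nc.
  by move: hr; rewrite rx hstX // xcell.
have cA c : #|A c| <= T2 \/ c \notin cs.
  have [ccs|] := boolP (c \in cs); last by right.
  left; have [->|cr] := eqVneq c root; first by rewrite A0 cards0.
  by case: (AP ccs cr) => _ ->.
(* Partners avoid the set [A] of the host cell, so no request takes a reserved vertex. *)
pose Yr r := [set y in vc (hst r) | [set r; y] \in M] :\: (ZZ :|: A (hst r)).
have [y [yY yI]] : exists y : V -> V, {in R, forall r, y r \in Yr r} /\ {in R &, injective y}.
  apply: (distinct_representatives (key := hst) (cell := cell)) => r rR.
    apply/subsetP => z; rewrite !inE => /andP[_ /andP[->]] //.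
  have [h1 h2 h3] := hstP (reqR r rR).
  apply: leq_trans (loadR _) _.
  have : T1./2 <= #|[set y in vc (hst r) | [set r; y] \in M]|.
    apply: leq_trans (half_leq h3) _; rewrite -card_star.
    apply: leq_trans (M2 (reqR r rR)) _.
    rewrite -(card_imset _ (_ : injective (fun z => [set r; z]))); last first.
      move=> a b /= ab; have [ar|ar] := eqVneq a r; last exact: set2_inj_l ar ab.
      have [->|br] := eqVneq b r; first by [].
      by rewrite (set2_inj_l br (Logic.eq_sym ab)).
    apply: subset_leq_card; apply/subsetP => z; rewrite inE => /andP[/imsetP[t]].
    rewrite inE => /andP[th rt] -> tM; apply: imset_f; rewrite inE th.
    by rewrite tM.
  have := cardsID (ZZ :|: A (hst r)) [set y in vc (hst r) | [set r; y] \in M].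
  have : #|[set y in vc (hst r) | [set r; y] \in M] :&: (ZZ :|: A (hst r))| <= 2 + T2.
    rewrite setIUr; apply: leq_trans (leq_card_setU _ _) _; apply: leq_add.
      apply: leq_trans (Z2 (hst r)); apply: subset_leq_card; rewrite setIC.
      by apply: setIS; apply/subsetP => z; rewrite inE => /andP[].
    apply: leq_trans (subset_leq_card (subsetIr _ _)) _.
    by case: (cA (hst r)); rewrite ?h1.
  have := loadT h1; rewrite /Yr; clear; lia.
have yP r : r \in R -> [/\ cell (y r) = hst r, [set r; y r] \in M, y r \notin ZZ & y r \notin A (hst r)].
  by move=> /yY; rewrite !inE negb_or => /andP[/andP[-> ->] /andP[/eqP -> ->]].
have S1R r : r \in S1 -> r \in R by move=> h; apply/setUP; left.
have XR r : r \in X -> r \in R by move=> h; apply/setUP; right.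
have pmS1 : pm M (\bigcup_(r in S1) [set r; y r]).
  apply: pm_bigcup => [r rS|r r' rS rS' rr'].
    by apply: pm_edge; case: (yP r (S1R r rS)).
  have ncs z : z \in S1 -> cell z \notin cs by case/setDP => /SgU[].
  have ycs z : z \in S1 -> cell (y z) \in cs.
    by move=> /S1R zR; have [-> _ _ _] := yP z zR; case: (hstP (reqR z zR)).
  have ryne a b : a \in S1 -> b \in S1 -> a != y b.
    by move=> /ncs aS /ycs bS; apply: contraNneq aS => ->.
  rewrite disjoint_set2 !inE !negb_or rr' ryne //= eq_sym ryne //=.
  by apply: contraNneq rr' => h; apply/eqP/yI => //; apply: S1R.
(* The cells in [l'] have been treated. A vertex in a cell of [l] is missing from [S] only because
   it serves a cluster, a vertex of [S1], or the parity of a treated cell. *)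
have forest (l l' : seq C) (S : {set V}) : cs = l ++ l' -> S \subset [set v | cell v \in l] ->
    ~~ odd #|S| -> (forall v, cell v \in l -> v \notin S ->
      [\/ v \in ZZ, v \in y @: S1 | exists d, [/\ d \in l', d != root & v = y (x d)]]) -> pm M S.
  elim/last_ind: l l' S => [|l c IH] l' S csE Sl evS Sloss.
    have -> : S = set0 by apply/eqP; rewrite -subset0; apply: subset_trans Sl _; apply/subsetP => v; rewrite inE.
    exact: pm_set0.
  have ccs : c \in cs by rewrite csE mem_cat mem_rcons inE eqxx.
  have [_ _ _ loss] := qP ccs.
  have lcs d : d \in l -> d \in cs by rewrite csE mem_cat mem_rcons inE => ->; rewrite orbT.
  have l'cs d : d \in l' -> d \in cs by rewrite csE mem_cat => ->; rewrite orbT.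
  have cl' : c \notin l'.
    by move: ucs; rewrite csE cat_uniq => /and3P[_ /hasPn/(_ c)]; rewrite mem_rcons inE eqxx; case: (c \in l') => // /(_ isT).
  have cll : c \notin l by move: ucs; rewrite csE cat_uniq rcons_uniq => /and3P[/andP[]].
  have lossS : #|vc c :\: S| <= 2 + load c.
    have : vc c :\: S \subset (ZZ :&: vc c) :|: (y @: [set r in R | hst r == c]).
      apply/subsetP => v; rewrite 2!inE => /andP[vS /eqP cv].
      have [|vZ|/imsetP[r rS vr]|[d [dl dr vd]]] := Sloss v _ vS.
      - by rewrite cv mem_rcons inE eqxx.
      - by rewrite 3!inE vZ cv eqxx.
      - rewrite inE; apply/orP; right; rewrite vr; apply: imset_f.
        by rewrite inE S1R //; have [<- _ _ _] := yP r (S1R r rS); rewrite -vr cv eqxx.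
      - have nd : nonroot d by rewrite /nonroot dr (l'cs d dl).
        rewrite inE; apply/orP; right; rewrite vd; apply: imset_f.
        have xR := XR _ (xX d nd).
        by rewrite inE xR; have [<- _ _ _] := yP _ xR; rewrite -vd cv eqxx.
    move/subset_leq_card/leq_trans; apply; apply: leq_trans (leq_card_setU _ _) _.
    by apply: leq_add => //; apply: leq_trans (leq_imset_card _ _) (loadR c).
  have step (D S' : {set V}) : S' = S :\: vc c :\: D -> (forall v, v \in D -> cell v \in l ->
       exists d, [/\ d \in c :: l', d != root & v = y (x d)]) -> ~~ odd #|S'| -> pm M S'.
    move=> S'E hD evS'; apply: (IH (c :: l')) => //.
    - by rewrite csE cat_rcons.
    - apply/subsetP => v; rewrite S'E !inE => /and3P[_ vc_ vS].
      by have := subsetP Sl _ vS; rewrite inE mem_rcons inE (negbTE vc_).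
    - move=> v vl vS'.
      have vc_ : cell v != c by apply: contraNneq cll => <-.
      have [vD|vD] := boolP (v \in D); first by apply: Or33; apply: hD.
      have vS : v \notin S by move: vS'; rewrite S'E !inE vD vc_.
      have [|||[d [dl dr vd]]] := Sloss v _ vS; first by rewrite mem_rcons inE vl orbT.
      + by apply: Or31.
      + by apply: Or32.
      + by apply: Or33; exists d; rewrite inE dl orbT.
  have splitS : S = (S :&: vc c) :|: (S :\: vc c) by rewrite setID.
  have cS : #|S| = #|S :&: vc c| + #|S :\: vc c| by rewrite cardsID.
  have [oddc|evc] := boolP (odd #|S :&: vc c|); last first.
    rewrite splitS; apply: pm_union.
    - by rewrite disjoint_sym disjoints_subset; apply/subsetP => v; rewrite !inE => /andP[/negbTE ->]; rewrite andbF.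
    - apply: (M1 ccs) => //; first exact: subsetIr.
      rewrite setDIr setDv setU0; apply: leq_trans lossS _; move: loss; clear; lia.
    apply: (step set0) => [|v|]; first by rewrite setD0.
      by rewrite inE.
    by move: evS; rewrite cS oddD (negbTE evc).
  (* If the root comes last, [l] is empty: starting from a cell of [l], parents would stay in [l]
     with ever smaller indices and never reach the root. Then [S] lies in the root cell, whose part
     of [S] is even. *)
  have cr : c != root.
    apply/negP => /eqP croot; have [l0|[d dl]] : l = [::] \/ exists d, d \in l.
      by case: (l) => [|d ?]; [left|right; exists d; rewrite mem_head].
      have e0 : S :\: vc c = set0.
        apply/eqP; rewrite setD_eq0; apply: subset_trans Sl _.
        by apply/subsetP => v; rewrite l0 !inE.
      by move: evS; rewrite cS e0 cards0 addn0 oddc.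
    have : forall k d, index d cs <= k -> d \in l -> False.
      elim=> [|k IHk] d1 dk dl1.
        have dr : d1 != root by apply: contraNneq cll => d1r; rewrite croot -d1r.
        have [_] := parP (lcs d1 dl1) dr; move: dk; rewrite leqn0 => /eqP ->.
        by rewrite ltn0.
      have dr : d1 != root by apply: contraNneq cll => d1r; rewrite croot -d1r.
      have [pcs plt] := parP (lcs d1 dl1) dr.
      apply: (IHk (par d1)); first by rewrite -ltnS; apply: leq_trans plt dk.
      have : index d1 cs < size l by rewrite csE cat_rcons index_cat dl1 index_mem.
      move=> dlt; have := ltn_trans plt dlt.
      rewrite csE cat_rcons index_cat; case: ifP => //= _.
      by rewrite ltnNge leq_addr.
    by move=> /(_ _ d (leqnn _) dl).
  have nc : nonroot c by rewrite /nonroot ccs cr.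
  have [_ _ xA xZ xSg] := XP _ (xX c nc); rewrite xcell // in xA.
  have xRc := XR _ (xX c nc); have [ycell xyM yZ yA] := yP _ xRc.
  rewrite hstX // in ycell yA.
  have ynA r : r \in R -> cell (y r) = c -> y r \notin A c.
    by move=> rR h; have [h1 _ _ h2] := yP r rR; rewrite -h h1.
  have xS : x c \in S.
    apply: contraT => nS; have [|h|/imsetP[r rS xr]|[d [dl dr vd]]] := Sloss (x c) _ nS.
    - by rewrite xcell // mem_rcons inE eqxx.
    - by rewrite h in xZ.
    - by have := ynA r (S1R r rS); rewrite -xr xcell // xA => /(_ erefl).
    - have nd : nonroot d by rewrite /nonroot dr (l'cs d dl).
      by have := ynA _ (XR _ (xX d nd)); rewrite -vd xcell // xA => /(_ erefl).
  have [pcs plt] := parP ccs cr.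
  have pl : par c \in l.
    move: plt; rewrite [in X in _ < X]csE cat_rcons index_cat (negbTE cll) /= eqxx addn0.
    by rewrite csE cat_rcons index_cat; case: ifP => //= _; rewrite ltnNge leq_addr.
  have pc : par c != c by apply: contraNneq cll => <-.
  have yS : y (x c) \in S.
    apply: contraT => nS; have [|h|/imsetP[r rS xr]|[d [dl dr vd]]] := Sloss _ _ nS.
    - by rewrite ycell mem_rcons inE pl orbT.
    - by rewrite h in yZ.
    - have h := yI _ _ xRc (S1R r rS) xr; move: rS; rewrite -h inE (negbTE xSg).
      by rewrite andbF.
    - have nd : nonroot d by rewrite /nonroot dr (l'cs d dl).
      have h := yI _ _ xRc (XR _ (xX d nd)) vd.
      by move: cl'; rewrite -(xcell c nc) h xcell // dl.
  have xc := xcell c nc.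
  have -> : S = [set x c; y (x c)] :|: (((S :&: vc c) :\ x c) :|: (S :\: vc c :\ y (x c))).
    apply/setP => v; rewrite !inE; have [->|vx] := eqVneq v (x c); first by rewrite xS.
    have [->|vy] := eqVneq v (y (x c)); first by rewrite yS.
    by case: (v \in S); case: (cell v == c).
  have e1 : #|S :&: vc c| = (#|(S :&: vc c) :\ x c|).+1.
    by rewrite (cardsD1 (x c)) !inE xS xc eqxx.
  have e2 : #|S :\: vc c| = (#|S :\: vc c :\ y (x c)|).+1.
    by rewrite (cardsD1 (y (x c))) !inE yS ycell pc.
  have o1 : ~~ odd #|(S :&: vc c) :\ x c| by move: oddc; rewrite e1 /=.
  have o2 : ~~ odd #|S :\: vc c :\ y (x c)|.
    by move: evS; rewrite cS e1 e2 addSn addnS /= negbK oddD (negbTE o1).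
  apply: pm_union.
  - apply: disjoint_intro => v; rewrite !inE => /orP[]/eqP->.
      by rewrite eqxx xc eqxx /= andbF.
    by rewrite eqxx ycell (negbTE pc) !andbF.
  - exact: pm_edge.
  apply: pm_union.
  - apply: disjoint_intro => v; rewrite !inE => /and3P[_ _ ->] /andP[_] //.
  - apply: (M1 ccs) => //.
      by apply: subset_trans (subsetDl _ _) (subsetIr _ _).
    have -> : vc c :\: ((S :&: vc c) :\ x c) = x c |: (vc c :\: S).
      apply/setP => v; rewrite !inE; case: (eqVneq v (x c)) => [->|vx] /=; first by rewrite xc eqxx.
      by case: (cell v == c); rewrite ?andbF ?andbT.
    apply: leq_trans (leq_card_setU _ _) _; rewrite cards1.
    by move: lossS loss; clear; lia.
  - apply: (step [set y (x c)]) => // v; rewrite inE => /eqP -> _.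
    by exists c; rewrite mem_head cr.
pose Act := [set v | cell v \in cs] :\: ZZ :\: (y @: S1).
have ys z : z \in y @: S1 -> cell z \in cs /\ z \notin ZZ.
  case/imsetP => r /S1R rR ->; have [-> _ h _] := yP r rR; split=> //.
  by case: (hstP (reqR r rR)).
have VE : [set: V] = (U :|: ZZ) :|: ((\bigcup_(r in S1) [set r; y r]) :|: Act).
  apply/setP => v; rewrite in_setT; symmetry; rewrite 2!inE.
  case/or3P: (cover3 v) => h; rewrite ?h //; last first.
    case vZ: (v \in ZZ); first by rewrite orbT.
    rewrite [X in _ || X]inE; apply/orP; right; apply/orP; left; apply/bigcupP.
    by exists v; rewrite !inE ?eqxx // vZ h.
  case vZ: (v \in ZZ); first by rewrite orbT.
  rewrite [X in _ || X]inE; apply/orP; right.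
  have [/imsetP[r rS vr]|vy] := boolP (v \in y @: S1).
    by apply/orP; left; apply/bigcupP; exists r; rewrite // vr !inE eqxx orbT.
  by rewrite !(in_setD, in_set) vy vZ h orbT.
have d1 : [disjoint \bigcup_(r in S1) [set r; y r] & Act].
  apply: disjoint_intro => v /bigcupP[r rS]; rewrite in_set2 => /orP[]/eqP->.
    by rewrite !(in_setD, in_set) => /and3P[_ _]; move: rS; rewrite inE => /andP[_ /SgU[/negbTE ->]].
  by rewrite !(in_setD, in_set) imset_f.
have d2 : [disjoint U :|: ZZ & (\bigcup_(r in S1) [set r; y r]) :|: Act].
  apply: disjoint_intro => v /setUP[vU|vZ] /setUP[/bigcupP[r rS]|].
  - rewrite in_set2 => /orP[]/eqP vE.
      by move: rS; rewrite -vE inE => /andP[_ /SgU[_]]; rewrite vU.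
    by have [] := ys v; rewrite ?vE ?imset_f // -vE; have /negbTE -> := Ucs vU.
  - by rewrite !(in_setD, in_set) => /and3P[_ _]; have /negbTE -> := Ucs vU.
  - rewrite in_set2 => /orP[]/eqP vE; first by move: rS; rewrite -vE inE vZ.
    have vy : v \in y @: S1 by rewrite vE imset_f.
    by case: (ys v vy) => _; rewrite vZ.
  - by rewrite !(in_setD, in_set) vZ andbF.
(* What the clusters and [S1] use is already matched, hence even, so the parity of [#|V|] passes to
   the active cells. *)
have evAct : ~~ odd #|Act|.
  have cU (D D' : {set V}) : [disjoint D & D'] -> #|D :|: D'| = #|D| + #|D'|.
    by move=> d; rewrite cardsU (disjoint_setI0 d) cards0 subn0.
  move: evV; rewrite -cardsT VE (cU _ _ d2) (cU _ _ d1) !oddD.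
  by rewrite (negbTE (pm_even Mcard pmUZ)) (negbTE (pm_even Mcard pmS1)).
rewrite VE; apply: pm_union => //; apply: pm_union => //.
apply: (forest cs [::]); rewrite ?cats0 //.
  by apply/subsetP => v; rewrite !(in_setD, in_set) => /and3P[].
move=> v vcs; rewrite !(in_setD, in_set) vcs andbT negb_and !negbK => /orP[h|h].
  by apply: Or32.
by apply: Or31.
Qed.
End Assembly.

Let W (i : C + (V + V)) (M : {set {set V}}) : Prop := match i with
  | inl c => c \in cs -> robust (vc c) (q c) M
  | inr (inl v) => requester v -> #|star v|./2 <= #|star v :&: M|
  | inr (inr k) => saturated 2 (P k) (Y k) M end.

Let B (i : C + (V + V)) : {set {set V}} := match i with
  | inl c => if c \in cs then clique_edges (vc c) else set0
  | inr (inl v) => if requester v then star v else set0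
  | inr (inr k) => touching e (P k) (Y k) end.

Let Wup i : upward (W i).
Proof.
case: i => [c|[v|k]] M N MN h /=; last exact: saturated_upward h.
  by move=> ccs; apply: robust_upward MN (h ccs).
move=> rv; apply: leq_trans (h rv) _; apply: subset_leq_card; exact: setIS.
Qed.

Let Bwin i : mwin (W i) (B i) set0.
Proof.
case: i => [c|[v|k]] /=; last exact: win.
  case: ifP => ccs; last by apply: (mwin_now _ (Wup (i := inl c))); rewrite /= ccs.
  have [q187 q1 q2 _] := qP ccs.
  have q4 : 3 < q c by apply: leq_trans q187.
  by apply: mwin_impl (mwin_clique q4 q1 q2 (q_large_ok q187 q2)) _ => M' _ h _.
case: ifP => rv; last by apply: (mwin_now _ (Wup (i := inr (inl v)))); rewrite /= rv.
by apply: mwin_impl (mwin_half (star v)) _ => M' _ h _.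
Qed.

Let starP v x : x \in star v -> exists y, [/\ x = [set v; y], e v y & cell y = hst v].
Proof. by case/imsetP => y; rewrite !inE => /andP[/eqP cy vy] ->; exists y. Qed.

Let reqU v : requester v -> v \notin U.
Proof.
rewrite /requester => /orP[/SgU[]//|/andP[vcs _]].
by apply: contraL vcs; apply: Ucs.
Qed.

Let Bedges i : B i \subset edges e.
Proof.
case: i => [c|[v|k]] /=; apply/subsetP => x; last first.
- by move/touchingP => [u [v [_ _ uv ->]]]; apply/edgesP; exists u, v.
- case: ifP => rv; last by rewrite inE.
  by case/starP => y [-> vy _]; apply/edgesP; exists v, y.
case: ifP => ccs; last by rewrite inE.
case/imsetP => [[u v]]; rewrite !inE /= => /and3P[/eqP cu /eqP cv uv] ->.
by apply/edgesP; exists u, v; split=> //; apply: (clique ccs).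
Qed.

Let touchU k x : x \in touching e (P k) (Y k) -> exists2 u, u \in x & u \in P k.
Proof. by move/touchingP => [u [v [uP _ _ ->]]]; exists u; rewrite // !inE eqxx. Qed.

Let PU k u : u \in P k -> u \in U.
Proof. by rewrite inE => /andP[]. Qed.

Let cliqueV c x v : c \in cs -> x \in clique_edges (vc c) -> v \in x -> cell v = c.
Proof.
move=> ccs /imsetP[[a b]]; rewrite !inE /= => /and3P[/eqP ca /eqP cb _] ->.
by rewrite !inE => /orP[]/eqP->.
Qed.

(** A request leads to another cell, so stars contain no edge inside an active cell. A cluster edge
    contains a vertex of [U], which belongs to one cluster only and to no edge of a star or an
    active cell. An edge in two stars would lead from each endpoint to a cell of smaller index. *)
Let Bdisj i j : i != j -> [disjoint B i & B j].
Proof.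
have cell_star c v x : c \in cs -> requester v -> x \in clique_edges (vc c) -> x \in star v -> False.
  move=> ccs rv xc /starP[y [xE vy cy]]; have [h1 h2 _] := hstP rv.
  have cv : cell v = c by apply: cliqueV xc _ => //; rewrite xE !inE eqxx.
  have cy' : cell y = c by apply: cliqueV xc _ => //; rewrite xE !inE eqxx orbT.
  by move: h2; rewrite -cy cv cy' ltnn.
have cell_touch c k x : c \in cs -> x \in clique_edges (vc c) -> x \in touching e (P k) (Y k) -> False.
  move=> ccs xc /touchU[u ux /PU/Ucs]; by rewrite (cliqueV ccs xc ux) ccs.
have star_touch v k x : requester v -> x \in star v -> x \in touching e (P k) (Y k) -> False.
  move=> rv /starP[y [-> _ cy]] /touchU[u]; rewrite !inE => /orP[]/eqP-> /andP[uU _].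
    by have := reqU rv; rewrite uU.
  by have [h _ _] := hstP rv; have := Ucs uU; rewrite cy h.
have memc c x : x \in B (inl c) -> c \in cs /\ x \in clique_edges (vc c).
  by rewrite /=; case: ifP => // _; rewrite inE.
have memv v x : x \in B (inr (inl v)) -> requester v /\ x \in star v.
  by rewrite /=; case: ifP => // _; rewrite inE.
move=> ne; apply: disjoint_intro => x.
case: i j ne => [c|[v|k]] [c'|[v'|k']] ne; try (move=> /memc[h1 x1]); try (move=> /memv[h1 x1]);
  try (move=> /memc[h2 x2]); try (move=> /memv[h2 x2]).
- have /imsetP[[a b] _ xE] := x1; have ax : a \in x by rewrite xE !inE eqxx.
  by case/eqP: ne; rewrite -(cliqueV h1 x1 ax) -(cliqueV h2 x2 ax).
- exact: cell_star h1 h2 x1 x2.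
- exact: cell_touch h1 x1.
- exact: cell_star h2 h1 x2 x1.
- have [y [xE vy cy]] := starP x1; have [y' [xE' vy' cy']] := starP x2.
  have vv' : v != v' by apply: contra_neq ne => ->.
  have [y'E yE] : v = y' /\ v' = y.
    have h3 : v' \in x by rewrite xE' !inE eqxx.
    have h4 : v \in x by rewrite xE !inE eqxx.
    rewrite xE !inE eq_sym (negbTE vv') /= in h3.
    by rewrite xE' !inE (negbTE vv') /= in h4; rewrite (eqP h3) (eqP h4).
  have [_ l1 _] := hstP h1; have [_ l2 _] := hstP h2.
  move: l1 l2; rewrite -cy -cy' -y'E -yE => l1 l2.
  by have := ltn_trans l1 l2; rewrite ltnn.
- exact: star_touch h1 x1.
- by move=> x1 /memc[h2 x2]; apply: cell_touch h2 x2 x1.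
- by move=> x1 /memv[h2 x2]; apply: star_touch h2 x2 x1.
move=> x1 x2; have {}ne : k != k' by apply: contra_neq ne => ->.
have PYk (m : V) v : v \in P m :|: Y m -> v \in U -> v \in P m.
  by case/setUP => // /YU /negbTE ->.
have [a ax aP] := touchU x1.
have := touching_notin x2 ax => /PYk/(_ (PU aP)).
by move: aP ne; rewrite !inE => /andP[_ /eqP ->] kk' /andP[_]; rewrite (negbTE kk').
Qed.

Lemma forest_mwin :
  mwin (fun M => exists2 N : {set {set V}}, perfect_matching e N & N \subset M) (edges e) set0.
Proof.
(* Intersecting with [edges e] makes every element of Maker's set an edge, as [assembly]
   requires. *)
have h : mwin (fun M => forall i, W i (M :&: edges e)) (edges e) set0.
  apply: (mwin_restrict (W := fun M => forall i, W i M)) => //.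
  exact: (mwin_family Wup Bwin Bdisj Bedges).
apply: mwin_impl h _ => M _ hM.
have [N NM [tN cN]] := assembly (subsetIr M (edges e)) (fun c => hM (inl c))
  (fun v => hM (inr (inl v))) (fun k => hM (inr (inr k))).
exists N; last by apply: subset_trans NM (subsetIl _ _).
by rewrite /perfect_matching tN cN eqxx (subset_trans NM (subsetIr _ _)).
Qed.
End Forest.

Lemma maker_wins_pm_mono (T : finType) (e e' : rel T) : subrel e' e ->
  mwin (fun M => exists2 N : {set {set T}}, perfect_matching e' N & N \subset M) (edges e') set0 ->
  maker_wins_pm e.
Proof.
move=> se h; have sE : edges e' \subset edges e.
  by apply/subsetP => x /edgesP[u [v [/se uv ->]]]; apply/edgesP; exists u, v.
apply: mwin_maker_wins set0 _ _.
  by move=> A1 A2 s [N N1 N2]; exists N => //; apply: subset_trans s.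
have {}h : mwin (fun M => exists2 N : {set {set T}}, perfect_matching e N & N \subset M) (edges e') set0.
  apply: mwin_impl h _ => M _ [N /and3P[N1 N2 N3] NM]; exists N => //.
  by rewrite /perfect_matching N2 N3 (subset_trans N1).
apply: mwin_mono h _ (sub0set _).
  by move=> A1 A2 s [N N1 N2]; exists N => //; apply: subset_trans s.
by apply: subset_trans sE (subsetUl _ _).
Qed.

Lemma card_bigcup_le (V I : finType) (D : {set I}) (F : I -> {set V}) m k : #|D| <= k ->
  (forall i, i \in D -> #|F i| <= m) -> #|\bigcup_(i in D) F i| <= k * m.
Proof.
move=> Dk Fm; apply: leq_trans (_ : \sum_(i in D) #|F i| <= _).
  elim/big_rec2: _ => [|i a A _ h]; first by rewrite cards0.
  by apply: leq_trans (leq_card_setU _ _) _; rewrite leq_add2l.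
apply: leq_trans (_ : \sum_(i in D) m <= _); first exact: leq_sum.
by rewrite sum_nat_const leq_mul2r Dk orbT.
Qed.

(** * Active cells *)

Section Activation.
Variables (V C : finType) (H : rel V) (cell : V -> C) (root : C) (T1 T2 : nat).

Definition attached c v := T1 <= #|[set y | (cell y == c) && H v y]|.
Definition attaching c' c := [set v | (cell v == c) && attached c' v].

Definition activation (cs : seq C) (par : C -> C) := [/\ uniq cs, root \in cs &
  forall c, c \in cs -> c != root ->
    [/\ par c \in cs, index (par c) cs < index c cs & T2 <= #|attaching (par c) c|]].

(** A list of maximal length: a cell violating the last clause could be appended with parent
    [c']. *)
Lemma maximal_activation : exists cs par, activation cs par /\
  forall c c', c \notin cs -> c' \in cs -> #|attaching c' c| < T2.
Proof.
pose Pr k := `[< exists cs par, activation cs par /\ size cs = k >].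
have P1 : Pr 1.
  apply/asboolP; exists [:: root], id; split=> //; split=> //; first by rewrite inE eqxx.
  by move=> c; rewrite inE => ->.
have Pb k : Pr k -> k <= #|C|.
  move/asboolP => [cs [par [[u _ _] <-]]]; rewrite -(card_uniqP u).
  exact: max_card.
have [k /asboolP[cs [par [[u rcs parP] sz]]] kmax] := ex_maxnP (ex_intro _ 1 P1) Pb.
exists cs, par; split=> // c c' cn c'cs; rewrite ltnNge; apply/negP => big.
have : Pr k.+1.
  apply/asboolP; exists (rcons cs c), (fun d => if d == c then c' else par d).
  split; last by rewrite size_rcons sz.
  split; first by rewrite rcons_uniq cn.
    by rewrite mem_rcons inE rcs orbT.
  move=> d; rewrite mem_rcons inE; case: eqVneq => [-> _ _|dc /= dcs dr].
    split=> //; first by rewrite mem_rcons inE c'cs orbT.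
    by rewrite -cats1 !index_cat c'cs (negbTE cn) /= eqxx addn0 index_mem.
  have [h1 h2 h3] := parP d dcs dr; split=> //; first by rewrite mem_rcons inE h1 orbT.
  by rewrite -cats1 !index_cat h1 dcs.
by move/kmax; rewrite ltnn.
Qed.

End Activation.

Section FromActivation.
Variables (V C : finType) (e H : rel V) (cell : V -> C) (root : C) (T1 T2 K : nat)
  (near : C -> {set C}) (cs : seq C) (par : C -> C).
Let att := attached H cell T1.
Hypotheses (eirr : irreflexive e) (evV : ~~ odd #|V|)
  (Hsym : symmetric H) (He : subrel H e)
  (nearS : forall c d, d \in near c -> c \in near d)
  (nearK : forall c, #|near c| <= K)
  (Hnear : forall u v, H u v -> cell v \in near (cell u))
  (Hcell : forall u v, cell u = cell v -> u != v -> H u v)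
  (T2_big : 188 * 188 <= T2)
  (T1_big : 2 * (K * T2 + K + T2 + 3) * (K * T2 + K + T2 + 3) <= T1)
  (act : activation H cell root T1 T2 cs par)
  (maxi : forall c c', c \notin cs -> c' \in cs -> #|attaching H cell T1 c' c| < T2)
  (root_big : T2 <= #|[set v | cell v == root]|).

Definition singles := [set v | (cell v \notin cs) && [exists c, (c \in cs) && att c v]].
Definition unattached := [set v | (cell v \notin cs) && ~~ [exists c, (c \in cs) && att c v]].

Lemma T1_gt0 : 0 < T1.
Proof. by apply: leq_trans T1_big; rewrite !addnS. Qed.

Lemma att_near c v : att c v -> c \in near (cell v).
Proof.
rewrite /att /attached => h; have /card_gt0P[y] := leq_trans T1_gt0 h.
by rewrite inE => /andP[/eqP <- /Hnear].
Qed.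

(** A near active cell contributes fewer than [T1] neighbours. In a near inactive cell a neighbour
    outside [unattached] is attached to one of at most [K] active cells, and maximality allows fewer
    than [T2] for each. *)
Lemma unattached_neighbours z : z \in unattached ->
  #|[set v | (v \notin unattached) && H z v]| <= K * (T1 + K * T2).
Proof.
rewrite inE => /andP[_ /existsPn zU].
have sub : [set v | (v \notin unattached) && H z v] \subset
    \bigcup_(c in near (cell z)) [set v | [&& v \notin unattached, H z v & cell v == c]].
  apply/subsetP => v; rewrite inE => /andP[vU zv]; apply/bigcupP.
  by exists (cell v); [exact: Hnear|rewrite inE vU zv eqxx].
apply: leq_trans (subset_leq_card sub) _.
apply: card_bigcup_le => // c _.
have [ccs|ccs] := boolP (c \in cs).
  apply: leq_trans (leq_addr _ _); have := zU c; rewrite ccs /= -ltnNge => /ltnW h.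
  apply: leq_trans h; apply: subset_leq_card; apply/subsetP => v.
  by rewrite !inE => /and3P[_ -> ->].
apply: leq_trans (leq_addl _ _).
have sub2 : [set v | [&& v \notin unattached, H z v & cell v == c]] \subset
    \bigcup_(c' in near c :&: [set c' in cs]) attaching H cell T1 c' c.
  apply/subsetP => v; rewrite !inE => /and3P[vU zv /eqP cv].
  move: vU; rewrite cv ccs /= negbK => /existsP[c' /andP[c'cs av]].
  apply/bigcupP; exists c'; last by rewrite inE cv eqxx.
  by rewrite !inE c'cs andbT -cv att_near.
apply: leq_trans (subset_leq_card sub2) _; apply: card_bigcup_le.
  by apply: leq_trans (nearK c); apply: subset_leq_card; apply: subsetIl.
by move=> c'; rewrite !inE => /andP[_ c'cs]; apply/ltnW/maxi.
Qed.

Variables (cl : V -> V) (Y : V -> {set V}).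
Let P k := [set u in unattached | cl u == k].
Hypotheses (YU : forall k v, v \in Y k -> v \notin unattached)
  (Ysep : forall k k' v v', v \in Y k -> v' \in Y k' -> cell v = cell v' -> k = k')
  (win : forall k, mwin (saturated 2 (P k) (Y k)) (touching e (P k) (Y k)) set0).

Let host v := if [pick c | (c \in cs) && att c v] is Some c then c else root.

Let hostE v : v \in singles -> host v \in cs /\ att (host v) v.
Proof.
rewrite inE => /andP[_ /existsP[c hc]]; rewrite /host; case: pickP => [d /andP[]//|/(_ c)].
by rewrite hc.
Qed.

Let vc c := [set v | cell v == c].
Let load c := #|[set v in singles | host v == c]| +
  #|[set d | [&& d \in cs, d != root & par d == c]]|.

Let load_le c : c \in cs -> load c <= K * T2 + K.
Proof.
move=> ccs; apply: leq_add; last first.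
  apply: leq_trans (nearK c); apply: subset_leq_card; apply/subsetP => d.
  rewrite inE => /and3P[dcs dr /eqP pd]; have [_ _ parP] := act.
  have [_ _ h] := parP d dcs dr.
  have /card_gt0P[v] : 0 < #|attaching H cell T1 (par d) d|.
    by apply: leq_trans h; apply: leq_trans T2_big.
  by rewrite inE => /andP[/eqP cv /att_near]; rewrite cv pd; apply: nearS.
have sub : [set v in singles | host v == c] \subset
    \bigcup_(d in near c :\: [set d in cs]) attaching H cell T1 c d.
  apply/subsetP => v; rewrite inE => /andP[vS /eqP hv]; have [_ av] := hostE vS.
  rewrite hv in av; apply/bigcupP; exists (cell v); last by rewrite inE eqxx.
  move: vS; rewrite !inE => /andP[-> _] /=; apply: nearS; exact: att_near.
apply: leq_trans (subset_leq_card sub) _.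
apply: card_bigcup_le.
  by apply: leq_trans (nearK c); apply: subset_leq_card; apply: subsetDl.
by move=> d; rewrite !inE => /andP[dcs _]; apply/ltnW/maxi.
Qed.

(** The tolerance [2 * q c] of a cell with [T2] vertices would not cover a load of order [K * T2].
    But a request comes with [T1] neighbours in its host, so cells with a load are large, and [T1]
    is chosen above the square of the load. *)
Let load_big c : 0 < load c -> T1 <= #|vc c|.
Proof.
have big v : att c v -> T1 <= #|vc c|.
  move=> h; apply: leq_trans h _; apply: subset_leq_card.
  by apply/subsetP => y; rewrite !inE => /andP[].
rewrite /load addn_gt0 => /orP[] /card_gt0P[v]; rewrite inE.
  by move=> /andP[/hostE[_ av] /eqP hv]; apply: (big v); rewrite -hv.
move=> /and3P[dcs dr /eqP pd]; have [_ _ parP] := act.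
have [_ _ h] := parP v dcs dr.
have /card_gt0P[y] : 0 < #|attaching H cell T1 (par v) v|.
  by apply: leq_trans h; apply: leq_trans T2_big.
by rewrite inE pd => /andP[_]; apply: big.
Qed.

(** The integer square root of the size of the cell. *)
Let q c := [arg max_(k > ord0 : 'I_(#|V|.+1) | k * k <= #|vc c|) (k : nat)].

Let cell_big c : c \in cs -> T2 <= #|vc c|.
Proof.
move=> ccs; have [->//|cr] := eqVneq c root; have [_ _ parP] := act.
have [_ _ h] := parP c ccs cr; apply: leq_trans h _; apply: subset_leq_card.
by apply/subsetP => v; rewrite !inE => /andP[].
Qed.

Let qE c : q c * q c <= #|vc c| /\ #|vc c| < (q c).+1 * (q c).+1.
Proof.
rewrite /q; case: arg_maxnP => //= k kc kmax; split=> //.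
rewrite ltnNge; apply/negP => h.
have kV : k.+1 < #|V|.+1.
  rewrite ltnS; apply: leq_trans (leq_pmulr k.+1 (ltn0Sn k)) _.
  by apply: leq_trans h (max_card _).
by have := kmax (Ordinal kV) h; rewrite /= ltnn.
Qed.

Let sqr_lt a b : a * a < b.+1 * b.+1 -> a <= b.
Proof. by move=> h; rewrite leqNgt; apply/negP => ba; move: h; rewrite ltnNge leq_mul. Qed.

Let A0 c := if c == root then set0 else
  if [pick D : {set V} | (D \subset attaching H cell T1 (par c) c) && (#|D| == T2)] is Some D then D else set0.

Let A0P c : c \in cs -> c != root -> A0 c \subset attaching H cell T1 (par c) c /\ #|A0 c| = T2.
Proof.
move=> ccs cr; rewrite /A0 (negbTE cr); have [_ _ parP] := act.
have [_ _ h] := parP c ccs cr; case: pickP => [D /andP[h1 /eqP h2]//|no].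
by have [D D1 D2] := card_subset_exists h; have := no D; rewrite D1 D2 eqxx.
Qed.

Lemma activation_mwin :
  mwin (fun M => exists2 N : {set {set V}}, perfect_matching e N & N \subset M) (edges e) set0.
Proof.
have [ucs rcs parP] := act.
have Het c v : att c v -> T1 <= #|[set y in [set y | cell y == c] | e v y]|.
  move=> h; apply: leq_trans h _; apply: subset_leq_card; apply/subsetP => y.
  by rewrite !inE => /andP[-> /He].
apply: (@forest_mwin V C e cell cs root par A0 singles unattached host (fun c => q c) cl Y T1 T2) => //.
- move=> v; case: (boolP (cell v \in cs)) => //= h; rewrite !inE h /=.
  by case: [exists c, _].
- by move=> v; rewrite !inE => /andP[-> ->].
- by move=> v; rewrite inE => /andP[].
- by move=> c ccs cr; have [h1 h2 _] := parP c ccs cr.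
- by rewrite /A0 eqxx.
- move=> c ccs cr; have [h1 h2] := A0P ccs cr; split=> //.
  by apply: subset_trans h1 _; apply/subsetP => v; rewrite !inE => /andP[].
- move=> c v ccs cr vA; have [/subsetP/(_ _ vA)] := A0P ccs cr.
  by rewrite inE => /andP[_] h _; apply: Het.
- by move=> v /hostE[h1 h2]; split=> //; apply: Het.
- by move=> c x y _ cx cy xy; apply/He/Hcell; rewrite ?cx.
(* [188 * 188 <= T2] makes [q c] at least [187], the bound of [q_large_ok]. *)
- move=> c ccs; have [q1 q2] := qE c; split=> //.
    by apply: sqr_lt; apply: leq_ltn_trans q2; apply: leq_trans (cell_big ccs); apply: leq_trans T2_big.
  have h187 : 187 <= q c.
    by apply: sqr_lt; apply: leq_ltn_trans q2; apply: leq_trans (cell_big ccs); apply: leq_trans T2_big.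
  rewrite -/(load c); have [l0|l0] := posnP (load c).
    by rewrite l0; move: h187; clear; lia.
  have := load_le ccs; have : K * T2 + K + T2 + 3 <= q c.
    apply: sqr_lt; apply: leq_ltn_trans q2; apply: leq_trans (load_big l0).
    by apply: leq_trans T1_big; rewrite -mulnA leq_pmull.
  by move: (K * T2); clear; lia.
- move=> c ccs; have := load_le ccs; rewrite -/(load c).
  have : 2 * (K * T2 + K + T2 + 3) <= T1.
    by apply: leq_trans T1_big; apply: leq_pmulr; rewrite addnS.
  by move: (K * T2) (load c); clear; lia.
- by apply: leq_trans T2_big.
Qed.

End FromActivation.

(** * Points in a grid *)

(* The distance |a - b|; the subtractions are truncated. *)
Definition adn (a b : nat) : nat := (a - b) + (b - a).

Definition dsq (p q : nat * nat) : nat :=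
  adn p.1 q.1 * adn p.1 q.1 + adn p.2 q.2 * adn p.2 q.2.

Lemma adnC a b : adn a b = adn b a. Proof. by rewrite /adn addnC. Qed.

Lemma adnn a : adn a a = 0. Proof. by rewrite /adn subnn. Qed.

Lemma dsqC p q : dsq p q = dsq q p. Proof. by rewrite /dsq !(adnC q.1, adnC q.2). Qed.

Lemma adn_tri a b c : adn a c <= adn a b + adn b c.
Proof. rewrite /adn; lia. Qed.

Lemma sqr_le_inv a b : a * a <= b * b -> a <= b.
Proof. by move=> h; rewrite leqNgt; apply/negP => ba; move: h; rewrite leqNgt ltn_mul. Qed.

Lemma dsq_le p q s : dsq p q <= s * s -> adn p.1 q.1 <= s /\ adn p.2 q.2 <= s.
Proof.
move=> h; split; apply: sqr_le_inv; apply: leq_trans h; [exact: leq_addr|exact: leq_addl].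
Qed.

Lemma dsq_ge p q m s : adn p.1 q.1 <= m -> adn p.2 q.2 <= m -> 2 * (m * m) <= s * s ->
  dsq p q <= s * s.
Proof.
move=> h1 h2; apply: leq_trans; rewrite mul2n -addnn.
by apply: leq_add; apply: leq_mul.
Qed.

(** Moving by at most [h] in each coordinate changes distances by at most [2 * h]. The estimate
    rests on [2 * (a + b) <= 3 * m] for [a * a + b * b <= m * m]. *)
Lemma dsq_shift p q r h s : 2 * h <= s -> adn p.1 q.1 <= h -> adn p.2 q.2 <= h ->
  dsq p r <= (s - 2 * h) * (s - 2 * h) -> dsq q r <= s * s.
Proof.
move=> hs h1 h2; rewrite /dsq.
have := adn_tri q.1 p.1 r.1; have := adn_tri q.2 p.2 r.2; rewrite ![adn q.1 p.1]adnC ![adn q.2 p.2]adnC.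
move: (adn p.1 q.1) (adn p.2 q.2) h1 h2 (adn p.1 r.1) (adn p.2 r.2) (adn q.1 r.1) (adn q.2 r.2).
move=> x y xh yh a b c d db ca; set m := s - 2 * h => ab.
have -> : s = m + 2 * h by rewrite /m; lia.
have c2 : c * c <= (a + h) * (a + h) by apply: leq_mul; lia.
have d2 : d * d <= (b + h) * (b + h) by apply: leq_mul; lia.
have abm : 2 * (a + b) <= 3 * m.
  apply: sqr_le_inv; have [+ _] := nat_Cauchy a b; rewrite !expnS !expn0 !muln1.
  by move: ab; clear; move: m => m; lia.
apply: leq_trans (leq_add c2 d2) _.
have h3 : h * (2 * (a + b)) <= h * (3 * m) by rewrite leq_mul2l abm orbT.
move: ab h3; clear; move: m => m; nia.
Qed.

Lemma divn_near a b w i : 0 < w -> a %/ w <= b %/ w + i -> b %/ w <= a %/ w + i ->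
  adn a b <= i.+1 * w.
Proof.
move=> w0 h1 h2; have := ltn_ceil a w0; have := ltn_ceil b w0.
have := leq_trunc_div a w; have := leq_trunc_div b w.
have h1' : (a %/ w) * w <= (b %/ w) * w + i * w by rewrite -mulnDl leq_mul2r h1 orbT.
have h2' : (b %/ w) * w <= (a %/ w) * w + i * w by rewrite -mulnDl leq_mul2r h2 orbT.
move: h1' h2'; rewrite !mulSn /adn; move: (_ * w) (_ * w) (_ * w); clear; lia.
Qed.

Lemma near_divn a b w i : 0 < w -> adn a b <= i * w -> a %/ w <= b %/ w + i.
Proof.
move=> w0 h; have : a <= b + i * w by move: h; rewrite /adn; lia.
by move/(leq_div2r w); rewrite divnDMl.
Qed.

(* For a cluster with leftmost, rightmost, top and bottom points l, r, t, b, all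
   points in this region are neighbours of the cluster outside it. *)
Definition in_region (s : nat) (l r t b y : nat * nat) : bool :=
  [|| (y.1 < l.1) && (dsq l y <= s * s), (r.1 < y.1) && (dsq r y <= s * s),
      [&& l.1 <= y.1, y.1 <= r.1, t.2 < y.2 & dsq t y <= s * s] |
      [&& l.1 <= y.1, y.1 <= r.1, y.2 < b.2 & dsq b y <= s * s]].

Definition swp (p : nat * nat) := (p.2, p.1).

Section Conditions.
Variables (V : finType) (pos : V -> nat * nat).

Definition adjacent (s : nat) : rel V := fun u v => (u != v) && (dsq (pos u) (pos v) <= s * s).

Definition no_sparse_region (s h D J : nat) : Prop := forall l r t b : V,
  (forall z, z \in [:: l; r; t; b] -> adn (pos l).1 (pos z).1 <= D /\ adn (pos l).2 (pos z).2 <= D) ->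
  (pos l).1 + h <= (pos r).1 ->
  (pos l).1 <= (pos t).1 <= (pos r).1 -> (pos l).1 <= (pos b).1 <= (pos r).1 ->
  J < #|[set v | in_region s (pos l) (pos r) (pos t) (pos b) (pos v)]|.

Definition in_box (h : nat) (u v : V) :=
  (adn (pos u).1 (pos v).1 <= h) && (adn (pos u).2 (pos v).2 <= h).

Definition close_pts h v := [set u | (u != v) && in_box h v u].
Definition inner_pts s h v :=
  [set u | ~~ in_box h v u & dsq (pos v) (pos u) <= (s - 2 * h) * (s - 2 * h)].
Definition annulus_pts s h v := [set u | [&& ~~ in_box h v u,
  (s - 2 * h) * (s - 2 * h) < dsq (pos v) (pos u) & dsq (pos v) (pos u) <= s * s]].

(* Points of the disc of radius s - 2h around v are adjacent to all points that
   are h-close to v. *)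
Definition no_poor_cluster (s h J : nat) : Prop := forall v : V, 1 < #|close_pts h v| ->
  #|inner_pts s h v| + #|annulus_pts s h v| <= J -> #|close_pts h v| <= #|inner_pts s h v|.

End Conditions.

(** * Good rows and columns, and why they are active *)

Section Skeleton.
Variables (V : finType) (pos : V -> nat * nat) (w B beta T1 T2 : nat).
Let N := B * beta.
Hypotheses (w0 : 0 < w) (posN : forall v, (pos v).1 < N * w /\ (pos v).2 < N * w).

Lemma cellx_subproof v : (pos v).1 %/ w < N.
Proof. by rewrite ltn_divLR //; case: (posN v). Qed.
Lemma celly_subproof v : (pos v).2 %/ w < N.
Proof. by rewrite ltn_divLR //; case: (posN v). Qed.

Definition coarse v : 'I_N * 'I_N := (Ordinal (cellx_subproof v), Ordinal (celly_subproof v)).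

Definition good (c : 'I_N * 'I_N) := T1 <= #|[set v | coarse v == c]|.

Definition good_row j (y : 'I_N) := forall x : 'I_N, B * j <= x -> x < B * j + 3 * B -> good (x, y).
Definition good_col i (x : 'I_N) := forall y : 'I_N, B * i <= y -> y < B * i + 3 * B -> good (x, y).

(* Coarse coordinates are grouped into blocks of length B; the rows of window i
   meet the blocks i, i+1, i+2. *)
Definition skeleton := forall i a, i + 3 <= beta -> a < beta ->
  (exists y : 'I_N, [/\ B * a + 6 <= y, y + 6 < B * a + B & good_row i y]) /\
  (exists x : 'I_N, [/\ B * a + 6 <= x, x + 6 < B * a + B & good_col i x]).

Let s := 5 * w.
Let H := adjacent pos s.

Definition near (c : 'I_N * 'I_N) : {set 'I_N * 'I_N} :=
  [set d : 'I_N * 'I_N | [&& d.1 <= c.1 + 5, c.1 <= d.1 + 5, d.2 <= c.2 + 5 & c.2 <= d.2 + 5]].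

Lemma near_sym c d : d \in near c -> c \in near d.
Proof. by rewrite !inE => /and4P[-> -> -> ->]. Qed.

Lemma card_near c : #|near c| <= 121.
Proof.
have I (a : 'I_N) : #|[set x : 'I_N | (x <= a + 5) && (a <= x + 5)]| <= 11.
  rewrite cardE -(size_map val) -[11](size_iota (a - 5)); apply: uniq_leq_size.
    by rewrite map_inj_uniq ?enum_uniq //; apply: val_inj.
  move=> x /mapP[y]; rewrite mem_enum inE => /andP[h1 h2] ->; rewrite mem_iota.
  by move: h1 h2 => /=; clear; lia.
have -> : 121 = 11 * 11 by [].
apply: leq_trans (leq_mul (I c.1) (I c.2)); rewrite -cardsX; apply: subset_leq_card.
by apply/subsetP => -[x y]; rewrite !inE /= => /and4P[-> -> -> ->].
Qed.

Lemma adjacent_near u v : H u v -> coarse v \in near (coarse u).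
Proof.
case/andP => _ /dsq_le[h1 h2]; rewrite inE /=.
by apply/and4P; split; apply: near_divn => //; rewrite // adnC.
Qed.

Lemma coarse_near u v i : (coarse u).1 <= (coarse v).1 + i -> (coarse v).1 <= (coarse u).1 + i ->
  (coarse u).2 <= (coarse v).2 + i -> (coarse v).2 <= (coarse u).2 + i ->
  adn (pos u).1 (pos v).1 <= i.+1 * w /\ adn (pos u).2 (pos v).2 <= i.+1 * w.
Proof. by move=> h1 h2 h3 h4; split; apply: divn_near. Qed.

(** Points whose cells are two apart differ by at most [3 * w] in each coordinate, and
    [2 * 9 <= 25]. *)
Lemma coarse_adjacent u v : u != v ->
  (coarse u).1 <= (coarse v).1 + 2 -> (coarse v).1 <= (coarse u).1 + 2 ->
  (coarse u).2 <= (coarse v).2 + 2 -> (coarse v).2 <= (coarse u).2 + 2 -> H u v.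
Proof.
move=> uv h1 h2 h3 h4; have [k1 k2] := coarse_near h1 h2 h3 h4.
by rewrite /H /adjacent uv; apply: (dsq_ge k1 k2); rewrite /s; clear; lia.
Qed.

Lemma coarse_eq_adjacent u v : coarse u = coarse v -> u != v -> H u v.
Proof. by move=> e uv; apply: coarse_adjacent; rewrite // e leq_addr. Qed.

Hypotheses (T12 : T2 <= T1) (T1_pos : 0 < T1) (sk : skeleton) (beta3 : 3 <= beta) (B13 : 13 < B).
Variables (cs : seq ('I_N * 'I_N)).
Hypothesis maxi : forall c c', c \notin cs -> c' \in cs ->
  #|attaching H coarse T1 c' c| < T2.

Lemma good_near_attached c v : good c -> coarse v != c ->
  (coarse v).1 <= c.1 + 2 -> c.1 <= (coarse v).1 + 2 ->
  (coarse v).2 <= c.2 + 2 -> c.2 <= (coarse v).2 + 2 -> attached H coarse T1 c v.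
Proof.
move=> g vc h1 h2 h3 h4; apply: leq_trans g _; apply: subset_leq_card.
apply/subsetP => y; rewrite !inE => /eqP yc; rewrite yc eqxx /=.
by apply: coarse_adjacent; rewrite ?yc //; apply: contraNneq vc => ->; apply/eqP.
Qed.

(** All vertices of [c'] are attached to [c], and there are at least [T1 >= T2] of them, so leaving
    [c'] inactive would contradict maximality. *)
Lemma good_adjacent_active c c' : good c -> good c' -> c \in cs ->
  c'.1 <= c.1 + 1 -> c.1 <= c'.1 + 1 -> c'.2 <= c.2 + 1 -> c.2 <= c'.2 + 1 -> c' \in cs.
Proof.
move=> g g' ccs h1 h2 h3 h4; apply: contraT => c'n; have := maxi c'n ccs.
rewrite ltnNge => /negP[]; apply: leq_trans T12 _; apply: leq_trans g' _; apply: subset_leq_card.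
apply/subsetP => v; rewrite !inE => /eqP vc; rewrite vc eqxx /=.
have cc' : c' != c by apply: contraNneq c'n => ->.
by apply: good_near_attached; rewrite ?vc //; move: h1 h2 h3 h4; clear; lia.
Qed.

Lemma line_active (f : nat -> 'I_N * 'I_N) (lo hi a : nat) : lo <= a < hi ->
  (forall k, lo <= k < hi -> good (f k)) ->
  (forall k, lo <= k -> k.+1 < hi -> f k \in cs -> f k.+1 \in cs) ->
  (forall k, lo <= k -> k.+1 < hi -> f k.+1 \in cs -> f k \in cs) ->
  f a \in cs -> forall k, lo <= k < hi -> f k \in cs.
Proof.
move=> /andP[la ah] g up dn fa.
have U k : a + k < hi -> f (a + k) \in cs.
  elim: k => [|k IH]; first by rewrite addn0.
  rewrite addnS => h; apply: up => //; last by apply: IH; apply: ltnW.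
  by apply: leq_trans la (leq_addr _ _).
have D k : lo + k <= a -> f (a - k) \in cs.
  elim: k => [|k IH] h; first by rewrite subn0.
  have e : a - k = (a - k.+1).+1 by move: h; clear; lia.
  apply: dn; rewrite -?e; last by apply: IH; move: h; clear; lia.
    by move: h; clear; lia.
  by move: ah h; clear; lia.
move=> k /andP[lk kh]; have [ak|ka] := leqP a k.
  by rewrite -(subnKC ak); apply: U; rewrite subnKC.
by rewrite -(subKn (ltnW ka)); apply: D; move: lk ka; clear; lia.
Qed.

Let N_gt0 : 0 < N.
Proof. by rewrite /N muln_gt0; move: beta3 B13; clear; lia. Qed.

Let nth_ord k : 'I_N := insubd (Ordinal N_gt0) k.

Let nth_ordK k : k < N -> nth_ord k = k :> nat.
Proof. by move=> h; rewrite /nth_ord val_insubd h. Qed.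

Let ord_nth (x : 'I_N) : nth_ord x = x.
Proof. by apply: val_inj; rewrite /= nth_ordK. Qed.

Let win_N i : i + 3 <= beta -> B * i + 3 * B <= N.
Proof. by move=> h; rewrite (mulnC 3) -mulnDr /N leq_mul2l h orbT. Qed.

Lemma row_active i y (x0 x : 'I_N) : i + 3 <= beta -> good_row i y ->
  B * i <= x0 < B * i + 3 * B -> (x0, y) \in cs ->
  B * i <= x < B * i + 3 * B -> (x, y) \in cs.
Proof.
move=> ib g x0r x0cs xr; have iN := win_N ib.
have inN k : k < B * i + 3 * B -> k < N by move/leq_trans; apply.
have gk k : B * i <= k < B * i + 3 * B -> good (nth_ord k, y).
  by move=> /andP[h1 h2]; apply: g; rewrite nth_ordK // inN.
have := @line_active (fun k => (nth_ord k, y)) (B * i) (B * i + 3 * B) x0 x0r gk.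
rewrite ord_nth => h; rewrite -(ord_nth x); apply: h => // k k1 k2 kcs.
  apply: good_adjacent_active kcs _ _ _ _; rewrite /= ?nth_ordK ?leq_addr //; try apply: gk; try apply: inN;
    by move: k1 k2; clear; lia.
apply: good_adjacent_active kcs _ _ _ _; rewrite /= ?nth_ordK ?leq_addr //; try apply: gk; try apply: inN;
    by move: k1 k2; clear; lia.
Qed.

Lemma col_active i x (y0 y : 'I_N) : i + 3 <= beta -> good_col i x ->
  B * i <= y0 < B * i + 3 * B -> (x, y0) \in cs ->
  B * i <= y < B * i + 3 * B -> (x, y) \in cs.
Proof.
move=> ib g x0r x0cs xr; have iN := win_N ib.
have inN k : k < B * i + 3 * B -> k < N by move/leq_trans; apply.
have gk k : B * i <= k < B * i + 3 * B -> good (x, nth_ord k).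
  by move=> /andP[h1 h2]; apply: g; rewrite nth_ordK // inN.
have := @line_active (fun k => (x, nth_ord k)) (B * i) (B * i + 3 * B) y0 x0r gk.
rewrite ord_nth => h; rewrite -(ord_nth y); apply: h => // k k1 k2 kcs.
  apply: good_adjacent_active kcs _ _ _ _; rewrite /= ?nth_ordK ?leq_addr //; try apply: gk; try apply: inN;
    by move: k1 k2; clear; lia.
apply: good_adjacent_active kcs _ _ _ _; rewrite /= ?nth_ordK ?leq_addr //; try apply: gk; try apply: inN;
    by move: k1 k2; clear; lia.
Qed.

(* [in_block c z]: the coarse coordinate z lies in block c. *)
Let in_block c (z : nat) := (B * c <= z) && (z < B * c + B).

Let block_in_window i c z : in_block c z -> i <= c -> c < i + 3 ->
  B * i <= z < B * i + 3 * B.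
Proof.
move=> /andP[h1 h2] ic ci.
have k1 : B * i <= B * c by rewrite leq_mul2l ic orbT.
have k2 : B * c + B <= B * i + 3 * B by rewrite (mulnC 3) -mulnDr -mulnSr leq_mul2l ci orbT.
by move: h1 h2 k1 k2; move: (B * c) (B * i) (3 * B); clear; lia.
Qed.

Let mid_block c z : B * c + 6 <= z -> z + 6 < B * c + B -> in_block c z.
Proof. by rewrite /in_block; move: (B * c); clear; lia. Qed.

Hypothesis root_active : exists2 y : 'I_N, good_row 0 y /\ in_block 0 y &
  forall x : 'I_N, x < 3 * B -> (x, y) \in cs.

Let rows_at a := forall j (y : 'I_N), j + 3 <= beta -> in_block a y -> good_row j y ->
  forall x : 'I_N, B * j <= x < B * j + 3 * B -> (x, y) \in cs.
Let cols_at i := forall c (x : 'I_N), c < beta -> in_block c x -> good_col i x ->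
  forall y : 'I_N, B * i <= y < B * i + 3 * B -> (x, y) \in cs.

(** A good column of vertical window [i] crosses every row of its three blocks, and activity passes
    through the common cell. *)
Let cols_rows i a : i + 3 <= beta -> i <= a -> a < i + 3 -> cols_at i -> rows_at a.
Proof.
move=> ib ia ai cols j y jb ya gy x xr.
have jb' : j < beta by move: jb; clear; lia.
have [_ [x1 [l1 l2 g1]]] := sk ib jb'.
have x1b := mid_block l1 l2.
have x1cs := cols j x1 jb' x1b g1 y (block_in_window ya ia ai).
by apply: row_active jb gy _ x1cs xr; apply: block_in_window x1b _ _; clear; lia.
Qed.

Let rows_cols i a : i + 3 <= beta -> i <= a -> a < i + 3 -> rows_at a -> cols_at i.
Proof.
move=> ib ia ai rows c x cb xc gx y yr.
pose j := minn c (beta - 3).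
have jb : j + 3 <= beta by rewrite /j; move: beta3; clear; lia.
have jc : j <= c by rewrite /j geq_minl.
have cj : c < j + 3 by rewrite /j; move: cb beta3; clear; lia.
have ab : a < beta by move: ai ib; clear; lia.
have [[y1 [l1 l2 g1]] _] := sk jb ab.
have y1b := mid_block l1 l2.
have y1cs := rows j y1 jb y1b g1 x (block_in_window xc jc cj).
by apply: col_active ib gx _ y1cs yr; apply: block_in_window y1b ia ai.
Qed.

(** Consecutive windows overlap: a good column in block [j.+1] meets a row that is already active in
    window [j] as well as the given row of window [j.+1]. *)
Let rows_at0 : rows_at 0.
Proof.
have [y0 [gy0 y0b] hy0] := root_active.
move=> j; elim: j => [|j IH] y jb yb gy x xr.
  have b0 : 0 < beta by move: beta3; clear; lia.
  have [_ [x1 [l1 l2 g1]]] := sk jb b0.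
  have x1b := mid_block l1 l2; have x1r := block_in_window x1b (leqnn 0) isT.
  have x1cs : (x1, y) \in cs.
    apply: (col_active (i := 0) (y0 := y0)) => //; [exact: block_in_window y0b _ _| |exact: block_in_window yb _ _].
    by apply: hy0; move: x1r; rewrite muln0 => /andP[].
  exact: row_active jb gy x1r x1cs xr.
have jb' : j + 3 <= beta by move: jb; clear; lia.
have [b0 jb1] : 0 < beta /\ j.+1 < beta by move: jb; clear; lia.
have [[y1 [k1 k2 gy1]] _] := sk jb' b0; have y1b := mid_block k1 k2.
have i3 : 0 + 3 <= beta by [].
have [_ [x1 [l1 l2 g1]]] := sk i3 jb1; have x1b := mid_block l1 l2.
have x1cs1 : (x1, y1) \in cs.
  by apply: (IH y1 jb' y1b gy1); apply: block_in_window x1b _ _; clear; lia.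
have x1cs : (x1, y) \in cs.
  apply: (col_active i3 g1 _ x1cs1); first exact: block_in_window y1b _ _.
  exact: block_in_window yb _ _.
by apply: row_active jb gy _ x1cs xr; apply: block_in_window x1b _ _; clear; lia.
Qed.

Lemma rows_active a : a < beta -> rows_at a.
Proof.
elim: a => [_|a IH ab]; first exact: rows_at0.
pose i := minn a (beta - 3).
have [ib ia ai] : [/\ i + 3 <= beta, i <= a & a.+1 < i + 3].
  by rewrite /i; move: beta3 ab; clear; split; lia.
apply: (cols_rows ib _ ai); first exact: leqW.
by apply: (rows_cols ib ia (ltnW ai)); apply: IH; apply: ltnW.
Qed.

Lemma cols_active i : i + 3 <= beta -> cols_at i.
Proof.
move=> ib; apply: (rows_cols ib (leqnn i)); first by clear; lia.
by apply: rows_active; move: ib; clear; lia.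
Qed.
End Skeleton.

(** * Shape and separation of the components of unattached vertices *)

Lemma cluster_width (V : finType) (pos : V -> nat * nat) (s h D J J0 : nat) (P : {set V}) :
  no_sparse_region pos s h D J ->
  {in P &, forall u v, adn (pos u).1 (pos v).1 <= D /\ adn (pos u).2 (pos v).2 <= D} ->
  {in P, forall z, #|[set v | v \notin P & dsq (pos z) (pos v) <= s * s]| <= J0} ->
  4 * J0 <= J -> {in P &, forall u v, (pos v).1 < (pos u).1 + h}.
Proof.
move=> sparse box deg J4 u v uP vP.
case: (arg_minnP (fun z => (pos z).1) uP) => l lP lmin.
case: (arg_maxnP (fun z => (pos z).1) uP) => r rP rmax.
case: (arg_maxnP (fun z => (pos z).2) uP) => t tP tmax.
case: (arg_minnP (fun z => (pos z).2) uP) => b bP bmin.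
rewrite ltnNge; apply/negP => wide.
(* A point of the region lies beyond an extreme point of [P], hence outside [P], and within [s] of
   one of the four extreme vertices; these have too few such neighbours. *)
have : J < #|[set y | in_region s (pos l) (pos r) (pos t) (pos b) (pos y)]|.
  apply: sparse.
  - move=> z; rewrite !inE => /or4P[]/eqP->; exact: box.
  - by apply: leq_trans (rmax v vP); apply: leq_trans wide; rewrite leq_add2r; apply: lmin.
  - by apply/andP; split; [apply: lmin|apply: rmax].
  - by apply/andP; split; [apply: lmin|apply: rmax].
apply/negP; rewrite -leqNgt; apply: leq_trans J4.
have sub : [set y | in_region s (pos l) (pos r) (pos t) (pos b) (pos y)] \subset
    \bigcup_(z in [set l; r; t; b]) [set v | v \notin P & dsq (pos z) (pos v) <= s * s].
  apply/subsetP => y; rewrite inE => /or4P[/andP[h1 h2]|/andP[h1 h2]|/and4P[_ _ h1 h2]|/and4P[_ _ h1 h2]];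
    apply/bigcupP; [exists l|exists r|exists t|exists b]; rewrite ?inE ?eqxx ?orbT //= h2 andbT;
    apply/negP => yP; move: h1; apply/negP; rewrite -leqNgt.
  - exact: lmin.
  - exact: rmax.
  - exact: tmax.
  - exact: bmin.
apply: leq_trans (subset_leq_card sub) _; apply: card_bigcup_le => [|z].
  by rewrite -[4]/(1 + 1 + 1 + 1) !(leq_trans (leq_card_setU _ _)) ?cards1 ?leq_add // (leq_trans (leq_card_setU _ _)) ?cards1 ?leq_add // (leq_trans (leq_card_setU _ _)) ?cards1.
by rewrite !inE -!orbA => /or4P[]/eqP->; apply: deg.
Qed.

(* The lines are active rows or columns, which no unattached vertex comes near;
   an H-component of unattached vertices cannot jump across them. *)
Section Walls.
Variables (V : finType) (U : {set V}) (f g : V -> nat) (B beta i : nat).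
Hypothesis B13 : 13 < B.
Hypothesis lines : forall c, c < beta -> exists x, [/\ B * c + 6 <= x, x + 6 < B * c + B &
  forall z, z \in U -> B * i <= g z < B * i + 3 * B -> 2 < adn (f z) x].

Lemma walls z0 : f z0 < B * beta -> 3 <= beta -> let c := f z0 %/ B in let k := minn c.-1 (beta - 3) in
  exists lo hi, [/\ lo <= f z0 <= hi, B * c <= lo + B /\ hi < B * c + 2 * B,
   (B * k = 0 \/ B * k + 5 <= lo) /\ (hi + 5 < B * k + 3 * B \/ B * beta <= B * k + 3 * B) &
   forall z z', z \in U -> z' \in U -> adn (f z) (f z') <= 5 -> f z' < B * beta ->
     B * i <= g z' < B * i + 3 * B -> lo <= f z <= hi -> lo <= f z' <= hi].
Proof.
move=> fN beta3 c k.
have B0 : 0 < B by apply: leq_trans B13.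
have cb : c < beta by rewrite /c ltn_divLR // mulnC.
have f1 : B * c <= f z0 by rewrite mulnC leq_trunc_div.
have f2 : f z0 < B * c + B by rewrite mulnC addnC -mulSn ltn_ceil.
have [lo [lo1 lo2 lo3 lo4]] : exists lo, [/\ lo <= f z0, B * c <= lo + B, B * k = 0 \/ B * k + 5 <= lo &
    forall z z', z \in U -> z' \in U -> adn (f z) (f z') <= 5 ->
     B * i <= g z' < B * i + 3 * B -> lo <= f z -> lo <= f z'].
  have [c0|c0] := posnP c.
    by exists 0; rewrite c0 muln0; split=> //; left; rewrite /k c0 min0n muln0.
  have c1b : c.-1 < beta by move: cb; clear; lia.
  have [x [x1 x2 x3]] := lines c1b.
  have e : B * c = B * c.-1 + B by rewrite -mulnSr prednK.
  have kc : B * k <= B * c.-1 by rewrite leq_mul2l geq_minl orbT.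
  (* Coordinates within 2 of the line are forbidden, and a step of length at most 5 cannot jump over
     these five values. *)
  exists (x + 3); split.
  - by move: f1 x2 e; clear; lia.
  - by move: x1 e; clear; lia.
  - by right; move: x1 kc; clear; lia.
  - move=> z z' zU z'U zz' gz' h; have := x3 z' z'U gz'.
    by move: zz' h; rewrite /adn; clear; lia.
have [hi [hi1 hi2 hi3 hi4]] : exists hi, [/\ f z0 <= hi, hi < B * c + 2 * B,
    hi + 5 < B * k + 3 * B \/ B * beta <= B * k + 3 * B &
    forall z z', z \in U -> z' \in U -> adn (f z) (f z') <= 5 -> f z' < B * beta ->
     B * i <= g z' < B * i + 3 * B -> f z <= hi -> f z' <= hi].
  have [c1|c1] := ltnP c.+1 beta; last first.
    have ec : beta = c.+1 by apply/eqP; rewrite eqn_leq c1 cb.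
    have eb : B * beta = B * c + B by rewrite ec mulnSr.
    have ek : B * beta = B * k + 3 * B.
      by rewrite (mulnC 3) -mulnDr; congr (B * _); rewrite /k ec; move: beta3; rewrite ec; clear; lia.
    (* In the last block the border of the square serves as the wall. *)
    exists (B * beta); split.
    - exact: ltnW.
    - by rewrite eb; move: B13; clear; lia.
    - by right; rewrite ek.
    - by move=> z z' _ _ _ h _ _; apply: ltnW.
  have [x [x1 x2 x3]] := lines c1.
  have e : B * c.+1 = B * c + B by rewrite mulnSr.
  have kc : B * c.+1 + B <= B * k + 3 * B.
    by rewrite (mulnC 3) -mulnDr -mulnSr leq_mul2l; apply/orP; right; rewrite /k; move: c1 beta3; clear; lia.
  exists (x - 3); split.
  - by move: f2 x1 e; clear; lia.
  - by move: x2 e; clear; lia.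
  - by left; move: x2 x1 kc; clear; lia.
  - move=> z z' zU z'U zz' _ gz' h; have := x3 z' z'U gz'.
    by move: zz' h x1; rewrite /adn; clear; lia.
exists lo, hi; split=> //; first by rewrite lo1.
move=> z z' zU z'U zz' fz' gz' /andP[h1 h2].
by rewrite (lo4 z z') // (hi4 z z').
Qed.
End Walls.

Section Lattice.
Variables (V : finType) (pos : V -> nat * nat) (w B beta T1 T2 h D D' : nat) (e : rel V).
Local Notation N := (B * beta).
Local Notation s := (5 * w).
Local Notation H := (adjacent pos s).
Local Notation J0 := (121 * (T1 + 121 * T2)).
Hypotheses (w0 : 0 < w) (posN : forall v, (pos v).1 < N * w /\ (pos v).2 < N * w).
Local Notation cell := (coarse w0 posN).
Hypotheses (eirr : irreflexive e) (evV : ~~ odd #|V|)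
  (He : subrel H e) (eD : forall u v, e u v -> adn (pos u).1 (pos v).1 <= D' /\ adn (pos u).2 (pos v).2 <= D')
  (deg2 : min_degree_ge e 2) (edeg3 : min_edge_degree_ge e 3)
  (T2_big : 188 * 188 <= T2)
  (T1_big : 2 * (121 * T2 + 121 + T2 + 3) * (121 * T2 + 121 + T2 + 3) <= T1)
  (beta3 : 3 <= beta) (B13 : 13 < B) (sk : skeleton T1 w0 posN)
  (hs : 3 * h <= s) (D3 : 3 * B * w <= D) (DD' : 2 * D' + w <= D)
  (sparse1 : no_sparse_region pos s h D (8 * J0 + 8))
  (sparse2 : no_sparse_region (swp \o pos) s h D (8 * J0 + 8))
  (poor : no_poor_cluster pos s h J0).

Let T12 : T2 <= T1.
Proof.
apply: leq_trans T1_big; apply: leq_trans (leq_pmulr _ _); last by rewrite addnS.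
by move: (121 * T2); clear; lia.
Qed.

Let T1_pos : 0 < T1. Proof. by apply: leq_trans T12; apply: leq_trans T2_big. Qed.

Let Hsym : symmetric H.
Proof. by move=> u v; rewrite /adjacent eq_sym dsqC. Qed.

Section Fixed.
Variables (root : 'I_N * 'I_N) (cs : seq ('I_N * 'I_N)) (par : 'I_N * 'I_N -> 'I_N * 'I_N).
Hypotheses (act : activation H cell root T1 T2 cs par)
  (maxi : forall c c', c \notin cs -> c' \in cs -> #|attaching H cell T1 c' c| < T2)
  (root0 : exists2 y : 'I_N, good_row T1 w0 posN 0 y /\ (B * 0 <= y) && (y < B * 0 + B) & root = (Ordinal (leq_ltn_trans (leq0n _) (ltn_ord y)), y)).

Local Notation U := (unattached H cell T1 cs).

Let root_active : exists2 y : 'I_N, good_row T1 w0 posN 0 y /\ (B * 0 <= y) && (y < B * 0 + B) &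
  forall x : 'I_N, x < 3 * B -> (x, y) \in cs.
Proof.
have [y [gy yb] re] := root0; exists y => // x xB; have [_ rcs _] := act.
have b3 : 0 + 3 <= beta by [].
apply: (row_active T12 beta3 B13 maxi b3 gy _ (x0 := (Ordinal (leq_ltn_trans (leq0n _) (ltn_ord y))))).
- by rewrite /= muln0; move: B13; clear; lia.
- by rewrite -re.
- by rewrite muln0 xB.
Qed.

Let far c z : c \in cs -> good T1 w0 posN c -> z \in U ->
  [|| c.1 + 2 < (cell z).1, (cell z).1 + 2 < c.1, c.2 + 2 < (cell z).2 | (cell z).2 + 2 < c.2].
Proof.
move=> ccs g zU; apply: contraT; rewrite !negb_or -!leqNgt => /and4P[h1 h2 h3 h4].
move: zU; rewrite inE => /andP[zc /existsPn/(_ c)]; rewrite ccs /= => /negP[].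
by apply: good_near_attached => //; apply: contraNneq zc => ->.
Qed.

Let linesx i c : i + 3 <= beta -> c < beta -> exists x, [/\ B * c + 6 <= x, x + 6 < B * c + B &
  forall z, z \in U -> B * i <= (cell z).2 < B * i + 3 * B -> 2 < adn (cell z).1 x].
Proof.
move=> ib cb; have [_ [x [x1 x2 g]]] := sk ib cb.
exists x; split=> // z zU zr.
have xb : (B * c <= x) && (x < B * c + B) by move: x1 x2; clear; lia.
have xcs := cols_active T12 sk beta3 B13 maxi root_active ib cb xb g zr.
have := far xcs (g _ _ _) zU; case/andP: zr => zr1 zr2 /(_ zr1 zr2).
rewrite /=; move: (cell z).1 (cell z).2 => a b; rewrite /adn; clear; lia.
Qed.

Let linesy i c : i + 3 <= beta -> c < beta -> exists x, [/\ B * c + 6 <= x, x + 6 < B * c + B &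
  forall z, z \in U -> B * i <= (cell z).1 < B * i + 3 * B -> 2 < adn (cell z).2 x].
Proof.
move=> ib cb; have [[y [x1 x2 g]] _] := sk ib cb.
exists y; split=> // z zU zr.
have xb : (B * c <= y) && (y < B * c + B) by move: x1 x2; clear; lia.
have xcs := rows_active T12 sk beta3 B13 maxi root_active cb ib xb g zr.
have := far xcs (g _ _ _) zU; case/andP: zr => zr1 zr2 /(_ zr1 zr2).
rewrite /=; move: (cell z).1 (cell z).2 => a b; rewrite /adn; clear; lia.
Qed.

Definition linked := [rel u v | [&& u \in U, v \in U & H u v]].

Lemma linked_sym : connect_sym linked.
Proof. by apply: sym_connect_sym => u v /=; rewrite Hsym andbCA. Qed.

Lemma linked_unattached u v : connect linked u v -> u \in U -> v \in U.
Proof.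
move=> /connectP[p]; elim: p u v => [|x p IH] u v /=; first by move=> _ ->.
by move=> /andP[/and3P[_ xU _] xp] vE _; apply: IH xp vE xU.
Qed.

Lemma linked_invariant (I : V -> bool) u v : connect linked u v -> I u ->
  (forall a b, a \in U -> b \in U -> H a b -> I a -> I b) -> I v.
Proof.
move=> /connectP[p]; elim: p u v => [|x p IH] u v /=; first by move=> _ ->.
move=> /andP[/and3P[uU xU ux] xp] vE Iu hI.
by apply: (IH x) => //; apply: hI ux Iu.
Qed.

(** Vertical walls are effective only within a window of rows, horizontal ones only within a window
    of columns. The invariant bounds both coordinates at once, so each pair of walls keeps the
    component where the other pair works. *)
Lemma linked_box u v : u \in U -> connect linked u v ->
  adn (pos u).1 (pos v).1 <= D /\ adn (pos u).2 (pos v).2 <= D.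
Proof.
move=> uU uv.
pose ix := minn ((cell u).1 %/ B).-1 (beta - 3); pose iy := minn ((cell u).2 %/ B).-1 (beta - 3).
have ixb : ix + 3 <= beta by rewrite /ix; move: beta3; clear; lia.
have iyb : iy + 3 <= beta by rewrite /iy; move: beta3; clear; lia.
have [xl [xh [x1 [x2 x3] [x4 x5] x6]]] :=
  walls B13 (fun c cb => linesx iyb cb) (ltn_ord (cell u).1) beta3.
have [yl [yh [y1 [y2 y3] [y4 y5] y6]]] :=
  walls B13 (fun c cb => linesy ixb cb) (ltn_ord (cell u).2) beta3.
pose I z := [&& xl <= (cell z).1, (cell z).1 <= xh, yl <= (cell z).2 & (cell z).2 <= yh].
have : I v.
  apply: (linked_invariant (I := I) uv); first by rewrite /I; case/andP: x1 => -> ->.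
  move=> a b aU bU ab /and4P[a1 a2 a3 a4].
  have := adjacent_near w0 posN ab; rewrite inE => /and4P[n1 n2 n3 n4].
  have nx : adn (cell a).1 (cell b).1 <= 5 by move: n1 n2; rewrite /adn; clear; lia.
  have ny : adn (cell a).2 (cell b).2 <= 5 by move: n3 n4; rewrite /adn; clear; lia.
  (* The distance of at least 5 between walls and ends of the window keeps the next step inside the
     window; hence the margin of 6 in [skeleton]. *)
  have bx : B * ix <= (cell b).1 < B * ix + 3 * B.
    have := ltn_ord (cell b).1; rewrite -/ix in x4 x5; move: x4 x5 nx a1 a2.
    by rewrite /adn; clear; lia.
  have by_ : B * iy <= (cell b).2 < B * iy + 3 * B.
    have := ltn_ord (cell b).2; rewrite -/iy in y4 y5; move: y4 y5 ny a3 a4.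
    by rewrite /adn; clear; lia.
  have ha : xl <= (cell a).1 <= xh by rewrite a1.
  have hb : yl <= (cell a).2 <= yh by rewrite a3.
  rewrite /I; have /andP[-> ->] := x6 a b aU bU nx (ltn_ord _) by_ ha.
  by have /andP[-> ->] := y6 a b aU bU ny (ltn_ord _) bx hb.
move=> /and4P[v1 v2 v3 v4].
have e3 : (3 * B).-1.+1 = 3 * B by rewrite prednK //; move: B13; clear; lia.
suff [h1 h2] : adn (pos u).1 (pos v).1 <= (3 * B).-1.+1 * w /\ adn (pos u).2 (pos v).2 <= (3 * B).-1.+1 * w.
  by split; [apply: leq_trans h1 _|apply: leq_trans h2 _]; rewrite e3.
apply: (coarse_near (w0 := w0) (posN := posN)).
- by move: x1 x2 x3 v1 v2; clear; lia.
- by move: x1 x2 x3 v1 v2; clear; lia.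
- by move: y1 y2 y3 v3 v4; clear; lia.
- by move: y1 y2 y3 v3 v4; clear; lia.
Qed.

Let comp u := [set v | connect linked u v].

Let dsq_swp p q : dsq (swp p) (swp q) = dsq p q.
Proof. by rewrite /dsq addnC. Qed.

Let comp_unattached u v : u \in U -> v \in comp u -> v \in U.
Proof. by move=> uU; rewrite inE => /linked_unattached; apply. Qed.

Let comp_closed u z v : u \in U -> z \in comp u -> v \in U -> H z v -> v \in comp u.
Proof.
move=> uU zc vU zv; have zU := comp_unattached uU zc; move: zc; rewrite !inE => zc.
by apply: connect_trans zc (connect1 _); rewrite /= zU vU.
Qed.

Let outer_degree z : z \in U -> #|[set v | (v \notin U) && H z v]| <= J0.
Proof.
apply: (unattached_neighbours (near := @near B beta)) => //; first exact: card_near.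
- exact: adjacent_near.
Qed.

Let comp_degree u : u \in U ->
  {in comp u, forall z, #|[set v | v \notin comp u & dsq (pos z) (pos v) <= s * s]| <= J0}.
Proof.
move=> uU z zc; have zU := comp_unattached uU zc.
apply: leq_trans (outer_degree zU); apply: subset_leq_card; apply/subsetP => v.
rewrite in_set => /andP[vc zv]; have Hzv : H z v.
  by rewrite /adjacent zv andbT; apply: contraNneq vc => <-.
by rewrite in_set Hzv andbT; apply: contra vc => vU; apply: comp_closed zc vU Hzv.
Qed.

Let comp_box u : u \in U -> {in comp u &, forall a b,
  adn (pos a).1 (pos b).1 <= D /\ adn (pos a).2 (pos b).2 <= D}.
Proof.
move=> uU a b ac bc; have aU := comp_unattached uU ac; apply: linked_box => //.
by move: ac bc; rewrite !inE linked_sym => /connect_trans k /k.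
Qed.

Let J4 : 4 * J0 <= 8 * J0 + 8.
Proof. by move: J0; clear; lia. Qed.

Let comp_width u : u \in U -> {in comp u &, forall a b, in_box pos h a b}.
Proof.
move=> uU a b ac bc.
have x1 := cluster_width sparse1 (comp_box uU) (comp_degree uU) J4.
have y1 : {in comp u &, forall u v, (pos v).2 < (pos u).2 + h}.
  apply: (cluster_width sparse2 _ _ J4) => [c d cc dc|z zc] /=.
    by have [] := comp_box uU cc dc.
  apply: leq_trans (comp_degree uU zc); apply: subset_leq_card.
  by apply/subsetP => v; rewrite !in_set dsq_swp.
have := x1 a b ac bc; have := x1 b a bc ac; have := y1 a b ac bc; have := y1 b a bc ac.
by rewrite /in_box /adn; clear; lia.
Qed.

Let h2s : 2 * (h * h) <= s * s.
Proof.
have : (3 * h) * (3 * h) <= s * s by apply: leq_mul.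
by apply: leq_trans; clear; lia.
Qed.

Let box_adjacent a b : a != b -> in_box pos h a b -> H a b.
Proof.
by move=> ab /andP[h1 h2]; rewrite /adjacent ab /=; apply: (dsq_ge h1 h2 h2s).
Qed.

Let comp_clique u : u \in U -> {in comp u &, forall a b, a != b -> H a b}.
Proof. by move=> uU a b ac bc ab; apply: box_adjacent => //; apply: comp_width ac bc. Qed.

Let self_comp u : u \in comp u. Proof. by rewrite inE connect0. Qed.

(** The component lies in the [h]-box around [u], so all its vertices are adjacent to every point of
    the smaller disc outside it. An unattached such point would join the component and hence lie in
    the box. *)
Let inner_common u v : u \in U -> v \in inner_pts pos s h u ->
  v \notin U /\ {in comp u, forall z, H z v}.
Proof.
move=> uU; rewrite in_set => /andP[nb d].
have h2 : 2 * h <= s by apply: leq_trans hs; rewrite leq_mul2r orbT.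
have vc : v \notin comp u.
  by apply: contra nb => vc; apply: comp_width (self_comp u) vc.
have Hz : {in comp u, forall z, H z v}.
  move=> z zc; have /andP[b1 b2] := comp_width uU (self_comp u) zc.
  rewrite /adjacent (dsq_shift h2 b1 b2 d) andbT.
  by apply: contraNneq vc => <-.
split=> //; apply: contra vc => vU.
exact: comp_closed (self_comp u) vU (Hz u (self_comp u)).
Qed.

Let comp_close u : u \in U -> comp u :\ u \subset close_pts pos h u.
Proof.
move=> uU; apply/subsetP => v; rewrite in_setD1 => /andP[vu vc].
by rewrite in_set vu; apply: comp_width (self_comp u) vc.
Qed.

Let far_degree u : u \in U -> #|inner_pts pos s h u| + #|annulus_pts pos s h u| <= J0.
Proof.
move=> uU; apply: leq_trans (outer_degree uU).
have d : [disjoint inner_pts pos s h u & annulus_pts pos s h u].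
  apply: disjoint_intro => v; rewrite !in_set => /andP[_ h1] /and3P[_ h3 _].
  by move: h3; rewrite ltnNge h1.
have -> : #|inner_pts pos s h u| + #|annulus_pts pos s h u| = #|inner_pts pos s h u :|: annulus_pts pos s h u|.
  by rewrite cardsU (disjoint_setI0 d) cards0 subn0.
apply: subset_leq_card; rewrite subUset; apply/andP; split; apply/subsetP => v vI.
  by have [vU Hv] := inner_common uU vI; rewrite in_set vU; apply: Hv (self_comp u).
rewrite in_set in vI; have /and3P[nb _ d2] := vI.
have uv : u != v.
  by apply: contraNneq nb => ->; rewrite /in_box !adnn leq0n.
have Huv : H u v by rewrite /adjacent uv.
rewrite in_set Huv andbT; apply: contra nb => vU.
have vc := comp_closed uU (self_comp u) vU Huv.
exact: comp_width (self_comp u) vc.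
Qed.

Let close_le u : u \in U -> #|close_pts pos h u| <= 1 \/ #|close_pts pos h u| <= #|inner_pts pos s h u|.
Proof.
move=> uU; have [h1|h1] := leqP #|close_pts pos h u| 1; first by left.
by right; apply: poor h1 (far_degree uU).
Qed.

Let degree_bound u : u \in U -> #|[set v | H u v]| <= 2 * J0 + 1.
Proof.
move=> uU; have sub : [set v | H u v] \subset [set v | (v \notin U) && H u v] :|: (comp u :\ u).
  apply/subsetP => v; rewrite in_set => Huv; rewrite in_setU in_setD1 in_set Huv andbT.
  have [vU|//] := boolP (v \in U); rewrite (comp_closed uU (self_comp u) vU Huv) andbT /=.
  by move: Huv; rewrite eq_sym => /andP[].
apply: leq_trans (subset_leq_card sub) _; apply: leq_trans (leq_card_setU _ _) _.
have := outer_degree uU; have := subset_leq_card (comp_close uU); have := far_degree uU.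
by case: (close_le uU); clear; lia.
Qed.

(** The pair is treated as a cluster of its own, without knowing that its vertices are in one
    component. [degree_bound] allows [2 * J0 + 1] neighbours each, and
    [4 * (2 * J0 + 1) <= 8 * J0 + 8] is the reason for the constant in the sparsity conditions. *)
Let apart u v : u \in U -> v \in U -> adn (pos u).1 (pos v).1 <= D ->
  adn (pos u).2 (pos v).2 <= D -> connect linked u v.
Proof.
move=> uU vU d1 d2; have [<-|uv] := eqVneq u v; first exact: connect0.
have J8 : 4 * (2 * J0 + 1) <= 8 * J0 + 8 by move: J0; clear; lia.
pose Q := [set u; v].
have box : {in Q &, forall u v, adn (pos u).1 (pos v).1 <= D /\ adn (pos u).2 (pos v).2 <= D}.
  move=> a b; rewrite !in_set2 => /orP[]/eqP-> /orP[]/eqP->; rewrite ?adnn //.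
  by rewrite adnC [adn _.2 _]adnC.
have deg : {in Q, forall z, #|[set x | x \notin Q & dsq (pos z) (pos x) <= s * s]| <= 2 * J0 + 1}.
  move=> z zQ; have zU : z \in U by move: zQ; rewrite in_set2 => /orP[]/eqP->.
  apply: leq_trans (degree_bound zU); apply: subset_leq_card; apply/subsetP => x.
  rewrite in_set => /andP[xQ zx]; rewrite in_set /adjacent zx andbT.
  by apply: contraNneq xQ => <-.
have uQ : u \in Q by rewrite in_set2 eqxx.
have vQ : v \in Q by rewrite in_set2 eqxx orbT.
have x1 := cluster_width sparse1 box deg J8.
have y1 : {in Q &, forall u v, (pos v).2 < (pos u).2 + h}.
  apply: (cluster_width sparse2 _ _ J8) => [c d cc dc|z zc] /=.
    by have [] := box _ _ cc dc.
  apply: leq_trans (deg _ zc); apply: subset_leq_card.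
  by apply/subsetP => x; rewrite !in_set dsq_swp.
apply: connect1; rewrite /= uU vU; apply: box_adjacent => //.
have := x1 u v uQ vQ; have := x1 v u vQ uQ; have := y1 u v uQ vQ; have := y1 v u vQ uQ.
by rewrite /in_box /adn; clear; lia.
Qed.

Let cl := fingraph.root linked.
Let Pk k := [set u in U | cl u == k].
Let Y k := [set v | (v \notin U) && (if #|Pk k| <= 2 then [exists u in Pk k, e u v]
   else (Pk k != set0) && [forall u in Pk k, H u v])].

Let PkE k u : u \in Pk k -> u \in U /\ Pk k = comp u.
Proof.
rewrite in_set => /andP[uU /eqP uk]; split=> //; apply/setP => v; rewrite in_set [v \in comp u]in_set -uk eq_sym.
rewrite /cl (root_connect linked_sym); apply/andb_idl => uv.
exact: linked_unattached uv uU.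
Qed.

Let YP k v : v \in Y k -> v \notin U /\ exists2 u, u \in Pk k & e u v.
Proof.
rewrite in_set => /andP[vU]; case: ifP => _.
  by move/existsP => [u /andP[uP uv]]; split=> //; exists u.
move=> /andP[/set0Pn[u uP] /forallP/(_ u)]; rewrite uP => /He uv; split=> //.
by exists u.
Qed.

Let D'D : D' <= D.
Proof. by apply: leq_trans DD'; move: D' w; clear; lia. Qed.

(** Partners in one cell put the two clusters within [2 * D' + w] of each other, and [apart] then
    makes them one. *)
Let Ysep k k' v v' : v \in Y k -> v' \in Y k' -> cell v = cell v' -> k = k'.
Proof.
move=> /YP[_ [u uP uv]] /YP[_ [u' uP' uv']] cvv.
have [c1 c2] : adn (pos v).1 (pos v').1 <= 1 * w /\ adn (pos v).2 (pos v').2 <= 1 * w.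
  by apply: (coarse_near (w0 := w0) (posN := posN)); rewrite cvv addn0.
have [a1 a2] := eD uv; have [b1 b2] := eD uv'.
have uU : u \in U by move: uP; rewrite in_set => /andP[].
have uU' : u' \in U by move: uP'; rewrite in_set => /andP[].
have : connect linked u u'.
  apply: apart => //; apply: leq_trans DD'.
    by move: a1 b1 c1; rewrite /adn; clear; lia.
  by move: a2 b2 c2; rewrite /adn; clear; lia.
move: uP uP'; rewrite !in_set => /andP[_ /eqP <-] /andP[_ /eqP <-].
by rewrite -(root_connect linked_sym) => /eqP.
Qed.

Let nbr_out u v : u \in U -> e u v -> v \in U -> v \in comp u.
Proof.
move=> uU uv vU; rewrite in_set; have [a1 a2] := eD uv.
by apply: apart => //; apply: leq_trans D'D.
Qed.

Let Ysmall k u v : #|Pk k| <= 2 -> u \in Pk k -> v \notin U -> e u v -> v \in [set y in Y k | e u y].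
Proof.
move=> k2 uP vU uv; rewrite in_set; apply/andP; split=> //; rewrite in_set vU k2; apply/existsP; exists u.
by rewrite uP.
Qed.

Let YnU k u : u \in Pk k -> u \notin Y k.
Proof. by move=> uP; apply/negP => /YP[+ _]; move: uP; rewrite in_set => /andP[->]. Qed.

(** For three or more vertices [close_le] gives at least [#|Pk k| - 1] common neighbours, which
    suits both parities in [mwin_cluster]. For one or two vertices [nbr_out] shows that neighbours
    outside the cluster lie outside [U], so the degree and edge-degree conditions give the
    hypotheses of [mwin_one] and [mwin_pair]. *)
Let win k : mwin (saturated 2 (Pk k) (Y k)) (touching e (Pk k) (Y k)) set0.
Proof.
have dPY : [disjoint Pk k & Y k].
  by apply: disjoint_intro => v /YnU /negP.
have [k2|k3] := leqP #|Pk k| 2; last first.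
  have /card_gt0P[u uP] : 0 < #|Pk k| by apply: leq_trans k3.
  have [uU PE] := PkE uP.
  have inY : inner_pts pos s h u \subset Y k.
    apply/subsetP => v /(inner_common uU)[vU Hv]; rewrite in_set vU leqNgt k3 /=.
    apply/andP; split; first by apply/set0Pn; exists u.
    by apply/forallP => z; apply/implyP; rewrite PE; apply: Hv.
  have cle : #|Pk k| <= #|close_pts pos h u|.+1.
    rewrite PE (cardsD1 u) self_comp add1n ltnS; apply: subset_leq_card; exact: comp_close.
  have big : #|Pk k| <= #|Y k|.+1.
    apply: (leq_trans cle); rewrite ltnS; have := subset_leq_card inY.
    case: (close_le uU) => [c1|c2]; last by apply: leq_trans.
    by move: cle k3 c1; clear; lia.
  apply: mwin_cluster => //.
  - by move=> a b; rewrite PE => aP bP ab; apply/He/(comp_clique uU).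
  - move=> a y aP yY; apply: He; move: yY; rewrite in_set leqNgt k3 /= => /and3P[_ _ /forallP/(_ a)].
    by rewrite aP.
  - by move=> _; move: big k3; clear; lia.
  - by move=> _ o; move: big k3 o; clear; lia.
have [P0|/card_gt0P[u uP]] := posnP #|Pk k|.
  have {}P0 : Pk k = set0 by apply/eqP; rewrite -cards_eq0 P0.
  rewrite P0; apply: mwin_cluster => //; rewrite ?eqxx //.
  - by rewrite -P0.
  - by move=> a b; rewrite inE.
  - by move=> a b; rewrite inE.
have [uU PE] := PkE uP.
have [/eqP/cards1P[u' Pu']|k1] := eqVneq #|Pk k| 1.
  have Pu : Pk k = [set u] by move: uP; rewrite Pu' inE => /eqP ->.
  apply: (@mwin_impl _ (saturated 1 (Pk k) (Y k))); last first.
    by move=> M _ [Z [z1 z2 z3]]; exists Z; split=> //; apply: leq_trans z2 _.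
  rewrite Pu; apply: mwin_one; first exact: YnU.
  apply: leq_trans (deg2 u) _; apply: subset_leq_card; apply/subsetP => v.
  rewrite [v \in neighbours _ _]in_set => uv; apply: Ysmall => //; apply/negP => vU.
  have := nbr_out uU uv vU; rewrite -PE Pu inE => /eqP vu.
  by rewrite vu eirr in uv.
have /eqP/cards2P[a [b [ab Pab]]] : #|Pk k| = 2.
  have : 0 < #|Pk k| by apply/card_gt0P; exists u.
  by move: k1 k2; clear; lia.
have aP : a \in Pk k by rewrite Pab !inE eqxx.
have bP : b \in Pk k by rewrite Pab !inE eqxx orbT.
have Hab : H a b by apply: (comp_clique uU); rewrite -?PE.
have inP x y : x \in Pk k -> e x y -> y \in U -> y \in [set a; b].
  by move=> xP xy yU; have [xU xE] := PkE xP; rewrite -Pab xE; apply: nbr_out.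
have one x y : x \in Pk k -> (forall z, z \in Pk k -> z != x -> z = y) -> 0 < #|[set z in Y k | e x z]|.
  move=> xP xy; have : neighbours e x \subset y |: [set z in Y k | e x z].
    apply/subsetP => z; rewrite in_set => xz; rewrite in_setU1.
    have [zU|zU] := boolP (z \in U); last by rewrite (Ysmall k2 xP zU xz) orbT.
    have zP : z \in Pk k by rewrite Pab; apply: inP xP xz zU.
    rewrite (xy z zP) ?eqxx //; by apply: contraTneq xz => ->; rewrite eirr.
  move/subset_leq_card/(leq_trans (deg2 x)); rewrite cardsU1.
  by case: (y \notin _) => /=; clear; lia.
rewrite Pab; apply: mwin_pair; rewrite ?YnU //.
- exact: He.
- apply: (one a b aP) => z; rewrite Pab !inE => /orP[]/eqP-> //; by rewrite eqxx.
- apply: (one b a bP) => z; rewrite Pab !inE => /orP[]/eqP-> //; by rewrite eqxx.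
apply: leq_trans (edeg3 (He Hab)) _; apply: subset_leq_card; apply/subsetP => z.
rewrite in_setD => /andP[zab]; rewrite in_setU => /orP[]; rewrite in_set => xz; rewrite in_setU.
  by apply/orP; left; apply: Ysmall => //; apply: contra zab; apply: inP aP xz.
by apply/orP; right; apply: Ysmall => //; apply: contra zab; apply: inP bP xz.
Qed.

Lemma fixed_mwin :
  mwin (fun M => exists2 N : {set {set V}}, perfect_matching e N & N \subset M) (edges e) set0.
Proof.
have [y [gy yb] re] := root0; have b3 : 0 + 3 <= beta by [].
apply: (activation_mwin (near := @near B beta) (K := 121) eirr evV He _ _ _ _ T2_big T1_big act maxi _ _ Ysep win) => //.
- exact: near_sym.
- exact: card_near.
- exact: adjacent_near.
- by move=> a b; apply: coarse_eq_adjacent.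
- apply: leq_trans T12 _; rewrite re; apply: gy; first by rewrite muln0.
  by rewrite /= muln0; move: B13; clear; lia.
- by move=> k v /YP[].
Qed.

End Fixed.

Theorem lattice_mwin :
  mwin (fun M => exists2 N : {set {set V}}, perfect_matching e N & N \subset M) (edges e) set0.
Proof.
have [b3 b0] : 0 + 3 <= beta /\ 0 < beta by move: beta3; clear; lia.
have [[y [y1 y2 gy]] _] := sk b3 b0.
pose root := (Ordinal (leq_ltn_trans (leq0n _) (ltn_ord y)), y).
have [cs [par [act maxi]]] := maximal_activation H cell root T1 T2.
apply: (fixed_mwin act maxi); exists y => //; split=> //.
by move: y1 y2; move: (nat_of_ord y); clear; lia.
Qed.

End Lattice.

Lemma div_block a b : 0 < b -> b * (a %/ b) <= a /\ a < b * (a %/ b) + b.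
Proof. by move=> b0; rewrite mulnC leq_trunc_div addnC -mulSn ltn_ceil. Qed.

(* If e has an edge longer than 6Bw at u, the radius exceeds 6Bw and u is joined to
   all the skeleton around it, so discarding long edges preserves the degree
   conditions. *)
Section LongEdges.
Variables (V : finType) (pos : V -> nat * nat) (w B beta T1 T2 h D : nat) (e : rel V).
Local Notation N := (B * beta).
Local Notation s := (5 * w).
Local Notation J0 := (121 * (T1 + 121 * T2)).
Hypotheses (w0 : 0 < w) (posN : forall v, (pos v).1 < N * w /\ (pos v).2 < N * w).
Local Notation cell := (coarse w0 posN).
Hypotheses (esym : symmetric e) (eirr : irreflexive e) (evV : ~~ odd #|V|)
  (He : subrel (adjacent pos s) e)
  (deg2 : min_degree_ge e 2) (edeg3 : min_edge_degree_ge e 3)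
  (long : forall u v a b, e u v ->
     (6 * B * w < adn (pos u).1 (pos v).1) || (6 * B * w < adn (pos u).2 (pos v).2) ->
     a != b -> in_box pos (3 * B * w) a b -> e a b)
  (T2_big : 188 * 188 <= T2)
  (T1_big : 2 * (121 * T2 + 121 + T2 + 3) * (121 * T2 + 121 + T2 + 3) <= T1)
  (beta3 : 3 <= beta) (B13 : 13 < B) (sk : skeleton T1 w0 posN)
  (hs : 3 * h <= s) (DB : 13 * B * w <= D)
  (sparse1 : no_sparse_region pos s h D (8 * J0 + 8))
  (sparse2 : no_sparse_region (swp \o pos) s h D (8 * J0 + 8))
  (poor : no_poor_cluster pos s h J0).

Definition short : rel V := fun u v => e u v && in_box pos (6 * B * w) u v.

(** A good row in the block of [u], for a window containing [u], has a good cell in the coarse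
    column of [u], less than [B] cells away. *)
Lemma rich u : 6 <= #|[set v | in_box pos (3 * B * w) u v]|.
Proof.
have B0 : 0 < B by apply: leq_trans B13.
pose c := (cell u).1 %/ B; pose d := (cell u).2 %/ B.
have cb : c < beta by rewrite /c ltn_divLR // [X in _ < X]mulnC; apply: ltn_ord.
have db : d < beta by rewrite /d ltn_divLR // [X in _ < X]mulnC; apply: ltn_ord.
have [c1 c2] := div_block (cell u).1 B0; have [d1 d2] := div_block (cell u).2 B0.
rewrite -/c in c1 c2; rewrite -/d in d1 d2.
pose i := minn c (beta - 3).
have [ib ic ci] : [/\ i + 3 <= beta, i <= c & c < i + 3].
  by rewrite /i; move: cb beta3; clear; split; lia.
have [[y [y1 y2 g]] _] := sk ib db.
have k1 : B * i <= B * c by rewrite leq_mul2l ic orbT.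
have k2 : B * c + B <= B * i + 3 * B by rewrite (mulnC 3) -mulnDr -mulnSr leq_mul2l ci orbT.
have good_ : good T1 w0 posN ((cell u).1, y).
  by apply: g; move: c1 c2 k1 k2; clear; lia.
have T6 : 6 <= T1.
  by apply: leq_trans T1_big; move: (121 * T2); clear; nia.
apply: leq_trans T6 _; apply: leq_trans good_ _; apply: subset_leq_card.
apply/subsetP => v; rewrite in_set => /eqP cv; rewrite in_set.
have e3 : (3 * B).-1.+1 = 3 * B by rewrite prednK //; move: B13; clear; lia.
have [] := @coarse_near _ _ _ _ _ w0 posN u v (3 * B).-1; rewrite ?cv /= ?leq_addr //.
- by move: d1 d2 y1 y2 => /=; clear; lia.
- by move: d1 d2 y1 y2 => /=; clear; lia.
by rewrite e3 /in_box => -> ->.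
Qed.

Let long_rich u v x : e u v -> ~~ in_box pos (6 * B * w) u v ->
  5 <= #|neighbours short x|.
Proof.
move=> uv nb; have := rich x; rewrite (cardsD1 x).
have : #|[set v0 | in_box pos (3 * B * w) x v0] :\ x| <= #|neighbours short x|.
  apply: subset_leq_card; apply/subsetP => y; rewrite !inE => /andP[yx xy].
  rewrite /short (long uv) ?(eq_sym x) // ?xy /=.
    by move: xy => /andP[h1 h2]; apply/andP; split; [apply: leq_trans h1 _|apply: leq_trans h2 _];
      rewrite -!mulnA leq_mul2r orbT.
  by move: nb; rewrite /in_box negb_and -!ltnNge.
by case: (x \in _) => /=; clear; lia.
Qed.

Let short_nbr u : (exists v, e u v /\ ~~ in_box pos (6 * B * w) u v) \/ neighbours short u = neighbours e u.
Proof.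
case: (pickP (fun v => e u v && ~~ in_box pos (6 * B * w) u v)) => [v /andP[h1 h2]|no].
  by left; exists v.
right; apply/setP => v; rewrite !inE /short; apply/andb_idr => uv.
by have := no v; rewrite uv /= => /negbFE.
Qed.

Theorem lattice_maker_wins : maker_wins_pm e.
Proof.
apply: (@maker_wins_pm_mono _ e short); first by move=> u v /andP[].
have ssym : symmetric short.
  by move=> u v; rewrite /short esym /in_box adnC [X in _ && (_ && (X <= _))]adnC.
apply: (lattice_mwin (h := h) (D := D) (D' := 6 * B * w) (T1 := T1) (T2 := T2) (posN := posN)) => //.
- by move=> u; rewrite /short eirr.
- move=> u v uv; rewrite /short (He uv) /=; case/andP: uv => _ /dsq_le[h1 h2].
  by apply/andP; split; [apply: leq_trans h1 _|apply: leq_trans h2 _]; rewrite leq_mul2r; apply/orP; right;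
    move: B13; clear; lia.
- by move=> u v /andP[_ /andP[]].
- move=> u; case: (short_nbr u) => [[v [uv nb]]|->]; last exact: deg2.
  by apply: leq_trans (long_rich u uv nb).
- move=> u v uv; rewrite /edge_degree.
  have big x : x = u \/ x = v -> 5 <= #|neighbours short x| -> 3 <= #|(neighbours short u :|: neighbours short v) :\: [set u; v]|.
    move=> xuv x5; have := cardsID [set u; v] (neighbours short u :|: neighbours short v).
    have : #|(neighbours short u :|: neighbours short v) :&: [set u; v]| <= 2.
      by apply: leq_trans (subset_leq_card (subsetIr _ _)) _; rewrite cards2; case: eqP.
    have : #|neighbours short x| <= #|neighbours short u :|: neighbours short v|.
      by apply: subset_leq_card; case: xuv => ->; rewrite ?subsetUl ?subsetUr.
    by move: x5; clear; lia.
  case: (short_nbr u) => [[x [ux nb]]|eu]; first by apply: (big u); [left|apply: long_rich ux nb].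
  case: (short_nbr v) => [[x [ux nb]]|ev]; first by apply: (big v); [right|apply: long_rich ux nb].
  by rewrite eu ev; apply: edeg3; case/andP: uv.
- by apply: leq_trans DB; rewrite leq_mul2r; apply/orP; right; clear; lia.
- apply: leq_trans DB; have : w <= B * w by rewrite leq_pmull // (leq_trans _ B13).
  by rewrite -!mulnA; clear; lia.
Qed.

End LongEdges.

(** * Counting grid points in discs, annuli and regions *)

Definition gpos M (p : 'I_M * 'I_M) : nat * nat := (val p.1, val p.2).

(* At x, this counts the directions along an axis in which there is room for a
   segment of length E, so that [side E M x * side E M y] quarter discs of radius E
   around (x, y) lie in the grid. *)
Definition side (E M x : nat) : nat := (E <= x) + (x + E < M).

(** The coordinates [p.1.+1] and [p.2.+1] leave out the axes, so the four reflected quadrants around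
    a point are disjoint and give lower bounds for discs; [closed_quadrant] keeps the axes and
    serves for upper bounds. *)
Definition quadrant (s : nat) : {set 'I_s * 'I_s} :=
  [set p : 'I_s * 'I_s | p.1.+1 * p.1.+1 + p.2.+1 * p.2.+1 <= s * s].

Definition quarter s := #|quadrant s|.

Definition closed_quadrant K (R : nat) : {set 'I_K * 'I_K} :=
  [set p : 'I_K * 'I_K | p.1 * p.1 + p.2 * p.2 <= R * R].

Lemma quarter_le s : quarter s <= s * s.
Proof. by apply: leq_trans (max_card _) _; rewrite card_prod !card_ord. Qed.

Lemma quarter_ge m : m * m <= quarter (2 * m).
Proof.
have mm : m <= 2 * m by rewrite leq_pmull.
rewrite -[X in X * X](card_ord m) -card_prod -cardsT.
rewrite -(card_imset _ (_ : injective (fun p : 'I_m * 'I_m => (widen_ord mm p.1, widen_ord mm p.2)))); last first.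
  by move=> [a b] [c d] /= [] /val_inj-> /val_inj->.
apply: subset_leq_card; apply/subsetP => _ /imsetP[[a b] _ ->]; rewrite inE /=.
have am := ltn_ord a; have bm := ltn_ord b.
have : a.+1 * a.+1 <= m * m by apply: leq_mul.
have : b.+1 * b.+1 <= m * m by apply: leq_mul.
clear; move: (m * m) (mulnACA 2 m 2 m) => mm ->; lia.
Qed.

Section Grid.
Variable M : nat.
Local Notation G := ('I_M * 'I_M)%type.

Lemma card_ge_inj (I : finType) (phi : I -> nat * nat) (D : {set I}) (A : {set G}) :
  {in D &, injective phi} -> (forall i, i \in D -> (phi i).1 < M /\ (phi i).2 < M) ->
  (forall y i, i \in D -> gpos y = phi i -> y \in A) -> #|D| <= #|A|.
Proof.
move=> inj rg im; have [->|[d0 d0D]] := set_0Vmem D; first by rewrite cards0.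
have M0 : 0 < M by have [h _] := rg _ d0D; case: (M) h.
pose o x : 'I_M := insubd (Ordinal M0) x.
have oE x : x < M -> val (o x) = x by move=> xM; rewrite val_insubd xM.
pose g i := (o (phi i).1, o (phi i).2).
have gE i : i \in D -> gpos (g i) = phi i.
  by move=> /rg[h1 h2]; rewrite /gpos !oE //; case: (phi i).
rewrite -(card_in_imset (f := g)); last by move=> i j iD jD /(congr1 (@gpos M)); rewrite !gE //; apply: inj.
by apply: subset_leq_card; apply/subsetP => _ /imsetP[i iD ->]; apply: (im _ i) => //; apply: gE.
Qed.

Definition beyond (sg : bool) (p y : nat) := if sg then p < y else y < p.
Definition room (sg : bool) (s p : nat) := if sg then p + s < M else s <= p.
Definition step (sg : bool) (p a : nat) := if sg then p + a.+1 else p - a.+1.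

Lemma step_lt sg s p a : p < M -> room sg s p -> a < s -> step sg p a < M.
Proof. by case: sg; rewrite /room /step; lia. Qed.
Lemma step_beyond sg s p a : room sg s p -> a < s -> beyond sg p (step sg p a).
Proof. by case: sg; rewrite /beyond /room /step; lia. Qed.
Lemma step_adn sg s p a : room sg s p -> a < s -> adn p (step sg p a) = a.+1.
Proof. by case: sg; rewrite /adn /room /step; lia. Qed.
Lemma step_inj sg s p a b : room sg s p -> a < s -> b < s -> step sg p a = step sg p b -> a = b.
Proof. by case: sg; rewrite /room /step; lia. Qed.

Lemma quarter_card s sx sy (p : nat * nat) : p.1 < M -> p.2 < M -> room sx s p.1 -> room sy s p.2 ->
  quarter s <= #|[set y : G | [&& beyond sx p.1 y.1, beyond sy p.2 y.2 & dsq p (gpos y) <= s * s]]|.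
Proof.
move=> p1 p2 rx ry; apply: (card_ge_inj (phi := fun i => (step sx p.1 (val i.1), step sy p.2 (val i.2)))).
- move=> [a b] [c d] _ _ /= [h1 h2]; congr (_, _); apply: val_inj.
    by apply: (step_inj rx _ _ h1).
  by apply: (step_inj ry _ _ h2).
- by move=> [a b] _ /=; split; [apply: (step_lt _ rx)|apply: (step_lt _ ry)].
- move=> y [a b]; rewrite !in_set /= => h [h1 h2]; rewrite h1 h2.
  rewrite (step_beyond rx) // (step_beyond ry) //= /dsq /gpos /= h1 h2.
  by rewrite (step_adn rx) // (step_adn ry).
Qed.

Lemma half_card s sx (p : nat * nat) : p.1 < M -> p.2 < M -> room sx s p.1 ->
  side s M p.2 * quarter s <= #|[set y : G | beyond sx p.1 y.1 && (dsq p (gpos y) <= s * s)]|.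
Proof.
move=> p1 p2 rx; set S := [set y : G | _].
have Q sy : room sy s p.2 * quarter s <= #|S :&: [set y : G | beyond sy p.2 y.2]|.
  have [ry|] := boolP (room sy s p.2); last by rewrite mul0n.
  rewrite mul1n; apply: leq_trans (quarter_card p1 p2 rx ry) _; apply: subset_leq_card.
  by apply/subsetP => y; rewrite !in_set => /and3P[-> -> ->].
have -> : side s M p.2 = room true s p.2 + room false s p.2 by rewrite /side addnC.
rewrite mulnDl; apply: leq_trans (leq_add (Q true) (Q false)) _.
rewrite -cardsUI [X in _ + X](_ : _ = 0) ?addn0; last first.
  apply/eqP; rewrite cards_eq0; apply/eqP/setP => y; rewrite !in_set /beyond.
  by apply/negP => /andP[/andP[_ h1] /andP[_ h2]]; move: h1 h2; clear; lia.
by rewrite subset_leq_card //; apply/subsetP => y; rewrite !in_set => /orP[] /andP[].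
Qed.

Lemma ball_card_ge s (p : nat * nat) : p.1 < M -> p.2 < M ->
  side s M p.1 * side s M p.2 * quarter s <= #|[set y : G | dsq p (gpos y) <= s * s]|.
Proof.
move=> p1 p2; set S := [set y : G | _].
have Q sx : room sx s p.1 * (side s M p.2 * quarter s) <= #|S :&: [set y : G | beyond sx p.1 y.1]|.
  have [rx|] := boolP (room sx s p.1); last by rewrite mul0n.
  rewrite mul1n; apply: leq_trans (half_card p1 p2 rx) _; apply: subset_leq_card.
  by apply/subsetP => y; rewrite !in_set => /andP[-> ->].
have -> : side s M p.1 = room true s p.1 + room false s p.1 by rewrite /side addnC.
rewrite -mulnA mulnDl; apply: leq_trans (leq_add (Q true) (Q false)) _.
rewrite -cardsUI [X in _ + X](_ : _ = 0) ?addn0; last first.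
  apply/eqP; rewrite cards_eq0; apply/eqP/setP => y; rewrite !in_set /beyond.
  by apply/negP => /andP[/andP[_ h1] /andP[_ h2]]; move: h1 h2; clear; lia.
by rewrite subset_leq_card //; apply/subsetP => y; rewrite !in_set => /orP[] /andP[].
Qed.

(** A rectangle of width [h] and height [s %/ 2] beyond [t]. It lies in the disc since [h] is at
    most [s %/ 2], and it starts at most [h] to the left of [t] so as to stay between [l] and
    [r]. *)
Lemma strip_card s h sy (l r : nat) (t : nat * nat) : r < M -> t.2 < M -> l <= t.1 <= r -> l + h <= r ->
  2 * h <= s -> room sy s t.2 ->
  h * (s %/ 2) <= #|[set y : G | [&& l <= y.1, y.1 <= r, beyond sy t.2 y.2 & dsq t (gpos y) <= s * s]]|.
Proof.
move=> rM t2 /andP[lt tr] lh hs ry.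
rewrite -[X in X * _](card_ord h) -[X in _ * X](card_ord (s %/ 2)) -card_prod -cardsT.
have s2 : s %/ 2 * 2 <= s by apply: leq_trunc_div.
have x0 : forall a, a < h -> l <= maxn l (t.1 - h) + a <= r /\ adn t.1 (maxn l (t.1 - h) + a) <= h.
  by move=> a ah; rewrite /adn; move: lt tr lh ah; clear; lia.
apply: (card_ge_inj (phi := fun i => (maxn l (t.1 - h) + val i.1, step sy t.2 (val i.2)))).
- move=> [a b] [c d] _ _ /= [/addnI h1 h2]; congr (_, _); apply: val_inj => //.
  apply: (step_inj ry _ _ h2); apply: leq_trans (ltn_ord _) _; move: s2; clear; lia.
- move=> [a b] _ /=; have [/andP[_ h1] _] := x0 _ (ltn_ord a); split; first exact: leq_ltn_trans h1 rM.
  by apply: (step_lt _ ry) => //; apply: leq_trans (ltn_ord _) _; move: s2; clear; lia.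
- move=> y [a b]; rewrite !in_set /= => _ [h1 h2]; rewrite h1 h2.
  have [/andP[-> ->] h3] := x0 _ (ltn_ord a).
  have bs : b < s by apply: leq_trans (ltn_ord _) _; move: s2; clear; lia.
  rewrite (step_beyond ry) //=; apply: (@dsq_ge _ _ (s %/ 2)); rewrite /gpos /= ?h1 ?h2.
  + by apply: leq_trans h3 _; rewrite leq_divRL // mulnC.
  + by rewrite (step_adn ry).
  + have := leq_mul s2 s2; clear; move: (s %/ 2) => m; lia.
Qed.

Lemma card_le_quadrants K (Phi : nat -> nat -> bool) (p : nat * nat) :
  (forall a b, Phi a b -> a < K /\ b < K) ->
  #|[set y : G | Phi (adn p.1 y.1) (adn p.2 y.2)]| <= 4 * #|[set q : 'I_K * 'I_K | Phi q.1 q.2]|.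
Proof.
move=> PK; case: (posnP K) => [K0|K0].
  rewrite (_ : [set y : G | _] = set0) ?cards0 //; apply/setP => y; rewrite !in_set.
  by apply/negP => /PK; rewrite K0 => -[].
pose o x : 'I_K := insubd (Ordinal K0) x.
have oE x : x < K -> val (o x) = x by move=> xK; rewrite val_insubd xK.
pose g (y : G) := ((y.1 < p.1, y.2 < p.2), (o (adn p.1 y.1), o (adn p.2 y.2))).
have -> : 4 * #|[set q : 'I_K * 'I_K | Phi q.1 q.2]| = #|setX [set: bool * bool] [set q : 'I_K * 'I_K | Phi q.1 q.2]|.
  by rewrite cardsX cardsT card_prod card_bool.
rewrite -(card_in_imset (f := g)); last first.
  move=> [a b] [c d]; rewrite !in_set => /= /PK[h1 h2] /PK[h3 h4] /= [e1 e2 /(congr1 val) e3 /(congr1 val) e4].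
  rewrite !oE // in e3 e4; congr (_, _); apply: ord_inj.
    by move: e1 e3; rewrite /adn; clear; lia.
  by move: e2 e4; rewrite /adn; clear; lia.
apply: subset_leq_card; apply/subsetP => _ /imsetP[y yS ->]; rewrite in_set in yS.
by have [h1 h2] := PK _ _ yS; rewrite !inE !oE.
Qed.

Lemma box_card_le a (p : nat * nat) :
  #|[set y : G | (adn p.1 y.1 <= a) && (adn p.2 y.2 <= a)]| <= 4 * (a.+1 * a.+1).
Proof.
apply: leq_trans (@card_le_quadrants a.+1 (fun x y => (x <= a) && (y <= a)) p _) _.
  by move=> x y /andP[].
by rewrite leq_mul2l /=; apply: leq_trans (max_card _) _; rewrite card_prod !card_ord.
Qed.

End Grid.

(* A translate by (2d, 2d) of most of the quarter disc of radius R + d lies in the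
   quarter disc of radius R, so that thin annuli have few points. *)
Lemma shift_quadrant R d a b : 9 * d <= 2 * R -> 2 * d <= a -> 2 * d <= b ->
  a * a + b * b <= (R + d) * (R + d) -> (a - 2 * d) * (a - 2 * d) + (b - 2 * d) * (b - 2 * d) <= R * R.
Proof.
move=> dR da db; set x := a - 2 * d; set y := b - 2 * d.
have -> : a = x + 2 * d by rewrite subnK.
have -> : b = y + 2 * d by rewrite subnK.
have [//|h] := leqP (x * x + y * y) (R * R).
have Rxy : R <= x + y.
  apply: sqr_le_inv; apply: leq_trans (ltnW h) _; clear; nia.
move: dR Rxy h; clear => h1 h2 h3; nia.
Qed.

Lemma card_ord_lt K m : #|[set x : 'I_K | x < m]| <= m.
Proof.
rewrite cardE -(size_map val) -[X in _ <= X](size_iota 0); apply: uniq_leq_size.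
  by rewrite map_inj_uniq ?enum_uniq //; apply: val_inj.
by move=> x /mapP[y]; rewrite mem_enum in_set => ym ->; rewrite mem_iota.
Qed.

(** Points with a coordinate below [2 * d] cannot be translated; the error term counts them. *)
Lemma closed_quadrant_shift K R d : R + d < K -> 9 * d <= 2 * R ->
  #|closed_quadrant K (R + d)| <= #|closed_quadrant K R| + 4 * d * (R + d).+1.
Proof.
move=> RK dR.
set A := closed_quadrant K (R + d).
pose A1 := [set p in A | p.1 < 2 * d]; pose A2 := [set p in A | p.2 < 2 * d].
pose A3 := [set p in A | (2 * d <= p.1) && (2 * d <= p.2)].
have sub : A \subset A3 :|: (A1 :|: A2).
  apply/subsetP => p pA; rewrite in_setU [p \in A3]in_set in_setU [p \in A1]in_set [p \in A2]in_set pA /=.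
  by case: (ltnP p.1) => //= _; case: ltnP.
have lt p : p \in A -> p.1 < (R + d).+1 /\ p.2 < (R + d).+1.
  rewrite in_set => h; split; rewrite ltnS; apply: sqr_le_inv; apply: leq_trans h;
  [exact: leq_addr|exact: leq_addl].
have K0 : 0 < K by exact: leq_ltn_trans RK.
have c3 : #|A3| <= #|closed_quadrant K R|.
  pose g (p : 'I_K * 'I_K) : 'I_K * 'I_K := (insubd (Ordinal K0) (p.1 - 2 * d), insubd (Ordinal K0) (p.2 - 2 * d)).
  have gE (a : 'I_K) : val (insubd (Ordinal K0) (a - 2 * d)) = a - 2 * d.
    by rewrite val_insubd (leq_ltn_trans (leq_subr _ _) (ltn_ord a)).
  rewrite -(card_in_imset (f := g)); last first.
    move=> [a b] [c e]; rewrite !in_set /= => /and3P[_ h1 h2] /and3P[_ h3 h4] [/(congr1 val) e1 /(congr1 val) e2].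
    rewrite !gE in e1 e2; congr (_, _); apply: ord_inj; [move: e1 h1 h3|move: e2 h2 h4]; clear; lia.
  apply: subset_leq_card; apply/subsetP => _ /imsetP[p pA ->]; rewrite in_set !gE.
  move: pA; rewrite !in_set => /and3P[h1 h2 h3]; exact: shift_quadrant.
have box m1 m2 (S : {set 'I_K * 'I_K}) : (forall p, p \in S -> p.1 < m1 /\ p.2 < m2) -> #|S| <= m1 * m2.
  move=> h; apply: leq_trans (leq_mul (card_ord_lt K m1) (card_ord_lt K m2)).
  rewrite -cardsX; apply: subset_leq_card; apply/subsetP => p /h[h1 h2].
  by case: p h1 h2 => a b h1 h2; rewrite in_setX !in_set h1 h2.
have c1 : #|A1| <= 2 * d * (R + d).+1.
  by apply: box => p; rewrite in_set => /andP[/lt[_ h1] h2].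
have c2 : #|A2| <= 2 * d * (R + d).+1.
  by rewrite mulnC; apply: box => p; rewrite in_set => /andP[/lt[h1 _] h2].
apply: leq_trans (subset_leq_card sub) _; apply: leq_trans (leq_card_setU _ _) _.
apply: leq_add => //; apply: leq_trans (leq_card_setU _ _) _.
by apply: leq_trans (leq_add c1 c2) _; rewrite -mulnDl -mulnDl.
Qed.

Lemma card_ord_pair_lt K m1 m2 (S : {set 'I_K * 'I_K}) :
  (forall p, p \in S -> p.1 < m1 /\ p.2 < m2) -> #|S| <= m1 * m2.
Proof.
move=> h; apply: leq_trans (leq_mul (card_ord_lt K m1) (card_ord_lt K m2)).
rewrite -cardsX; apply: subset_leq_card; apply/subsetP => p /h[h1 h2].
by case: p h1 h2 => a b h1 h2; rewrite in_setX !in_set h1 h2.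
Qed.

Lemma closed_quadrant_le K s : #|closed_quadrant K s| <= quarter s + 2 * s.+1.
Proof.
set A := closed_quadrant K s.
pose A1 := [set p in A | p.1 < 1]; pose A2 := [set p in A | p.2 < 1].
pose A3 := [set p in A | (0 < p.1) && (0 < p.2)].
have sub : A \subset A3 :|: (A1 :|: A2).
  apply/subsetP => p pA; rewrite in_setU [p \in A3]in_set in_setU [p \in A1]in_set [p \in A2]in_set pA /=.
  by case: (posnP p.1) => [->|_] //=; case: (posnP p.2) => [->|_]; rewrite ?orbT.
have lt p : p \in A -> p.1 < s.+1 /\ p.2 < s.+1.
  rewrite in_set => h; split; rewrite ltnS; apply: sqr_le_inv; apply: leq_trans h;
  [exact: leq_addr|exact: leq_addl].
have c1 : #|A1| <= 1 * s.+1.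
  by apply: card_ord_pair_lt => p; rewrite in_set => /andP[/lt[_ h1] h2].
have c2 : #|A2| <= s.+1 * 1.
  by apply: card_ord_pair_lt => p; rewrite in_set => /andP[/lt[h1 _] h2].
have c3 : #|A3| <= quarter s.
  have [s0|s0] := posnP s.
    rewrite (_ : A3 = set0) ?cards0 //; apply/setP => p; rewrite in_set in_set0.
    by apply/negP => /and3P[/lt[h _] h1 _]; move: h h1; rewrite s0; clear; lia.
  pose g (p : 'I_K * 'I_K) : 'I_s * 'I_s := (insubd (Ordinal s0) p.1.-1, insubd (Ordinal s0) p.2.-1).
  have gE a : 0 < a < s.+1 -> (val (insubd (Ordinal s0) a.-1)).+1 = a.
    by case: a => //= a; rewrite ltnS => h; rewrite val_insubd h.
  have gp p : p \in A3 -> 0 < p.1 < s.+1 /\ 0 < p.2 < s.+1.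
    by rewrite in_set => /and3P[/lt[h1 h2] -> ->]; rewrite h1 h2.
  rewrite -(card_in_imset (f := g)); last first.
    move=> [a b] [c e] /gp[h1 h2] /gp[h3 h4] [/(congr1 val) e1 /(congr1 val) e2].
    congr (_, _); apply: ord_inj.
      by rewrite -(gE _ h1) -(gE _ h3) /= e1.
    by rewrite -(gE _ h2) -(gE _ h4) /= e2.
  apply: subset_leq_card; apply/subsetP => _ /imsetP[p pA ->].
  have [h1 h2] := gp _ pA; rewrite in_set !gE //.
  by move: pA; rewrite in_set => /andP[]; rewrite in_set.
apply: leq_trans (subset_leq_card sub) _; apply: leq_trans (leq_card_setU _ _) _.
apply: leq_add => //; apply: leq_trans (leq_card_setU _ _) _.
by apply: leq_trans (leq_add c1 c2) _; rewrite mul1n muln1 mul2n addnn.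
Qed.

Section GridUpper.
Variable M : nat.
Local Notation G := ('I_M * 'I_M)%type.

Lemma annulus_card_le s h (p : nat * nat) : 11 * h <= s ->
  #|[set y : G | ((s - 2 * h) * (s - 2 * h) < dsq p (gpos y)) && (dsq p (gpos y) <= s * s)]|
  <= 32 * h * s.+1.
Proof.
move=> hs; pose Phi a b := ((s - 2 * h) * (s - 2 * h) < a * a + b * b) && (a * a + b * b <= s * s).
apply: leq_trans (@card_le_quadrants M s.+1 Phi p _) _.
  move=> a b /andP[_ h1]; split; rewrite ltnS; apply: sqr_le_inv; apply: leq_trans h1;
  [exact: leq_addr|exact: leq_addl].
have sE : (s - 2 * h) + 2 * h = s by rewrite subnK //; move: hs; clear; lia.
have := @closed_quadrant_shift s.+1 (s - 2 * h) (2 * h).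
rewrite sE => /(_ (ltnSn _)) H.
have {}H : #|closed_quadrant s.+1 s| <= #|closed_quadrant s.+1 (s - 2 * h)| + 4 * (2 * h) * s.+1.
  by apply: H; move: hs; clear; lia.
have -> : [set q : 'I_s.+1 * 'I_s.+1 | Phi q.1 q.2] = closed_quadrant s.+1 s :\: closed_quadrant s.+1 (s - 2 * h).
  by apply/setP => q; rewrite in_setD !in_set /Phi -ltnNge.
rewrite cardsD (setIidPr _).
  rewrite (_ : 32 * h * s.+1 = 4 * (4 * (2 * h) * s.+1)); last by clear; lia.
  by rewrite leq_mul2l /= leq_subLR.
apply/subsetP => q; rewrite !in_set => h1; apply: leq_trans h1 _.
by apply: leq_mul; apply: leq_subr.
Qed.

Lemma ball_card_le s d (p : nat * nat) : 9 * d <= 2 * s ->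
  #|[set y : G | dsq p (gpos y) <= (s + d) * (s + d)]| <= 4 * quarter s + (16 * d + 8) * (s + d).+1.
Proof.
move=> ds; apply: leq_trans (@card_le_quadrants M (s + d).+1 (fun a b => a * a + b * b <= (s + d) * (s + d)) p _) _.
  move=> a b h1; split; rewrite ltnS; apply: sqr_le_inv; apply: leq_trans h1;
  [exact: leq_addr|exact: leq_addl].
have h1 := @closed_quadrant_shift (s + d).+1 s d (ltnSn _) ds.
have h2 := closed_quadrant_le (s + d).+1 s.
have h3 : 2 * s.+1 <= 2 * (s + d).+1 by rewrite leq_mul2l /= ltnS leq_addr.
have h4 : #|closed_quadrant (s + d).+1 (s + d)| <= quarter s + (4 * d + 2) * (s + d).+1.
  by apply: leq_trans h1 _; rewrite mulnDl [X in _ <= _ + X]addnC addnA leq_add2r (leq_trans h2) // leq_add2l.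
apply: leq_trans (leq_mul (leqnn 4) h4) _; rewrite [leqLHS]mulnDr leq_add2l mulnA leq_mul2r; apply/orP; right.
by clear; lia.
Qed.

End GridUpper.

Section Region.
Variable M : nat.
Local Notation G := ('I_M * 'I_M)%type.

Lemma room_le sg E F x y D : adn x y <= D -> D + E <= F -> room M sg F x <= room M sg E y.
Proof.
rewrite /room /adn => h1 h2.
have : room M sg F x -> room M sg E y by case: sg; rewrite /room; move: h1 h2; clear; lia.
by rewrite /room; case: sg; case: (_ <= _) => // /(_ isT) ->.
Qed.

Lemma side_room E x : side E M x = room M true E x + room M false E x.
Proof. by rewrite /side addnC. Qed.

Lemma side_le E F x y D : adn x y <= D -> D + E <= F -> side F M x <= side E M y.
Proof. by move=> h1 h2; rewrite !side_room leq_add ?(room_le _ h1). Qed.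

(** The half-discs left of [l] and right of [r] make up one disc, cut off by the boundary at most as
    for [l]: room [D + s] at [l] implies room [s] at the other extreme points. The part between [l]
    and [r] is the gain: a strip above [t] or below [b], one of which fits because
    [2 * (D + s) <= M]. *)
Lemma region_card_ge s D h (l r t b : G) :
  (forall z, z \in [:: l; r; t; b] -> adn l.1 z.1 <= D /\ adn l.2 z.2 <= D) ->
  l.1 + h <= r.1 -> l.1 <= t.1 <= r.1 -> l.1 <= b.1 <= r.1 -> 2 * h <= s -> 2 * (D + s) <= M ->
  side (D + s) M l.1 * side (D + s) M l.2 * quarter s + h * (s %/ 2)
  <= #|[set y : G | in_region s (gpos l) (gpos r) (gpos t) (gpos b) (gpos y)]|.
Proof.
move=> near lr lt lb hs DM; set S := [set y : G | _].
have [nr1 nr2] : adn l.1 r.1 <= D /\ adn l.2 r.2 <= D by apply: near; rewrite !inE eqxx !orbT.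
have [_ nt2] : adn l.1 t.1 <= D /\ adn l.2 t.2 <= D by apply: near; rewrite !inE eqxx !orbT.
have [_ nb2] : adn l.1 b.1 <= D /\ adn l.2 b.2 <= D by apply: near; rewrite !inE eqxx !orbT.
pose S1 := [set y in S | y.1 < l.1]; pose S2 := [set y in S | r.1 < y.1].
pose S3 := [set y in S | (l.1 <= y.1) && (y.1 <= r.1)].
have disjU (A B : {set G}) : (forall y, y \in A -> y \in B -> False) -> #|A :|: B| = #|A| + #|B|.
  move=> dAB; rewrite -cardsUI [X in _ = _ + X](_ : _ = 0) ?addn0 //.
  apply/eqP; rewrite cards_eq0; apply/eqP/setP => y; rewrite in_setI in_set0.
  by apply/negP => /andP[/dAB].
have sub : S1 :|: S2 :|: S3 \subset S.
  by apply/subsetP => y; rewrite in_setU in_setU => /orP[/orP[]|]; rewrite in_set => /andP[].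
apply: leq_trans (subset_leq_card sub).
rewrite disjU; last first.
  move=> y; rewrite in_setU => /orP[]; rewrite in_set => /andP[_ h1]; rewrite in_set => /and3P[_ h2 h3];
  by move: h1 h2 h3 lr; clear; lia.
rewrite disjU; last first.
  by move=> y; rewrite in_set => /andP[_ h1]; rewrite in_set => /andP[_ h2]; move: h1 h2 lr; clear; lia.
have sY y : adn l.2 y <= D -> side (D + s) M l.2 <= side s M y.
  by move=> h1; apply: side_le h1 _.
have SE y : (y \in S) = in_region s (gpos l) (gpos r) (gpos t) (gpos b) (gpos y) by rewrite in_set.
apply: leq_add.
  rewrite side_room -mulnA mulnDl addnC; apply: leq_add.
    have [rl|] := boolP (room M false (D + s) l.1); last by rewrite mul0n.
    have rl' : room M false s l.1 by move: rl; rewrite /room; apply: leq_trans; apply: leq_addl.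
    rewrite mul1n; apply: leq_trans (_ : side s M l.2 * quarter s <= _).
      by rewrite leq_mul2r sY ?adnn ?orbT.
    apply: leq_trans (@half_card M s false (gpos l) (ltn_ord _) (ltn_ord _) rl') _.
    apply: subset_leq_card; apply/subsetP => y; rewrite in_set [y \in S1]in_set SE /in_region.
    by move=> /andP[h1 ->]; rewrite /beyond in h1; rewrite h1.
  have [rl|] := boolP (room M true (D + s) l.1); last by rewrite mul0n.
  have rl' : room M true s r.1 by have := room_le true nr1 (leqnn (D + s)); rewrite rl; case: room.
  rewrite mul1n; apply: leq_trans (_ : side s M r.2 * quarter s <= _).
    by rewrite leq_mul2r sY ?orbT.
  apply: leq_trans (@half_card M s true (gpos r) (ltn_ord _) (ltn_ord _) rl') _.
  apply: subset_leq_card; apply/subsetP => y; rewrite in_set [y \in S2]in_set SE /in_region.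
  by move=> /andP[h1 ->]; rewrite /beyond in h1; rewrite h1 !andbT orbT.
have [rl|rl] := boolP (room M true (D + s) l.2).
  have rt : room M true s t.2 by have := room_le true nt2 (leqnn (D + s)); rewrite rl; case: room.
  apply: leq_trans (strip_card (t := gpos t) (ltn_ord r.1) (ltn_ord t.2) lt lr hs rt) _.
  apply: subset_leq_card; apply/subsetP => y; rewrite in_set [y \in S3]in_set SE /in_region.
  by move=> /and4P[h1 h2 h3 h4]; rewrite /beyond in h3; rewrite h1 h2 h3 h4 !orbT.
have rb : room M false s b.2.
  have : room M false (D + s) l.2 by move: rl DM; rewrite /room; clear; lia.
  by have := room_le false nb2 (leqnn (D + s)) => + h1; rewrite h1; case: room.
apply: leq_trans (strip_card (t := gpos b) (ltn_ord r.1) (ltn_ord b.2) lb lr hs rb) _.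
apply: subset_leq_card; apply/subsetP => y; rewrite in_set [y \in S3]in_set SE /in_region.
by move=> /and4P[h1 h2 h3 h4]; rewrite /beyond in h3; rewrite h1 h2 h3 h4 !orbT.
Qed.
End Region.

From mathcomp Require Import archimedean reals sequences exp.
Local Open Scope ring_scope.

(** * First moments *)

Section Counting.
Variables (n : nat) (G : finType).
Implicit Types (Rg : {set G}).
Local Open Scope nat_scope.

Lemma card_family_prod (I : finType) (F : I -> pred G) :
  #|(family F : simpl_pred {ffun I -> G})| = \prod_i #|F i|.
Proof. by rewrite card_family foldrE big_map big_enum. Qed.

Definition placed k (i : k.-tuple 'I_n) (q : k.-tuple G) Rg : {set {ffun 'I_n -> G}} :=
  [set f : {ffun 'I_n -> G} | (map f i == q) && [forall j, (j \in i) || (f j \notin Rg)]].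

Lemma card_placed k (i : k.-tuple 'I_n) (q : k.-tuple G) Rg : uniq i ->
  #|placed i q Rg| <= (#|G| - #|Rg|) ^ (n - k).
Proof.
move=> ui; have [->|[f0 f0P]] := set_0Vmem (placed i q Rg); first by rewrite cards0.
pose F (j : 'I_n) : pred G := if j \in i then pred1 (f0 j) else mem (~: Rg).
have sub : placed i q Rg \subset (family F : simpl_pred {ffun 'I_n -> G}).
  apply/subsetP => f; rewrite inE => /andP[/eqP fq /forallP fR].
  move: f0P; rewrite inE => /andP[/eqP f0q _].
  apply/familyP => j; rewrite /F; case: ifP => ji; last by have := fR j; rewrite ji !inE.
  have := congr1 (fun t => nth (f j) t (index j i)) (etrans fq (esym f0q)) => /=.
  by rewrite !(nth_map j) ?index_mem // nth_index // inE => ->.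
apply: leq_trans (subset_leq_card sub) _; rewrite card_family_prod.
rewrite (bigID (fun j => j \in i)) /= big1 ?mul1n; last first.
  by move=> j ji; rewrite /F ji card1.
rewrite (eq_bigr (fun=> #|G| - #|Rg|)); last first.
  move=> j /negbTE ji; rewrite /F ji; have <- : #|~: Rg| = #|G| - #|Rg| by rewrite -(cardsC Rg) addKn.
  by apply: eq_card.
rewrite prod_nat_const.
have -> : #|[pred j | j \notin i]| = n - k; last by [].
have h := cardC (mem i); have := card_ord n; rewrite -{}h (card_uniqP ui) size_tuple.
by move=> h; rewrite -[X in _ = X - k]h addKn.
Qed.

Definition pattern_event k (Pat : pred (k.-tuple G)) (Rg : k.-tuple G -> {set G}) : {set {ffun 'I_n -> G}} :=
  [set f | [exists i : k.-tuple 'I_n, exists q : k.-tuple G, [&& uniq i, Pat q & f \in placed i q (Rg q)]]].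

Lemma card_bigU_le (T I : finType) (P : pred I) (F : I -> {set T}) :
  #|\bigcup_(i | P i) F i| <= \sum_(i | P i) #|F i|.
Proof.
elim/big_rec2: _ => [|i a A _ h]; first by rewrite cards0.
by apply: leq_trans (leq_card_setU _ _) _; rewrite leq_add2l.
Qed.

Lemma card_pattern_event k (Pat : pred (k.-tuple G)) (Rg : k.-tuple G -> {set G}) :
  #|pattern_event Pat Rg| <= n ^ k * \sum_(q | Pat q) (#|G| - #|Rg q|) ^ (n - k).
Proof.
have -> : pattern_event Pat Rg = \bigcup_(i : k.-tuple 'I_n | uniq i) \bigcup_(q | Pat q) placed i q (Rg q).
  apply/setP => f; rewrite inE; apply/existsP/bigcupP.
    by move=> [i /existsP[q /and3P[ui pq fq]]]; exists i => //; apply/bigcupP; exists q.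
  by move=> [i ui /bigcupP[q pq fq]]; exists i; apply/existsP; exists q; rewrite ui pq.
apply: leq_trans (card_bigU_le _ _) _.
apply: leq_trans (_ : \sum_(i : k.-tuple 'I_n | uniq i) \sum_(q | Pat q) (#|G| - #|Rg q|) ^ (n - k) <= _).
  apply: leq_sum => i ui; apply: leq_trans (card_bigU_le _ _) _; apply: leq_sum => q _.
  exact: card_placed.
rewrite sum_nat_const leq_mul2r; apply/orP; right.
by apply: leq_trans (max_card _) _; rewrite card_tuple card_ord.
Qed.

Lemma pattern_event_large k (Pat : pred (k.-tuple G)) (Rg : k.-tuple G -> {set G}) : n < k -> pattern_event Pat Rg = set0.
Proof.
move=> nk; apply/setP => f; rewrite in_set0 /pattern_event in_set.
apply: negbTE; apply/negP => /existsP[i /existsP[q /and3P[ui _ _]]].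
have := max_card (mem i); rewrite (card_uniqP ui) size_tuple => h.
by have := leq_trans h (eq_leq (card_ord n)); rewrite leqNgt nk.
Qed.

Lemma card_tuples_in k (S : 'I_k -> {set G}) :
  #|[set q : k.-tuple G | [forall j : 'I_k, tnth q j \in S j]]| <= \prod_(j < k) #|S j|.
Proof.
have -> : \prod_(j < k) #|S j| = #|(family (fun j : 'I_k => mem (S j)) : simpl_pred {ffun 'I_k -> G})|.
  by rewrite card_family_prod.
have inj : injective (fun q : k.-tuple G => finfun (tnth q)).
  by move=> q q' /ffunP h; apply: eq_from_tnth => j; have := h j; rewrite !ffunE.
rewrite -(card_imset _ inj); apply: subset_leq_card.
apply/subsetP => g /imsetP[q]; rewrite inE => /forallP h ->.
by apply/familyP => j; rewrite ffunE; apply: h.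
Qed.
End Counting.

Section Probability.
Variables (R : realType) (n : nat) (G : finType).
Hypothesis G0 : 0 < #|G|%:R :> R.
Local Notation mu := (n%:R / #|G|%:R : R).

Definition pr (A : {set {ffun 'I_n -> G}}) : R := #|A|%:R / (#|G| ^ n)%:R.

Lemma pr_le (A B : {set {ffun 'I_n -> G}}) : A \subset B -> pr A <= pr B.
Proof. by move=> AB; rewrite ler_wpM2r ?invr_ge0 ?ler0n // ler_nat subset_leq_card. Qed.

Lemma pr_bigU (I : finType) (P : pred I) (F : I -> {set {ffun 'I_n -> G}}) :
  pr (\bigcup_(i | P i) F i) <= \sum_(i | P i) pr (F i).
Proof.
rewrite -mulr_suml ler_wpM2r ?invr_ge0 ?ler0n // -natr_sum ler_nat; exact: card_bigU_le.
Qed.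

Lemma pr_setU (A B : {set {ffun 'I_n -> G}}) : pr (A :|: B) <= pr A + pr B.
Proof. by rewrite -mulrDl ler_wpM2r ?invr_ge0 ?ler0n // -natrD ler_nat leq_card_setU. Qed.

(** This is [1 - m / g <= exp (- m / g)]; the [k] points missing from the exponent cost a factor of
    at most [e] each. *)
Lemma avoid_le_expR m k : (m <= #|G|)%N -> (k <= n)%N ->
  ((#|G| - m) ^ (n - k))%:R / (#|G| ^ n)%:R
  <= (expR 1 / #|G|%:R) ^+ k * expR (- (mu * m%:R)) :> R.
Proof.
move=> mG kn; set g : R := #|G|%:R; have g0 : 0 < g by [].
have gn0 : g != 0 by rewrite gt_eqF.
rewrite !natrX natrB // -/g.
have -> : (g - m%:R) ^+ (n - k) / g ^+ n = g^-1 ^+ k * (1 - m%:R / g) ^+ (n - k).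
  have -> : g - m%:R = g * (1 - m%:R / g) by field.
  have -> : g ^+ n = g ^+ (n - k) * g ^+ k by rewrite -exprD subnK.
  rewrite exprMn exprVn; move: (1 - _) (n - k)%N => x j; field.
  by rewrite !expf_neq0.
rewrite [X in _ <= X * _]exprMn -mulrA mulrCA ler_wpM2l //; first by rewrite exprn_ge0 // invr_ge0 ltW.
have mg : m%:R / g <= 1 by rewrite ler_pdivrMr // mul1r ler_nat.
have mg0 : 0 <= m%:R / g by rewrite divr_ge0 ?ler0n // ltW.
apply: (@le_trans _ _ (expR (- (m%:R / g)) ^+ (n - k))).
  by rewrite lerXn2r ?nnegrE ?expR_ge0 ?subr_ge0 // expR_ge1Dx.
rewrite -!expRM_natl -expRD ler_expR natrB // mulr1.
rewrite -/g; have -> : - (n%:R / g * m%:R) = n%:R * - (m%:R / g) by ring.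
have : k%:R * (m%:R / g) <= k%:R :> R by rewrite ler_piMr.
by move: (m%:R / g) => x; lra.
Qed.

Lemma pr_pattern_event k (Pat : pred (k.-tuple G)) (Rg : k.-tuple G -> {set G}) :
  pr (pattern_event n Pat Rg)
  <= (expR 1 * mu) ^+ k * \sum_(q | Pat q) expR (- (mu * #|Rg q|%:R)).
Proof.
have [nk|kn] := ltnP n k.
  rewrite pattern_event_large // /pr cards0 mul0r mulr_ge0 ?exprn_ge0 //.
    by rewrite mulr_ge0 ?expR_ge0 // divr_ge0 // ltW.
  by apply: sumr_ge0 => q _; apply: expR_ge0.
have h := card_pattern_event n Pat Rg.
apply: (@le_trans _ _ ((n ^ k * \sum_(q | Pat q) (#|G| - #|Rg q|) ^ (n - k))%:R / (#|G| ^ n)%:R)).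
  by rewrite ler_wpM2r ?invr_ge0 ?ler0n // ler_nat.
rewrite natrM natr_sum -mulrA mulr_suml.
have -> : (expR 1 * mu) ^+ k = n%:R ^+ k * (expR 1 / #|G|%:R) ^+ k by rewrite -exprMn; congr (_ ^+ _); ring.
rewrite -mulrA natrX ler_wpM2l ?exprn_ge0 ?ler0n // mulr_sumr.
by apply: ler_sum => q _; apply: avoid_le_expR => //; apply: max_card.
Qed.

(** Pattern and region depend on the position of a base point, so that counting the other positions
    leaves a sum over this single one. *)
Definition based_event k (Pat : G -> pred (k.-tuple G)) (Rg : G -> k.-tuple G -> {set G}) :
    {set {ffun 'I_n -> G}} :=
  [set f : {ffun 'I_n -> G} | [exists i0 : 'I_n, exists i : k.-tuple 'I_n,
    [&& uniq (i0 :: i), Pat (f i0) (map_tuple f i)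
      & [forall j, (j \in i0 :: i) || (f j \notin Rg (f i0) (map_tuple f i))]]]].

Lemma based_event_sub k (Pat : G -> pred (k.-tuple G)) (Rg : G -> k.-tuple G -> {set G}) :
  based_event Pat Rg \subset pattern_event n (fun q : k.+1.-tuple G => Pat (thead q) (behead_tuple q))
     (fun q : k.+1.-tuple G => Rg (thead q) (behead_tuple q)).
Proof.
apply/subsetP => f; rewrite /based_event in_set => /existsP[i0 /existsP[i /and3P[ui pq fR]]].
rewrite /pattern_event in_set; apply/existsP; exists [tuple of i0 :: i].
apply/existsP; exists [tuple of f i0 :: map_tuple f i]; rewrite ui theadE /=.
have -> : behead_tuple [tuple of f i0 :: map_tuple f i] = map_tuple f i by apply: val_inj.
by rewrite pq /placed in_set eqxx.
Qed.

Lemma sum_expR_based k (Pat : G -> pred (k.-tuple G)) (S : 'I_k -> G -> {set G}) (a : 'I_k -> nat)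
    (N : G -> k.-tuple G -> R) (g : G -> R) :
  (forall v q j, Pat v q -> tnth q j \in S j v) -> (forall j v, #|S j v| <= a j)%N ->
  (forall v q, Pat v q -> g v <= N v q) ->
  \sum_(q : k.+1.-tuple G | Pat (thead q) (behead_tuple q)) expR (- (mu * N (thead q) (behead_tuple q)))
  <= (\prod_j a j)%:R * \sum_v expR (- (mu * g v)).
Proof.
move=> PS Sa gN.
have -> : \sum_(q : k.+1.-tuple G | Pat (thead q) (behead_tuple q))
     expR (- (mu * N (thead q) (behead_tuple q)))
  = \sum_v \sum_(q | Pat v q) expR (- (mu * N v q)).
  rewrite pair_big_dep /=.
  rewrite (reindex (fun p : G * k.-tuple G => [tuple of p.1 :: p.2])) /=; last first.
    exists (fun q => (thead q, behead_tuple q)) => [[v q] _|q _] /=.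
      by rewrite theadE; congr (_, _); apply: val_inj.
    by rewrite -tuple_eta.
  apply: eq_big => [[v q]|[v q] _]; rewrite /= theadE;
  by have -> : behead_tuple [tuple of v :: q] = q by apply: val_inj.
rewrite mulr_sumr; apply: ler_sum => v _.
apply: (@le_trans _ _ (\sum_(q | Pat v q) expR (- (mu * g v)))).
  apply: ler_sum => q pq; rewrite ler_expR lerN2 ler_wpM2l ?gN //.
  by rewrite divr_ge0 ?ler0n // ltW.
rewrite sumr_const -[leLHS]mulr_natl ler_wpM2r ?expR_ge0 // ler_nat.
apply: leq_trans (_ : \prod_j #|S j v| <= _)%N; last by apply: leq_prod => j _; apply: Sa.
apply: leq_trans (card_tuples_in (fun j => S j v)); apply: subset_leq_card.
by apply/subsetP => q pq; rewrite in_set; apply/forallP => j; apply: PS.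
Qed.

Lemma pr_based_event k (Pat : G -> pred (k.-tuple G)) (Rg : G -> k.-tuple G -> {set G})
    (S : 'I_k -> G -> {set G}) (a : 'I_k -> nat) (g : G -> R) :
  (forall v q j, Pat v q -> tnth q j \in S j v) -> (forall j v, #|S j v| <= a j)%N ->
  (forall v q, Pat v q -> g v <= #|Rg v q|%:R) ->
  pr (based_event Pat Rg)
  <= (expR 1 * mu) ^+ k.+1 * (\prod_j a j)%:R * \sum_v expR (- (mu * g v)).
Proof.
move=> PS Sa gN; apply: le_trans (pr_le (based_event_sub Pat Rg)) _.
apply: le_trans (pr_pattern_event _ _) _; rewrite -mulrA ler_wpM2l //.
  by rewrite exprn_ge0 // mulr_ge0 ?expR_ge0 // divr_ge0 // ltW.
exact: (sum_expR_based (N := fun v q => #|Rg v q|%:R) PS Sa gN).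
Qed.

End Probability.

Section Events.
Variables (R : realType) (n M s h D J : nat).
Local Notation G := ('I_M * 'I_M)%type.
Local Notation conf := {ffun 'I_n -> G}.
Local Notation mu := (n%:R / #|{: G}|%:R : R).
Hypothesis G0 : 0 < #|{: G}|%:R :> R.

Definition fpos (f : conf) (i : 'I_n) : nat * nat := gpos (f i).

Definition sparse_conf : {set conf} :=
  [set f : conf | ~~ `[< no_sparse_region (fpos f) s h D J >]].

Definition poor_conf : {set conf} :=
  [set f : conf | ~~ `[< no_poor_cluster (fpos f) s h J >]].

(** Up to a constant factor, a bound for the expected number of points whose disc of radius [s]
    contains no other point, with the loss near sides and corners taken into account. *)
Definition side_sum : R :=
  mu * \sum_(v : G) expR (- (mu * (side (D + s) M v.1 * side (D + s) M v.2 * quarter s)%:R)).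

(* The indices point into v :: q, where v is the leftmost point of the cluster. *)
Definition extreme k (jrtb : 'I_(J + 4) * 'I_(J + 4) * 'I_(J + 4)) (v : G) (q : k.-tuple G) :=
  (nth v (v :: q) jrtb.1.1, nth v (v :: q) jrtb.1.2, nth v (v :: q) jrtb.2).

Definition sparse_pat k jrtb (v : G) : pred (k.-tuple G) := fun q =>
  let: (r, t, b) := extreme jrtb v q in
  [&& all (fun z : G => (adn v.1 z.1 <= D) && (adn v.2 z.2 <= D)) [:: v; r; t; b],
      v.1 + h <= r.1, v.1 <= t.1 <= r.1, v.1 <= b.1 <= r.1
    & [forall j, (adn v.1 (tnth q j).1 <= D + s) && (adn v.2 (tnth q j).2 <= D + s)]]%N.

Definition sparse_reg k jrtb (v : G) (q : k.-tuple G) : {set G} :=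
  let: (r, t, b) := extreme jrtb v q in
  [set y : G | in_region s (gpos v) (gpos r) (gpos t) (gpos b) (gpos y)].

Lemma in_region_near (l r t b y : nat * nat) : in_region s l r t b y ->
  exists2 z, z \in [:: l; r; t; b] & (dsq z y <= s * s)%N.
Proof.
by case/or4P => [/andP[_ ?]|/andP[_ ?]|/and4P[_ _ _ ?]|/and4P[_ _ _ ?]];
  [exists l|exists r|exists t|exists b] => //; rewrite !inE eqxx ?orbT.
Qed.

(** The tuple lists all points of the region besides [r], [t] and [b], so it has at most [J + 3]
    entries, and every other point avoids the region, as [based_event] demands. *)
Lemma sparse_conf_sub :
  sparse_conf \subset \bigcup_(p : 'I_(J + 4) * ('I_(J + 4) * 'I_(J + 4) * 'I_(J + 4)))
     based_event n (@sparse_pat p.1 p.2) (@sparse_reg p.1 p.2).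
Proof.
apply/subsetP => f; rewrite in_set => /asboolPn nf.
have : exists l r t b : 'I_n, [/\ forall z, z \in [:: l; r; t; b] ->
    (adn (fpos f l).1 (fpos f z).1 <= D)%N /\ (adn (fpos f l).2 (fpos f z).2 <= D)%N,
  ((fpos f l).1 + h <= (fpos f r).1)%N,
  ((fpos f l).1 <= (fpos f t).1 <= (fpos f r).1)%N, ((fpos f l).1 <= (fpos f b).1 <= (fpos f r).1)%N &
  (#|[set v | in_region s (fpos f l) (fpos f r) (fpos f t) (fpos f b) (fpos f v)]| <= J)%N].
  apply: contrapT => no; apply: nf => l r t b h1 h2 h3 h4; rewrite ltnNge; apply/negP => h5.
  by apply: no; exists l, r, t, b.
case=> l [r [t [b [near lr lt lb RJ]]]].
set Reg := [set v | _] in RJ.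
set T := (r |: (t |: (b |: Reg))) :\ l.
have TJ : (#|T| < J + 4)%N.
  rewrite addnC addSn ltnS; apply: leq_trans (subset_leq_card (subD1set _ _)) _.
  apply: leq_trans (leq_card_setU _ _) _; rewrite cards1 addSn ltnS add0n.
  apply: leq_trans (leq_card_setU _ _) _; rewrite cards1 addSn ltnS add0n.
  by apply: leq_trans (leq_card_setU _ _) _; rewrite cards1 addSn ltnS add0n.
pose i := enum_tuple T.
have sz : size (l :: i) = #|T|.+1 by rewrite /= size_tuple.
have ix z : z \in r |: (t |: (b |: Reg)) -> (index z (l :: i) < J + 4)%N /\ nth l (l :: i) (index z (l :: i)) = z.
  move=> zT; have zi : z \in l :: i by rewrite in_cons mem_enum in_setD1 zT andbT orbN.
  by rewrite nth_index //; split=> //; apply: leq_trans TJ; rewrite -sz index_mem.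
have [rJ rE] : (index r (l :: i) < J + 4)%N /\ nth l (l :: i) (index r (l :: i)) = r.
  by apply: ix; rewrite !in_setU in_set1 eqxx.
have [tJ tE] : (index t (l :: i) < J + 4)%N /\ nth l (l :: i) (index t (l :: i)) = t.
  by apply: ix; rewrite !in_setU !in_set1 eqxx !orbT.
have [bJ bE] : (index b (l :: i) < J + 4)%N /\ nth l (l :: i) (index b (l :: i)) = b.
  by apply: ix; rewrite !in_setU !in_set1 eqxx !orbT.
apply/bigcupP; exists (Ordinal TJ, (Ordinal rJ, Ordinal tJ, Ordinal bJ)) => //.
rewrite in_set; apply/existsP; exists l; apply/existsP; exists i.
have fE k : (k < J + 4)%N -> (k <= #|T|)%N -> nth (f l) (f l :: map_tuple f i) k = f (nth l (l :: i) k).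
  move=> _ kT; rewrite -[f l :: map_tuple f i]/(map f (l :: i)) (nth_map l) //=.
  by rewrite size_tuple ltnS.
have idx z : z \in l :: i -> (index z (l :: i) <= #|T|)%N.
  by rewrite -ltnS -sz index_mem.
have mem z : z \in r |: (t |: (b |: Reg)) -> z \in l :: i.
  by move=> zT; rewrite in_cons mem_enum in_setD1 zT andbT orbN.
have EE : extreme (Ordinal rJ, Ordinal tJ, Ordinal bJ) (f l) (map_tuple f i) = (f r, f t, f b).
  rewrite /extreme; rewrite !fE ?rE ?tE ?bE //; apply: idx; apply: mem;
  by rewrite !in_setU !in_set1 eqxx ?orbT.
apply/and3P; split.
- by rewrite /= mem_enum in_setD1 eqxx enum_uniq.
- rewrite /sparse_pat EE /=; apply/and5P; split=> //.
    have near' z : z \in [:: l; r; t; b] -> (adn (f l).1 (f z).1 <= D)%N && (adn (f l).2 (f z).2 <= D)%N.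
      by move=> /near[h1 h2]; apply/andP.
    by rewrite !near' //; rewrite !inE eqxx ?orbT.
  apply/forallP => j; rewrite tnth_map.
  have : tnth i j \in T by rewrite -mem_enum mem_tnth.
  rewrite in_setD1 => /andP[_].
  have near' z : z \in [:: l; r; t; b] -> (adn (f l).1 (f z).1 <= D + s)%N && (adn (f l).2 (f z).2 <= D + s)%N.
    by move=> /near[h1 h2]; apply/andP; split; apply: leq_trans (leq_addr _ _).
  rewrite !in_setU !in_set1 => /or4P[/eqP->|/eqP->|/eqP->|]; try by apply: near'; rewrite !inE eqxx ?orbT.
  rewrite in_set => /in_region_near[z zl zd].
  have [z' z'l zz'] : exists2 z', z' \in [:: l; r; t; b] & z = fpos f z'.
    by move: zl; rewrite !inE => /or4P[]/eqP->; [exists l|exists r|exists t|exists b]; rewrite ?inE ?eqxx ?orbT.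
  rewrite zz' in zd; have [h1 h2] := dsq_le zd; have [h3 h4] := near _ z'l.
  apply/andP; split; [apply: leq_trans (adn_tri _ (f z').1 _) _|apply: leq_trans (adn_tri _ (f z').2 _) _];
  exact: leq_add.
- apply/forallP => j; rewrite /sparse_reg EE in_set -implyNb; apply/implyP => jn; apply: contra jn => jR.
  by apply: mem; rewrite !in_setU in_set [X in _ || (_ || (_ || X))]jR !orbT.
Qed.

Lemma pr_sparse_conf (Lam : R) : 1 <= Lam ->
  expR 1 * mu * (4 * ((D + s).+1 * (D + s).+1))%:R <= Lam ->
  (2 * h <= s)%N -> (2 * (D + s) <= M)%N ->
  pr R sparse_conf <= ((J + 4) ^ 4)%:R * (Lam ^+ (J + 4) * expR 1 * side_sum * expR (- (mu * (h * (s %/ 2))%:R))).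
Proof.
move=> L1 Lam_ge hs DM; apply: le_trans (pr_le R sparse_conf_sub) _.
apply: le_trans (pr_bigU _ _ _) _.
set C := Lam ^+ _ * _ * _ * _.
have mu0 : 0 <= mu by rewrite divr_ge0 ?ler0n.
have -> : ((J + 4) ^ 4)%:R * C = \sum_(p : 'I_(J + 4) * ('I_(J + 4) * 'I_(J + 4) * 'I_(J + 4))) C.
  by rewrite sumr_const !card_prod !card_ord mulr_natl; congr (_ *+ _); rewrite !expnS expn0 muln1 !mulnA.
apply: ler_sum => -[[k kJ] p] _ /=.
pose S (j : 'I_k) (v : G) := [set y : G | (adn v.1 y.1 <= D + s)%N && (adn v.2 y.2 <= D + s)%N].
pose g (v : G) : R := (side (D + s) M v.1 * side (D + s) M v.2 * quarter s)%:R + (h * (s %/ 2))%:R.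
apply: le_trans (@pr_based_event R n _ G0 k _ _ S (fun=> 4 * ((D + s).+1 * (D + s).+1))%N g _ _ _) _.
- move=> v q j; rewrite /sparse_pat; case: extreme => [[r t] b] /and5P[_ _ _ _ /forallP/(_ j)].
  by rewrite in_set.
- by move=> j v; exact: (@box_card_le M (D + s) (gpos v)).
- move=> v q; rewrite /sparse_pat /sparse_reg; case: extreme => [[r t] b] /and5P[/allP near lr lt lb _].
  rewrite /g -natrD ler_nat; apply: (region_card_ge _ lr lt lb hs DM) => z /near/andP[h1 h2] //.
rewrite prod_nat_const card_ord natrX exprS.
have -> : \sum_v expR (- (mu * g v)) = expR (- (mu * (h * (s %/ 2))%:R)) * 
   \sum_(v : G) expR (- (mu * (side (D + s) M v.1 * side (D + s) M v.2 * quarter s)%:R)).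
  rewrite mulr_sumr; apply: eq_bigr => v _; rewrite -expRD; congr expR; rewrite /g; ring.
rewrite /C /side_sum; set S0 := \sum_(v : G) _; set E := expR (- _).
have S00 : 0 <= S0 by apply: sumr_ge0 => v _; apply: expR_ge0.
have -> : expR 1 * mu * (expR 1 * mu) ^+ k * (4 * ((D + s).+1 * (D + s).+1))%:R ^+ k * (E * S0)
  = (expR 1 * mu * (4 * ((D + s).+1 * (D + s).+1))%:R) ^+ k * (expR 1 * (mu * S0) * E).
  set m := mu; rewrite [in RHS]exprMn; move: (_ ^+ k) (_ ^+ k) => u w'; move: m => m; ring.
have -> : Lam ^+ (J + 4) * expR 1 * (mu * S0) * E = Lam ^+ (J + 4) * (expR 1 * (mu * S0) * E).
  by rewrite !mulrA.
rewrite ler_wpM2r //; first by rewrite mulr_ge0 ?expR_ge0 // mulr_ge0 ?expR_ge0 // (mulr_ge0 mu0).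
apply: le_trans (_ : Lam ^+ k <= _); last by apply: ler_weXn2l => //; apply: ltnW.
rewrite lerXn2r ?nnegrE //; last exact: le_trans ler01 L1.
by apply: mulr_ge0; rewrite ?ler0n // (mulr_ge0 (expR_ge0 _) mu0).
Qed.

(* k close points, then c inner points, then points of the annulus. *)
Definition poor_set (v : G) (k c j : nat) : {set G} :=
  if (j < k)%N then [set y : G | (adn v.1 y.1 <= h)%N && (adn v.2 y.2 <= h)%N]
  else if (j < k + c)%N then [set y : G | (adn v.1 y.1 <= s)%N && (adn v.2 y.2 <= s)%N]
  else [set y : G | ((s - 2 * h) * (s - 2 * h) < dsq (gpos v) (gpos y))%N && (dsq (gpos v) (gpos y) <= s * s)%N].

Definition poor_pat (k c m : nat) (v : G) : pred ((k + c + m).-tuple G) := fun q =>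
  [forall j : 'I_(k + c + m), tnth q j \in poor_set v k c j].

Definition poor_reg (v : G) : {set G} :=
  [set y : G | (dsq (gpos v) (gpos y) <= s * s)%N] :\: [set y : G | (adn v.1 y.1 <= h)%N && (adn v.2 y.2 <= h)%N].

(** With [c] inner points only [maxn 2 c.+1] of the close points are recorded; the region to be
    avoided leaves out the box, where further close points may lie. *)
Lemma poor_conf_sub :
  poor_conf \subset \bigcup_(p : 'I_J.+1 * 'I_J.+1)
     based_event n (@poor_pat (maxn 2 p.1.+1) p.1 p.2) (fun v _ => poor_reg v).
Proof.
apply/subsetP => f; rewrite in_set => /asboolPn nf.
have : exists v : 'I_n, [/\ (1 < #|close_pts (fpos f) h v|)%N,
    (#|inner_pts (fpos f) s h v| + #|annulus_pts (fpos f) s h v| <= J)%N &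
    (#|inner_pts (fpos f) s h v| < #|close_pts (fpos f) h v|)%N].
  apply: contrapT => no; apply: nf => v h1 h2; rewrite leqNgt; apply/negP => h3.
  by apply: no; exists v.
case=> v [c1 cmJ ck].
set Cl := close_pts _ _ _ in c1 ck; set In := inner_pts _ _ _ _ in ck cmJ; set An := annulus_pts _ _ _ _ in cmJ.
have cJ : (#|In| < J.+1)%N by rewrite ltnS; apply: leq_trans cmJ; apply: leq_addr.
have mJ : (#|An| < J.+1)%N by rewrite ltnS; apply: leq_trans cmJ; apply: leq_addl.
have [Cs CsC Csk] : exists2 B : {set 'I_n}, B \subset Cl & #|B| = maxn 2 #|In|.+1.
  by apply: card_subset_exists; rewrite geq_max c1.
apply/bigcupP; exists (Ordinal cJ, Ordinal mJ) => //; rewrite in_set; apply/existsP; exists v.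
have sz : size (enum Cs ++ enum In ++ enum An) == (maxn 2 #|In|.+1 + #|In| + #|An|)%N.
  by rewrite !size_cat -!cardE Csk addnA.
apply/existsP; exists (Tuple sz).
have CsP j : j \in Cs -> (j != v) && in_box (fpos f) h v j.
  by move=> /(subsetP CsC); rewrite /Cl /close_pts in_set.
have InP j : (j \in In) = (~~ in_box (fpos f) h v j && (dsq (fpos f v) (fpos f j) <= (s - 2 * h) * (s - 2 * h))%N).
  by rewrite /In /inner_pts in_set.
have AnP j : (j \in An) = [&& ~~ in_box (fpos f) h v j, ((s - 2 * h) * (s - 2 * h) < dsq (fpos f v) (fpos f j))%N
   & (dsq (fpos f v) (fpos f j) <= s * s)%N].
  by rewrite /An /annulus_pts in_set.
have vv : in_box (fpos f) h v v by rewrite /in_box !adnn.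
apply/and3P; split.
- rewrite /= mem_cat mem_cat !mem_enum InP AnP vv /= !orbF.
  apply/andP; split; first by apply/negP => /CsP; rewrite eqxx.
  rewrite !cat_uniq !enum_uniq /= andbT; apply/andP; split.
    apply/hasPn => j; rewrite mem_cat !mem_enum => jIA; apply/negP => /CsP/andP[_ jb].
    by case/orP: jIA; rewrite ?InP ?AnP jb.
  apply/hasPn => j; rewrite !mem_enum AnP InP => /and3P[_ h1 _]; rewrite negb_and.
  by rewrite -ltnNge h1 orbT.
- apply/forallP => j; rewrite tnth_map (tnth_nth v) /= /poor_set.
  have sC : size (enum Cs) = maxn 2 #|In|.+1 by rewrite -cardE.
  have sI : size (enum In) = #|In| by rewrite -cardE.
  rewrite !nth_cat sC sI; case: ltnP => jk.
    have : nth v (enum Cs) j \in Cs by rewrite -mem_enum mem_nth // sC.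
    by move=> /CsP/andP[_ h1]; rewrite in_set.
  rewrite ltn_subLR // -[(j < _)%N]/(_); case: ltnP => jkc.
    have : nth v (enum In) (j - maxn 2 #|In|.+1) \in In.
      by rewrite -mem_enum mem_nth // sI ltn_subLR.
    rewrite InP in_set => /andP[_ h1].
    by have [h2 h3] := dsq_le (leq_trans h1 (leq_mul (leq_subr _ _) (leq_subr _ _))); apply/andP.
  have : nth v (enum An) (j - maxn 2 #|In|.+1 - #|In|) \in An.
    rewrite -mem_enum mem_nth // -cardE -subnDA ltn_subLR //.
  by rewrite AnP in_set => /and3P[_ -> ->].
- apply/forallP => j; rewrite -implyNb; apply/implyP => jn; apply: contra jn.
  rewrite in_setD !in_set => /andP[h1 h2]; rewrite /= in_cons !mem_cat !mem_enum InP AnP.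
  have -> : in_box (fpos f) h v j = false by apply: negbTE.
  by rewrite h2 /= andbT; case: (leqP (dsq _ _)); rewrite !orbT.
Qed.

Lemma poor_reg_ge (v : G) :
  (side (D + s) M v.1 * side (D + s) M v.2 * quarter s)%:R - (4 * (h.+1 * h.+1))%:R <= #|poor_reg v|%:R :> R.
Proof.
rewrite lerBlDr -natrD ler_nat.
have h1 := @ball_card_ge M s (gpos v) (ltn_ord _) (ltn_ord _).
have h2 := @box_card_le M h (gpos v).
have h3 : (side (D + s) M v.1 * side (D + s) M v.2 * quarter s <=
  side s M v.1 * side s M v.2 * quarter s)%N.
  by rewrite leq_mul2r leq_mul ?orbT // (@side_le M s (D + s) _ _ D) // adnn.
apply: leq_trans h3 _; apply: leq_trans h1 _; rewrite addnC -leq_subLR.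
apply: leq_trans (leq_sub2l _ h2) _; rewrite leq_subLR -(cardsID [set y : G | (adn v.1 y.1 <= h)%N && (adn v.2 y.2 <= h)%N]).
by rewrite leq_add2r subset_leq_card // subsetIr.
Qed.

(** A close point costs the small factor [del], an inner point a large one whose product with [del]
    is at most [Y]. As there is at least one more close point than inner points, a factor [del] is
    left over. *)
Lemma pr_poor_conf (del W Y : R) : (11 * h <= s)%N -> 1 <= W -> 1 <= Y -> del <= 1 ->
  expR 1 * mu * (4 * (h.+1 * h.+1))%:R <= del ->
  expR 1 * mu * (32 * h * s.+1)%:R <= W ->
  del * (expR 1 * mu * (4 * (s.+1 * s.+1))%:R) <= Y ->
  pr R poor_conf <= (J.+1 ^ 2)%:R * (expR 1 * side_sum * expR 1 * del * (Y * W) ^+ J).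
Proof.
move=> hs W1 Y1 d1 delP WP YP; apply: le_trans (pr_le R poor_conf_sub) _.
apply: le_trans (pr_bigU _ _ _) _; set C := _ * _ ^+ J.
have mu0 : 0 <= mu by rewrite divr_ge0 ?ler0n.
have e0 : 0 <= expR 1 * mu by rewrite mulr_ge0 ?expR_ge0.
have d0 : 0 <= del by apply: le_trans delP; rewrite mulr_ge0 ?ler0n.
have -> : (J.+1 ^ 2)%:R * C = \sum_(p : 'I_J.+1 * 'I_J.+1) C.
  by rewrite sumr_const card_prod card_ord mulr_natl.
apply: ler_sum => -[[c cJ] [m mJ]] _ /=; set k := maxn 2 c.+1.
pose a (j : 'I_(k + c + m)) := (if j < k then 4 * (h.+1 * h.+1) else
   if j < k + c then 4 * (s.+1 * s.+1) else 32 * h * s.+1)%N.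
pose g (v : G) : R := (side (D + s) M v.1 * side (D + s) M v.2 * quarter s)%:R - (4 * (h.+1 * h.+1))%:R.
apply: le_trans (@pr_based_event R n _ G0 (k + c + m) _ _ (fun j v => poor_set v k c j) a g _ _ _) _.
- by move=> v q j /forallP/(_ j).
- move=> j v; rewrite /poor_set /a; case: ifP => _; first exact: (@box_card_le M h (gpos v)).
  case: ifP => _; first exact: (@box_card_le M s (gpos v)).
  exact: annulus_card_le.
- by move=> v q _; apply: poor_reg_ge.
have -> : (\prod_j a j = (4 * (h.+1 * h.+1)) ^ k * (4 * (s.+1 * s.+1)) ^ c * (32 * h * s.+1) ^ m)%N.
  rewrite big_split_ord big_split_ord /=; congr (_ * _ * _)%N.
  - rewrite (eq_bigr (fun=> 4 * (h.+1 * h.+1))%N) ?prod_nat_const ?card_ord // => j _.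
    by rewrite /a /= ltn_ord.
  - rewrite (eq_bigr (fun=> 4 * (s.+1 * s.+1))%N) ?prod_nat_const ?card_ord // => j _.
    by rewrite /a /= ltnNge leq_addr /= ltn_add2l ltn_ord.
  - rewrite (eq_bigr (fun=> 32 * h * s.+1)%N) ?prod_nat_const ?card_ord // => j _.
    by rewrite /a /= !ltnNge leq_addr /= -addnA leq_addr.
have -> : \sum_v expR (- (mu * g v)) = expR (mu * (4 * (h.+1 * h.+1))%:R) * 
   \sum_(v : G) expR (- (mu * (side (D + s) M v.1 * side (D + s) M v.2 * quarter s)%:R)).
  rewrite mulr_sumr; apply: eq_bigr => v _; rewrite -expRD; congr expR; rewrite /g; ring.
rewrite /C /side_sum; set S0 := \sum_(v : G) _.
have S00 : 0 <= S0 by apply: sumr_ge0 => v _; apply: expR_ge0.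
set x := (4 * (h.+1 * h.+1))%:R in delP *.
have Ex : expR (mu * x) <= expR 1.
  rewrite ler_expR (le_trans _ d1) // (le_trans _ delP) // -mulrA ler_peMl //; first by rewrite (mulr_ge0 mu0) ?ler0n.
  by apply: le_trans (expR_ge1Dx _); rewrite lerDl.
set y := (4 * (s.+1 * s.+1))%:R in YP *; set z := (32 * h * s.+1)%:R in WP *.
rewrite !natrM !natrX -/x -/y -/z exprS !exprD.
set em := expR 1 * mu in e0 delP YP WP *.
have x0 : 0 <= em * x by rewrite mulr_ge0 ?ler0n.
have y0 : 0 <= em * y by rewrite mulr_ge0 ?ler0n.
have z0 : 0 <= em * z by rewrite mulr_ge0 ?ler0n.
have -> : em * (em ^+ k * em ^+ c * em ^+ m) * (x ^+ k * y ^+ c * z ^+ m) * (expR (mu * x) * S0)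
  = ((em * x) ^+ k * (em * y) ^+ c * (em * z) ^+ m) * (em * (S0 * expR (mu * x))).
  rewrite !exprMn; move: (em ^+ k) (em ^+ c) (em ^+ m) (x ^+ k) (y ^+ c) (z ^+ m) => u1 u2 u3 u4 u5 u6; ring.
have -> : expR 1 * (mu * S0) * expR 1 * del * (Y * W) ^+ J
  = (del * Y ^+ J * W ^+ J) * (em * (S0 * expR 1)).
  by rewrite exprMn /em; move: (Y ^+ J) (W ^+ J) => u1 u2; ring.
apply: ler_pM; first by rewrite !mulr_ge0 ?exprn_ge0.
- by rewrite (mulr_ge0 e0) // mulr_ge0 ?expR_ge0.
- have mJ' : (m <= J)%N by rewrite -ltnS.
  have cJ' : (c <= J)%N by rewrite -ltnS.
  have zW : (em * z) ^+ m <= W ^+ J.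
    by apply: le_trans (_ : W ^+ m <= _); [rewrite lerXn2r ?nnegrE // (le_trans z0)|apply: ler_weXn2l].
  apply: ler_pM => //; rewrite ?mulr_ge0 ?exprn_ge0 //.
  have xd : (em * x) ^+ k <= del ^+ k by rewrite lerXn2r ?nnegrE.
  apply: le_trans (ler_wpM2r (exprn_ge0 _ y0) xd) _.
  have -> : k = (maxn 2 c.+1).-1.+1 by rewrite prednK // leq_max.
  rewrite exprS -mulrA ler_wpM2l //.
  case: (posnP c) => [->|c0].
    rewrite expr0 mulr1 /=; apply: le_trans (_ : 1 <= _); last by rewrite exprn_ege1.
    by rewrite exprn_ile1.
  have -> : (maxn 2 c.+1).-1 = c by rewrite maxnC /maxn; case: (c) c0 => [//|[|c']].
  rewrite -exprMn; apply: le_trans (_ : Y ^+ c <= _); last by apply: ler_weXn2l.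
  by rewrite lerXn2r ?nnegrE //; [exact: mulr_ge0|exact: le_trans ler01 Y1].
- by rewrite ler_wpM2l // ler_wpM2l.
Qed.

End Events.

(** * Isolated vertices *)

Section SecondMoment.
Variables (R : realType) (n : nat) (G : finType).
Hypotheses (n0 : (0 < n)%N) (G0 : 0 < #|G|%:R :> R).
Variables (Cen : {set G}) (ball : G -> {set G}) (N : nat).
Hypothesis ballN : forall c, c \in Cen -> (#|ball c| <= N)%N.
Hypothesis ball_disj : forall c c', c \in Cen -> c' \in Cen -> c' \notin ball c -> [disjoint ball c & ball c'].
Local Notation conf := {ffun 'I_n -> G}.
Local Notation x c := (#|ball c|%:R / #|G|%:R : R).
Local Notation xmax := (N%:R / #|G|%:R : R).

Definition lonely (f : conf) (i : 'I_n) := (f i \in Cen) && [forall j, (j != i) ==> (f j \notin ball (f i))].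

Definition lonely_conf : {set conf} := [set f : conf | [exists i, lonely f i]].

Let mean : R := n%:R * \sum_(c in Cen) (1 - x c) ^+ n.-1 / #|G|%:R.

Lemma card_lonely_at i c : c \in Cen ->
  #|[set f : conf | lonely f i & f i == c]| = ((#|G| - #|ball c|) ^ n.-1)%N.
Proof.
move=> cC; pose F (j : 'I_n) : pred G := if j == i then pred1 c else mem (~: ball c).
have -> : #|[set f : conf | lonely f i & f i == c]| = #|(family F : simpl_pred conf)|.
  apply: eq_card => f; rewrite in_set; apply/andP/familyP => [[/andP[_ /forallP h] /eqP fi] j|h].
    rewrite /F; case: eqP => [->|/eqP ji]; first by rewrite inE fi.
    by have := h j; rewrite ji fi -[f j \in mem _]/(f j \in ~: ball c) in_setC.
  have fi : f i = c by have := h i; rewrite /F eqxx inE => /eqP.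
  rewrite /lonely fi cC eqxx; split=> //; apply/forallP => j; apply/implyP => ji.
  by have := h j; rewrite /F (negbTE ji) !inE.
rewrite card_family_prod (bigD1 i) //= /F eqxx card1 mul1n.
rewrite (eq_bigr (fun=> #|G| - #|ball c|)%N); last first.
  by move=> j /negbTE ->; rewrite -(cardsC (ball c)) addKn; apply: eq_card.
by rewrite prod_nat_const cardC1 card_ord.
Qed.

(** If both points are lonely, [c'] is outside the ball of [c]; then the balls are disjoint and all
    other points avoid both. *)
Lemma card_lonely_pair i i' c c' : c \in Cen -> c' \in Cen -> i != i' ->
  (#|[set f : conf | [&& lonely f i, lonely f i', f i == c & f i' == c']]|
    <= (#|G| - (#|ball c| + #|ball c'|)) ^ (n - 2))%N.
Proof.
move=> cC cC' ii'; set S := [set f : conf | _].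
have [->|[f0 f0S]] := set_0Vmem S; first by rewrite cards0.
have dj : [disjoint ball c & ball c'].
  move: f0S; rewrite in_set => /and4P[/andP[_ /forallP h] _ /eqP fi /eqP fi'].
  by have := h i'; rewrite eq_sym ii' fi fi' /=; apply: ball_disj.
pose F (j : 'I_n) : pred G := if j == i then pred1 c else if j == i' then pred1 c' else mem (~: (ball c :|: ball c')).
have sub : S \subset (family F : simpl_pred conf).
  apply/subsetP => f; rewrite in_set => /and4P[/andP[_ /forallP h] /andP[_ /forallP h'] /eqP fi /eqP fi'].
  apply/familyP => j; rewrite /F; case: (j =P i) => [->|/eqP ji]; first by rewrite inE fi.
  case: (j =P i') => [->|/eqP ji']; first by rewrite inE fi'.
  rewrite -[f j \in mem _]/(f j \in ~: (ball c :|: ball c')) in_setC in_setU.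
  by have := h j; have := h' j; rewrite ji ji' fi fi' /= => /negbTE-> /negbTE->.
apply: leq_trans (subset_leq_card sub) _.
rewrite card_family_prod (bigD1 i) //= (bigD1 i') /=; last by rewrite eq_sym.
rewrite /F eqxx card1 mul1n eq_sym (negbTE ii') eqxx card1 mul1n.
rewrite (eq_bigr (fun=> #|G| - (#|ball c| + #|ball c'|))%N); last first.
  move=> j /andP[/negbTE -> /negbTE ->].
  have <- : #|ball c :|: ball c'| = (#|ball c| + #|ball c'|)%N.
    by apply/eqP; rewrite (leq_card_setU _ _).2.
  rewrite -(cardsC (ball c :|: ball c')).
  by rewrite addKn; apply: eq_card.
rewrite prod_nat_const leq_eqVlt; apply/orP; left; apply/eqP; congr (_ ^ _)%N.
have h : #|~: [set i; i']| = (n - 2)%N.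
  have := cardsC [set i; i']; rewrite cards2 ii' => h; have := card_ord n; rewrite -{}h.
  by move=> h; rewrite -[X in (_ = X - 2)%N]h addKn.
by rewrite -h; apply: eq_card => j; rewrite !inE negb_or.
Qed.

Let Yc (f : conf) : R := \sum_i (lonely f i)%:R.

Lemma sum_lonely : \sum_(f : conf) Yc f = mean * (#|G| ^ n)%:R.
Proof.
rewrite exchange_big /=.
have gn0 : (#|G|%:R : R) != 0 by rewrite gt_eqF.
have E i : \sum_(f : conf) (lonely f i)%:R = \sum_(c in Cen) ((#|G| - #|ball c|) ^ n.-1)%:R :> R.
  transitivity (\sum_(c in Cen) \sum_(f : conf) (lonely f i && (f i == c))%:R : R).
    rewrite exchange_big /=; apply: eq_bigr => f _.
    have [fC|fC] := boolP (f i \in Cen).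
      rewrite (bigD1 (f i)) //= eqxx andbT big1 ?addr0 // => c /andP[_ /negbTE].
      by rewrite eq_sym => ->; rewrite andbF.
    rewrite big1 => [|c cC]; first by rewrite /lonely (negbTE fC).
    by rewrite /lonely (negbTE fC).
  apply: eq_bigr => c cC; rewrite -(card_lonely_at i cC) -sum1_card natr_sum [RHS]big_mkcond /=.
  by apply: eq_bigr => f _; rewrite in_set; case: (_ && _).
rewrite (eq_bigr _ (fun i _ => E i)) sumr_const card_ord -[LHS]mulr_natl /mean -[RHS]mulrA; congr (_ * _).
rewrite mulr_suml; apply: eq_bigr => c cC.
rewrite !natrX natrB ?max_card //.
have -> : #|G|%:R ^+ n = #|G|%:R * #|G|%:R ^+ n.-1 :> R by rewrite -exprS prednK.
have -> : #|G|%:R - #|ball c|%:R = #|G|%:R * (1 - x c) :> R by field.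
by rewrite exprMn; move: ((1 - x c) ^+ _) (#|G|%:R ^+ _) => u v; field.
Qed.

(** The two centres are almost independent: pairs factor up to the exponent [n - 2] in place of
    [n.-1], which costs [(1 - xmax) ^- 2]. *)
Lemma sum_lonely_sq : (1 < n)%N -> xmax < 1 ->
  \sum_(f : conf) Yc f ^+ 2 <= (mean + mean ^+ 2 / (1 - xmax) ^+ 2) * (#|G| ^ n)%:R.
Proof.
move=> n1 x1.
have gn0 : (#|G|%:R : R) != 0 by rewrite gt_eqF.
have xc c : c \in Cen -> 0 <= 1 - xmax <= 1 - x c.
  by move=> cC; rewrite subr_ge0 (ltW x1) /= lerD2l lerN2 ler_pM2r ?invr_gt0 // ler_nat ballN.
have xc1 c : c \in Cen -> 0 <= 1 - x c by move=> /xc/andP[h1]; apply: le_trans.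
have -> : \sum_(f : conf) Yc f ^+ 2
   = \sum_(f : conf) Yc f + \sum_i \sum_(i' | i != i') \sum_(f : conf) (lonely f i && lonely f i')%:R.
  have -> : \sum_i \sum_(i' | i != i') \sum_(f : conf) (lonely f i && lonely f i')%:R
    = \sum_(f : conf) \sum_i \sum_(i' | i != i') (lonely f i && lonely f i')%:R :> R.
    by rewrite [RHS]exchange_big /=; apply: eq_bigr => i _; rewrite [RHS]exchange_big.
  rewrite -big_split /=; apply: eq_bigr => f _.
  rewrite expr2 /Yc mulr_suml -big_split /=; apply: eq_bigr => i _.
  rewrite mulr_sumr (bigD1 i) //= -natrM mulnb andbb; congr (_ + _).
  by rewrite (eq_bigl (fun i' => i != i')) => [|i']; [apply: eq_bigr => i' _; rewrite -natrM mulnb|rewrite eq_sym].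
rewrite sum_lonely mulrDl lerD2l.
pose u (c : G) : R := (1 - x c) ^+ (n - 2).
have E i i' : i != i' -> \sum_(f : conf) (lonely f i && lonely f i')%:R
   <= \sum_(c in Cen) \sum_(c' in Cen) (#|G| ^ (n - 2))%:R * (u c * u c') :> R.
  move=> ii'; apply: (@le_trans _ _ (\sum_(c in Cen) \sum_(c' in Cen) \sum_(f : conf)
      [&& lonely f i, lonely f i', f i == c & f i' == c']%:R)).
    rewrite [leRHS](eq_bigr _ (fun c _ => exchange_big _ _ _ _ _ _)) /= [leRHS]exchange_big /=.
    apply: ler_sum => f _; have [/andP[fi fi']|_] := boolP (lonely f i && lonely f i'); last first.
      by apply: sumr_ge0 => c _; apply: sumr_ge0 => c' _.
    have [fC _] := andP fi; have [fC' _] := andP fi'.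
    rewrite (bigD1 (f i)) //= (bigD1 (f i')) //= fi fi' !eqxx /= -addrA lerDl addr_ge0 //.
      by apply: sumr_ge0 => c' _.
    by apply: sumr_ge0 => c _; apply: sumr_ge0 => c' _.
  apply: ler_sum => c cC; apply: ler_sum => c' cC'.
  apply: (@le_trans _ _ ((#|G| - (#|ball c| + #|ball c'|)) ^ (n - 2))%:R).
    apply: le_trans (_ : (#|[set f : conf | [&& lonely f i, lonely f i', f i == c & f i' == c']]|)%:R <= _).
      rewrite -sum1_card natr_sum [leRHS]big_mkcond /=.
      by apply: ler_sum => f _; rewrite in_set; case: [&& _, _, _ & _].
    by rewrite ler_nat card_lonely_pair.
  rewrite !natrX /u -!exprMn lerXn2r ?nnegrE ?ler0n //.
    by apply: mulr_ge0; [exact: ltW|apply: mulr_ge0; exact: xc1].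
  case: (leqP (#|ball c| + #|ball c'|)%N #|G|) => h; last first.
    by rewrite (eqP (ltnW h)); apply: mulr_ge0; [exact: ltW|apply: mulr_ge0; exact: xc1].
  rewrite natrB // natrD.
  have -> : #|G|%:R * ((1 - x c) * (1 - x c')) = #|G|%:R - (#|ball c|%:R + #|ball c'|%:R)
    + #|ball c|%:R * #|ball c'|%:R / #|G|%:R :> R by field.
  by rewrite lerDl divr_ge0 ?mulr_ge0.
apply: (@le_trans _ _ (\sum_(i < n) \sum_(i' < n) \sum_(c in Cen) \sum_(c' in Cen) (#|G| ^ (n - 2))%:R * (u c * u c'))).
  have u0 c : c \in Cen -> 0 <= u c by move=> /xc/andP[h1 h2]; rewrite exprn_ge0 // (le_trans h1).
  apply: ler_sum => i _; rewrite [leLHS]big_mkcond /=; apply: ler_sum => i' _.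
  case: ifP => [/E //|_]; apply: sumr_ge0 => c cC; apply: sumr_ge0 => c' cC'.
  by rewrite mulr_ge0 ?mulr_ge0 ?u0.
rewrite !sumr_const !card_ord -!mulrnA.
have -> : \sum_(c in Cen) \sum_(c' in Cen) (#|G| ^ (n - 2))%:R * (u c * u c')
  = (#|G| ^ (n - 2))%:R * (\sum_(c in Cen) u c) ^+ 2 :> R.
  rewrite expr2 mulr_suml mulr_sumr; apply: eq_bigr => c cC.
  by rewrite !mulr_sumr.
have us : \sum_(c in Cen) u c <= \sum_(c in Cen) (1 - x c) ^+ n.-1 / (1 - xmax).
  apply: ler_sum => c cC; have /andP[h1 h2] := xc _ cC.
  rewrite ler_pdivlMr ?subr_gt0 // /u.
  have -> : n.-1 = (n - 2).+1 by move: n1; clear; lia.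
  by rewrite exprSr ler_wpM2l // exprn_ge0 // (le_trans h1).
have us0 : 0 <= \sum_(c in Cen) u c.
  by apply: sumr_ge0 => c /xc/andP[h1 h2]; rewrite exprn_ge0 // (le_trans h1).
have -> : mean ^+ 2 / (1 - xmax) ^+ 2 * (#|G| ^ n)%:R
  = (n * n)%:R * (#|G| ^ (n - 2))%:R * (\sum_(c in Cen) (1 - x c) ^+ n.-1 / (1 - xmax)) ^+ 2.
  rewrite -mulr_suml; rewrite /mean -mulr_suml.
  have -> : (#|G| ^ n)%:R = #|G|%:R ^+ 2 * (#|G| ^ (n - 2))%:R :> R by rewrite -natrX -natrM -expnD subnKC.
  have : 1 - xmax != 0 by rewrite gt_eqF // subr_gt0.
  rewrite natrM; move: (1 - xmax) => b b0; move: (\sum_(c in Cen) _) => a; field.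
  by rewrite b0 gn0.
rewrite -[leLHS]mulr_natl mulrA ler_wpM2l ?mulr_ge0 ?ler0n //.
by rewrite lerXn2r ?nnegrE // (le_trans us0).
Qed.

(** Chebyshev's inequality for the number of lonely points. *)
Lemma pr_not_lonely (m : R) : (1 < n)%N -> xmax <= 2^-1 -> 0 < m -> m <= mean ->
  pr R (~: lonely_conf) <= m^-1 + 8 * xmax.
Proof.
move=> n1 x1 m0 mm; have M0 : 0 < mean by apply: lt_le_trans mm.
have x01 : xmax < 1 by apply: le_lt_trans x1 _; rewrite invf_lt1 ?ltr1n.
have gn : 0 < (#|G| ^ n)%:R :> R by rewrite natrX exprn_gt0.
have Y0 f : f \in ~: lonely_conf -> Yc f = 0.
  rewrite in_setC in_set negb_exists => /forallP h; apply: big1 => i _.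
  by rewrite (negbTE (h i)).
have cheb : mean ^+ 2 * #|~: lonely_conf|%:R <= \sum_(f : conf) (Yc f - mean) ^+ 2.
  rewrite [leRHS](bigID (fun f => f \in ~: lonely_conf)) /= -[leLHS]addr0 lerD //.
    rewrite (eq_bigr (fun=> mean ^+ 2)) => [|f /Y0 ->]; last by rewrite sub0r sqrrN.
    by rewrite sumr_const mulr_natr.
  by apply: sumr_ge0 => f _; apply: sqr_ge0.
have E : \sum_(f : conf) (Yc f - mean) ^+ 2 = \sum_(f : conf) Yc f ^+ 2 - mean ^+ 2 * (#|G| ^ n)%:R.
  have -> : \sum_(f : conf) (Yc f - mean) ^+ 2 = \sum_(f : conf) (Yc f ^+ 2 - 2 * mean * Yc f + mean ^+ 2).
    by apply: eq_bigr => f _; ring.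
  rewrite big_split /= sumrB sumr_const -mulr_sumr sum_lonely card_ffun card_ord -mulr_natr; ring.
rewrite E in cheb; have := le_trans cheb (lerB (sum_lonely_sq n1 x01) (lexx _)).
rewrite -mulrBl => h.
have : #|~: lonely_conf|%:R / (#|G| ^ n)%:R <= mean^-1 + ((1 - xmax) ^- 2 - 1).
  rewrite ler_pdivrMr // -(ler_pM2l (exprn_gt0 2 M0)); apply: le_trans h _.
  have aux (a y : R) : a != 0 -> y != 0 -> a + a ^+ 2 / y ^+ 2 - a ^+ 2 = a ^+ 2 * (a^-1 + (y ^- 2 - 1)).
    by move=> a0 y0; field; rewrite a0 y0.
  rewrite [leRHS]mulrA ler_pM2r // aux // gt_eqF // subr_gt0 //.
move=> {}h; apply: le_trans h _; apply: lerD.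
  by rewrite lef_pV2 ?posrE.
have : 0 <= xmax by rewrite divr_ge0 ?ler0n.
move: xmax x1 => y y1 y0; rewrite lerBlDr -exprVn expr2.
have y2 : 0 < 1 - y by lra.
rewrite -invfM -[leLHS]div1r ler_pdivrMr ?mulr_gt0 //.
have : y <= 1/2 by lra.
nra.
Qed.

End SecondMoment.

Section Swap.
Variables (R : realType) (n M : nat).
Local Notation G := ('I_M * 'I_M)%type.
Local Notation conf := {ffun 'I_n -> G}.

(** Exchanging the coordinates preserves the uniform measure, so bounds for rows and widths also
    serve for columns and heights. *)
Definition fsw (f : conf) : conf := [ffun i => ((f i).2, (f i).1)].

Lemma fswK : involutive fsw.
Proof. by move=> f; apply/ffunP => i; rewrite !ffunE; case: (f i). Qed.

Lemma fpos_fsw f : fpos (fsw f) = swp \o fpos f.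
Proof. by apply: funext => i; rewrite /fpos ffunE. Qed.

Lemma pr_fsw (A : {set conf}) : pr R [set f | fsw f \in A] = pr R A.
Proof.
rewrite /pr -(card_imset [set f | fsw f \in A] (can_inj fswK)); congr (_%:R / _).
apply: eq_card => f; apply/imsetP/idP => [[g]|fA]; first by rewrite in_set => gA ->.
by exists (fsw f); rewrite ?in_set fswK.
Qed.

End Swap.

(** * Probability that good rows or isolated points are missing *)

Section Blocks.
Variables (R : realType) (n w B beta T1 : nat).
Hypotheses (w0 : (0 < w)%N) (B12 : (12 < B)%N).
Local Notation M := (B * beta * w)%N.
Local Notation G := ('I_M * 'I_M)%type.
Local Notation conf := {ffun 'I_n -> G}.
Local Notation mu := (n%:R / #|{: G}|%:R : R).
Hypothesis G0 : 0 < #|{: G}|%:R :> R.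

(** [B - 12] leaves the margin of 6 that [skeleton] demands at both ends of a block. *)
Definition row_bad (f : conf) (i a : nat) := [forall t : 'I_(B - 12), [exists x : 'I_(3 * B),
  (#|[set v : 'I_n | ((fpos f v).1 %/ w == B * i + x) && ((fpos f v).2 %/ w == B * a + 6 + t)]| < T1)%N]].

Lemma fpos_lt (f : conf) v : ((fpos f v).1 < M)%N /\ ((fpos f v).2 < M)%N.
Proof. by split; apply: ltn_ord. Qed.

Definition row_conf i a : {set conf} := [set f : conf | row_bad f i a].

Definition skeleton_conf : {set conf} := [set f : conf | `[< skeleton T1 w0 (fpos_lt f) >]].

Lemma skeleton_conf_sub : ~: skeleton_conf \subset
  \bigcup_(p : 'I_beta * 'I_beta | (p.1 + 3 <= beta)%N) (row_conf p.1 p.2 :|: [set f | fsw f \in row_conf p.1 p.2]).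
Proof.
apply/subsetP => f; rewrite in_setC in_set => /asboolPn nf.
apply: contrapT => no; apply: nf => i a ib ab.
have i_lt : (i < beta)%N by move: ib; clear; lia.
have nr : f \notin row_conf i a /\ fsw f \notin row_conf i a.
  split; apply/negP => h; apply: no; apply/bigcupP; exists (Ordinal i_lt, Ordinal ab) => //.
    by rewrite in_setU h.
  by rewrite in_setU orbC [X in X || _]in_set h.
have lt t : (t < B - 12)%N -> [/\ B * a + 6 <= B * a + 6 + t, B * a + 6 + t + 6 < B * a + B & B * a + 6 + t < B * beta]%N.
  move=> tB; have : (B * a.+1 <= B * beta)%N by rewrite leq_mul2l ab orbT.
  by move: tB; rewrite mulnS; clear => h1 h2; split; lia.
have fx (x : 'I_(B * beta)) : (B * i <= x)%N -> (x < B * i + 3 * B)%N -> exists2 x' : 'I_(3 * B), (B * i + x' = x)%N & True.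
  move=> h1 h2; have h3 : (x - B * i < 3 * B)%N by move: h1 h2; clear; lia.
  by exists (Ordinal h3); rewrite ?subnKC.
case: nr => [nr nc]; split.
- move: nr; rewrite in_set negb_forall => /existsP[t]; rewrite negb_exists => /forallP h.
  have [h1 h2 h3] := lt (t : nat) (ltn_ord t); exists (Ordinal h3); split=> // x xi1 xi2.
  have [x' x'E _] := fx x xi1 xi2; have := h x'; rewrite -leqNgt x'E => h4.
  apply: leq_trans h4 _; apply: subset_leq_card; apply/subsetP => v; rewrite !in_set => /andP[/eqP e1 /eqP e2].
  by rewrite -?[coarse _ _ _]/(_, _) ?xpair_eqE -?val_eqE /= e1 e2 !eqxx.
- move: nc; rewrite in_set negb_forall => /existsP[t]; rewrite negb_exists => /forallP h.
  have [h1 h2 h3] := lt (t : nat) (ltn_ord t); exists (Ordinal h3); split=> // x xi1 xi2.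
  have [x' x'E _] := fx x xi1 xi2; have := h x'; rewrite -leqNgt x'E fpos_fsw => h4.
  apply: leq_trans h4 _; apply: subset_leq_card; apply/subsetP => v; rewrite !in_set => /andP[/eqP e1 /eqP e2].
  by rewrite -?[coarse _ _ _]/(_, _) ?xpair_eqE -?val_eqE /= e1 e2 !eqxx.
Qed.

Definition row_reg i a (c : {ffun 'I_(B - 12) -> 'I_(3 * B)}) : {set G} :=
  [set p : G | [exists t : 'I_(B - 12), (p.1 %/ w == B * i + c t)%N && (p.2 %/ w == B * a + 6 + t)%N]].

Lemma row_reg_ge i a c : (i + 3 <= beta)%N -> (a < beta)%N -> ((B - 12) * (w * w) <= #|row_reg i a c|)%N.
Proof.
move=> ib ab.
rewrite -[X in (X * _)%N](card_ord (B - 12)) -{1 2}[w](card_ord w) -!card_prod -cardsT.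
apply: (card_ge_inj (phi := fun p : 'I_(B - 12) * ('I_w * 'I_w) =>
  ((B * i + c p.1) * w + p.2.1, (B * a + 6 + p.1) * w + p.2.2)%N)).
- move=> [t [x y]] [t' [x' y']] _ _ /= [e1 e2].
  have dE q r : (r < w)%N -> ((q * w + r) %/ w = q)%N by move=> rw; rewrite divnMDl // divn_small // addn0.
  have tt : t = t'.
    apply: val_inj; have := congr1 (fun q => q %/ w)%N e2; rewrite !dE //.
    by move/eqP; rewrite eqn_add2l => /eqP.
  rewrite -tt in e1 e2 *; congr (_, (_, _)); apply: val_inj; apply/eqP.
    by rewrite -(eqn_add2l ((B * i + c t) * w)); apply/eqP.
  by rewrite -(eqn_add2l ((B * a + 6 + t) * w)); apply/eqP.
- move=> [t [x y]] _ /=.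
  have lt q z : (q < B * beta)%N -> (z < w)%N -> (q * w + z < M)%N.
    move=> h1 h2; apply: (@leq_trans (q.+1 * w)); last by rewrite leq_mul2r h1 orbT.
    by rewrite mulSn addnC ltn_add2r.
  have h1 : (B * (i + 3) <= B * beta)%N by rewrite leq_mul2l ib orbT.
  have h2 : (B * a.+1 <= B * beta)%N by rewrite leq_mul2l ab orbT.
  split; apply: lt => //.
    by apply: leq_trans h1; rewrite mulnDr ltn_add2l [X in (_ < X)%N]mulnC; apply: ltn_ord.
  by apply: leq_trans h2; have := ltn_ord t; rewrite mulnS; clear; lia.
- move=> p [t [x y]] _ /= [e1 e2]; rewrite in_set; apply/existsP; exists t.
  by rewrite e1 e2 !divnMDl // !divn_small // !addn0 !eqxx.
Qed.

Let K := ((B - 12) * T1)%N.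

(** Choosing a deficient cell [c t] in every row gives a region of [B - 12] cells with at most [K]
    points in all. For large [B] its area is a large multiple of that of a disc, which makes this
    far less likely than an isolated point. *)
Lemma row_conf_sub i a : row_conf i a \subset
  \bigcup_(p : {ffun 'I_(B - 12) -> 'I_(3 * B)} * 'I_K.+1)
     pattern_event n (fun q : p.2.-tuple G => all (mem (row_reg i a p.1)) q) (fun=> row_reg i a p.1).
Proof.
apply/subsetP => f; rewrite in_set => /forallP bad.
have B3 : (0 < 3 * B)%N by move: B12; clear; lia.
pose c : {ffun 'I_(B - 12) -> 'I_(3 * B)} := [ffun t : 'I_(B - 12) => odflt (Ordinal B3) [pick x : 'I_(3 * B) |
   (#|[set v : 'I_n | ((fpos f v).1 %/ w == B * i + x) && ((fpos f v).2 %/ w == B * a + 6 + t)]| < T1)%N]].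
have cP t : (#|[set v : 'I_n | ((fpos f v).1 %/ w == B * i + c t) && ((fpos f v).2 %/ w == B * a + 6 + t)]| < T1)%N.
  rewrite ffunE; case: pickP => [x //|no].
  by have /existsP[x] := bad t; rewrite no.
set S := [set v : 'I_n | f v \in row_reg i a c].
have SK : (#|S| < K.+1)%N.
  rewrite ltnS.
  have -> : S = \bigcup_(t : 'I_(B - 12)) [set v : 'I_n | ((fpos f v).1 %/ w == B * i + c t)%N && ((fpos f v).2 %/ w == B * a + 6 + t)%N].
    apply/setP => v; rewrite !in_set; apply/existsP/bigcupP => [[t h]|[t _]]; first by exists t; rewrite ?in_set.
    by rewrite in_set => h; exists t.
  apply: leq_trans (card_bigU_le _ _) _; apply: leq_trans (leq_sum _ (fun t _ => ltnW (cP t))) _.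
  by rewrite sum_nat_const card_ord.
apply/bigcupP; exists (c, Ordinal SK) => //; rewrite in_set /=.
apply/existsP; exists (enum_tuple S); apply/existsP; exists (map_tuple f (enum_tuple S)).
apply/and3P; split; first exact: enum_uniq.
  by apply/allP => _ /mapP[v + ->]; rewrite mem_enum in_set.
rewrite in_set eqxx; apply/forallP => v; rewrite mem_enum in_set.
by case: (_ \in _).
Qed.

(** Half of the exponent absorbs the power, and the other half survives. *)
Lemma expR_pow_le (y : R) k : 0 <= y -> y ^+ k * expR (- y) <= 2 ^+ k * k`!%:R * expR (- (y / 2)).
Proof.
move=> y0; have y2 : 0 <= y / 2 by rewrite divr_ge0.
have h : (y / 2) ^+ k <= k`!%:R * expR (y / 2).
  case: k => [|k]; first by rewrite expr0 fact0 mul1r (le_trans _ (expR_ge1Dx _)) // lerDl.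
  rewrite [leRHS]mulrC -ler_pdivrMr ?ltr0n ?fact_gt0 //; apply: le_trans (expR_ge1Dxn k y2).
  by rewrite lerDr ler01.
have -> : expR (- y) = expR (- (y / 2)) * expR (- (y / 2)) by rewrite -expRD; congr expR; field.
have -> : y ^+ k = 2 ^+ k * (y / 2) ^+ k by rewrite -exprMn; congr (_ ^+ _); field.
have : (y / 2) ^+ k * expR (- (y / 2)) <= k`!%:R.
  by rewrite expRN ler_pdivrMr ?expR_gt0.
move: (expR_ge0 (- (y / 2))); move: (expR _) => E E0 h2.
have -> : 2 ^+ k * (y / 2) ^+ k * (E * E) = (2 ^+ k * E) * ((y / 2) ^+ k * E) by ring.
have -> : 2 ^+ k * k`!%:R * E = (2 ^+ k * E) * k`!%:R by ring.
by rewrite ler_wpM2l // mulr_ge0 ?exprn_ge0.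
Qed.

Definition row_constant : R := \sum_(p : {ffun 'I_(B - 12) -> 'I_(3 * B)} * 'I_K.+1) expR 1 ^+ p.2 * (2 ^+ p.2 * p.2`!%:R).

Lemma pr_row_conf i a : (i + 3 <= beta)%N -> (a < beta)%N ->
  pr R (row_conf i a) <= row_constant * expR (- (mu * ((B - 12) * (w * w))%:R / 2)).
Proof.
move=> ib ab; apply: le_trans (pr_le R (row_conf_sub i a)) _; apply: le_trans (pr_bigU _ _ _) _.
rewrite mulr_suml; apply: ler_sum => -[c [k kK]] _ /=.
apply: le_trans (pr_pattern_event _ G0 _ _) _.
have mu0 : 0 <= mu by rewrite divr_ge0 ?ler0n.
rewrite sumr_const.
have ck : (#|[pred q : k.-tuple G | all (mem (row_reg i a c)) q]| <= #|row_reg i a c| ^ k)%N.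
  have := card_tuples_in (fun=> row_reg i a c) : (_ <= \prod_(j < k) _)%N.
  rewrite prod_nat_const card_ord; apply: leq_trans; apply: subset_leq_card.
  by apply/subsetP => q /allP h; rewrite in_set; apply/forallP => j; apply: h; apply: mem_tnth.
have em0 : 0 <= expR 1 * mu by rewrite (mulr_ge0 (expR_ge0 _) mu0).
apply: le_trans (_ : (expR 1 * mu) ^+ k * (expR (- (mu * #|row_reg i a c|%:R)) *+ (#|row_reg i a c| ^ k)) <= _).
  by rewrite ler_wpM2l ?exprn_ge0 //; apply: (ler_wpMn2l (expR_ge0 _) ck).
have y0 : 0 <= mu * #|row_reg i a c|%:R by rewrite (mulr_ge0 mu0).
have h := expR_pow_le k y0.
rewrite -[X in _ * X <= _]mulr_natl natrX.
have -> : (expR 1 * mu) ^+ k * (#|row_reg i a c|%:R ^+ k * expR (- (mu * #|row_reg i a c|%:R)))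
  = expR 1 ^+ k * ((mu * #|row_reg i a c|%:R) ^+ k * expR (- (mu * #|row_reg i a c|%:R))).
  set E := expR (- _); move: E; set m := mu; move: m => m E; rewrite !exprMn; ring.
rewrite -[leRHS]mulrA ler_wpM2l ?exprn_ge0 ?expR_ge0 //; apply: le_trans h _.
rewrite ler_wpM2l ?mulr_ge0 ?exprn_ge0 // ler_expR lerN2 ler_wpM2r ?invr_ge0 //.
by rewrite ler_wpM2l // ler_nat row_reg_ge.
Qed.

Lemma pr_skeleton_conf : pr R (~: skeleton_conf) <=
  2 * (beta * beta)%:R * row_constant * expR (- (mu * ((B - 12) * (w * w))%:R / 2)).
Proof.
apply: le_trans (pr_le R skeleton_conf_sub) _; apply: le_trans (pr_bigU _ _ _) _.
set C := expR _; have rc0 : 0 <= row_constant.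
  by apply: sumr_ge0 => p _; rewrite mulr_ge0 ?exprn_ge0 ?expR_ge0 // mulr_ge0 ?exprn_ge0.
apply: (@le_trans _ _ (\sum_(p : 'I_beta * 'I_beta) 2 * row_constant * C)); last first.
  by rewrite sumr_const -[leLHS]mulr_natl card_prod card_ord le_eqVlt; apply/orP; left; apply/eqP; ring.
rewrite [leLHS]big_mkcond /=; apply: ler_sum => -[i a] _ /=; case: ifP => [ib|_]; last first.
  by rewrite mulr_ge0 ?expR_ge0 ?mulr_ge0.
apply: le_trans (pr_setU _ _ _) _; rewrite pr_fsw.
have := pr_row_conf ib (ltn_ord a); rewrite -/C; lra.
Qed.


Variable s : nat.
Local Notation r := (s + 4)%N.

Definition isolated_conf : {set conf} := [set f : conf | [exists i, [forall j,
  (j != i) ==> (r * r < dsq (fpos f i) (fpos f j))%N]]].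

(** The middle cells of the blocks. In each direction two such positions are either within [w] or
    far apart, which gives the dichotomy for balls that the second moment needs; the density
    [1 / B ^ 2] costs only a constant factor. *)
Definition central : {set G} :=
  [set p : G | ((p.1 %/ w) %% B == B %/ 2)%N && ((p.2 %/ w) %% B == B %/ 2)%N].

Definition gball (c : G) : {set G} := [set y : G | (dsq (gpos c) (gpos y) <= r * r)%N].

Lemma card_central : (beta * w * (beta * w) <= #|central|)%N.
Proof.
have B0 : (0 < B)%N by apply: leq_trans B12.
have B2 : (B %/ 2 < B)%N by rewrite ltn_divLR // ltn_Pmulr.
rewrite -[X in (X * w * _)%N](card_ord beta) -[X in (_ * X * _)%N](card_ord w).
rewrite -[X in (_ * (X * w))%N](card_ord beta) -[X in (_ * (_ * X))%N](card_ord w) -!card_prod -cardsT.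
have dE q x : (x < w)%N -> ((q * w + x) %/ w = q)%N by move=> rw; rewrite divnMDl // divn_small // addn0.
have dB q : ((B * q + B %/ 2) %/ B = q)%N by rewrite mulnC divnMDl // (divn_small B2) addn0.
have inj (i j : 'I_beta) (x y : 'I_w) : ((B * i + B %/ 2) * w + x = (B * j + B %/ 2) * w + y)%N -> (i, x) = (j, y).
  move=> e; have := congr1 (fun q => q %/ w %/ B)%N e; rewrite !dE // !dB => ij.
  have {}ij : i = j by apply: val_inj.
  rewrite ij in e *; congr (_, _); apply: val_inj; apply/eqP.
  by rewrite -(eqn_add2l ((B * j + B %/ 2) * w)); apply/eqP.
apply: (card_ge_inj (phi := fun p : ('I_beta * 'I_w) * ('I_beta * 'I_w) =>
  ((B * p.1.1 + B %/ 2) * w + p.1.2, (B * p.2.1 + B %/ 2) * w + p.2.2)%N)).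
- by move=> [[i x] [j y]] [[i' x'] [j' y']] _ _ /= [/inj-> /inj->].
- move=> [[i x] [j y]] _ /=.
  have lt (k : 'I_beta) (z : 'I_w) : ((B * k + B %/ 2) * w + z < M)%N.
    apply: (@leq_trans ((B * k.+1) * w)); last by rewrite leq_mul2r leq_mul2l (ltn_ord k) !orbT.
    apply: (@leq_trans ((B * k + B %/ 2).+1 * w)); first by rewrite mulSn addnC ltn_add2r.
    by rewrite leq_mul2r mulnS [X in (_ < X)%N]addnC ltn_add2l B2 orbT.
  by split; apply: lt.
- move=> p [[i x] [j y]] _ /= [e1 e2]; rewrite in_set e1 e2 !dE //.
  have mE q : ((B * q + B %/ 2) %% B = B %/ 2)%N by rewrite mulnC modnMDl modn_small.
  by rewrite !mE !eqxx.
Qed.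

(** If the balls meet, each coordinate differs by at most [2 * (s + 4) <= 11 * w], which uses
    [8 <= w]. Since [B > 12], equal residues then force equal cells, so the centres are within [w]
    in both coordinates. *)
Lemma gball_disj c c' : (8 <= w)%N -> s = (5 * w)%N -> c \in central -> c' \in central ->
  c' \notin gball c -> [disjoint gball c & gball c'].
Proof.
move=> w8 sE; rewrite !in_set => /andP[/eqP c1 /eqP c2] /andP[/eqP c1' /eqP c2'] nb.
rewrite disjoint_subset; apply/subsetP => y; rewrite in_set => /dsq_le[h1 h2].
rewrite inE in_set; apply/negP => /dsq_le[h3 h4]; move/negP: nb; apply.
have close (a b z : nat) : (adn a z <= r)%N -> (adn b z <= r)%N -> (a %/ w %% B = B %/ 2)%N -> (b %/ w %% B = B %/ 2)%N ->
  (adn a b <= w)%N.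
  move=> az bz aB bB; have ab : (adn a b <= 11 * w)%N.
    apply: leq_trans (adn_tri _ z _) _; rewrite (adnC z).
    by apply: leq_trans (leq_add az bz) _; rewrite sE; move: w8; clear; lia.
  have h : (a %/ w = b %/ w)%N.
    have d1 := near_divn w0 ab; have d2 : (b %/ w <= a %/ w + 11)%N by apply: near_divn; rewrite // adnC.
    move: d1 d2; rewrite (divn_eq (a %/ w) B) (divn_eq (b %/ w) B) aB bB.
    move: (_ %/ _)%N (_ %/ _)%N (_ %/ _)%N => x' b' x.
    move=> d1 d2; suff -> : x = x' by [].
    have e1 : (x * B <= x' * B + 11)%N by move: d1; clear; lia.
    have e2 : (x' * B <= x * B + 11)%N by move: d2; clear; lia.
    apply/eqP; rewrite eqn_leq; apply/andP; split; rewrite leqNgt; apply/negP => h.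
      have : (x'.+1 * B <= x * B)%N by rewrite leq_mul2r h orbT.
      by rewrite mulSn; move: e1 B12; clear; lia.
    have : (x.+1 * B <= x' * B)%N by rewrite leq_mul2r h orbT.
    by rewrite mulSn; move: e2 B12; clear; lia.
  by have := @divn_near a b w 0 w0; rewrite h addn0 leqnn mul1n => /(_ isT isT).
apply: (@dsq_ge _ _ w); first exact: (close _ _ _ h1 h3 c1 c1').
  exact: (close _ _ _ h2 h4 c2 c2').
rewrite mulnA; apply: leq_mul; rewrite sE; clear; lia.
Qed.

Lemma pr_isolated_conf (m : R) (N := (4 * quarter s + 72 * (s + 4).+1)%N) :
  (8 <= w)%N -> s = (5 * w)%N -> (1 < n)%N ->
  N%:R / #|{: G}|%:R <= 2^-1 :> R -> 0 < m ->
  m <= mu * (beta * w * (beta * w))%:R * (1 - N%:R / #|{: G}|%:R) ^+ n ->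
  pr R (~: isolated_conf) <= m^-1 + 8 * (N%:R / #|{: G}|%:R).
Proof.
move=> w8 sE n1 x1 m0 hm.
have sub : ~: isolated_conf \subset ~: lonely_conf n central gball.
  rewrite setCS; apply/subsetP => f; rewrite in_set => /existsP[i /andP[_ /forallP h]].
  rewrite in_set; apply/existsP; exists i; apply/forallP => j; apply/implyP => ji.
  by have := h j; rewrite ji /= in_set -ltnNge.
apply: le_trans (pr_le R sub) _.
have bN c : (#|gball c| <= N)%N.
  apply: (@ball_card_le M s 4 (gpos c)); rewrite sE; move: w8; clear; lia.
apply: pr_not_lonely => //; first by apply: ltnW.
- by move=> c c' cC cC' h; apply: (gball_disj w8 sE cC cC' h).
apply: le_trans hm _.
have x10 : 0 <= 1 - N%:R / #|{: G}|%:R :> R by move: x1; move: (N%:R / _) => x; lra.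
have x11 : 1 - N%:R / #|{: G}|%:R <= 1 :> R by rewrite lerBlDr lerDl divr_ge0.
rewrite -mulr_suml mulrA -[leRHS]mulrAC -mulrA ler_wpM2l ?divr_ge0 //.
apply: (@le_trans _ _ (\sum_(c in central) (1 - N%:R / #|{: G}|%:R) ^+ n)).
  by rewrite sumr_const -[leRHS]mulr_natl ler_wpM2r ?exprn_ge0 // ler_nat card_central.
apply: ler_sum => c _; apply: (@le_trans _ _ ((1 - N%:R / #|{: G}|%:R) ^+ n.-1)).
  by apply: ler_wiXn2l => //; apply: leq_pred.
have xc : 1 - N%:R / #|{: G}|%:R <= 1 - #|gball c|%:R / #|{: G}|%:R :> R.
  by rewrite lerD2l lerN2 ler_wpM2r ?invr_ge0 // ler_nat bN.
by rewrite lerXn2r ?nnegrE // (le_trans x10).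
Qed.

End Blocks.

Lemma card_ord_ge M m : (#|[set x : 'I_M | M <= x + m]| <= m)%N.
Proof.
rewrite cardE -(size_map val) -[X in (_ <= X)%N](size_iota (M - m)); apply: uniq_leq_size.
  by rewrite map_inj_uniq ?enum_uniq //; apply: val_inj.
move=> x /mapP[y]; rewrite mem_enum in_set => ym ->; rewrite mem_iota.
have := ltn_ord y; move: ym; clear => /= h1 h2; lia.
Qed.

Lemma card_side_lt E M : (#|[set x : 'I_M | side E M x < 2]| <= 2 * E)%N.
Proof.
have sub : [set x : 'I_M | side E M x < 2]%N \subset [set x : 'I_M | x < E]%N :|: [set x : 'I_M | M <= x + E]%N.
  by apply/subsetP => x; rewrite in_setU !in_set /side; case: (leqP E) => //= h1; case: (ltnP (x + E)).
apply: leq_trans (subset_leq_card sub) _; apply: leq_trans (leq_card_setU _ _) _.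
by rewrite mul2n -addnn leq_add ?card_ord_lt ?card_ord_ge.
Qed.

(** * Asymptotics *)

Section SideSum.
Variables (R : realType) (n M s D : nat).
Local Notation G := ('I_M * 'I_M)%type.
Variable mu : R.
Hypothesis muE : mu = n%:R / #|{: G}|%:R.
Local Notation E := (D + s)%N.
Hypothesis G0 : 0 < #|{: G}|%:R :> R.
Hypothesis EM : (2 * E <= M)%N.
Variable lam : R.
Hypothesis lamE : lam = 4 * (mu * (quarter s)%:R).

(** The terms come from the interior, the sides and the corners, where a disc keeps its whole area,
    at least a half, or at least a quarter. *)
Lemma side_sum_le3 : side_sum R n M s D <=
  n%:R * expR (- lam) + 4 * (mu * (E * M)%:R * expR (- (lam / 2))) + 4 * (mu * (E * E)%:R * expR (- (lam / 4))).
Proof.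
have mu0 : 0 <= mu by rewrite muE divr_ge0 ?ler0n.
have gE : #|{: G}|%:R = (M * M)%:R :> R by rewrite card_prod card_ord.
pose x1 (v : G) : R := (side E M v.1 < 2)%N%:R.
pose x2 (v : G) : R := (side E M v.2 < 2)%N%:R.
have sd x : (side E M x = 1 \/ side E M x = 2)%N.
  rewrite /side; case: leqP => h1; case: ltnP => h2; rewrite /=; auto.
  by move: h1 h2 EM; clear; lia.
have pt (v : G) : expR (- (mu * (side E M v.1 * side E M v.2 * quarter s)%:R)) <=
   expR (- lam) + x1 v * expR (- (lam / 2)) + x2 v * expR (- (lam / 2)) + x1 v * x2 v * expR (- (lam / 4)).
  have := expR_ge0 (- lam); have := expR_ge0 (- (lam / 2)); have := expR_ge0 (- (lam / 4)).
  rewrite /x1 /x2 !natrM; case: (sd v.1) => ->; case: (sd v.2) => -> /=.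
  - have -> : mu * (1 * 1 * (quarter s)%:R) = lam / 4 by rewrite lamE; field.
    by move: (expR _) (expR _) (expR _) => a b c; lra.
  - have -> : mu * (1 * 2 * (quarter s)%:R) = lam / 2.
      by rewrite lamE; field.
    by move: (expR _) (expR _) (expR _) => a b c; lra.
  - have -> : mu * (2 * 1 * (quarter s)%:R) = lam / 2.
      by rewrite lamE; field.
    by move: (expR _) (expR _) (expR _) => a b c; lra.
  - have -> : mu * (2 * 2 * (quarter s)%:R) = lam.
      by rewrite lamE; field.
    by move: (expR _) (expR _) (expR _) => a b c; lra.
have c1 : \sum_(x : 'I_M) (side E M x < 2)%N%:R <= (2 * E)%:R :> R.
  rewrite -natr_sum ler_nat; apply: leq_trans (card_side_lt E M).
  rewrite -sum1_card [X in (_ <= X)%N]big_mkcond /=; apply: leq_sum => x _; rewrite in_set.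
  by case: (_ < _)%N.
have c10 : 0 <= \sum_(x : 'I_M) (side E M x < 2)%N%:R :> R by rewrite sumr_ge0.
rewrite /side_sum -muE.
apply: (@le_trans _ _ (mu * \sum_(v : G) (expR (- lam) + x1 v * expR (- (lam / 2)) + x2 v * expR (- (lam / 2)) + x1 v * x2 v * expR (- (lam / 4))))).
  by rewrite ler_wpM2l // ler_sum.
rewrite !big_split /= -!mulr_suml sumr_const -[_ *+ _]mulr_natl.
have -> : \sum_v x1 v = M%:R * \sum_(x : 'I_M) (side E M x < 2)%N%:R.
  rewrite -(pair_big xpredT xpredT (fun x y : 'I_M => (side E M x < 2)%N%:R)) /= mulr_sumr.
  by apply: eq_bigr => x _; rewrite sumr_const card_ord mulr_natl.
have -> : \sum_v x2 v = M%:R * \sum_(x : 'I_M) (side E M x < 2)%N%:R.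
  rewrite -(pair_big xpredT xpredT (fun x y : 'I_M => (side E M y < 2)%N%:R)) /= sumr_const card_ord.
  by rewrite mulr_natl.
have -> : \sum_v x1 v * x2 v = (\sum_(x : 'I_M) (side E M x < 2)%N%:R) * \sum_(x : 'I_M) (side E M x < 2)%N%:R.
  rewrite -(pair_big xpredT xpredT (fun x y : 'I_M => (side E M x < 2)%N%:R * (side E M y < 2)%N%:R)) /= mulr_suml.
  by apply: eq_bigr => x _; rewrite mulr_sumr.
set S := \sum_(x : 'I_M) _ in c1 c10 *.
have cc : S * S <= (2 * E)%:R * (2 * E)%:R by apply: ler_pM.
have ccM : M%:R * S <= M%:R * (2 * E)%:R by rewrite ler_wpM2l.
rewrite !mulrDr; have -> : mu * (#|{: G}|%:R * expR (- lam)) = n%:R * expR (- lam) by rewrite muE; field; rewrite gt_eqF.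
have e1 : mu * (M%:R * S * expR (- (lam / 2))) <= mu * (M%:R * (2 * E)%:R * expR (- (lam / 2))).
  by rewrite ler_wpM2l // ler_wpM2r ?expR_ge0.
have e2 : mu * (S * S * expR (- (lam / 4))) <= mu * ((2 * E)%:R * (2 * E)%:R * expR (- (lam / 4))).
  by rewrite ler_wpM2l // ler_wpM2r ?expR_ge0.
have f1 : mu * (M%:R * (2 * E)%:R * expR (- (lam / 2))) = 2 * (mu * (E * M)%:R * expR (- (lam / 2))).
  by rewrite !natrM; ring.
have f2 : mu * ((2 * E)%:R * (2 * E)%:R * expR (- (lam / 4))) = 4 * (mu * (E * E)%:R * expR (- (lam / 4))).
  by rewrite !natrM; ring.
rewrite f1 in e1; rewrite f2 in e2; move: e1 e2; clear.
move: (mu * _) (mu * _) (mu * _ * _) (mu * _ * _) (n%:R * _) => a b c d e; lra.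
Qed.

Variables (z L C : R) (P : nat).
Hypotheses (z1 : 1 <= z) (LE : L = z ^+ (2 * P)) (lamL : lam <= 2 * L)
  (nz : n%:R * expR (- lam) <= z) (C0 : 0 <= C) (EC : mu * (E * E)%:R <= C ^+ 2 * lam).

(** Since [mu * M ^ 2 = n], the square of the side term is [mu * E ^ 2] times the interior term,
    hence at most of order [z * L]. With [L = z ^ (2 * P)] the sides dominate the bound. *)
Lemma side_sum_le : side_sum R n M s D <= (1 + 8 * C + 16 * C ^+ 2) * z ^+ P.+1.
Proof.
have z0 : 0 <= z by apply: le_trans z1.
have mu0 : 0 <= mu by rewrite muE divr_ge0 ?ler0n.
apply: le_trans side_sum_le3 _.
have zP : 1 <= z ^+ P.+1 by rewrite exprn_ege1.
have t1 : z <= z ^+ P.+1 by rewrite -{1}[z]expr1 ler_weXn2l.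
have t3 : mu * (E * E)%:R * expR (- (lam / 4)) <= 4 * C ^+ 2.
  apply: le_trans (ler_wpM2r (expR_ge0 _) EC) _.
  have : lam / 4 * expR (- (lam / 4)) <= 1.
    rewrite expRN ler_pdivrMr ?expR_gt0 // mul1r (le_trans _ (expR_ge1Dx _)) //.
    by rewrite lerDr.
  have := sqr_ge0 C; move: (expR _) (C ^+ 2) => e c c0 h.
  have -> : c * lam * e = 4 * c * (lam / 4 * e) by field.
  by rewrite -[leRHS]mulr1 ler_wpM2l // mulr_ge0.
have t2 : mu * (E * M)%:R * expR (- (lam / 2)) <= 2 * C * z ^+ P.+1.
  rewrite -(@ler_pXn2r _ 2) ?nnegrE //; last 2 first.
  - by rewrite (mulr_ge0 _ (expR_ge0 _)) // (mulr_ge0 mu0).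
  - by rewrite mulr_ge0 ?(le_trans ler01 zP) // mulr_ge0.
  have -> : (mu * (E * M)%:R * expR (- (lam / 2))) ^+ 2 = (mu * (E * E)%:R) * (n%:R * expR (- lam)).
    have -> : expR (- lam) = expR (- (lam / 2)) ^+ 2 by rewrite expr2 -expRD; congr expR; field.
    have -> : n%:R = mu * (M%:R * M%:R).
      by rewrite -natrM -[in X in _ = _ * X](card_ord M) -card_prod muE; field; rewrite gt_eqF.
    by rewrite !natrM; ring.
  apply: le_trans (ler_pM _ _ EC nz) _; rewrite ?(mulr_ge0 mu0) ?mulr_ge0 ?expR_ge0 //.
  apply: (@le_trans _ _ (C ^+ 2 * (2 * L) * z)).
    by rewrite ler_wpM2r // ler_wpM2l ?sqr_ge0.
  have -> : (2 * C * z ^+ P.+1) ^+ 2 = C ^+ 2 * (2 * L) * z * (2 * z).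
    by rewrite LE !exprMn -!exprM -[in LHS]mulnC mulnS exprD; move: (z ^+ (2 * P)) => t; ring.
  have z2 : 1 <= 2 * z by apply: le_trans z1 _; rewrite ler_peMl // ler1n.
  by rewrite ler_peMr // !mulr_ge0 ?sqr_ge0 // LE exprn_ge0.
have C2 : C ^+ 2 <= C ^+ 2 * z ^+ P.+1 by rewrite ler_peMr ?sqr_ge0.
have t0 := le_trans nz t1; move: t0 t2 t3 C2.
move: (mu * _ * _) (mu * _ * _) (n%:R * _) (z ^+ _) (C ^+ 2) => a b c y D2 h1 h2 h3 h4; lra.
Qed.

End SideSum.

Lemma expR_sq_le (R : realType) (x : R) : 0 <= x -> x ^+ 2 <= 2 * expR x.
Proof.
move=> x0; have := expR_ge1Dxn 1 x0; have -> : (2`!)%:R = 2 :> R by [].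
by rewrite -ler_pdivrMl // mulrC => h; apply: le_trans h; rewrite lerDr.
Qed.

Lemma expR_le_1Bn (R : realType) (x : R) n : 0 <= x <= 1 / 2 ->
  expR (- (n%:R * x + 2 * (n%:R * x ^+ 2))) <= (1 - x) ^+ n.
Proof.
move=> /andP[x0 x1]; have y0 : 0 < 1 - x by lra.
have -> : n%:R * x + 2 * (n%:R * x ^+ 2) = n%:R * (x + 2 * x ^+ 2) by ring.
rewrite -mulrN expRM_natl lerXn2r ?nnegrE ?expR_ge0 ?(ltW y0) //.
rewrite expRN invf_ple ?posrE ?expR_gt0 //.
have : (1 - x)^-1 <= 1 + (x + 2 * x ^+ 2).
  rewrite -div1r ler_pdivrMr // expr2; nra.
by move/le_trans; apply; apply: expR_ge1Dx.
Qed.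

(* lam is the expected number of points in a disc of radius s, L = ln n, and h is
   about z s / L.  The side w of the coarse cells is a large multiple of n only to
   make discretization errors negligible. *)
Section Bounds.
Variables (R : realType) (n w B beta h P J0 T1 : nat).
Local Notation s := (5 * w)%N.
Local Notation M := (B * beta * w)%N.
Local Notation D := (13 * B * w)%N.
Local Notation G := ('I_M * 'I_M)%type.
Variables (mu lam z L : R).
Hypotheses (muE : mu = n%:R / #|{: G}|%:R) (G0 : 0 < #|{: G}|%:R :> R).
Hypothesis lamE : lam = 4 * (mu * (quarter s)%:R).
Hypotheses (n0 : (0 < n)%N) (w4 : w = (4 * n)%N) (B12 : (412 <= B)%N).
Hypotheses (z1 : 1 <= z) (P1 : (1 < P)%N) (LE : L = z ^+ (2 * P)) (nL : n%:R = expR L).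
Hypotheses (lamL : lam <= 2 * L) (Llam : L <= 2 * lam).
Hypotheses (nz : n%:R * expR (- lam) <= z) (zn : z <= expR 1 * (n%:R * expR (- lam))).
Hypotheses (h0 : (0 < h)%N) (hL : z * s%:R <= h%:R * L) (Lh : h%:R * L <= 2 * (z * s%:R)).
Hypotheses (h11 : (11 * h <= s)%N) (EM : (2 * (D + s) <= M)%N).

Variables (C C1 : R).
Hypotheses (CE : C = (13 * B + 6)%:R) (C1E : C1 = 1 + 8 * C + 16 * C ^+ 2).

Lemma z_ge0 : 0 <= z. Proof. exact: le_trans ler01 z1. Qed.
Lemma L_ge1 : 1 <= L. Proof. by rewrite LE exprn_ege1. Qed.
Lemma L_gt0 : 0 < L. Proof. exact: lt_le_trans ltr01 L_ge1. Qed.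
Lemma mu_ge0 : 0 <= mu. Proof. by rewrite muE divr_ge0. Qed.
Lemma w_even : (s = 2 * (10 * n))%N. Proof. by rewrite w4; clear; lia. Qed.

Lemma smu_le : mu * (s%:R * s%:R) <= lam.
Proof.
rewrite lamE [leRHS]mulrCA ler_wpM2l ?mu_ge0 // -!natrM ler_nat w_even.
by have := quarter_ge (10 * n); clear; move: (quarter _) => q; lia.
Qed.

Lemma lam_le : lam <= 4 * (mu * (s%:R * s%:R)).
Proof. by rewrite lamE ler_wpM2l // ler_wpM2l ?mu_ge0 // -natrM ler_nat quarter_le. Qed.

Lemma muM : mu * (M * M)%:R = n%:R.
Proof.
have -> : (M * M)%:R = #|{: G}|%:R :> R by rewrite card_prod card_ord.
by rewrite muE divfK // gt_eqF.
Qed.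

Lemma side_sum_bound : side_sum R n M s D <= C1 * z ^+ P.+1.
Proof.
rewrite C1E; apply: (@side_sum_le R n M s D mu muE G0 EM lam lamE z L C P z1 LE lamL nz); first by rewrite CE ler0n.
apply: (@le_trans _ _ (C ^+ 2 * (mu * (s%:R * s%:R)))).
  rewrite [leRHS]mulrCA ler_wpM2l ?mu_ge0 // CE expr2 -!natrM ler_nat.
  have : (D + s <= (13 * B + 6) * s)%N by move: B12; clear; nia.
  by move=> hh; apply: leq_trans (leq_mul hh hh) _; rewrite mulnACA.
by rewrite ler_wpM2l ?sqr_ge0 // smu_le.
Qed.

Lemma side_sum_ge0 : 0 <= side_sum R n M s D.
Proof. by rewrite /side_sum mulr_ge0 -?muE ?mu_ge0 // sumr_ge0 // => v _; apply: expR_ge0. Qed.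

(** The additional area [h * (s %/ 2)] holds at least [z / 16] points on average; the powers of [z]
    come from the side sum and from the [J + 4] factors [Lam], each of order [L]. *)
Lemma sparse_bound J : pr R (sparse_conf n M s h D J) <=
  ((J + 4) ^ 4)%:R * ((8 * expR 1 * C ^+ 2) ^+ (J + 4) * expR 1 * C1) * (z ^+ (2 * P * (J + 4) + P.+1) * expR (- (z / 16))).
Proof.
have e1 : 1 <= expR 1 :> R by apply: le_trans (expR_ge1Dx _); rewrite lerDl.
have C2 : 1 <= C ^+ 2 by rewrite CE exprn_ege1 // ler1n addn_gt0 orbT.
set Lam := 8 * expR 1 * C ^+ 2 * L.
have Lam1 : 1 <= Lam.
  rewrite /Lam; apply: mulr_ege1 L_ge1; apply: mulr_ege1 C2; apply: mulr_ege1 e1.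
  by rewrite ler1n.
have cond : expR 1 * (n%:R / #|{: G}|%:R) * (4 * ((D + s).+1 * (D + s).+1))%:R <= Lam.
  rewrite -muE.
  have c : ((D + s).+1 * (D + s).+1 <= (13 * B + 6) * (13 * B + 6) * (s * s))%N.
    have : ((D + s).+1 <= (13 * B + 6) * s)%N by move: B12 n0; rewrite w4; clear; nia.
    by move=> hh; apply: leq_trans (leq_mul hh hh) _; rewrite mulnACA.
  have {}c : ((D + s).+1 * (D + s).+1)%:R <= C ^+ 2 * (s%:R * s%:R) :> R.
    by rewrite CE expr2 -!natrM ler_nat.
  rewrite natrM; apply: (@le_trans _ _ (expR 1 * 4 * (C ^+ 2 * lam))).
    have -> : expR 1 * mu * (4 * ((D + s).+1 * (D + s).+1)%:R) = expR 1 * 4 * (mu * ((D + s).+1 * (D + s).+1)%:R) by ring.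
    rewrite ler_wpM2l ?mulr_ge0 ?expR_ge0 //.
    apply: le_trans (ler_wpM2l mu_ge0 c) _; rewrite mulrCA ler_wpM2l ?smu_le //.
    exact: le_trans ler01 C2.
  have -> : Lam = expR 1 * 4 * (C ^+ 2 * (2 * L)) by rewrite /Lam; ring.
  by rewrite ler_wpM2l ?mulr_ge0 ?expR_ge0 // ler_wpM2l ?lamL // (le_trans ler01).
have h2 : (2 * h <= s)%N by move: h11; clear; lia.
apply: le_trans (pr_sparse_conf J G0 Lam1 cond h2 EM) _.
rewrite -[leRHS]mulrA ler_wpM2l //.
have -> : (8 * expR 1 * C ^+ 2) ^+ (J + 4) * expR 1 * C1 * (z ^+ (2 * P * (J + 4) + P.+1) * expR (- (z / 16)))
   = Lam ^+ (J + 4) * expR 1 * (C1 * z ^+ P.+1) * expR (- (z / 16)).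
  by rewrite /Lam [(8 * expR 1 * C ^+ 2 * L) ^+ _]exprMn LE -exprM [z ^+ (_ + P.+1)]exprD; move: ((8 * _ * _) ^+ _) => a; ring.
have Lam0 : 0 <= Lam ^+ (J + 4) * expR 1 by rewrite mulr_ge0 ?expR_ge0 // exprn_ge0 // (le_trans ler01).
apply: ler_pM; [exact: (mulr_ge0 Lam0 side_sum_ge0)|exact: expR_ge0| |].
  by rewrite ler_wpM2l // side_sum_bound.
rewrite ler_expR lerN2 -muE natrM.
have sE : s%:R = 2 * (s %/ 2)%:R :> R by rewrite -natrM w_even mulKn.
rewrite -(ler_pM2r L_gt0).
have -> : mu * (h%:R * (s %/ 2)%:R) * L = (mu * s%:R / 2) * (h%:R * L).
  by rewrite sE; field.
have m0 : 0 <= mu * s%:R / 2 by rewrite divr_ge0 // mulr_ge0 ?mu_ge0.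
apply: le_trans (ler_wpM2l m0 hL).
have -> : mu * s%:R / 2 * (z * s%:R) = z / 8 * (4 * (mu * (s%:R * s%:R))) by field.
apply: (@le_trans _ _ (z / 8 * lam)); last by rewrite ler_wpM2l ?lam_le // divr_ge0 ?z_ge0.
have -> : z / 16 * L = z / 8 * (L / 2) by field.
by rewrite ler_wpM2l ?divr_ge0 ?z_ge0 // ler_pdivrMr // mulrC.
Qed.

(** The side sum gives [z ^ P.+1], the surplus close point [z ^ 2 / L], and the inner and annulus
    points [z ^ (3 * J0)]. With [L = z ^ (2 * P)] the exponent is [3 * J0 + 3 - P], and the choice
    of [P] makes it [-1]. *)
Lemma poor_bound : P = (3 * J0 + 4)%N -> 128 * expR 1 * z ^+ 2 <= L ->
  pr R (poor_conf n M s h J0) <=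
  (J0.+1 ^ 2)%:R * (expR 1 * C1 * expR 1 * (128 * expR 1) * (4096 * expR 1 ^+ 2 * (256 * expR 1)) ^+ J0) / z.
Proof.
move=> PE zL.
have e1 : 1 <= expR 1 :> R by apply: le_trans (expR_ge1Dx _); rewrite lerDl.
have e0 : 0 <= expR 1 :> R by apply: expR_ge0.
have z0 := z_ge0; have L0 := L_gt0; have s0 := smu_le; have mu0 := mu_ge0.
set del := 128 * expR 1 * z ^+ 2 / L.
have d1 : del <= 1 by rewrite ler_pdivrMr // mul1r.
have d0 : 0 <= del by rewrite divr_ge0 ?(ltW L0) // mulr_ge0 ?exprn_ge0 // mulr_ge0.
have sL : mu * (s%:R * s%:R) <= 2 * L := le_trans smu_le lamL.
have hh : h%:R <= 2 * (z * s%:R) / L by rewrite ler_pdivlMr.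
have q1 : expR 1 * (n%:R / #|{: G}|%:R) * (4 * (h.+1 * h.+1))%:R <= del.
  rewrite -muE; apply: (@le_trans _ _ (expR 1 * mu * (16 * (h%:R * h%:R)))).
    rewrite ler_wpM2l ?mulr_ge0 // -!natrM ler_nat; move: h0; clear; nia.
  apply: (@le_trans _ _ (expR 1 * mu * (16 * (2 * (z * s%:R) / L * (2 * (z * s%:R) / L))))).
    by rewrite ler_wpM2l ?mulr_ge0 // ler_wpM2l // ler_pM.
  have -> : expR 1 * mu * (16 * (2 * (z * s%:R) / L * (2 * (z * s%:R) / L)))
    = (64 * expR 1 * z ^+ 2 / (L * L)) * (mu * (s%:R * s%:R)) by field; rewrite gt_eqF.
  have -> : del = (64 * expR 1 * z ^+ 2 / (L * L)) * (2 * L) by rewrite /del; field; rewrite gt_eqF.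
  by rewrite ler_wpM2l // divr_ge0 ?mulr_ge0 ?exprn_ge0 ?(ltW L0).
have q2 : expR 1 * (n%:R / #|{: G}|%:R) * (32 * h * s.+1)%:R <= 256 * expR 1 * z.
  rewrite -muE; apply: (@le_trans _ _ (expR 1 * mu * (64 * (h%:R * s%:R)))).
    rewrite ler_wpM2l ?mulr_ge0 // -!natrM ler_nat w4; move: n0; clear; nia.
  apply: (@le_trans _ _ (expR 1 * mu * (64 * (2 * (z * s%:R) / L * s%:R)))).
    by rewrite ler_wpM2l ?mulr_ge0 // ler_wpM2l // ler_wpM2r.
  have -> : expR 1 * mu * (64 * (2 * (z * s%:R) / L * s%:R))
    = (128 * expR 1 * z / L) * (mu * (s%:R * s%:R)) by field; rewrite gt_eqF.
  have -> : 256 * expR 1 * z = (128 * expR 1 * z / L) * (2 * L) by field; rewrite gt_eqF.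
  by rewrite ler_wpM2l // divr_ge0 ?mulr_ge0 ?(ltW L0).
have q3 : del * (expR 1 * (n%:R / #|{: G}|%:R) * (4 * (s.+1 * s.+1))%:R) <= 4096 * expR 1 ^+ 2 * z ^+ 2.
  have -> : 4096 * expR 1 ^+ 2 * z ^+ 2 = del * (16 * expR 1 * (2 * L)) by rewrite /del; field; rewrite gt_eqF.
  rewrite ler_wpM2l // -muE; apply: (@le_trans _ _ (16 * expR 1 * (mu * (s%:R * s%:R)))).
    have -> : 16 * expR 1 * (mu * (s%:R * s%:R)) = expR 1 * mu * (16 * (s%:R * s%:R)) by ring.
    rewrite ler_wpM2l ?mulr_ge0 // -!natrM ler_nat w4; move: n0; clear; nia.
  by rewrite ler_wpM2l // mulr_ge0.
have W1 : 1 <= 256 * expR 1 * z by apply: mulr_ege1 z1; apply: mulr_ege1 e1; rewrite ler1n.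
have Y1 : 1 <= 4096 * expR 1 ^+ 2 * z ^+ 2.
  by apply: mulr_ege1; rewrite ?exprn_ege1 //; apply: mulr_ege1; rewrite ?exprn_ege1 // ler1n.
have key := @pr_poor_conf R n M s h D J0 G0 del _ _ h11 W1 Y1 d1 q1 q2 q3.
apply: le_trans key _.
rewrite -[leRHS]mulrA ler_wpM2l //.
apply: (@le_trans _ _ (expR 1 * (C1 * z ^+ P.+1) * expR 1 * del * (4096 * expR 1 ^+ 2 * z ^+ 2 * (256 * expR 1 * z)) ^+ J0)).
  rewrite ler_wpM2r ?exprn_ge0 ?(mulr_ge0 (le_trans ler01 Y1) (le_trans ler01 W1)) //.
  by rewrite ler_wpM2r // ler_wpM2r // ler_wpM2l // side_sum_bound.
have -> : 4096 * expR 1 ^+ 2 * z ^+ 2 * (256 * expR 1 * z) = (4096 * expR 1 ^+ 2 * (256 * expR 1)) * z ^+ 3 by ring.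
rewrite exprMn -exprM /del LE.
have -> : z ^+ (2 * P) = z ^+ P.+1 * z ^+ 2 * z ^+ (3 * J0) * z.
  by rewrite -!exprD -exprSr; congr (_ ^+ _); rewrite PE; clear; lia.
rewrite le_eqVlt; apply/orP; left; apply/eqP.
have zn0 : z != 0 by rewrite gt_eqF // (lt_le_trans ltr01).
move: (_ ^+ J0) (expf_neq0 (3 * J0) zn0) (expf_neq0 P.+1 zn0) => a.
by move: (z ^+ (3 * J0)) (z ^+ P.+1) => b c b0 c0; field; rewrite b0 c0 zn0.
Qed.


Lemma n_ge_z3 : z ^+ 3 <= n%:R.
Proof.
rewrite nL; apply: le_trans (_ : L <= _); last first.
  by apply: le_trans (expR_ge1Dx L); rewrite lerDr.
by rewrite LE ler_weXn2l //; move: P1; clear; lia.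
Qed.

(** [412] makes [B - 12] at least [400], for which the exponent in [pr_skeleton_conf] is at least
    [2 * lam]. There are at most [n] pairs of window and block, and [n * exp (- (2 * lam))] is at
    most [z ^ 2 / n], where [z ^ 3 <= n]. *)
Lemma skeleton_bound (w0 : (0 < w)%N) :
  pr R (~: skeleton_conf n B beta T1 w0) <= 2 * (@row_constant R B T1) / z.
Proof.
have B12' : (12 < B)%N by apply: leq_trans B12.
have z0 : 0 < z := lt_le_trans ltr01 z1.
have rc0 : 0 <= @row_constant R B T1.
  by apply: sumr_ge0 => p _; rewrite mulr_ge0 ?exprn_ge0 ?expR_ge0 // mulr_ge0 ?exprn_ge0.
have key := @pr_skeleton_conf R n w B beta T1 w0 B12' G0.
apply: le_trans key _; rewrite -muE.
have n0' : 0 < n%:R :> R by rewrite ltr0n.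
have mu0 := mu_ge0.
have e1 : 2 * lam <= mu * ((B - 12) * (w * w))%:R / 2.
  apply: (@le_trans _ _ (8 * (mu * (s%:R * s%:R)))).
    by have := lam_le; move: (mu * _) => a; lra.
  have -> : 8 * (mu * (s%:R * s%:R)) = mu * (400 * (w%:R * w%:R)) / 2 by rewrite natrM; field.
  rewrite ler_wpM2r ?invr_ge0 // ler_wpM2l // -!natrM ler_nat leq_mul2r; apply/orP; right.
  by move: B12; clear; lia.
have e2 : (beta * beta)%:R <= n%:R :> R.
  rewrite -muM.
  have -> : (B * beta * w * (B * beta * w))%:R = (beta * beta)%:R * ((B * B)%:R * (w * w)%:R) :> R.
    by rewrite -!natrM; congr (_%:R); clear; lia.
  rewrite mulrCA ler_peMr //.
  apply: (@le_trans _ _ (2 * (4 * (mu * (s%:R * s%:R))))).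
    apply: le_trans (_ : 2 * lam <= _); first exact: le_trans L_ge1 Llam.
    by rewrite ler_wpM2l // lam_le.
  have -> : 2 * (4 * (mu * (s%:R * s%:R))) = mu * (200 * (w * w)%:R) by rewrite !natrM; ring.
  rewrite ler_wpM2l // -!natrM ler_nat leq_mul2r; apply/orP; right.
  by apply: leq_trans (leq_mul B12 B12).
apply: (@le_trans _ _ (2 * n%:R * @row_constant R B T1 * expR (- (2 * lam)))).
  apply: ler_pM; rewrite ?expR_ge0 //; first by rewrite !mulr_ge0.
    by rewrite ler_wpM2r // ler_wpM2l.
  by rewrite ler_expR lerN2.
have -> : 2 * n%:R * @row_constant R B T1 * expR (- (2 * lam)) = 2 * @row_constant R B T1 * ((n%:R * expR (- lam)) ^+ 2 / n%:R).
  have -> : expR (- (2 * lam)) = expR (- lam) ^+ 2 by rewrite expr2 -expRD; congr expR; ring.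
  by field; rewrite gt_eqF.
rewrite ler_wpM2l ?mulr_ge0 // ler_pdivrMr // ler_pdivlMl //.
apply: (@le_trans _ _ (z * z ^+ 2)).
  by rewrite ler_wpM2l ?(ltW z0) // lerXn2r ?nnegrE ?(ltW z0) // mulr_ge0 ?expR_ge0.
by rewrite -exprS n_ge_z3.
Qed.

(** Here the fineness [w = 4 * n] matters: passing from radius [s] to [s + 4] adds only order [s]
    grid points, and [mu * s <= 1 / 10]. So the mean number of lonely points is still at least a
    constant times [z]. *)
Lemma isolated_bound : 128 <= z ->
  pr R (~: isolated_conf n w B beta s) <= ((B * B)%:R * expR (31 + 2 * (32 * 64)) + 512) / z.
Proof.
move=> z128.
have B12' : (12 < B)%N by apply: leq_trans B12.
have z0 : 0 < z := lt_le_trans ltr01 z1.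
have w0 : (0 < w)%N by rewrite w4 muln_gt0.
have n0' : 0 < n%:R :> R by rewrite ltr0n.
have mu0 := mu_ge0; have L0 := L_gt0; have L1 := L_ge1.
set N := (4 * quarter s + 72 * (s + 4).+1)%N.
have zL : z <= L by rewrite LE -{1}[z]expr1 ler_weXn2l //; move: P1; clear; lia.
have Ln : L ^+ 2 <= 2 * n%:R by rewrite nL expR_sq_le // ltW.
have Ln1 : L <= n%:R by rewrite nL; apply: le_trans (expR_ge1Dx _); rewrite lerDr.
have muN : mu * N%:R <= lam + 30.
  rewrite /N natrD mulrDr natrM mulrCA -lamE lerD2l.
  have sn : s%:R = 20 * n%:R :> R by rewrite -natrM w4; congr (_%:R); clear; lia.
  have ms : mu * s%:R <= 1 / 10.
    rewrite -(ler_pM2r (_ : 0 < s%:R)); last by rewrite sn mulr_gt0.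
    rewrite -mulrA; apply: le_trans smu_le _; apply: le_trans lamL _.
    rewrite sn; have := Ln1; move: (n%:R) => a b; lra.
  apply: (@le_trans _ _ (mu * (144 * s%:R))).
    by rewrite ler_wpM2l // -natrM ler_nat w4; move: n0; clear; lia.
  rewrite mulrCA; move: (mu * _) ms => a b; lra.
set x : R := N%:R / #|{: G}|%:R.
have xE : n%:R * x = mu * N%:R by rewrite /x muE; field; rewrite gt_eqF.
have x0 : 0 <= x by rewrite divr_ge0.
have xL : n%:R * x <= 32 * L.
  rewrite xE; apply: le_trans muN _; have := lamL; have := L1; move: (L) (lam) => a b; lra.
have xz : L * x <= 64.
  rewrite -(ler_pM2l L0); apply: (@le_trans _ _ (2 * (n%:R * x))).
    have -> : L * (L * x) = L ^+ 2 * x by ring.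
    by rewrite [leRHS]mulrA ler_wpM2r.
  by have := xL; move: (n%:R * x) (L) => a b; lra.
have xz' : z * x <= 64 by apply: le_trans xz; rewrite ler_wpM2r.
have x2 : x <= 1 / 2.
  rewrite -(ler_pM2l z0); apply: le_trans xz' _.
  by rewrite mulrA mulr1 ler_pdivlMr // -natrM.
have nx2 : n%:R * x ^+ 2 <= 32 * 64.
  have -> : n%:R * x ^+ 2 = (n%:R * x) * x by ring.
  apply: (@le_trans _ _ (32 * L * x)); first by rewrite ler_wpM2r.
  by rewrite -mulrA; move: (L * x) xz => a b; lra.
have powx : expR (- (lam + 30 + 2 * (32 * 64))) <= (1 - x) ^+ n.
  apply: le_trans (expR_le_1Bn n _); last by rewrite x0.
  by rewrite ler_expR lerN2 xE; move: (mu * _) (n%:R * _) muN nx2 => a b; lra.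
have BB : 0 < (B * B)%:R :> R by rewrite ltr0n muln_gt0 andbb (leq_trans _ B12).
set m : R := z / ((B * B)%:R * expR (31 + 2 * (32 * 64))).
have m0 : 0 < m by rewrite divr_gt0 // mulr_gt0 ?expR_gt0.
have muB : mu * (beta * w * (beta * w))%:R = n%:R / (B * B)%:R.
  rewrite -muM; have -> : (M * M)%:R = (B * B)%:R * (beta * w * (beta * w))%:R :> R.
    by rewrite -natrM; congr (_%:R); clear; lia.
  by rewrite [(B * B)%:R * _]mulrC mulrA mulfK // gt_eqF.
have hm : m <= mu * (beta * w * (beta * w))%:R * (1 - x) ^+ n.
  rewrite muB; apply: le_trans (_ : n%:R / (B * B)%:R * expR (- (lam + 30 + 2 * (32 * 64))) <= _); last first.
    by rewrite ler_wpM2l // divr_ge0.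
  rewrite /m; have -> : z / ((B * B)%:R * expR (31 + 2 * (32 * 64))) = (z * expR (- (31 + 2 * (32 * 64)))) / (B * B)%:R.
    by rewrite expRN; move: (expR _) => E; rewrite invfM mulrA mulrAC.
  have -> : n%:R / (B * B)%:R * expR (- (lam + 30 + 2 * (32 * 64))) = (n%:R * expR (- (lam + 30 + 2 * (32 * 64)))) / (B * B)%:R.
    by rewrite mulrAC.
  rewrite ler_wpM2r ?invr_ge0 //.
  apply: le_trans (ler_wpM2r (expR_ge0 _) zn) _.
  have -> : expR 1 * (n%:R * expR (- lam)) * expR (- (31 + 2 * (32 * 64))) = n%:R * expR (1 - lam - (31 + 2 * (32 * 64))).
    by rewrite !expRD; ring.
  by rewrite ler_wpM2l // ler_expR; move: (lam) => a; lra.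
have w8 : (8 <= w)%N.
  have : 8 <= n%:R :> R by apply: le_trans Ln1; apply: le_trans zL; apply: le_trans z128; lra.
  by rewrite ler_nat w4; clear; lia.
have n1 : (1 < n)%N.
  have : 2 <= n%:R :> R by apply: le_trans Ln1; apply: le_trans zL; apply: le_trans z128; lra.
  by rewrite ler_nat.
rewrite muE in hm.
have x2' : x <= 2^-1 by move: x2; move: (x) => a; lra.
apply: le_trans (pr_isolated_conf w0 B12' G0 w8 (erefl s) n1 x2' m0 hm) _.
rewrite [leRHS]mulrDl; apply: lerD; first by rewrite /m invf_div.
rewrite -[leLHS]/(8 * x) ler_pdivlMr // -mulrA [x * z]mulrC.
have -> : 512 = 8 * 64 :> R by ring.
by rewrite ler_wpM2l.
Qed.

End Bounds.

(** * Choice of the parameters *)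

Lemma sq_step (R : realType) (a b l : R) :
  a <= (b + 1) * (b + 1) * l -> 3 * l * b <= b * b -> l <= l * b -> a <= (l + 1) * (b * b).
Proof. lra. Qed.

Section ParameterChoice.
Variables (R : realType) (n B P : nat) (z L : R).
Local Notation w := (4 * n)%N.
Local Notation s := (5 * (4 * n))%N.
Hypotheses (B412 : (412 <= B)%N) (P1 : (1 < P)%N).
Hypotheses (zB : (16 * B * B)%:R <= z) (LE : L = z ^+ (2 * P)) (nL : n%:R = expR L).

Lemma z_ge : 1000 <= z.
Proof.
apply: le_trans zB; rewrite ler_nat; apply: (@leq_trans (16 * 412 * 412)) => //.
by apply: leq_mul => //; rewrite leq_mul2l B412.
Qed.

Lemma z_gt0 : 0 < z. Proof. by apply: lt_le_trans z_ge. Qed.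
Lemma z_ge1 : 1 <= z. Proof. by apply: le_trans z_ge; rewrite ler1n. Qed.

Lemma L_ge : z ^+ 2 <= L.
Proof. by rewrite LE ler_weXn2l ?z_ge1 //; move: P1; clear; lia. Qed.

Lemma L_ge_z : 1000 * z <= L.
Proof. by apply: le_trans L_ge; rewrite expr2 ler_wpM2r ?z_ge // ltW // z_gt0. Qed.

Lemma ln_n_gt0 : 0 < L. Proof. by apply: lt_le_trans L_ge; rewrite exprn_gt0 // z_gt0. Qed.

Lemma n_ge_L : L <= n%:R.
Proof. by rewrite nL; apply: le_trans (expR_ge1Dx L); rewrite lerDr. Qed.

Lemma n_gt0 : 0 < n%:R :> R. Proof. exact: lt_le_trans ln_n_gt0 n_ge_L. Qed.

Lemma n_ge_L4 : L ^+ 4 <= 24 * n%:R.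
Proof.
rewrite nL; have := expR_ge1Dxn 3 (ltW ln_n_gt0); have -> : (4`!)%:R = 24 :> R by [].
by rewrite -ler_pdivrMl // mulrC => h; apply: le_trans h; rewrite lerDr.
Qed.

(** [h] is the integer part of [z * s / L] plus 1, which is at most twice the quotient since the
    latter is at least 1. *)
Lemma exists_h : exists h : nat, [/\ (0 < h)%N, z * s%:R <= h%:R * L,
  h%:R * L <= 2 * (z * s%:R), (11 * h <= s)%N & (3 * h <= s)%N].
Proof.
have L0 := ln_n_gt0; have z0 := z_gt0.
set y := z * s%:R / L.
have sL : L <= s%:R.
  by apply: le_trans n_ge_L _; rewrite ler_nat mulnA leq_pmull.
have y1 : 1 <= y.
  rewrite ler_pdivlMr // mul1r; apply: le_trans sL _; rewrite ler_peMl ?z_ge1 //.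
have y0 : 0 <= y by apply: le_trans y1.
have yL : y * L = z * s%:R by rewrite /y divfK // gt_eqF.
have /andP[h1 h2] := truncn_itv y0.
exists (Num.truncn y).+1.
have hy : (Num.truncn y).+1%:R <= 2 * y by rewrite -natr1 mulr_natl mulr2n lerD.
have hL : (Num.truncn y).+1%:R * L <= 2 * (z * s%:R).
  by rewrite -yL mulrA ler_wpM2r // ltW.
have big : (11 * (Num.truncn y).+1 <= s)%N.
  rewrite -(ler_nat R) natrM -(ler_pM2r L0) -mulrA.
  apply: (@le_trans _ _ (11 * (2 * (z * s%:R)))); first by rewrite ler_wpM2l.
  have -> : 11 * (2 * (z * s%:R)) = s%:R * (22 * z) by ring.
  rewrite ler_wpM2l // (le_trans _ L_ge_z) // ler_wpM2r ?(ltW z0) //; lra.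
split=> //; first by rewrite -yL ler_wpM2r // ltW.
by apply: leq_trans big; rewrite leq_mul2r orbT.
Qed.

(** The target is [l = L - ln z], for which [n * exp (- l) = z]. As [lam] has the form
    [a / beta ^ 2] with an integer [beta], it is hit only approximately: rounding the square root of
    [a / l] down raises [lam] by at most 1, because [beta] is at least [3 * l]. This is the origin
    of the factor [expR 1]. *)
Lemma exists_beta : exists beta : nat, exists lam : R,
  let M := (B * beta * w)%N in
  [/\ (27 <= beta)%N, (0 < M)%N,
      lam = 4 * (n%:R / #|{: 'I_M * 'I_M}|%:R * (quarter s)%:R),
      lam <= 2 * L /\ L <= 2 * lam
    & n%:R * expR (- lam) <= z /\ z <= expR 1 * (n%:R * expR (- lam))].
Proof.
have L0 := ln_n_gt0; have z0 := z_gt0; have n0 := n_gt0; have z1 := z_ge1.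
have z1000 := z_ge; have Lz := L_ge_z.
have n0' : (0 < n)%N by rewrite -(ltr_nat R).
have B0 : (0 < B)%N by apply: leq_trans B412.
pose l : R := L - ln z.
have lz : ln z <= z by rewrite ltW // ln_sublinear.
have lz0 : 0 <= ln z by rewrite ln_ge0.
have lL : l <= L by rewrite gerBl.
have Ll : L <= 2 * l by rewrite /l; lra.
have l1 : 1 <= l by lra.
have l0 : 0 < l by lra.
have el : n%:R * expR (- l) = z.
  by rewrite /l opprB expRD lnK ?posrE // nL mulrCA -expRD subrr expR0 mulr1.
set a : R := 4 * (n%:R * (quarter s)%:R) / (B * B * (w * w))%:R.
have BBw : 0 < (B * B * (w * w))%:R :> R by rewrite ltr0n !muln_gt0 B0 n0'.
have BB : 0 < (B * B)%:R :> R by rewrite ltr0n muln_gt0 B0.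
have a_ge : 25 * n%:R / (B * B)%:R <= a.
  rewrite /a ler_pdivlMr // [(B * B * (w * w))%:R]natrM.
  have -> : 25 * n%:R / (B * B)%:R * ((B * B)%:R * (w * w)%:R) = 25 * n%:R * (w * w)%:R :> R.
    by rewrite [LHS]mulrA divfK // gt_eqF.
  have q : (100 * (n * n))%:R <= (quarter s)%:R :> R.
    rewrite ler_nat; have := quarter_ge (10 * n); have -> : (5 * (4 * n) = 2 * (10 * n))%N by clear; lia.
    by clear; move: (quarter _) => q; lia.
  apply: (@le_trans _ _ (4 * (n%:R * (100 * (n * n))%:R))); last by rewrite ler_wpM2l // ler_wpM2l // ltW.
  by rewrite !natrM le_eqVlt; apply/orP; left; apply/eqP; ring.
have a0 : 0 < a by apply: lt_le_trans a_ge; rewrite divr_gt0 // mulr_gt0.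
pose t := Num.sqrt (a / l); pose beta := Num.truncn t.
have t0 : 0 <= t by apply: sqrtr_ge0.
have tt : t * t = a / l by rewrite -expr2 sqr_sqrtr // divr_ge0 // ltW.
have /andP[b1 b2] := truncn_itv t0; rewrite -/beta in b1 b2.
have big : 16 * (l * l) * l <= a.
  apply: le_trans a_ge; rewrite ler_pdivlMr //.
  apply: (@le_trans _ _ (16 * (L * L) * L * (B * B)%:R)).
    by rewrite ler_wpM2r ?(ltW BB) // ler_pM ?mulr_ge0 ?(ltW l0) // ler_wpM2l // ler_pM ?(ltW l0).
  have BL : (16 * B * B)%:R <= L by apply: le_trans zB _; apply: le_trans Lz; rewrite ler_peMl ?(ltW z0) ?ler1n.
  have -> : 16 * (L * L) * L * (B * B)%:R = L ^+ 3 * (16 * B * B)%:R by rewrite !natrM; ring.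
  apply: (@le_trans _ _ (L ^+ 3 * L)); first by rewrite ler_wpM2l // exprn_ge0 // ltW.
  by rewrite -exprSr; apply: le_trans n_ge_L4 _; rewrite ler_wpM2r ?(ltW n0) // ler_nat.
have t4 : 4 * l <= t.
  rewrite -(@ler_pXn2r _ 2) ?nnegrE ?mulr_ge0 ?(ltW l0) // !expr2 tt ler_pdivlMr //.
  by apply: le_trans big; rewrite le_eqVlt; apply/orP; left; apply/eqP; ring.
have b3 : 3 * l <= beta%:R by move: b2; rewrite -natr1; lra.
have b0 : 0 < beta%:R :> R by lra.
have b0' : (0 < beta)%N by rewrite -(ltr_nat R).
exists beta, (a / (beta%:R * beta%:R)); set lam := a / _.
have lb : l <= lam.
  rewrite /lam ler_pdivlMr ?mulr_gt0 // mulrC -ler_pdivlMr // -tt.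
  by rewrite ler_pM ?(ltW b0).
have bl : lam <= l + 1.
  rewrite /lam ler_pdivrMr ?mulr_gt0 //.
  have : a <= (beta%:R + 1) * (beta%:R + 1) * l.
    rewrite -ler_pdivrMr // -tt natr1 ler_pM // ltW //.
  have : 3 * l * beta%:R <= beta%:R * beta%:R by rewrite ler_wpM2r // ltW.
  have : l <= l * beta%:R by rewrite ler_peMr ?(ltW l0) //; lra.
  by move=> h1 h2 h3; apply: sq_step h3 h2 h1.
split.
- by rewrite -(ler_nat R); lra.
- by rewrite !muln_gt0 B0 b0' n0'.
- rewrite card_prod card_ord /lam /a !natrM; field.
  by rewrite !pnatr_eq0 -!lt0n B0 b0' n0'.
- by split; lra.
- split.
    by rewrite -el ler_wpM2l ?(ltW n0) // ler_expR lerN2.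
  rewrite mulrCA -expRD -{1}el ler_wpM2l ?(ltW n0) // ler_expR; lra.
Qed.

End ParameterChoice.

Section GoodConfigurations.
Variables (n w B beta h T1 T2 : nat) (w0 : (0 < w)%N).
Local Notation s := (5 * w)%N.
Local Notation M := (B * beta * w)%N.
Local Notation D := (13 * B * w)%N.
Local Notation J0 := (121 * (T1 + 121 * T2))%N.

Definition good_conf : {set {ffun 'I_n -> 'I_M * 'I_M}} :=
  [set f | [&& f \in skeleton_conf n B beta T1 w0, f \notin sparse_conf n M s h D (8 * J0 + 8),
     fsw f \notin sparse_conf n M s h D (8 * J0 + 8), f \notin poor_conf n M s h J0
   & f \in isolated_conf n w B beta s]].

Lemma pr_not_good (R : realType) :
  pr R (~: good_conf) <= pr R (~: skeleton_conf n B beta T1 w0)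
   + 2 * pr R (sparse_conf n M s h D (8 * J0 + 8)) + pr R (poor_conf n M s h J0)
   + pr R (~: isolated_conf n w B beta s).
Proof.
set A := skeleton_conf _ _ _ _ _; set S := sparse_conf _ _ _ _ _ _; set Q := poor_conf _ _ _ _ _.
set I := isolated_conf _ _ _ _ _.
have sub : ~: good_conf \subset ((~: A :|: (S :|: [set f | fsw f \in S])) :|: Q) :|: ~: I.
  apply/subsetP => f; rewrite in_setC [f \in good_conf]in_set !negb_and !negbK.
  rewrite !in_setU [f \in ~: A]in_setC [f \in ~: I]in_setC.
  have -> : (f \in [set f0 | fsw f0 \in S]) = (fsw f \in S) by rewrite in_set.
  by rewrite -!orbA.
apply: le_trans (pr_le R sub) _; apply: le_trans (pr_setU R _ _) _; rewrite lerD2r.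
apply: le_trans (pr_setU R _ _) _; rewrite lerD2r.
apply: le_trans (pr_setU R _ _) _; rewrite lerD2l.
by apply: le_trans (pr_setU R _ _) _; rewrite pr_fsw mulr_natl mulr2n.
Qed.

End GoodConfigurations.

Lemma poly_exp_le (R : realType) (z : R) k : 1 <= z ->
  z ^+ k * expR (- (z / 16)) <= 16 ^+ k.+1 * (2 ^+ k.+1 * k.+1`!%:R) / z.
Proof.
move=> z1; have z0 : 0 < z by apply: lt_le_trans z1.
rewrite ler_pdivlMr //.
have y0 : 0 <= z / 16 by rewrite divr_ge0 // ltW.
have h := expR_pow_le k.+1 y0.
have -> : z ^+ k * expR (- (z / 16)) * z = 16 ^+ k.+1 * ((z / 16) ^+ k.+1 * expR (- (z / 16))).
  have -> : (z / 16) ^+ k.+1 = z ^+ k.+1 / 16 ^+ k.+1 by rewrite expr_div_n.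
  have u0 : 16 ^+ k.+1 != 0 :> R by rewrite expf_neq0 // pnatr_eq0.
  by rewrite [z ^+ k.+1]exprS; move: (16 ^+ k.+1) (z ^+ k) u0 => u v u0; field.
rewrite ler_wpM2l ?exprn_ge0 //; apply: le_trans h _.
rewrite -[leRHS]mulr1 ler_wpM2l ?mulr_ge0 ?exprn_ge0 // expR_le1 oppr_le0 divr_ge0 //.
Qed.

(** Here [z] is the root of order [2 * P] of [L = ln n], and each of the bounds is at most a
    constant over [z]. *)
Theorem exists_good (R : realType) (T1 T2 B : nat) (eps : R) : (412 <= B)%N -> 0 < eps ->
  exists N, forall n, (N <= n)%N -> exists w beta h (w0 : (0 < w)%N),
  [/\ (8 <= w)%N, (27 <= beta)%N, (3 * h <= 5 * w)%N &
      pr R (~: good_conf n B beta h T1 T2 w0) <= eps].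
Proof.
move=> B412 eps0.
pose J0 := (121 * (T1 + 121 * T2))%N; pose J := (8 * J0 + 8)%N; pose P := (3 * J0 + 4)%N.
have P1 : (1 < P)%N by rewrite /P addnC ltn_addr.
pose C : R := (13 * B + 6)%:R; pose C1 : R := 1 + 8 * C + 16 * C ^+ 2.
pose k := (2 * P * (J + 4) + P.+1)%N.
pose K1 : R := ((J + 4) ^ 4)%:R * ((8 * expR 1 * C ^+ 2) ^+ (J + 4) * expR 1 * C1).
pose K2 : R := 16 ^+ k.+1 * (2 ^+ k.+1 * k.+1`!%:R).
pose K3 : R := (J0.+1 ^ 2)%:R * (expR 1 * C1 * expR 1 * (128 * expR 1) * (4096 * expR 1 ^+ 2 * (256 * expR 1)) ^+ J0).
pose K4 : R := 2 * row_constant R B T1.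
pose K5 : R := (B * B)%:R * expR (31 + 2 * (32 * 64)) + 512.
pose K : R := K4 + 2 * (K1 * K2) + K3 + K5.
(* The summands make [z] large compared with [B], give the condition [128 * expR 1 * z ^ 2 <= L] of
   [poor_bound], and ensure [K / z <= eps]. *)
pose Z : R := (16 * B * B)%:R + 128 * expR 1 + `|K| / eps.
have Ke : 0 <= `|K| / eps by rewrite divr_ge0 // ltW.
have e128 : 0 < 128 * expR 1 :> R by rewrite mulr_gt0 ?expR_gt0.
have Z0 : 0 < Z by rewrite /Z ltr_wpDr // ltr_wpDl.
exists (Num.truncn (expR (Z ^+ (2 * P)))).+1 => n nN.
have nZ : expR (Z ^+ (2 * P)) <= n%:R.
  by apply: le_trans (ltW (truncnS_gt _)) _; rewrite ler_nat.
have n0 : 0 < n%:R :> R by apply: lt_le_trans nZ; apply: expR_gt0.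
have n0' : (0 < n)%N by rewrite -(ltr_nat R).
pose L : R := ln n%:R.
have nL : n%:R = expR L by rewrite lnK.
have LZ : Z ^+ (2 * P) <= L by rewrite -ler_expR -nL.
have L0 : 0 < L.
  by apply: lt_le_trans LZ; rewrite exprn_gt0.
pose z : R := expR (ln L / (2 * P)%:R).
have LE : L = z ^+ (2 * P).
  by rewrite /z -expRM_natl mulrC divfK ?lnK // pnatr_eq0 muln_eq0 /= -lt0n ltnW.
have zZ : Z <= z.
  by rewrite -(@ler_pXn2r _ (2 * P)) ?nnegrE ?expR_ge0 ?(ltW Z0) -?LE // muln_gt0 /= ltnW.
have zB : (16 * B * B)%:R <= z.
  by apply: (le_trans _ zZ); rewrite /Z -addrA lerDl; apply: addr_ge0; [exact: ltW|exact: Ke].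
have ze : 128 * expR 1 <= z.
  apply: (le_trans _ zZ); rewrite /Z [_ + 128 * _]addrC -addrA lerDl; apply: addr_ge0; [exact: ler0n|exact: Ke].
have zK : `|K| <= eps * z.
  rewrite -ler_pdivrMl // mulrC; apply: (le_trans _ zZ); rewrite /Z lerDr; apply: addr_ge0; [exact: ler0n|exact: ltW].
have z1 := z_ge1 B412 zB; have z0 := z_gt0 B412 zB.
have [h [h0 hL Lh h11 h3]] := exists_h B412 P1 zB LE nL.
have [beta [lam [b27 M0 lamE [lamL Llam] [nz zn]]]] := exists_beta B412 P1 zB LE nL.
have w0 : (0 < 4 * n)%N by rewrite muln_gt0.
exists (4 * n)%N, beta, h, w0; split=> //.
  have : 2 <= n%:R :> R.
    apply: le_trans (n_ge_L nL); apply: le_trans (L_ge_z B412 P1 zB LE).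
    by have := z1; lra.
  by rewrite ler_nat; clear; lia.
apply: le_trans (pr_not_good _ _ _ _ _ _ _ _) _.
set M := (B * beta * (4 * n))%N in M0 lamE *.
have G0 : 0 < #|{: 'I_M * 'I_M}|%:R :> R by rewrite ltr0n card_prod card_ord muln_gt0 M0.
have EM : (2 * (13 * B * (4 * n) + 5 * (4 * n)) <= M)%N.
  rewrite -mulnDl mulnA leq_mul2r; apply/orP; right.
  apply: leq_trans (_ : B * 27 <= _)%N; last by rewrite leq_mul2l b27 orbT.
  by move: B412; clear; lia.
have bS := sparse_bound (erefl _) G0 lamE n0' (erefl _) B412 z1 LE lamL Llam nz hL h11 EM (erefl C) (erefl C1) J.
have bP := poor_bound (erefl _) G0 lamE n0' (erefl _) B412 z1 LE lamL nz h0 Lh h11 EM (erefl C) (erefl C1) (erefl P).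
have bK := skeleton_bound T1 (erefl _) G0 lamE n0' B412 z1 P1 LE nL Llam nz w0.
have bI := isolated_bound (erefl _) G0 lamE n0' (erefl _) B412 z1 P1 LE nL lamL zn.
have {}bP : pr R (poor_conf n M (5 * (4 * n)) h J0) <= K3 / z.
  apply: bP; apply: le_trans (_ : z ^+ 3 <= _).
    by rewrite [z ^+ 3]exprS ler_wpM2r // exprn_ge0 // ltW.
  by rewrite LE ler_weXn2l //; move: P1; clear; lia.
have {}bI : pr R (~: isolated_conf n (4 * n) B beta (5 * (4 * n))) <= K5 / z.
  by apply: bI; apply: le_trans (z_ge B412 zB); rewrite ler_nat.
have {}bS : pr R (sparse_conf n M (5 * (4 * n)) h (13 * B * (4 * n)) J) <= K1 * K2 / z.
  apply: le_trans bS _; rewrite -/K1 -mulrA ler_wpM2l //; last exact: poly_exp_le.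
  rewrite /K1 /C1 mulr_ge0 // mulr_ge0 ?mulr_ge0 ?expR_ge0 ?exprn_ge0 ?addr_ge0 ?mulr_ge0 ?expR_ge0 ?exprn_ge0 //.
apply: (@le_trans _ _ (K4 / z + 2 * (K1 * K2 / z) + K3 / z + K5 / z)).
  by rewrite lerD // lerD // lerD // ler_wpM2l.
rewrite mulrA -!mulrDl -/K ler_pdivrMr //; apply: le_trans zK; exact: ler_norm.
Qed.

(** * From the grid to the unit square *)

Section Discretization.
Variables (R : realType) (n M : nat) (x : 'I_n -> R * R) (f : {ffun 'I_n -> 'I_M * 'I_M}).
Hypothesis M0 : (0 < M)%N.

Definition in_cell (k : nat) (t : R) := (k%:R / M%:R <= t) && (t < k.+1%:R / M%:R).

Hypothesis xf : forall i, in_cell (f i).1 (x i).1 && in_cell (f i).2 (x i).2.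

Lemma in_cell_dist k l t u : in_cell k t -> in_cell l u ->
  `|M%:R * (t - u)| <= (adn k l).+1%:R /\ (adn k l)%:R <= `|M%:R * (t - u)| + 1.
Proof.
have M0R : 0 < M%:R :> R by rewrite ltr0n.
rewrite /in_cell !ler_pdivrMr // !ltr_pdivlMr // -!natr1 => /andP[h1 h2] /andP[h3 h4].
have -> : (adn k l)%:R = `|k%:R - l%:R| :> R.
  rewrite /adn; case: (leqP k l) => kl.
    by rewrite (eqP kl) add0n natrB // distrC ger0_norm // subr_ge0 ler_nat.
  by rewrite (eqP (ltnW kl)) addn0 natrB ?(ltnW kl) // ger0_norm // subr_ge0 ler_nat ltnW.
have -> : M%:R * (t - u) = t * M%:R - u * M%:R by ring.
move: (t * M%:R) (u * M%:R) h1 h2 h3 h4 => a b h1 h2 h3 h4.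
have d1 : `|(a - b) - (k%:R - l%:R)| <= 1 by rewrite ler_norml; apply/andP; split; lra.
split.
  have := ler_normD ((a - b) - (k%:R - l%:R)) (k%:R - l%:R); rewrite subrK.
  move: (`|_ - _ - _|) d1 (`|a - b|) (`|_ - _|) => p p1 q t0; lra.
have := ler_normB (a - b) ((a - b) - (k%:R - l%:R)); rewrite opprB addrC subrK.
move: (`|_ - _ - _|) d1 (`|a - b|) (`|_ - _|) => p p1 q t0; lra.
Qed.

Lemma edist_le r i j : 0 < M%:R :> R -> (edist (x i) (x j) <= r) = (0 <= r) &&
  ((M%:R * ((x i).1 - (x j).1)) ^+ 2 + (M%:R * ((x i).2 - (x j).2)) ^+ 2 <= (M%:R * r) ^+ 2).
Proof.
move=> M0R; set a := _ - _; set b := (x i).2 - _.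
rewrite !exprMn -mulrDr ler_pM2l ?exprn_gt0 //.
rewrite /edist -/a -/b; have ab0 : 0 <= a ^+ 2 + b ^+ 2 by rewrite addr_ge0 ?sqr_ge0.
have [r0|r0] := leP 0 r; last first.
  by apply/negbTE; rewrite -ltNge; apply: lt_le_trans r0 _; apply: sqrtr_ge0.
have -> : (Num.sqrt (a ^+ 2 + b ^+ 2) <= r) = (Num.sqrt (a ^+ 2 + b ^+ 2) ^+ 2 <= r ^+ 2).
  by rewrite ler_pXn2r ?nnegrE ?sqrtr_ge0.
by rewrite sqr_sqrtr.
Qed.

Lemma edistC (p q : R * R) : edist p q = edist q p.
Proof. by rewrite /edist -(opprB q.1) -(opprB q.2) !sqrrN. Qed.

Lemma geom_graph_sym r : symmetric (geom_graph x r).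
Proof. by move=> i j; rewrite /geom_graph eq_sym edistC. Qed.

Lemma geom_graph_irr r : irreflexive (geom_graph x r).
Proof. by move=> i; rewrite /geom_graph eqxx. Qed.

Lemma cell_dists i j : [/\ `|M%:R * ((x i).1 - (x j).1)| <= (adn (fpos f i).1 (fpos f j).1).+1%:R,
   `|M%:R * ((x i).2 - (x j).2)| <= (adn (fpos f i).2 (fpos f j).2).+1%:R,
   (adn (fpos f i).1 (fpos f j).1)%:R <= `|M%:R * ((x i).1 - (x j).1)| + 1 &
   (adn (fpos f i).2 (fpos f j).2)%:R <= `|M%:R * ((x i).2 - (x j).2)| + 1].
Proof.
have /andP[i1 i2] := xf i; have /andP[j1 j2] := xf j.
by have [h1 h2] := in_cell_dist i1 j1; have [h3 h4] := in_cell_dist i2 j2.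
Qed.

(** Rounding changes each coordinate difference by at most 1, and
    [(a + 1) ^ 2 + (b + 1) ^ 2 <= (s + 2) ^ 2]. Together with [geom_graph_far], the threshold
    [s + 2] separates the radii at which the graph contains the grid graph of radius [s] from those
    at which a point isolated up to [s + 4] in the grid is isolated. *)
Lemma geom_graph_close r i j s : i != j -> (dsq (fpos f i) (fpos f j) <= s * s)%N ->
  (s + 2)%:R <= M%:R * r -> geom_graph x r i j.
Proof.
move=> ij ds sr; have M0R : 0 < M%:R :> R by rewrite ltr0n.
rewrite /geom_graph ij edist_le //; have s0 : 0 <= (s + 2)%:R :> R by [].
have r0 : 0 <= r by rewrite -(pmulr_rge0 _ M0R) (le_trans s0).
rewrite r0 /=; have [h1 h2 _ _] := cell_dists i j; have [a1 a2] := dsq_le ds.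
apply: (@le_trans _ _ ((s + 2)%:R ^+ 2)); last by rewrite ler_pXn2r ?nnegrE ?mulr_ge0 // ltW.
rewrite -(real_normK (num_real (M%:R * ((x i).1 - _)))) -(real_normK (num_real (M%:R * ((x i).2 - _)))).
move: ds a1 a2 h1 h2; rewrite /dsq; move: (adn _ _) (adn _ _) => b a ds a1 a2 h1 h2.
apply: (@le_trans _ _ (a.+1%:R ^+ 2 + b.+1%:R ^+ 2)).
  by rewrite lerD // ler_pXn2r ?nnegrE.
rewrite -!natrX -natrD ler_nat !expnS !expn0 !muln1; move: ds a1 a2; clear; nia.
Qed.

Lemma geom_graph_far r i j s : geom_graph x r i j -> M%:R * r < (s + 2)%:R ->
  (dsq (fpos f i) (fpos f j) <= (s + 4) * (s + 4))%N.
Proof.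
move=> /andP[_]; have M0R : 0 < M%:R :> R by rewrite ltr0n.
rewrite edist_le // => /andP[r0 hd] sr; have [_ _ h1 h2] := cell_dists i j.
have Mr0 : 0 <= M%:R * r by rewrite mulr_ge0 // ltW.
have {}hd : (M%:R * ((x i).1 - (x j).1)) ^+ 2 + (M%:R * ((x i).2 - (x j).2)) ^+ 2 <= (s + 2)%:R ^+ 2.
  by apply: le_trans hd _; rewrite ler_pXn2r ?nnegrE // ltW.
rewrite -(real_normK (num_real (M%:R * ((x i).1 - _)))) -(real_normK (num_real (M%:R * ((x i).2 - _)))) in hd.
move: h1 h2 hd; rewrite /dsq; move: (adn _ _) (adn _ _) => b a.
move: (normr_ge0 (M%:R * ((x i).1 - (x j).1))) (normr_ge0 (M%:R * ((x i).2 - (x j).2))).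
move: `|_| `|_| => q p p0 q0 h1 h2 hd.
rewrite -(ler_nat R) natrD !natrM !natrD; rewrite natrD in hd.
have s0 : 0 <= s%:R :> R by [].
have aa : a%:R * a%:R <= (p + 1) * (p + 1) :> R by apply: ler_pM.
have bb : b%:R * b%:R <= (q + 1) * (q + 1) :> R by apply: ler_pM.
have ps : p <= s%:R + 2 by rewrite -(@ler_pXn2r _ 2) ?nnegrE ?addr_ge0 //; apply: le_trans hd; rewrite lerDl sqr_ge0.
have qs : q <= s%:R + 2 by rewrite -(@ler_pXn2r _ 2) ?nnegrE ?addr_ge0 //; apply: le_trans hd; rewrite lerDr sqr_ge0.
rewrite !expr2 in hd; move: (s%:R) s0 aa bb ps qs hd => t t0; nra.
Qed.

End Discretization.

Section GoodGraphs.
Variables (R : realType) (n w B beta h T1 T2 : nat) (w0 : (0 < w)%N).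
Local Notation M := (B * beta * w)%N.
Local Notation s := (5 * w)%N.
Variables (x : 'I_n -> R * R) (f : {ffun 'I_n -> 'I_M * 'I_M}).
Hypotheses (xf : forall i, in_cell M (f i).1 (x i).1 && in_cell M (f i).2 (x i).2).
Hypotheses (evn : ~~ odd n) (B412 : (412 <= B)%N) (b27 : (27 <= beta)%N) (h3 : (3 * h <= s)%N).
Hypotheses (T2_big : (188 * 188 <= T2)%N)
  (T1_big : (2 * (121 * T2 + 121 + T2 + 3) * (121 * T2 + 121 + T2 + 3) <= T1)%N).
Hypothesis good : f \in good_conf n B beta h T1 T2 w0.

(** Only sufficiency depends on the configuration. If [M * r] is below [s + 2], the isolated vertex
    contradicts the minimum degree; otherwise [lattice_maker_wins] applies. *)
Lemma good_maker_wins r : maker_wins_pm (geom_graph x r) <->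
  min_degree_ge (geom_graph x r) 2 /\ min_edge_degree_ge (geom_graph x r) 3.
Proof.
have gs := geom_graph_sym x r; have gi := geom_graph_irr x r.
split; first exact: maker_wins_pm_necessary.
move=> [deg2 edeg3].
have M0 : (0 < M)%N by rewrite !muln_gt0 w0 (leq_trans _ B412) ?(leq_trans _ b27).
have M0R : 0 < M%:R :> R by rewrite ltr0n.
move: good; rewrite in_set => /and5P[]; rewrite [_ \in skeleton_conf _ _ _ _ _]in_set => /asboolP sk.
rewrite [_ \in sparse_conf _ _ _ _ _ _]in_set negbK => /asboolP sp1.
rewrite [_ \in sparse_conf _ _ _ _ _ _]in_set negbK fpos_fsw => /asboolP sp2.
rewrite [_ \in poor_conf _ _ _ _ _]in_set negbK => /asboolP pc.
rewrite in_set => /existsP[i /forallP iso].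
have [sr|sr] := leP (s + 2)%:R (M%:R * r); last first.
  have /card_gt0P[j] := leq_trans (isT : 0 < 2)%N (deg2 i); rewrite in_set => gij.
  have := iso j; rewrite ltnNge (geom_graph_far M0 xf gij sr) implybF negbK => /eqP ji.
  by rewrite ji gi in gij.
apply: (@lattice_maker_wins _ (fpos f) w B beta T1 T2 h (13 * B * w) _ w0 (fpos_lt f)) => //.
- by rewrite card_ord.
- by move=> u v /andP[uv d]; apply: (geom_graph_close M0 xf uv d sr).
(* An edge longer than [6 * B * w] in one coordinate makes [M * r] at least [2 * (3 * B * w)], more
   than the distance of points that differ by [3 * B * w] in both coordinates, rounding included. *)
- move=> u v a b guv far ab /andP[x1 x2].
  rewrite /geom_graph ab (edist_le _ _ _ _ M0R); move/andP: guv => [_]; rewrite (edist_le _ _ _ _ M0R) => /andP[r0 guv].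
  rewrite r0 /=; apply: (le_trans _ guv).
  have K3 : (3 <= 3 * B * w)%N by rewrite -mulnA leq_pmulr // muln_gt0 w0 andbT (leq_trans _ B412).
  have [a1 a2 _ _] := cell_dists M0 xf a b; have [_ _ u1 u2] := cell_dists M0 xf u v.
  apply: (@le_trans _ _ ((2 * (3 * B * w))%:R ^+ 2)).
    have sq (t : R) m : `|t| <= m.+1%:R -> (m <= 3 * B * w)%N -> t ^+ 2 <= (3 * B * w).+1%:R ^+ 2.
      move=> tm mK; rewrite -(real_normK (num_real t)) ler_pXn2r ?nnegrE //.
      by apply: le_trans tm _; rewrite ler_nat.
    apply: le_trans (lerD (sq _ _ a1 x1) (sq _ _ a2 x2)) _.
    by rewrite -!natrX -natrD ler_nat !expnS !expn0 !muln1; move: K3; clear; move: (3 * B * w)%N => k; nia.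
  have sq (t : R) m : m%:R <= `|t| + 1 -> (6 * B * w < m)%N -> (2 * (3 * B * w))%:R ^+ 2 <= t ^+ 2.
    move=> tm mK; rewrite -(real_normK (num_real t)) ler_pXn2r ?nnegrE //.
    rewrite -(lerD2r 1); apply: le_trans tm; rewrite natr1 ler_nat; apply: leq_trans mK.
    by rewrite ltnS !mulnA.
  case/orP: far => far.
    by apply: le_trans (sq _ _ u1 far) _; rewrite lerDl sqr_ge0.
  by apply: le_trans (sq _ _ u2 far) _; rewrite lerDr sqr_ge0.
- exact: leq_trans b27.
- exact: leq_trans B412.
Qed.

End GoodGraphs.

From mathcomp Require Import finmap all_classical all_reals all_analysis.
From mathcomp Require Import measurable_realfun measurable_fun_approximation.
Import numFieldNormedType.Exports.
Local Open Scope classical_set_scope.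
Local Open Scope ring_scope.

(** * Random points: probabilities of grid configurations and measurability *)

Section Cells.
Variables (d : measure_display) (Omega : measurableType d) (R : realType)
  (P : probability Omega R) (X : nat -> Omega -> R * R).
Hypothesis hX : iid_uniform_unit_square P X.

Section FixedGrid.
Variables (n M : nat).
Hypothesis M0 : (0 < M)%N.

Definition cell_box (p : 'I_M * 'I_M) : set (R * R) :=
  [set y | in_cell M p.1 y.1 && in_cell M p.2 y.2].

Definition cell_itv k : set R := `[k%:R / M%:R, k.+1%:R / M%:R[.

Lemma cell_boxE p : cell_box p = cell_itv p.1 `*` cell_itv p.2.
Proof.
apply/seteqP; split => y; rewrite /cell_box /cell_itv /= !in_itv /=.
  by move=> /andP[h1 h2]; split.
by move=> [h1 h2]; apply/andP; split.
Qed.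

Lemma measurable_cell_box p : measurable (cell_box p).
Proof. by rewrite cell_boxE; apply: measurableX; apply: measurable_itv. Qed.

Lemma cell_itv_sub (k : 'I_M) : cell_itv k `<=` `[0, 1].
Proof.
have M0R : 0 < M%:R :> R by rewrite ltr0n.
move=> t; rewrite /cell_itv /= !in_itv /= => /andP[h1 h2]; apply/andP; split.
  by apply: le_trans h1; rewrite divr_ge0.
by apply: le_trans (ltW h2) _; rewrite ler_pdivrMr // mul1r ler_nat ltn_ord.
Qed.

Lemma lebesgue_cell_itv k : lebesgue_measure (cell_itv k) = (M%:R^-1)%:E.
Proof.
have M0R : 0 < M%:R :> R by rewrite ltr0n.
rewrite /cell_itv lebesgue_measure_itv /= lte_fin ltr_pM2r ?invr_gt0 // ltr_nat ltnSn.
by rewrite -EFinB -mulrBl -natr1 addrAC subrr add0r mul1r.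
Qed.

Lemma prob_cell_box i p : P (X i @^-1` cell_box p) = ((M * M)%:R^-1)%:E.
Proof.
case: hX => _ /(_ i) u _; rewrite u; last exact: measurable_cell_box.
rewrite cell_boxE setIidl; last by move=> y [y1 y2]; split; [exact: cell_itv_sub y1|exact: cell_itv_sub y2].
rewrite product_measure1E; [|exact: measurable_itv|exact: measurable_itv].
rewrite [X in (X * _)%E]lebesgue_cell_itv [X in (_ * X)%E]lebesgue_cell_itv.
by rewrite -EFinM natrM invfM.
Qed.

Definition conf_event (f : {ffun 'I_n -> 'I_M * 'I_M}) : set Omega :=
  [set w | forall i : 'I_n, cell_box (f i) (X i w)].

(** An intersection over a finite set of natural numbers is the form in which independence is
    stated; indices outside the range would get the whole space. *)
Lemma conf_eventE f : conf_event f = \bigcap_(i in [set` seq_fset tt (iota 0 n)])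
   (X i @^-1` (if insub i is Some j then cell_box (f j) else setT)).
Proof.
apply/seteqP; split => w h /=.
  move=> i _ /=; case: insubP => [j _ ji|_] //; rewrite -ji; exact: h.
move=> i; have iN : (i : nat) \in seq_fset tt (iota 0 n) by rewrite seq_fsetE mem_iota add0n ltn_ord.
have := h i iN.
by rewrite /preimage /=; case: insubP => [j _ /val_inj ->|]; rewrite ?ltn_ord.
Qed.

Lemma measurable_conf_event f : measurable (conf_event f).
Proof.
rewrite conf_eventE; case: hX => mX _ _; apply: fin_bigcap_measurable => // i _.
rewrite -[X in measurable X]setTI; apply: mX => //.
by case: insubP => [j _ _|_] //; apply: measurable_cell_box.
Qed.

Lemma prob_conf_event f : P (conf_event f) = (((M * M) ^ n)%:R^-1)%:E.
Proof.
rewrite conf_eventE; case: hX => _ _ ind.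
rewrite (ind _ (fun i => if insub i is Some j then cell_box (f j) else setT)); last first.
  by move=> i; case: insubP => [j _ _|_] //; apply: measurable_cell_box.
rewrite (eq_big_seq (fun=> (((M * M)%:R^-1)%:E : \bar R))); last first.
  move=> i; rewrite seq_fsetE mem_iota add0n => iN; rewrite insubT.
  exact: prob_cell_box.
rewrite prodEFin; congr (_%:E).
rewrite big_const_seq count_predT iter_mulr_1 natrX exprVn; congr (_ ^+ _)^-1.
by rewrite size_seq_fset undup_id ?iota_uniq // size_iota.
Qed.

Lemma prob_good_event (A : {set {ffun 'I_n -> 'I_M * 'I_M}}) :
  P (\bigcup_(f in [set` A]) conf_event f) = (pr R A)%:E.
Proof.
rewrite measure_fin_bigcup //; last first.
- by move=> f _; apply: measurable_conf_event.
- apply/trivIsetP => f g _ _ fg; apply/seteqP; split => w //= [hf hg].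
  case/eqP: fg; apply/ffunP => i.
  have inj k l (t : R) : in_cell M k t -> in_cell M l t -> (k <= l)%N.
    move=> /andP[k1 _] /andP[_ l2]; have := le_lt_trans k1 l2.
    by rewrite ltr_pM2r ?invr_gt0 ?ltr0n // ltr_nat ltnS.
  have /andP[f1 f2] := hf i; have /andP[g1 g2] := hg i.
  have e1 : (f i).1 = (g i).1 by apply: val_inj; apply/eqP; rewrite eqn_leq (inj _ _ _ f1 g1) (inj _ _ _ g1 f1).
  have e2 : (f i).2 = (g i).2 by apply: val_inj; apply/eqP; rewrite eqn_leq (inj _ _ _ f2 g2) (inj _ _ _ g2 f2).
  by rewrite [f i]surjective_pairing [g i]surjective_pairing e1 e2.
rewrite (eq_fsbigr (fun=> (((M * M) ^ n)%:R^-1)%:E)); last by move=> f _; apply: prob_conf_event.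
have -> : [set` A] = [set` enum A] by apply/seteqP; split => f /=; rewrite mem_enum.
rewrite -fsbig_seq ?enum_uniq // sumEFin big_const_seq count_predT iter_addr_0 -cardE; congr (_%:E).
by rewrite /pr card_prod card_ord mulr_natl.
Qed.

Lemma measurable_good_event (A : {set {ffun 'I_n -> 'I_M * 'I_M}}) :
  measurable (\bigcup_(f in [set` A]) conf_event f).
Proof. by apply: fin_bigcup_measurable => // f _; apply: measurable_conf_event. Qed.

End FixedGrid.

Section HittingRadius.
Variable n : nat.
Implicit Types (Q : rel 'I_n -> Prop).
Local Notation V := 'I_n.

(* As r varies, the geometric graph changes only at these radii. *)
Definition crit_radius (x : V -> R * R) (c : option (V * V)) : R :=
  if c is Some p then Defs.edist (x p.1) (x p.2) else 0.

Lemma crit_radius_ge0 x c : 0 <= crit_radius x c.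
Proof. by case: c => [p|] //=; apply: sqrtr_ge0. Qed.

(** The largest critical radius not above [r] works; [None], of radius 0, ensures that there is
    one. *)
Lemma geom_graph_crit_radius (x : V -> R * R) r : 0 <= r ->
  exists2 c, crit_radius x c <= r & geom_graph x r = geom_graph x (crit_radius x c).
Proof.
move=> r0.
pose c0 : option (V * V) := None.
have c0P : crit_radius x c0 <= r by [].
case: (@Order.TotalTheory.arg_maxP _ R (option (V * V)) c0 (fun c => crit_radius x c <= r) (crit_radius x) c0P) => c cr cmax.
exists c => //; apply/funext => i; apply/funext => j; rewrite /geom_graph; congr andb.
apply/idP/idP => h; last exact: le_trans h cr.
exact: (cmax (Some (i, j)) h).
Qed.

Definition candidate Q (x : V -> R * R) (c : option (V * V)) : \bar R :=
  if `[< Q (geom_graph x (crit_radius x c)) >] then (crit_radius x c)%:E else +oo%E.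

(** Replacing the infimum by a minimum over finitely many random variables makes the hitting radius
    measurable. *)
Lemma hitting_radiusE Q x :
  hitting_radius x Q = \big[mine/+oo%E]_(c : option (V * V)) candidate Q x c.
Proof.
apply/eqP; rewrite eq_le; apply/andP; split.
  elim/big_ind: _ => [|a b ha hb|c _]; first by rewrite leey.
    by rewrite /mine; case: ifP.
  rewrite /candidate; case: ifPn => [/asboolP qc|_]; last by rewrite leey.
  by apply: ereal_inf_lbound; exists (crit_radius x c) => //; split=> //; apply: crit_radius_ge0.
apply: le_ereal_inf_tmp => _ [r [r0 qr] <-].
have [c cr gE] := geom_graph_crit_radius x r0.
have : candidate Q x c = (crit_radius x c)%:E by rewrite /candidate ifT //; apply/asboolP; rewrite -gE.
move=> cE; apply: (@le_trans _ _ (candidate Q x c)); last by rewrite cE lee_fin.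
by rewrite (bigD1 c) //= ge_min lexx.
Qed.

Local Notation Xn := (fun w (i : V) => X i w).

Lemma measurable_edist (i j : nat) : measurable_fun [set: Omega] (fun w => Defs.edist (X i w) (X j w)).
Proof.
case: hX => mX _ _.
have m1 k : measurable_fun [set: Omega] (fun w => (X k w).1) by apply: measurableT_comp (mX k).
have m2 k : measurable_fun [set: Omega] (fun w => (X k w).2) by apply: measurableT_comp (mX k).
apply: measurableT_comp => //; first by apply: continuous_measurable_fun; apply: sqrt_continuous.
apply: measurable_funD; apply: measurable_funX; exact: measurable_funB.
Qed.

Lemma measurable_crit_radius c : measurable_fun [set: Omega] (fun w => crit_radius (Xn w) c).
Proof. by case: c => [p|] /=; [apply: measurable_edist|apply: measurable_cst]. Qed.

(** There are finitely many graphs on [V], and for each of them the event is a finite intersection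
    of comparisons of measurable functions. *)
Lemma measurable_graph_event Q c : measurable [set w | Q (geom_graph (Xn w) (crit_radius (Xn w) c))].
Proof.
pose rel_of (g : {ffun V * V -> bool}) : rel V := fun i j => g (i, j).
have -> : [set w | Q (geom_graph (Xn w) (crit_radius (Xn w) c))] =
  \bigcup_(g in [set g : {ffun V * V -> bool} | Q (rel_of g)])
    \bigcap_(p in [set: V * V]) [set w | geom_graph (Xn w) (crit_radius (Xn w) c) p.1 p.2 = g p].
  apply/seteqP; split => w /=.
    move=> qw; exists [ffun p => geom_graph (Xn w) (crit_radius (Xn w) c) p.1 p.2] => /=; last by move=> p _; rewrite /= ffunE.
    by congr Q: qw; apply/funext => i; apply/funext => j; rewrite /rel_of ffunE.
  move=> [g qg h]; have -> // : geom_graph (Xn w) (crit_radius (Xn w) c) = rel_of g.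
  by apply/funext => i; apply/funext => j; apply: (h (i, j)).
apply: fin_bigcup_measurable => // g _; apply: fin_bigcap_measurable => // p _.
have mb : measurable_fun [set: Omega] (fun w => geom_graph (Xn w) (crit_radius (Xn w) c) p.1 p.2).
  rewrite /geom_graph; case: (p.1 != p.2) => /=; last exact: measurable_cst.
  by apply: measurable_fun_ler; [apply: measurable_edist|apply: measurable_crit_radius].
by have := mb measurableT [set g p] I; rewrite setTI; apply.
Qed.

Lemma measurable_hitting_radius Q : measurable_fun [set: Omega] (fun w => hitting_radius (Xn w) Q).
Proof.
have -> : (fun w => hitting_radius (Xn w) Q) = (fun w => \big[mine/+oo%E]_(c : option (V * V)) candidate Q (Xn w) c).
  by apply/funext => w; rewrite hitting_radiusE.
have mc c : measurable_fun [set: Omega] (fun w => candidate Q (Xn w) c).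
  apply: measurable_fun_ifT; last exact: measurable_cst.
    apply: (measurable_fun_bool true); rewrite setTI.
    rewrite [X in measurable X](_ : _ = [set w | Q (geom_graph (Xn w) (crit_radius (Xn w) c))]).
      exact: measurable_graph_event.
    by apply/seteqP; split => w /= /asboolP.
  by apply/measurable_EFinP; apply: measurable_crit_radius.
elim: (index_enum _) => [|c r IH].
  by under eq_fun do rewrite big_nil; apply: measurable_cst.
by under eq_fun do rewrite big_cons; apply: measurable_mine.
Qed.

End HittingRadius.
End Cells.

Lemma pr_setC (R : realType) n (G : finType) (A : {set {ffun 'I_n -> G}}) : (0 < #|G|)%N ->
  pr R A = 1 - pr R (finset.setC A).
Proof.
move=> G0; rewrite /pr; have g0 : (#|G| ^ n)%:R != 0 :> R by rewrite pnatr_eq0 expn_eq0 negb_and -lt0n G0.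
apply/eqP; rewrite -subr_eq0 opprB addrA -mulrDl -natrD cardsC card_ffun card_ord.
by rewrite divff // subrr.
Qed.

Lemma eq_hitting_radius (R : realType) n (x : 'I_n -> R * R) (Q1 Q2 : rel 'I_n -> Prop) :
  (forall r, Q1 (geom_graph x r) <-> Q2 (geom_graph x r)) -> hitting_radius x Q1 = hitting_radius x Q2.
Proof.
move=> QQ; rewrite /hitting_radius; congr (ereal_inf (_ @` _)).
by apply/seteqP; split => r /= [r0 q]; split => //; apply/QQ.
Qed.

Theorem theorem1p3 (d : measure_display) (Omega : measurableType d)
    (R : realType) (P : probability Omega R) (X : nat -> Omega -> R * R)
    (hX : iid_uniform_unit_square P X) :
  P [set w | hitting_radius (fun i : 'I_(m.*2) => X i w)
               (fun e => maker_wins_pm e)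
           = hitting_radius (fun i : 'I_(m.*2) => X i w)
               (fun e => min_degree_ge e 2 /\ min_edge_degree_ge e 3)]
    @[m --> \oo] --> 1%E.
Proof.
pose S (m : nat) : set Omega := [set w | hitting_radius (fun i : 'I_(m.*2) => X i w)
    (fun e => maker_wins_pm e) = hitting_radius (fun i : 'I_(m.*2) => X i w)
    (fun e => min_degree_ge e 2 /\ min_edge_degree_ge e 3)].
suff: P (S m) @[m --> \oo] --> 1%E by [].
(* Measurability of [S m] is needed to compare its probability with that of the good event. *)
have mS (m : nat) : measurable (S m).
  have := measurable_eqe measurableT (measurable_hitting_radius hX (fun e : rel 'I_(m.*2) => maker_wins_pm e))
    (measurable_hitting_radius hX (fun e : rel 'I_(m.*2) => min_degree_ge e 2 /\ min_edge_degree_ge e 3)).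
  by rewrite setTI.
have fS (m : nat) : P (S m) \is a fin_num by apply: fin_num_measure.
apply/fine_cvgP; split; first by apply: nearW.
(* Only these inequalities about the three constants matter from here on; the values stay hidden
   behind the existentials. *)
have [T2 T2_big] : exists T2, (188 * 188 <= T2)%N by exists (188 * 188)%N.
have [T1 T1_big] : exists T1, (2 * (121 * T2 + 121 + T2 + 3) * (121 * T2 + 121 + T2 + 3) <= T1)%N.
  by eexists.
have [B B412] : exists B, (412 <= B)%N by exists 412%N.
apply/cvgrPdist_le => eps eps0.
have [N NP] := exists_good T1 T2 B412 eps0.
near=> m; have /NP[w [beta [h [w0 [w8 b27 h3 prb]]]]] : (N <= m.*2)%N.
  by apply: leq_trans (_ : m <= _)%N; [near: m; apply: nbhs_infty_ge|rewrite -addnn leq_addr].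
set A := good_conf _ _ _ _ _ _ _ in prb.
have M0 : (0 < B * beta * w)%N by rewrite !muln_gt0 w0 (leq_trans _ B412) ?(leq_trans _ b27).
set E := \bigcup_(f in [set` A]) conf_event X f.
have ES : E `<=` S m.
  move=> v [f fA fv]; apply: eq_hitting_radius => r.
  by apply: (good_maker_wins (f := f) (w0 := w0) _ _ B412 b27 h3 T2_big T1_big fA) => //; rewrite odd_double.
have PE : P E = (pr R A)%:E by apply: prob_good_event.
have PS : ((pr R A)%:E <= P (S m))%E.
  by rewrite -PE; apply: le_measure => //; rewrite inE; [exact: (measurable_good_event hX)|exact: mS].
have P1 : (P (S m) <= 1)%E by apply: probability_le1.
rewrite /= ger0_norm; last by rewrite subr_ge0 -lee_fin fineK.
rewrite lerBlDr -lerBlDl -lee_fin fineK //; apply: le_trans PS; rewrite lee_fin pr_setC.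
  by rewrite lerD2l lerN2.
by rewrite card_prod card_ord muln_gt0 M0.
Unshelve. all: by end_near.
Qed.
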